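(* Let $p>0$, $\mathtt R:=[-1,1]^d$, and for $\omega\in\mathtt R$ let $\mathfrak L=\mathfrak L(\omega t):=-\Delta+V(\omega t+\mathbf Kx)$ acting on $\mathfrak H^p$, where $V$ satisfies (H$V$) (see context). There exist $\gamma_*,\epsilon_*>0$ and $C>0$ such that for any $\gamma\in(0,\gamma_* )$ and any potential $V$ satisfying $\epsilon:=\gamma^{-1}\|V\|_{\mathtt a,\mathtt p}<\epsilon_*$, there exist a (Cantor-like, measurable) set $\mathcal C\subset\mathtt R$ with $\mathrm{meas}(\mathtt R\setminus\mathcal C)\le C\gamma$, a sequence of real Lipschitz functions $\mathtt R\ni\omega\mapsto\Omega_j(\omega)$, $j\in\mathbb Z^2$, and a bounded invertible linear operator $G$ on $\mathfrak H^p$, close to the identity and depending quasi-periodically on time, such that for any $\omega\in\mathcal C$ $$G_*\mathfrak L:=-\mathrm iG^{-1}\dot G+G^{-1}\mathfrak LG=\mathrm{diag}(\Omega_j)_{j\in\mathbb Z^2},$$ where, for all $j\in\mathbb Z^2$ and $\omega\in\mathtt R$, $$\Omega_j(\omega)=|j|^2+\frac{\varpi(v(j),b(j),\omega)}{\langle b(j)\rangle^2}e^{-\kappa|v(j)|}+\frac{\Theta^{(1)}(j,\omega)}{\langle b(j)\rangle\langle j\rangle^{\mu}}+\frac{\Theta^{(2)}(j,\omega)}{\langle j\rangle^{2\mu}},$$ $$\sup_{\omega\in\mathtt R}\sup_{j\in\mathbb Z^2}\big(|\varpi(v(j),b(j),\omega)|+|\Theta^{(1)}(j,\omega)|+|\Theta^{(2)}(j,\omega)|\big)\le2\|V\|_{\mathtt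 a,\mathtt p},$$ for suitable functions $\varpi,\Theta^{(1)},\Theta^{(2)}$ (the first depending on $j$ only through $v(j)$ and $b(j)$), with $\kappa>0$ depending on $\mathtt a$ and on the matrix $\mathbf K$ only. Moreover, for any integer $N\ge3$ there exist $\tau_N>0$, $c_N^*>0$ and a Cantor set $\mathcal C_N\subseteq\mathcal C$ such that $\mathrm{meas}(\mathtt R\setminus\mathcal C_N)\le c_N^*\gamma$ and for all $\omega\in\mathcal C_N$ and all $(\ell,L)\in\mathcal G_N$ $$\Big|\omega\cdot\ell+\sum_{j\in\mathbb Z^2}\Omega_jL_j\Big|\ge\gamma\langle\ell\rangle^{-\tau_N},$$ where $\mathcal G_N$ is the set of $(\ell,L)\in\mathbb Z^d\times\mathbb Z^{\mathbb Z^2}$ such that: $|L|:=\sum_{j\in\mathbb Z^2}|L_j|\le N$; $\sum_{i=1}^d\ell_i+\sum_{j}L_j=0$; $\sum_{i=1}^d\ell_i\mathbf k^{(i)}+\sum_jjL_j=0$; and, if $\ell=0$, then $\sum_j|j|^2L_j\ne0$.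
   Context: $\mathbb T=\mathbb R/2\pi\mathbb Z$. The vectors $\mathbf k^{(1)},\dots,\mathbf k^{(d)}\in\mathbb Z^2$ are fixed and $\mathbf K$ is the $d\times2$ integer matrix with rows $\mathbf k^{(i)}$, assumed of maximal rank. $\pi(\ell):=\sum_i\ell_i\mathbf k^{(i)}$ for $\ell\in\mathbb Z^d$. $\langle x\rangle:=\max\{1,|x|\}$; $|j|$ is the Euclidean norm on $\mathbb Z^2$. Fix $\mathtt a>0$, $\mathtt p>d/2$. Function space: $u=\sum_ju_je^{\mathrm ij\cdot x}$ is identified with $(u_j)_{j\in\mathbb Z^2}$; $\mathfrak H^p:=\ell^1(\mathbb Z^2)\cap h^p(\mathbb Z^2)$ with norm $\|u\|_p:=\|u\|_{\ell^1}+\|u\|_{h^p}$, $\|u\|_{h^p}^2=\sum_j\langle j\rangle^{2p}|u_j|^2$. Assumption (H$V$): $V(\varphi)=\sum_{\ell\in\mathbb Z^d}V(\ell)e^{\mathrm i\ell\cdot\varphi}$ is real-valued on $\mathbb T^d$, $\|V\|_{\mathtt a,\mathtt p}^2:=\sum_\ell e^{2\mathtt a|\ell|}|V(\ell)|^2\langle\ell\rangle^{2\mathtt p}<\infty$, and $V(\ell)=0$ whenever $\pi(\ell)=0$ or $\sum_i\ell_i\neq0$. Parameters: $\delta$ is a fixed, sufficiently small constant ($0<\delta\ll1$) and $\mu:=1-2\delta$. Generators: $v=(v_1,v_2)\in\mathbb Z^2\setminus\{0\}$ is a generator if $\gcd(v_1,v_2)=1$ and $v_1>0$, or $v=(0,1)$;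 $\mathcal V$ is the set of generators. For $j\in\mathbb Z^2\setminus\{0\}$, $v(j)\in\mathcal V$ is the first vector in the lexicographic order attaining $\min\{|v\cdot j|:v\in\mathcal V,\ |v|\le|j|^\delta\}$, and $b(j):=j\cdot v(j)$. For $j=0$ set $v(0):=(0,1)$, $b(0):=0$. ''Quasi-periodic dependence on time'' means $G=G(\varphi)|_{\varphi=\omega t}$ with $\varphi\in\mathbb T^d$, and $\dot G$ is the time derivative. *)

(* Defs.v *)
From HB Require Import structures.
From mathcomp Require Import all_boot all_order all_algebra.
From mathcomp Require Import all_classical all_reals all_analysis.
From mathcomp Require Import complex.

Set Implicit Arguments.
Unset Strict Implicit.
Unset Printing Implicit Defensive.

Import Order.TTheory GRing.Theory Num.Theory.
Import numFieldNormedType.Exports.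

Local Open Scope classical_set_scope.
Local Open Scope ring_scope.
Local Open Scope complex_scope.

(* Vectors are rows: Z^n is 'rV[int]_n, R^d is 'rV[R]_d, and the torus
   R^d / (2 pi Z)^d is represented by R^d together with periodicity. *)

Section Lattice.
Variable R : realType.

Definition dotZ n (u v : 'rV[int]_n) : int := \sum_i u 0 i * v 0 i.

Definition dotRZ n (x : 'rV[R]_n) (l : 'rV[int]_n) : R :=
  \sum_i x 0 i * (l 0 i)%:~R.

Definition sqnormZ n (u : 'rV[int]_n) : int := dotZ u u.

Definition enormZ n (u : 'rV[int]_n) : R := Num.sqrt ((sqnormZ u)%:~R).

Definition jap (x : R) : R := Num.max 1 `|x|.

Definition japZ n (u : 'rV[int]_n) : R := jap (enormZ u).

Definition is_generator (v : 'rV[int]_2) : Prop :=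
  (gcdz (v 0 0) (v 0 1) = 1 /\ 0 < v 0 0) \/ (v 0 0 = 0 /\ v 0 1 = 1).

Definition lexZ2 (v w : 'rV[int]_2) : bool :=
  (v 0 0 < w 0 0) || ((v 0 0 == w 0 0) && (v 0 1 <= w 0 1)).

Definition admissible (delta : R) (j v : 'rV[int]_2) : Prop :=
  is_generator v /\ enormZ v <= enormZ j `^ delta.

Definition is_vgen (delta : R) (j v : 'rV[int]_2) : Prop :=
  admissible delta j v /\
  forall w, admissible delta j w ->
    `|dotZ v j| <= `|dotZ w j| /\ (`|dotZ v j| = `|dotZ w j| -> lexZ2 v w).

Definition e2 : 'rV[int]_2 := \row_i (i == 1)%:R.

Definition vgen (delta : R) (j : 'rV[int]_2) : 'rV[int]_2 :=
  if j == 0 then e2 else xget e2 [set v | is_vgen delta j v].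

(* also covers b(0) = 0 *)
Definition bgen (delta : R) (j : 'rV[int]_2) : int := dotZ j (vgen delta j).

End Lattice.

Section Sums.
Variables (R : realType) (T : choiceType).

(* Sums of absolutely summable families, as differences of sums of nonnegative
   parts; the value is meaningful only for absolutely summable families. *)
Definition rsum (f : T -> R) : R :=
  let g x := (f x)%:E in
  fine (\esum_(x in [set: T]) (g^\+ x)%E - \esum_(x in [set: T]) (g^\- x)%E)%E.

Definition csum (f : T -> R[i]) : R[i] :=
  rsum (fun x => complex.Re (f x)) +i* rsum (fun x => complex.Im (f x)).

End Sums.

Section Spaces.
Variable R : realType.

Definition cabs (z : R[i]) : R := ComplexField.Normc.normc z.

Definition cis (x : R) : R[i] := cos x +i* sin x.

(* A function on T^2 is identified with its Fourier coefficients. *)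
Definition cseq : Type := 'rV[int]_2 -> R[i].

Definition l1_mass (u : cseq) : \bar R :=
  \esum_(j in [set: 'rV[int]_2]) (cabs (u j))%:E.

Definition hp_mass (p : R) (u : cseq) : \bar R :=
  \esum_(j in [set: 'rV[int]_2]) (japZ R j `^ (2 * p) * cabs (u j) ^+ 2)%:E.

Definition in_Hp (p : R) (u : cseq) : Prop :=
  (l1_mass u < +oo)%E /\ (hp_mass p u < +oo)%E.

Definition Hp_norm (p : R) (u : cseq) : R :=
  fine (l1_mass u) + Num.sqrt (fine (hp_mass p u)).

Definition bounded_by (p M : R) (A : cseq -> cseq) : Prop :=
  forall u, in_Hp p u -> in_Hp p (A u) /\ Hp_norm p (A u) <= M * Hp_norm p u.

Definition bounded_op (p : R) (A : cseq -> cseq) : Prop :=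
  exists M, bounded_by p M A.

Definition linear_op (p : R) (A : cseq -> cseq) : Prop :=
  forall (a : R[i]) u v, in_Hp p u -> in_Hp p v ->
    forall j, A (fun k => a * u k + v k) j = a * A u j + A v j.

Definition inverse_op (p : R) (A B : cseq -> cseq) : Prop :=
  forall u, in_Hp p u -> A (B u) = u /\ B (A u) = u.

Definition op_sub (A B : cseq -> cseq) : cseq -> cseq :=
  fun u j => A u j - B u j.

(* [D] is the derivative of [A] at [t], in the operator norm of H^p. *)
Definition op_derivative (p : R) (A : R -> cseq -> cseq) (t : R)
    (D : cseq -> cseq) : Prop :=
  forall eta : R, 0 < eta -> \forall h \near 0^',
    bounded_by p eta
      (fun u j => (h^-1)%:C * (A (t + h) u j - A t u j) - D u j).

(* G(phi), phi in T^d: a 2pi-periodic, norm continuous family on R^d. *)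
Definition op_torus_family (d : nat) (p : R)
    (G : 'rV[R]_d -> cseq -> cseq) : Prop :=
  (forall (phi : 'rV[R]_d) (m : 'rV[int]_d) u, in_Hp p u ->
     G (phi + (2 * pi) *: map_mx intr m) u = G phi u) /\
  (forall (phi : 'rV[R]_d) (eta : R), 0 < eta ->
     \forall psi \near phi, bounded_by p eta (op_sub (G psi) (G phi))).

End Spaces.

Section Potential.
Variables (R : realType) (d : nat) (K : 'M[int]_(d, 2)).

Definition momentum (l : 'rV[int]_d) : 'rV[int]_2 := \sum_i l 0 i *: row i K.

Definition mass (l : 'rV[int]_d) : int := \sum_i l 0 i.

(* A potential is given by its Fourier coefficients V(l). *)
Definition potential_fun (V : 'rV[int]_d -> R[i]) (phi : 'rV[R]_d) : R[i] :=
  csum (fun l => V l * cis (dotRZ phi l)).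

Definition potential_mass (a q : R) (V : 'rV[int]_d -> R[i]) : \bar R :=
  \esum_(l in [set: 'rV[int]_d])
    (expR (2 * a * enormZ R l) * cabs (V l) ^+ 2 * japZ R l `^ (2 * q))%:E.

Definition potential_norm (a q : R) (V : 'rV[int]_d -> R[i]) : R :=
  Num.sqrt (fine (potential_mass a q V)).

Definition hypV (a q : R) (V : 'rV[int]_d -> R[i]) : Prop :=
  [/\ (potential_mass a q V < +oo)%E,
      forall phi, complex.Im (potential_fun V phi) = 0 &
      forall l, momentum l = 0 \/ mass l <> 0 -> V l = 0].

(* Since l . (K x) = momentum l . x, the j-th Fourier coefficient in x of
   V(phi + K x) u(x) is the sum over l of V(l) e^{i l . phi} u_{j - momentum l}. *)
Definition mul_potential (V : 'rV[int]_d -> R[i]) (phi : 'rV[R]_d)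
    (u : cseq R) : cseq R :=
  fun j => csum (fun l => V l * cis (dotRZ phi l) * u (j - momentum l)).

Definition neg_laplacian (u : cseq R) : cseq R :=
  fun j => (sqnormZ j)%:~R * u j.

Definition schrodinger (V : 'rV[int]_d -> R[i]) (phi : 'rV[R]_d)
    (u : cseq R) : cseq R :=
  fun j => neg_laplacian u j + mul_potential V phi u j.

Definition diag_op (Om : 'rV[int]_2 -> R) (u : cseq R) : cseq R :=
  fun j => (Om j)%:C * u j.

(* The domain in H^p of the Laplacian, hence of L and of diag(Om) as well. *)
Definition in_domain (p : R) (u : cseq R) : Prop :=
  in_Hp p u /\ in_Hp p (neg_laplacian u).

(* - i G^-1 dG/dt + G^-1 L G = diag(Om) along phi = t omega, as an equality of
   unbounded operators on H^p, domains included. *)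
Definition conjugates_to_diag (p : R) (V : 'rV[int]_d -> R[i])
    (om : 'rV[R]_d) (G Ginv : 'rV[R]_d -> cseq R -> cseq R)
    (Om : 'rV[int]_2 -> R) : Prop :=
  exists dG : R -> cseq R -> cseq R,
    forall t : R,
      [/\ bounded_op p (dG t),
          op_derivative p (fun s => G (s *: om)) t (dG t),
          forall u, in_Hp p u ->
            (in_domain p (G (t *: om) u) <-> in_domain p u) &
          forall u, in_domain p u -> forall j,
            - 'i * Ginv (t *: om) (dG t u) j
            + Ginv (t *: om) (schrodinger V (t *: om) (G (t *: om) u)) j
            = diag_op Om u j].

(* The index set G_N. The first condition forces L to have finite support, so
   the \sum_(j \in setT) below are finite sums. *)
Definition resonance_index (N : nat) (l : 'rV[int]_d) (L : 'rV[int]_2 -> int)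
    : Prop :=
  [/\ (\esum_(j in [set: 'rV[int]_2]) (`|L j|%:~R : R)%:E <= N%:R%:E)%E,
      mass l + \sum_(j \in [set: 'rV[int]_2]) L j = 0,
      momentum l + \sum_(j \in [set: 'rV[int]_2]) L j *: j = 0 &
      l = 0 -> \sum_(j \in [set: 'rV[int]_2]) sqnormZ j * L j <> 0].

End Potential.

Section LebesgueMeasure.
Variables (R : realType) (d : nat).

Definition cube : set 'rV[R]_d := [set x | forall i, -1 <= x 0 i <= 1].

Definition box (a b : 'rV[R]_d) : set 'rV[R]_d :=
  [set x | forall i, a 0 i <= x 0 i <= b 0 i].

(* Lebesgue outer measure on R^d: infimum of the total volume of countable
   covers by boxes. *)
Definition lebesgue_outer (A : set 'rV[R]_d) : \bar R :=
  ereal_inf [set m | exists a b : nat -> 'rV[R]_d,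
    [/\ forall n i, a n 0 i <= b n 0 i,
        A `<=` \bigcup_n box (a n) (b n) &
        m = (\sum_(0 <= n <oo) (\prod_i (b n 0 i - a n 0 i))%:E)%E]].

Definition lebesgue_measurable (A : set 'rV[R]_d) : Prop :=
  lebesgue_outer.-caratheodory A.

(* Nonemptiness is not imposed: it follows from lower bounds on the measure. *)
Definition cantor_set (A : set 'rV[R]_d) : Prop :=
  [/\ compact A, perfect_set A & totally_disconnected A].

End LebesgueMeasure.

(* Main.v *)
Require Import Defs.
From HB Require Import structures.
From mathcomp Require Import all_boot all_order all_algebra.
From mathcomp Require Import all_classical all_reals all_analysis.
From mathcomp Require Import complex finmap.
From mathcomp Require Import zify ring lra.

(* Put the equation in Fourier form in both the angle and the space variable: a
   quasi-periodic operator is a family A_x(l), where x is a column and l in Z^d.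
   A KAM iteration at a fixed frequency, with no Lipschitz tracking and no reality
   built in, yields for every column x an exact solution W_x of
     (om.l + E(x + l)) W_x(l) + (V W_x)(l) = W_x(l) (E(x) + lam_x).
   Everything else about lam is read off this eigenvalue equation a posteriori.
   With e(l) = 2 j.momentum(l) the linear part of the divisor, the equation gives
   back a factor 1/(|e|+1) on all modes with e <> 0, and the leading term of lam is
   an odd function of l and cancels; this is the decay <b>^-2. Comparing two such
   equations through a Wronskian pairing shows that lam is real (one equation with
   itself), Lipschitz in om (two frequencies), and that lam_j differs from the
   eigenvalue of the problem restricted to the modes with momentum parallel to v(j)
   by the Theta terms; the restricted problem depends only on v(j) and b(j).
   For the measure, a small divisor is om.l + m + (a sum of boundedly many
   corrections f_i) with m an integer. The f_i have summable weights, so either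
   some f_i is negligible and can be dropped, or all of them lie in a polynomially
   large set; induction on the number of corrections gives the estimates. *)

Set Implicit Arguments.
Unset Strict Implicit.
Unset Printing Implicit Defensive.

Import Order.TTheory GRing.Theory Num.Theory.
Import numFieldNormedType.Exports.

Local Open Scope classical_set_scope.
Local Open Scope ring_scope.

(** The good frequencies are selected step by step, so before step n the stage n eigenvalues must
    already be Lipschitz in om and close to the reduced ones, although no Lipschitz norm is tracked.
    Hence the a posteriori estimates are proved for approximate eigenvectors with a residual, for
    any pair of frequencies that passed the first n steps. The residual after n steps is a multiple
    of rho^n, and rho = 2^-(tau+1) keeps it below the small divisor threshold gam / (C0 2^n)^tau.
    Geometric convergence is therefore enough: the cutoff doubles, the loss of analyticity halves,
    and every step gains the same factor rho. A divisor is a difference of two eigenvalues, each the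
    sum of two corrections, so it carries four. This number and d fix tau, after which Q, the cutoff
    and the smallness of V are chosen. Each correction has Lipschitz constant at most 1/8, so four
    of them vary at most half as fast as om.l does along an axis where l has a nonzero entry. The
    full problem and its restrictions to one direction are columns of a single iteration, indexed by
    a disjoint union, so that one set of estimates serves both. *)

Section Modulus.
Variable R : realType.
Implicit Types z w : R[i].

Lemma cabs_ge0 z : 0 <= cabs z.
Proof. by case: z => x y; exact: sqrtr_ge0. Qed.

Lemma cabsD z w : cabs (z + w) <= cabs z + cabs w.
Proof. exact: (@le_normcD R z w). Qed.

Lemma cabsM z w : cabs (z * w) = cabs z * cabs w.
Proof. exact: ComplexField.Normc.normcM. Qed.

Lemma cabs0 : cabs (0 : R[i]) = 0.
Proof. exact: ComplexField.Normc.normc0. Qed.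

Lemma cabs1 : cabs (1 : R[i]) = 1.
Proof. exact: ComplexField.Normc.normc1. Qed.

Lemma cabsN z : cabs (- z) = cabs z.
Proof. exact: (@normcN R z). Qed.

Lemma cabsV z : cabs z^-1 = (cabs z)^-1.
Proof. exact: ComplexField.Normc.normcV. Qed.

Lemma cabs_eq0 z : cabs z = 0 -> z = 0.
Proof. exact: ComplexField.Normc.eq0_normc. Qed.

Lemma cabsB z w : cabs (z - w) <= cabs z + cabs w.
Proof. by rewrite (le_trans (cabsD _ _))// cabsN. Qed.

Lemma cabs_conj z : cabs (z^*)%C = cabs z.
Proof. by case: z => x y; rewrite /cabs/= sqrrN. Qed.

Lemma cabs_real (x : R) : cabs x%:C%C = `|x|.
Proof. by rewrite /cabs/= expr0n/= addr0 sqrtr_sqr. Qed.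

Lemma cabs_Re z : `|complex.Re z| <= cabs z.
Proof.
case: z => x y; rewrite /cabs/= -sqrtr_sqr ler_wsqrtr// lerDl; exact: sqr_ge0.
Qed.

Lemma cabs_Im z : `|complex.Im z| <= cabs z.
Proof.
case: z => x y; rewrite /cabs/= -sqrtr_sqr ler_wsqrtr// lerDr; exact: sqr_ge0.
Qed.

Lemma cabs_sqr z : z * (z^*)%C = ((cabs z) ^+ 2)%:C%C.
Proof.
case: z => x y; rewrite /cabs/= sqr_sqrtr ?addr_ge0 ?sqr_ge0//.
by apply/eqP; rewrite eq_complex/=; apply/andP; split; apply/eqP; ring.
Qed.

Lemma cjD z w : ((z + w)^*)%C = (z^*)%C + (w^*)%C.
Proof. exact: rmorphD. Qed.

Lemma cjB z w : ((z - w)^*)%C = (z^*)%C - (w^*)%C.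
Proof. exact: rmorphB. Qed.

Lemma cjM z w : ((z * w)^*)%C = (z^*)%C * (w^*)%C.
Proof. exact: rmorphM. Qed.

Lemma cj_real (x : R) : ((x%:C)^*)%C = x%:C%C.
Proof. by apply/eqP; rewrite eq_complex/= oppr0 !eqxx. Qed.

End Modulus.

(** * Absolutely summable families, real and complex *)

Section RealSums.
Variables (R : realType) (T : choiceType).
Implicit Types (f g p q : T -> R) (M N : R).

(* Absolute summability with an explicit bound, phrased through finite sums. *)
Definition sums_le f M := forall s : seq T, uniq s -> \sum_(x <- s) f x <= M.

Lemma sleP f M : (forall x, 0 <= f x) ->
  sums_le f M <-> (\esum_(x in [set: T]) (f x)%:E <= M%:E)%E.
Proof.
move=> f0; split => H.
  apply: ge_ereal_sup => _ [A [finA _] <-].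
  rewrite fsbig_finite//= sumEFin lee_fin; by apply: H; exact: fset_uniq.
move=> s us; rewrite -lee_fin -sumEFin; apply: le_trans H.
apply: ereal_sup_ubound; exists [set` s].
  by split => //; exact: finite_seq.
rewrite fsbig_finite//=; apply: perm_big.
apply: uniq_perm => //.
by move=> x; rewrite in_fset_set ?mem_setE//; exact: finite_seq.
Qed.

Lemma sle_ge0 f M : sums_le f M -> 0 <= M.
Proof. by move=> /(_ [::] isT); rewrite big_nil. Qed.

Lemma sle_le f g M : (forall x, f x <= g x) -> sums_le g M -> sums_le f M.
Proof. by move=> fg H s us; apply: le_trans (H s us); exact: ler_sum. Qed.

Lemma sle_leM f M N : M <= N -> sums_le f M -> sums_le f N.
Proof. by move=> MN H s us; exact: le_trans (H s us) MN. Qed.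

Lemma sleD f g M N : sums_le f M -> sums_le g N -> sums_le (fun x => f x + g x) (M + N).
Proof. by move=> H K s us; rewrite big_split/= lerD ?H ?K. Qed.

Lemma sleZ c f M : 0 <= c -> sums_le f M -> sums_le (fun x => c * f x) (c * M).
Proof. by move=> c0 H s us; rewrite -mulr_sumr ler_wpM2l ?H. Qed.

Lemma sle_term f M x : sums_le f M -> f x <= M.
Proof. by move=> /(_ [:: x] isT); rewrite big_seq1. Qed.

Lemma sle0 f M : (forall x, f x = 0) -> 0 <= M -> sums_le f M.
Proof. by move=> f0 M0 s us; rewrite big1. Qed.

Definition tsum f : R := fine (\esum_(x in [set: T]) (f x)%:E).

Lemma tsumE f M : (forall x, 0 <= f x) -> sums_le f M ->
  (\esum_(x in [set: T]) (f x)%:E = (tsum f)%:E)%E.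
Proof.
move=> f0 /(sleP _ f0) H; rewrite /tsum fineK// ge0_fin_numE//.
  by rewrite (le_lt_trans H)// ltry.
by apply: esum_ge0 => x _; rewrite lee_fin.
Qed.

Lemma tsum_le f M : (forall x, 0 <= f x) -> sums_le f M -> tsum f <= M.
Proof. by move=> f0 H; rewrite -lee_fin -(tsumE f0 H); apply/sleP. Qed.

Lemma tsum_ge0 f : (forall x, 0 <= f x) -> 0 <= tsum f.
Proof. by move=> f0; apply: fine_ge0; apply: esum_ge0 => x _; rewrite lee_fin. Qed.

Lemma sle_tsum f M : (forall x, 0 <= f x) -> sums_le f M -> sums_le f (tsum f).
Proof. by move=> f0 H; apply/(sleP _ f0); rewrite (tsumE f0 H). Qed.

Lemma tsumD f g M N : (forall x, 0 <= f x) -> (forall x, 0 <= g x) ->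
  sums_le f M -> sums_le g N -> tsum (fun x => f x + g x) = tsum f + tsum g.
Proof.
move=> f0 g0 fM gN; apply: EFin_inj; rewrite EFinD.
rewrite -(tsumE f0 fM) -(tsumE g0 gN) -(@tsumE _ (M + N)); first last.
- exact: sleD.
- by move=> x; rewrite addr_ge0.
by rewrite -esumD// => x _; rewrite lee_fin.
Qed.

Lemma tsumZ c f M : 0 <= c -> (forall x, 0 <= f x) -> sums_le f M ->
  tsum (fun x => c * f x) = c * tsum f.
Proof.
move=> c0 f0 fM.
have cf0 x : 0 <= c * f x by rewrite mulr_ge0.
apply/eqP; rewrite eq_le; apply/andP; split.
  by apply: tsum_le => //; apply: sleZ => //; exact: sle_tsum fM.
have [->|cn0] := eqVneq c 0; first by rewrite mul0r; apply: tsum_ge0 => x; rewrite mul0r.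
have cp : 0 < c by rewrite lt0r cn0.
rewrite mulrC -ler_pdivlMr//; apply: tsum_le => // s us.
rewrite ler_pdivlMr// mulrC mulr_sumr.
by have := @sle_tsum _ _ cf0 (sleZ c0 fM) s us.
Qed.

(** Frees [rsum] from the canonical positive and negative parts, which are not additive; linearity
    then reduces to nonnegative families. *)
Lemma rsum_diff p q M N : (forall x, 0 <= p x) -> (forall x, 0 <= q x) ->
  sums_le p M -> sums_le q N -> rsum (fun x => p x - q x) = tsum p - tsum q.
Proof.
move=> p0 q0 pM qN.
have sm (f : T -> R) K : (forall x, 0 <= f x) -> sums_le f K ->
    summable [set: T] (fun x => (f x)%:E).
  move=> f0 fK; rewrite /summable (@eq_esum _ _ _ _ (fun x => (f x)%:E)).
    by rewrite (tsumE f0 fK) ltry.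
  by move=> x _; rewrite gee0_abs ?lee_fin.
have := esumB (sm _ _ p0 pM) (sm _ _ q0 qN) (fun x _ => p0 x) (fun x _ => q0 x).
rewrite (tsumE p0 pM) (tsumE q0 qN) /rsum => ->.
by rewrite -EFinB.
Qed.

End RealSums.

Section Fubini.
Variables (R : realType) (T U : choiceType).
Implicit Types (f : T -> U -> R) (M N : R).

Lemma sle_pair f M : (forall x y, 0 <= f x y) ->
  sums_le (fun p : T * U => f p.1 p.2) M <->
  (\esum_(x in [set: T]) \esum_(y in [set: U]) (f x y)%:E <= M%:E)%E.
Proof.
move=> f0; rewrite sleP; last by move=> p; exact: f0.
rewrite esum_esum; last by move=> *; rewrite lee_fin.
rewrite (_ : [set: T] `*`` (fun=> [set: U]) = [set: T * U]); first by [].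
by apply/seteqP; split.
Qed.

Lemma sle_row f M x : (forall x y, 0 <= f x y) ->
  sums_le (fun p : T * U => f p.1 p.2) M -> sums_le (f x) M.
Proof.
move=> f0 H s us.
have := H [seq (x, y) | y <- s]; rewrite big_map/=; apply.
by rewrite map_inj_uniq// => y y' [].
Qed.

Lemma sle_rows f M : (forall x y, 0 <= f x y) ->
  sums_le (fun p : T * U => f p.1 p.2) M -> sums_le (fun x => tsum (f x)) M.
Proof.
move=> f0 H; apply/sleP; first by move=> x; exact: tsum_ge0.
move/(sle_pair _ f0): (H); apply: le_trans; apply: le_esum => x _.
by rewrite (tsumE _ (sle_row x f0 H)).
Qed.

Lemma sle_fub f (g : T -> R) M : (forall x y, 0 <= f x y) ->
  (forall x, sums_le (f x) (g x)) -> sums_le g M -> sums_le (fun p : T * U => f p.1 p.2) M.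
Proof.
move=> f0 fg gM; apply/sle_pair => //.
have g0 x : 0 <= g x by apply: sle_ge0 (fg x).
move/sleP: gM => /(_ g0); apply: le_trans; apply: le_esum => x _.
exact/sleP.
Qed.

Lemma tsum_fub f M : (forall x y, 0 <= f x y) ->
  sums_le (fun p : T * U => f p.1 p.2) M ->
  tsum (fun x => tsum (f x)) = tsum (fun p : T * U => f p.1 p.2).
Proof.
move=> f0 H; rewrite /tsum; congr fine.
rewrite (@eq_esum _ _ _ _ (fun x => \esum_(y in [set: U]) (f x y)%:E)%E); last first.
  by move=> x _; rewrite (tsumE _ (sle_row x f0 H)).
rewrite esum_esum; last by move=> *; rewrite lee_fin.
by congr esum; apply/seteqP; split.
Qed.

End Fubini.

Section Reindex.
Variables (R : realType).

Lemma sle_inj (T U : choiceType) (f : T -> R) (e : U -> T) M :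
  injective e -> sums_le f M -> sums_le (f \o e) M.
Proof.
move=> einj H s us; have := H (map e s); rewrite big_map; apply.
by rewrite map_inj_uniq.
Qed.

Lemma sle_swap (T U : choiceType) (f : T -> U -> R) M :
  sums_le (fun p : T * U => f p.1 p.2) M -> sums_le (fun p : U * T => f p.2 p.1) M.
Proof.
move=> H; have := @sle_inj _ _ _ (fun p : U * T => (p.2, p.1)) _ _ H; apply.
by move=> [a b] [a' b'] /= [-> ->].
Qed.

Lemma esum_bij (T U : choiceType) (f : T -> \bar R) (e : U -> T) :
  bijective e ->
  (\esum_(x in [set: T]) f x = \esum_(y in [set: U]) f (e y))%E.
Proof.
move=> be; apply: reindex_esum.
by rewrite setTT_bijective.
Qed.

End Reindex.

Section RSum.
Variables (R : realType).
Section One.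
Variable T : choiceType.
Implicit Types (f g : T -> R) (M N : R).

Definition ppart f x := Num.max (f x) 0.
Definition npart f x := Num.max (- f x) 0.

Lemma ppart_ge0 f x : 0 <= ppart f x. Proof. by rewrite /ppart le_max lexx orbT. Qed.
Lemma npart_ge0 f x : 0 <= npart f x. Proof. by rewrite /npart le_max lexx orbT. Qed.
Lemma ppart_le f x : ppart f x <= `|f x|.
Proof. by rewrite /ppart ge_max normr_ge0 ler_norm. Qed.
Lemma npart_le f x : npart f x <= `|f x|.
Proof. by rewrite /npart ge_max normr_ge0 -normrN ler_norm. Qed.

Lemma pnpart f x : f x = ppart f x - npart f x.
Proof.
rewrite /ppart /npart; case: (leP (f x) 0) => h.
  by rewrite max_l ?oppr_ge0// sub0r opprK.
by rewrite max_r ?subr0// oppr_le0 ltW.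
Qed.

Lemma sle_ppart f M : sums_le (fun x => `|f x|) M -> sums_le (ppart f) M.
Proof. by apply: sle_le => x; exact: ppart_le. Qed.
Lemma sle_npart f M : sums_le (fun x => `|f x|) M -> sums_le (npart f) M.
Proof. by apply: sle_le => x; exact: npart_le. Qed.

Lemma rsumE f M : sums_le (fun x => `|f x|) M -> rsum f = tsum (ppart f) - tsum (npart f).
Proof.
move=> H; rewrite -(rsum_diff (ppart_ge0 f) (npart_ge0 f) (sle_ppart H) (sle_npart H)).
by congr rsum; apply: funext => x; exact: pnpart.
Qed.

Lemma rsumD f g M N : sums_le (fun x => `|f x|) M -> sums_le (fun x => `|g x|) N ->
  rsum (fun x => f x + g x) = rsum f + rsum g.
Proof.
move=> fM gN.
have [f1 f2 g1 g2] := And4 (sle_ppart fM) (sle_npart fM) (sle_ppart gN) (sle_npart gN).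
rewrite (rsumE fM) (rsumE gN) addrACA -opprD.
rewrite -(tsumD (ppart_ge0 f) (ppart_ge0 g) f1 g1).
rewrite -(tsumD (npart_ge0 f) (npart_ge0 g) f2 g2).
rewrite -(@rsum_diff _ _ _ _ (M + N) (M + N)).
- by congr rsum; apply: funext => x; rewrite {1}(pnpart f) {1}(pnpart g); ring.
- by move=> x; rewrite addr_ge0 ?ppart_ge0.
- by move=> x; rewrite addr_ge0 ?npart_ge0.
- exact: sleD.
- exact: sleD.
Qed.

Lemma rsumZ c f M : sums_le (fun x => `|f x|) M -> rsum (fun x => c * f x) = c * rsum f.
Proof.
move=> fM; have [f1 f2] := conj (sle_ppart fM) (sle_npart fM).
rewrite (rsumE fM); have [c0|c0] := leP 0 c.
  rewrite mulrBr -(tsumZ c0 (ppart_ge0 f) f1) -(tsumZ c0 (npart_ge0 f) f2).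
  rewrite -(@rsum_diff _ _ _ _ (c * M) (c * M)).
  - by congr rsum; apply: funext => x; rewrite {1}(pnpart f) mulrBr.
  - by move=> x; rewrite mulr_ge0 ?ppart_ge0.
  - by move=> x; rewrite mulr_ge0 ?npart_ge0.
  - exact: sleZ.
  - exact: sleZ.
have c0' : 0 <= - c by rewrite oppr_ge0 ltW.
transitivity ((- c) * tsum (npart f) - (- c) * tsum (ppart f)); last by ring.
rewrite -(tsumZ c0' (ppart_ge0 f) f1) -(tsumZ c0' (npart_ge0 f) f2).
rewrite -(@rsum_diff _ _ _ _ ((- c) * M) ((- c) * M)).
- by congr rsum; apply: funext => x; rewrite {1}(pnpart f); ring.
- by move=> x; rewrite mulr_ge0 ?npart_ge0.
- by move=> x; rewrite mulr_ge0 ?ppart_ge0.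
- exact: sleZ.
- exact: sleZ.
Qed.

Lemma rsum_le f M : sums_le (fun x => `|f x|) M -> rsum f <= M.
Proof.
move=> H; rewrite (rsumE H) lerBlDr (le_trans (tsum_le (ppart_ge0 f) (sle_ppart H)))//.
by rewrite lerDl tsum_ge0//; exact: npart_ge0.
Qed.

Lemma sle_single (a : T) (c : R) : 0 <= c -> sums_le (fun x => if x == a then c else 0) c.
Proof.
move=> c0 s us; rewrite -big_mkcond/= big_const_seq iter_addr_0.
have -> : count (fun i => i == a) s = (a \in s) by rewrite -count_uniq_mem.
by case: (a \in s); rewrite ?mulr0n ?mulr1n.
Qed.

Lemma tsum_single (a : T) (c : R) : 0 <= c -> tsum (fun x => if x == a then c else 0) = c.
Proof.
move=> c0; apply/eqP; rewrite eq_le; apply/andP; split.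
  by apply: tsum_le (sle_single _ c0) => x; case: ifP.
have f0 x : 0 <= (fun x => if x == a then c else 0) x by rewrite /=; case: ifP.
by have := sle_term a (sle_tsum f0 (sle_single a c0)); rewrite eqxx.
Qed.

Lemma rsum_single (a : T) (c : R) : rsum (fun x => if x == a then c else 0) = c.
Proof.
rewrite (@rsumE _ `|c|); last first.
  apply: sle_le (sle_single a (normr_ge0 c)) => x.
  by case: ifP; rewrite ?normr0.
rewrite [RHS](pnpart (fun=> c) a) /ppart /npart.
congr (_ - _).
  rewrite -[RHS](@tsum_single a); last by rewrite le_max lexx orbT.
  by congr tsum; apply: funext => x; case: ifP; rewrite ?maxxx.
rewrite -[RHS](@tsum_single a); last by rewrite le_max lexx orbT.
by congr tsum; apply: funext => x; case: ifP; rewrite ?oppr0 ?maxxx.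
Qed.

End One.

Lemma rsum_bij (T U : choiceType) (f : T -> R) (e : U -> T) :
  bijective e -> rsum f = rsum (f \o e).
Proof.
move=> be; rewrite /rsum.
congr (fine (_ - _)%E).
  rewrite (@esum_bij _ _ _ _ e be); apply: eq_esum => x _.
  by rewrite !funeposE.
rewrite (@esum_bij _ _ _ _ e be); apply: eq_esum => x _.
by rewrite !funenegE.
Qed.

Lemma rsum_fub (T U : choiceType) (f : T -> U -> R) M :
  sums_le (fun p : T * U => `|f p.1 p.2|) M ->
  rsum (fun x => rsum (f x)) = rsum (fun p : T * U => f p.1 p.2).
Proof.
move=> H.
pose P x y := Num.max (f x y) 0; pose Q x y := Num.max (- f x y) 0.
have P0 x y : 0 <= P x y by exact: (ppart_ge0 (f x)).
have Q0 x y : 0 <= Q x y by exact: (npart_ge0 (f x)).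
have PM : sums_le (fun p : T * U => P p.1 p.2) M.
  by apply: sle_le H => p; exact: (ppart_le (f p.1)).
have QM : sums_le (fun p : T * U => Q p.1 p.2) M.
  by apply: sle_le H => p; exact: (npart_le (f p.1)).
rewrite (rsumE H).
transitivity (tsum (fun p : T * U => P p.1 p.2) - tsum (fun p : T * U => Q p.1 p.2)); last by [].
rewrite -(tsum_fub P0 PM) -(tsum_fub Q0 QM).
rewrite -(@rsum_diff _ _ _ _ M M).
- congr rsum; apply: funext => x.
  by rewrite (@rsumE _ (f x) M)//; exact: (@sle_row _ _ _ (fun x y => `|f x y|)).
- by move=> x; exact: tsum_ge0.
- by move=> x; exact: tsum_ge0.
- exact: sle_rows.
- exact: sle_rows.
Qed.

End RSum.

Section CSum.
Variable R : realType.

Definition summable_c (T : choiceType) (f : T -> R[i]) := exists M, sums_le (fun x => cabs (f x)) M.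

Section One.
Variable T : choiceType.
Implicit Types (f g : T -> R[i]) (M N : R).

Lemma sle_re f M : sums_le (fun x => cabs (f x)) M -> sums_le (fun x => `|complex.Re (f x)|) M.
Proof. by apply: sle_le => x; exact: cabs_Re. Qed.

Lemma sle_im f M : sums_le (fun x => cabs (f x)) M -> sums_le (fun x => `|complex.Im (f x)|) M.
Proof. by apply: sle_le => x; exact: cabs_Im. Qed.

Lemma eq_csum f g : f =1 g -> csum f = csum g.
Proof. by move=> /funext ->. Qed.

Lemma smbD f g : summable_c f -> summable_c g -> summable_c (fun x => f x + g x).
Proof.
move=> [M fM] [N gN]; exists (M + N).
by apply: sle_le (sleD fM gN) => x; exact: cabsD.
Qed.

Lemma smbZ c f : summable_c f -> summable_c (fun x => c * f x).
Proof.
move=> [M fM]; exists (cabs c * M).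
by apply: sle_le (sleZ (cabs_ge0 c) fM) => x; rewrite cabsM.
Qed.

Lemma csumD f g : summable_c f -> summable_c g -> csum (fun x => f x + g x) = csum f + csum g.
Proof.
move=> [M fM] [N gN]; rewrite /csum.
apply/eqP; rewrite eq_complex/=; apply/andP; split; apply/eqP.
  rewrite -(rsumD (sle_re fM) (sle_re gN)); congr rsum; apply: funext => x.
  by case: (f x) (g x) => ? ? [].
rewrite -(rsumD (sle_im fM) (sle_im gN)); congr rsum; apply: funext => x.
by case: (f x) (g x) => ? ? [].
Qed.

Lemma csumZ c f : summable_c f -> csum (fun x => c * f x) = c * csum f.
Proof.
move=> [M fM]; rewrite /csum; case: c => a b.
have H (u : R) (h : T -> R) : sums_le (fun x => `|h x|) M -> sums_le (fun x => `|u * h x|) (`|u| * M).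
  by move=> hM; apply: sle_le (sleZ (normr_ge0 u) hM) => x; rewrite normrM.
have fr := sle_re fM; have fi := sle_im fM.
apply/eqP; rewrite eq_complex/=; apply/andP; split; apply/eqP.
  rewrite -!(rsumZ _ fr) -!(rsumZ _ fi) -mulN1r -(rsumZ _ (H b _ fi)).
  rewrite -(rsumD (H a _ fr) (N := `|b| * M)).
    by congr rsum; apply: funext => x; case: (f x) => ? ? /=; rewrite mulN1r.
  by apply: sle_le (H b _ fi) => x; rewrite mulN1r normrN.
rewrite -!(rsumZ _ fr) -!(rsumZ _ fi).
rewrite -(rsumD (H a _ fi) (H b _ fr)).
by congr rsum; apply: funext => x; case: (f x) => ? ?.
Qed.

Lemma csumZr c f : summable_c f -> csum (fun x => f x * c) = csum f * c.
Proof.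
by move=> fs; rewrite mulrC -csumZ//; apply: eq_csum => x; rewrite mulrC.
Qed.

Lemma csumN f : summable_c f -> csum (fun x => - f x) = - csum f.
Proof. by move=> fs; rewrite -mulN1r -csumZ//; apply: eq_csum => x; rewrite mulN1r. Qed.

Lemma smbN f : summable_c f -> summable_c (fun x => - f x).
Proof. by move=> [M fM]; exists M; apply: sle_le fM => x; rewrite cabsN. Qed.

Lemma csumB f g : summable_c f -> summable_c g -> csum (fun x => f x - g x) = csum f - csum g.
Proof. by move=> fs gs; rewrite csumD ?csumN//; exact: smbN. Qed.

Lemma csum_single (a : T) (c : R[i]) : csum (fun x => if x == a then c else 0) = c.
Proof.
rewrite /csum; apply/eqP; rewrite eq_complex/=; apply/andP; split; apply/eqP.
  by rewrite -[RHS](rsum_single a); congr rsum; apply: funext => x; case: ifP.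
by rewrite -[RHS](rsum_single a); congr rsum; apply: funext => x; case: ifP.
Qed.

Lemma csum0 : csum (fun _ : T => 0 : R[i]) = 0.
Proof.
have s0 : summable_c (fun _ : T => 0 : R[i]).
  by exists 0; apply: sle0 => // x; rewrite cabs0.
rewrite -[RHS](mul0r (csum (fun _ : T => 0 : R[i]))) -csumZ//.
by apply: eq_csum => x; rewrite mul0r.
Qed.

Lemma csum_conj f : summable_c f -> csum (fun x => ((f x)^*)%C) = ((csum f)^*)%C.
Proof.
move=> [M fM]; rewrite /csum; apply/eqP; rewrite eq_complex/=.
have := rsumZ (-1) (sle_im fM); rewrite mulN1r => <-.
apply/andP; split; apply/eqP; congr rsum; apply: funext => x; case: (f x) => ? ? //=.
by rewrite mulN1r.
Qed.

(* Rotating the sum onto the positive real axis reduces to real families. *)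
Lemma csum_le f M : sums_le (fun x => cabs (f x)) M -> cabs (csum f) <= M.
Proof.
move=> fM; have M0 := sle_ge0 fM.
have [->|z0] := eqVneq (csum f) 0; first by rewrite cabs0.
set z := csum f; set r := cabs z.
have r0 : r != 0 by apply: contra z0 => /eqP h; apply/eqP; exact: cabs_eq0 h.
have rp : 0 < r by rewrite lt0r r0 cabs_ge0.
pose u := (z^*)%C * (r^-1)%:C%C.
have cu : cabs u = 1.
  by rewrite cabsM cabs_conj cabs_real ger0_norm ?invr_ge0 ?cabs_ge0// divff.
have fs : summable_c f by exists M.
have : csum (fun x => u * f x) = r%:C%C.
  rewrite csumZ// -/z /u mulrAC [_^*%C * z]mulrC cabs_sqr -/r -rmorphM/=.
  by congr (_%:C)%C; rewrite expr2 -mulrA divff// mulr1.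
rewrite /csum => /(congr1 (@complex.Re R)) /= <-.
apply: rsum_le; apply: sle_le fM => x.
by rewrite (le_trans (cabs_Re _))// cabsM cu mul1r.
Qed.

End One.

Section Two.
Variables T U : choiceType.

Lemma csum_bij (f : T -> R[i]) (e : U -> T) : bijective e ->
  csum f = csum (f \o e).
Proof.
by move=> be; rewrite /csum (rsum_bij _ be) [X in (_ +i* X)%C](rsum_bij _ be).
Qed.

Lemma csum_pair (f : T -> U -> R[i]) : summable_c (fun p : T * U => f p.1 p.2) ->
  csum (fun x => csum (f x)) = csum (fun p : T * U => f p.1 p.2).
Proof.
move=> [M fM]; rewrite {1 3}/csum.
rewrite -(@rsum_fub _ _ _ (fun x y => complex.Re (f x y)) M); last exact: (sle_re fM).
by rewrite -(@rsum_fub _ _ _ (fun x y => complex.Im (f x y)) M)//; exact: (sle_im fM).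
Qed.

Lemma smb_swap (f : T -> U -> R[i]) : summable_c (fun p : T * U => f p.1 p.2) ->
  summable_c (fun p : U * T => f p.2 p.1).
Proof. by move=> [M /(@sle_swap _ _ _ (fun x y => cabs (f x y))) H]; exists M. Qed.

Lemma smb_row (f : T -> U -> R[i]) x : summable_c (fun p : T * U => f p.1 p.2) -> summable_c (f x).
Proof.
move=> [M H]; exists M; apply: (@sle_row _ _ _ (fun x y => cabs (f x y))) H => *.
exact: cabs_ge0.
Qed.

Lemma sle_csum (f : T -> U -> R[i]) M : sums_le (fun p : T * U => cabs (f p.1 p.2)) M ->
  sums_le (fun x => cabs (csum (f x))) M.
Proof.
move=> H.
have f0 x y : 0 <= cabs (f x y) by exact: cabs_ge0.
apply: sle_le (sle_rows f0 H) => x; apply: csum_le; apply: sle_tsum => //.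
exact: (@sle_row _ _ _ (fun x y => cabs (f x y)) M).
Qed.

End Two.

Lemma csum_swap (T U : choiceType) (f : T -> U -> R[i]) : summable_c (fun p : T * U => f p.1 p.2) ->
  csum (fun x => csum (f x)) = csum (fun y => csum (f^~ y)).
Proof.
move=> fs; rewrite csum_pair// (@csum_pair _ _ (fun y x => f x y)); last exact: smb_swap.
rewrite (@csum_bij _ _ _ (fun p : U * T => (p.2, p.1)))//.
by exists (fun p : T * U => (p.2, p.1)) => -[].
Qed.

End CSum.

(** * Summable weights on integers, lattices and lists *)

Section Weights.
Variable R : realType.

(** Comparison along an injection defined only on [p]; this is how summability is carried from one
    index type to another. *)
Lemma sle_map (T U : choiceType) (p : pred T) (f : T -> R) (g : U -> R) (e : T -> U) M :
  (forall x, ~~ p x -> f x <= 0) -> (forall x, p x -> f x <= g (e x)) ->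
  {in p &, injective e} -> (forall y, 0 <= g y) -> sums_le g M -> sums_le f M.
Proof.
move=> fp fg einj g0 gM s us.
rewrite (bigID p)/= -[leRHS]addr0 lerD//; last by apply: sumr_le0.
rewrite -big_filter; apply: (@le_trans _ _ (\sum_(x <- [seq x <- s | p x]) g (e x))).
  rewrite big_seq [leRHS]big_seq; apply: ler_sum => x.
  by rewrite mem_filter => /andP[px _]; exact: fg.
rewrite -(big_map e xpredT); apply: gM; rewrite map_inj_in_uniq ?filter_uniq// => x y.
by rewrite !mem_filter => /andP[px _] /andP[py _]; exact: einj.
Qed.

Lemma sle_nat (f : nat -> R) M : (forall k, 0 <= f k) ->
  (forall n, \sum_(0 <= k < n) f k <= M) -> sums_le f M.
Proof.
move=> f0 H; apply/sleP => //; rewrite -nneseries_esumT; last by move=> k; rewrite lee_fin.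
apply: lime_le.
  by apply: is_cvg_nneseries => k _ _; rewrite lee_fin.
by apply: nearW => n; rewrite sumEFin lee_fin.
Qed.

Lemma sle_nat_inv2 : sums_le (fun k : nat => k.+1%:R ^- 2 : R) 2.
Proof.
have H n : \sum_(0 <= k < n.+1) (k.+1%:R ^- 2 : R) <= 2 - n.+1%:R^-1.
  elim: n => [|n ih]; first by rewrite big_nat1 expr1n; lra.
  rewrite big_nat_recr//= (le_trans (lerD ih (lexx _)))//.
  have n1 : 0 < n.+1%:R :> R by rewrite ltr0n.
  have E : n.+2%:R = n.+1%:R + 1 :> R by rewrite -natr1.
  rewrite E; set x := n.+1%:R in n1 *.
  have -> : 2 - (x + 1)^-1 = 2 - x^-1 + (x * (x + 1))^-1.
    by field; apply/andP; split; lra.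
  rewrite lerD2l lef_pV2 ?posrE ?exprn_gt0 ?mulr_gt0//; nra.
apply: sle_nat => [k|[|n]]; first by rewrite invr_ge0 exprn_ge0.
  by rewrite big_geq.
by rewrite (le_trans (H n))// gerBl invr_ge0.
Qed.

(** Pays for unions over the integer part of a small divisor. *)
Definition wint (k : int) : R := (1 + `|k|%N)%:R ^- 2.

Lemma wint_ge0 k : 0 <= wint k.
Proof. by rewrite invr_ge0 exprn_ge0. Qed.

Lemma sle_wint : sums_le wint (2 + 2).
Proof.
have S1 : sums_le (fun k => if (0 <= k)%R then wint k else 0) 2.
  apply: (@sle_map _ _ (fun k : int => 0 <= k) _ (fun k : nat => k.+1%:R ^- 2) absz) sle_nat_inv2.
  - by move=> k /negbTE ->.
  - by move=> k ->; rewrite /wint add1n.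
  - by move=> x y x0 y0 E; rewrite -(gez0_abs x0) -(gez0_abs y0) E.
  - by move=> k; rewrite invr_ge0 exprn_ge0.
have S2 : sums_le (fun k => if (k < 0)%R then wint k else 0) 2.
  apply: (@sle_map _ _ (fun k : int => k < 0) _ (fun k : nat => k.+1%:R ^- 2) absz) sle_nat_inv2.
  - by move=> k /negbTE ->.
  - by move=> k ->; rewrite /wint add1n.
  - move=> x y /ltW x0 /ltW y0 E.
    by apply: oppr_inj; rewrite -(lez0_abs x0) -(lez0_abs y0) E.
  - by move=> k; rewrite invr_ge0 exprn_ge0.
apply: sle_le (sleD S1 S2) => k.
by case: (leP 0 k); rewrite ?addr0 ?add0r.
Qed.

(** Splitting a list into head and tail makes the sum over lists of length n a power. It pays for
    unions over lists of corrections, and read on lists of coordinates it gives summability on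
    Z^n. *)
Lemma sle_seqprod (T : choiceType) (f : T -> R) S n : (forall x, 0 <= f x) -> sums_le f S ->
  sums_le (fun s : seq T => if size s == n then \prod_(x <- s) f x else 0) (S ^+ n).
Proof.
move=> f0 fS.
have P0 (s : seq T) : 0 <= \prod_(x <- s) f x by apply: prodr_ge0 => x _.
have S0 := sle_ge0 fS.
elim: n => [|n ih].
  rewrite expr0; apply: (@sle_le _ _ _ (fun s : seq T => if s == [::] then 1 else 0)).
    by move=> [|x s] //=; rewrite big_nil.
  by apply: sle_single.
case: (pselect (exists x : T, True)) => [[x0 _]|nT]; last first.
  apply: sle0; last by rewrite exprn_ge0.
  by move=> [|x s] //; case: nT; exists x.
pose h (s : seq T) := if size s == n then \prod_(x <- s) f x else 0.
have h0 s : 0 <= h s by rewrite /h; case: ifP.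
have fub := @sle_fub _ _ _ (fun x s => f x * h s) (fun x => f x * S ^+ n) (S * S ^+ n).
apply: (@sle_map _ _ (fun s => s != [::]) _ (fun p : T * seq T => f p.1 * h p.2)
   (fun s => (head x0 s, behead s))).
- by case.
- move=> [|x s] //= _; rewrite eqSS /h; case: ifP; rewrite ?mulr0//.
  by rewrite big_cons.
- by move=> [|x s] [|y t] //= _ _ [-> ->].
- by move=> p; rewrite mulr_ge0.
- rewrite exprS; apply: fub.
  + by move=> x s; rewrite mulr_ge0.
  + by move=> x; apply: sleZ.
  + have := sleZ (exprn_ge0 n S0) fS; rewrite mulrC; apply: sle_le => x.
    by rewrite mulrC.
Qed.

Definition n1 n (l : 'rV[int]_n) : nat := (\sum_i `|l 0%R i|%N)%N.

Lemma n1_0 n : n1 (0 : 'rV[int]_n) = 0%N.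
Proof. by rewrite /n1 big1// => i _; rewrite mxE. Qed.

Lemma n1_entry n (l : 'rV[int]_n) i : (`|l 0%R i|%N <= n1 l)%N.
Proof. by rewrite /n1 (bigD1 i)//= leq_addr. Qed.

Lemma n1_eq0 n (l : 'rV[int]_n) : n1 l = 0%N -> l = 0.
Proof.
move=> H; apply/rowP => i; rewrite mxE; apply/eqP; rewrite -absz_eq0 -leqn0.
by have := n1_entry l i; rewrite H.
Qed.

Lemma n1_gt0 n (l : 'rV[int]_n) : l != 0 -> (0 < n1 l)%N.
Proof. by move=> l0; rewrite lt0n; apply: contra l0 => /eqP /n1_eq0 ->. Qed.

Lemma n1D n (l m : 'rV[int]_n) : (n1 (l + m)%R <= n1 l + n1 m)%N.
Proof.
rewrite /n1 -big_split/=; apply: leq_sum => i _; rewrite mxE.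
by move: (l 0 i) (m 0 i) => x y; lia.
Qed.

Lemma n1N n (l : 'rV[int]_n) : n1 (- l) = n1 l.
Proof. by rewrite /n1; apply: eq_bigr => i _; rewrite mxE abszN. Qed.

(** The exponent 2n makes the weight at most a product of n inverse squares, since no entry of l
    exceeds [n1 l]. *)
Definition wlat n (l : 'rV[int]_n) : R := (1 + n1 l)%:R ^- (2 * n).

Lemma wlat_ge0 n (l : 'rV[int]_n) : 0 <= wlat l.
Proof. by rewrite invr_ge0 exprn_ge0. Qed.

Lemma sle_wlat n : sums_le (@wlat n) (4 ^+ n).
Proof.
have -> : 4 = 2 + 2 :> R by lra.
have H := sle_seqprod n wint_ge0 sle_wint.
apply: (@sle_map _ _ xpredT _ _ (fun l : 'rV[int]_n => [seq l 0 i | i <- enum 'I_n])) H => //.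
- move=> l _; rewrite size_map size_enum_ord eqxx big_map big_enum/= /wlat.
  rewrite exprM.
  have -> : ((1 + n1 l)%:R ^+ 2) ^- n = \prod_(i < n) ((1 + n1 l)%:R ^- 2) :> R.
    by rewrite prodr_const card_ord exprVn.
  apply: ler_prod => i _; rewrite invr_ge0 exprn_ge0//= /wint.
  rewrite lef_pV2 ?posrE ?exprn_gt0 ?ltr0n// lerXn2r ?nnegrE//.
  by rewrite ler_nat leq_add2l n1_entry.
- move=> l m _ _ E; apply/rowP => i.
  by have /eq_in_map := E => /(_ i); rewrite mem_enum; exact.
- by move=> s; case: ifP => // _; apply: prodr_ge0 => x _; exact: wint_ge0.
Qed.

Lemma exp_poly (k : nat) (s : R) : 0 < s ->
  exists C : R, 0 < C /\ forall x : nat, (1 + x)%:R ^+ k <= C * expR (s * x%:R).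
Proof.
(* The power k + 1 instead of k keeps the denominator nonzero when k = 0. *)
move=> s0; pose t := s / k.+1%:R.
have t0 : 0 < t by rewrite divr_gt0.
pose c := 1 + t^-1.
have c0 : 0 < c by rewrite addr_gt0// invr_gt0.
exists (c ^+ k.+1); split; first exact: exprn_gt0.
move=> x; apply: (@le_trans _ _ ((1 + x)%:R ^+ k.+1)).
  by rewrite ler_weXn2l// natrD lerDl.
have -> : expR (s * x%:R) = expR (t * x%:R) ^+ k.+1.
  rewrite -expRM_natl; congr expR; rewrite /t; field.
  by rewrite gt_eqF// ltr_pwDl.
rewrite -exprMn lerXn2r ?nnegrE ?mulr_ge0 ?expR_ge0 ?(ltW c0)//.
have H : 1 + t * x%:R <= expR (t * x%:R) by exact: expR_ge1Dx.
apply: le_trans (ler_wpM2l (ltW c0) H).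
rewrite /c natrD mulrDl mul1r mulrDr mulr1 [t^-1 * (t * _)]mulrA mulVf ?gt_eqF// mul1r.
have : 0 <= t * x%:R by rewrite mulr_ge0// ltW.
have : 0 < t^-1 by rewrite invr_gt0.
lra.
Qed.

Lemma sle_exp n (s : R) : 0 < s ->
  exists S, 0 < S /\ sums_le (fun l : 'rV[int]_n => expR (- s * (n1 l)%:R)) S.
Proof.
move=> s0; have [C [C0 HC]] := exp_poly (2 * n) s0.
exists (C * 4 ^+ n); split; first by rewrite mulr_gt0 ?exprn_gt0.
apply: sle_le (sleZ (ltW C0) (@sle_wlat n)) => l.
rewrite /wlat mulNr expRN -[leRHS]invrK invfM invrK lef_pV2 ?posrE ?expR_gt0//.
  by rewrite mulrC ler_pdivrMr// mulrC; exact: HC.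
by rewrite mulr_gt0 ?invr_gt0 ?exprn_gt0// ltr0n.
Qed.

End Weights.

Lemma esum_inj (R : realType) (T U : choiceType) (f : T -> \bar R) (e : U -> T) :
  injective e -> (forall x, ~ range e x -> f x = 0%E) ->
  (\esum_(x in [set: T]) f x = \esum_(y in [set: U]) f (e y))%E.
Proof.
move=> ei f0; rewrite -(@esum_image _ _ _ setT e f); last by move=> x y _ _; exact: ei.
rewrite [RHS]esum_mkcond; apply: eq_esum => x _.
by case: ifPn => // /negP h; rewrite f0// => h'; apply: h; exact: mem_set.
Qed.

Lemma csum_inj (R : realType) (T U : choiceType) (f : T -> R[i]) (e : U -> T) :
  injective e -> (forall x, ~ range e x -> f x = 0) -> csum f = csum (f \o e).
Proof.
move=> ei f0; rewrite /csum /rsum; congr (fine (_ - _)%E +i* fine (_ - _)%E)%C.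
- rewrite (esum_inj ei); first by apply: eq_esum => x _; rewrite !funeposE.
  by move=> x /f0; rewrite funeposE => ->/=; rewrite maxxx.
- rewrite (esum_inj ei); first by apply: eq_esum => x _; rewrite !funenegE.
  by move=> x /f0; rewrite funenegE => ->/=; rewrite oppr0 maxxx.
- rewrite (esum_inj ei); first by apply: eq_esum => x _; rewrite !funeposE.
  by move=> x /f0; rewrite funeposE => ->/=; rewrite maxxx.
- rewrite (esum_inj ei); first by apply: eq_esum => x _; rewrite !funenegE.
  by move=> x /f0; rewrite funenegE => ->/=; rewrite oppr0 maxxx.
Qed.

Lemma csum_natS (R : realType) (f : nat -> R[i]) : summable_c f ->
  csum f = f 0 + csum (fun k => f k.+1).
Proof.
move=> [M fM].
have E : f = (fun k => (if k == 0 then f 0 else 0) + (if k == 0 then 0 else f k)).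
  by apply: funext => -[|k]; rewrite ?addr0 ?add0r.
rewrite {1}E csumD; first last.
- exists M; apply: sle_le fM => k.
  by case: ifP => //; rewrite cabs0 cabs_ge0.
- exists (cabs (f 0)); apply: sle_le (sle_single 0%N (cabs_ge0 (f 0))) => k.
  by case: ifP; rewrite ?cabs0.
rewrite csum_single (@csum_inj _ _ _ _ succn); first by [].
- exact: succn_inj.
- by move=> [|k]//= H; case: H; exists k.
Qed.

(** * The weighted algebra of quasi-periodic operators *)

Section Algebra.
Variables (R : realType) (d : nat) (X : Type).
Notation G := ('rV[int]_d).
Variables (sh : X -> G -> X) (al : X -> G -> bool).
Hypothesis sh0 : forall x, sh x 0 = x.
Hypothesis shD : forall x l m, sh (sh x l) m = sh x (l + m).
Hypothesis al0 : forall x, al x 0.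
Hypothesis alD : forall x l m, al x l -> al (sh x l) m -> al x (l + m).
Notation C := R[i].
(** [A x l] is the matrix entry leading from the column x to [sh x l], carried by the time mode
    l. *)
Definition opT : Type := X -> G -> C.
Implicit Types (A B F : opT) (s M N : R).

Definition ew s (l : G) : R := expR (s * (n1 l)%:R).

Lemma ew_ge0 s l : 0 <= ew s l. Proof. exact: expR_ge0. Qed.

Lemma ew_ge1 s l : 0 <= s -> 1 <= ew s l.
Proof. by move=> s0; rewrite -expR0 ler_expR mulr_ge0. Qed.

Lemma ewD s l m : 0 <= s -> ew s (l + m) <= ew s l * ew s m.
Proof.
move=> s0; rewrite -expRD -mulrDr ler_expR ler_wpM2l// -natrD ler_nat.
exact: n1D.
Qed.

Lemma ew_sub s l m : 0 <= s -> ew s l <= ew s (l - m) * ew s m.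
Proof. by move=> s0; rewrite -[in leLHS](subrK m l); exact: ewD. Qed.

Lemma ew_le s s' l : s <= s' -> ew s l <= ew s' l.
Proof. by move=> ss; rewrite ler_expR ler_wpM2r. Qed.

Lemma ew0 s : ew s 0 = 1.
Proof. by rewrite /ew n1_0 mulr0 expR0. Qed.

(** An exponentially weighted l^1 norm of the columns, uniform in x. The support condition [al] lets
    the same norm serve operators that keep only a family of modes closed under composition. *)
Definition bd s M A := forall x, sums_le (fun l => ew s l * cabs (A x l)) M /\
  forall l, ~~ al x l -> A x l = 0.

Lemma bd_ge0 s M A (x : X) : bd s M A -> 0 <= M.
Proof. by move=> /(_ x) [] /sle_ge0. Qed.

Lemma bd_le s s' M M' A : s' <= s -> M <= M' -> bd s M A -> bd s' M' A.
Proof.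
move=> ss MM AM x; have [H K] := AM x; split => //.
by apply: sle_leM MM _; apply: sle_le H => l; rewrite ler_wpM2r ?cabs_ge0// ew_le.
Qed.

Lemma bd_term s M A x l : bd s M A -> cabs (A x l) <= M * ew (- s) l.
Proof.
move=> /(_ x) [/(sle_term l) H _].
by rewrite /ew mulNr expRN ler_pdivlMr ?expR_gt0// mulrC.
Qed.

Lemma bdD s M N A B : bd s M A -> bd s N B -> bd s (M + N) (fun x l => A x l + B x l).
Proof.
move=> AM BN x; have [A1 A2] := AM x; have [B1 B2] := BN x; split.
  apply: sle_le (sleD A1 B1) => l; rewrite -mulrDr ler_wpM2l ?ew_ge0//.
  exact: cabsD.
by move=> l nl; rewrite A2// B2// addr0.
Qed.

Lemma bd_mulr s M K A (c : X -> C) : (forall x, cabs (c x) <= K) -> 0 <= K -> bd s M A ->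
  bd s (M * K) (fun x l => A x l * c x).
Proof.
move=> cK K0 AM x; have [A1 A2] := AM x; split.
  have := sleZ K0 A1; rewrite mulrC; apply: sle_le => l.
  rewrite cabsM mulrA mulrC ler_wpM2r ?cK// mulr_ge0 ?ew_ge0 ?cabs_ge0//.
by move=> l nl; rewrite A2// mul0r.
Qed.

Lemma bd_dom s M A B : (forall x l, cabs (B x l) <= cabs (A x l)) -> bd s M A -> bd s M B.
Proof.
move=> BA AM x; have [A1 A2] := AM x; split.
  by apply: sle_le A1 => l; rewrite ler_wpM2l ?ew_ge0.
by move=> l nl; apply: cabs_eq0; apply/eqP; rewrite eq_le cabs_ge0 andbT (le_trans (BA x l))// A2// cabs0.
Qed.

Lemma bdN s M A : bd s M A -> bd s M (fun x l => - A x l).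
Proof. by apply: bd_dom => x l; rewrite cabsN. Qed.

Definition ido : opT := fun x l => if l == 0 then 1 else 0.

Lemma bd_ido s : bd s 1 ido.
Proof.
move=> x; split.
  have := sle_single (0 : G) (@ler01 R); apply: sle_le => l; rewrite /ido.
  by case: eqP => [->|_]; rewrite ?ew0 ?cabs1 ?cabs0 ?mul1r ?mulr0.
by move=> l; rewrite /ido; case: eqP => // -> ; rewrite al0.
Qed.

(** Matrix composition: B leads from x to [sh x m], and A continues from there to [sh x l]. *)
Definition cmul A B : opT := fun x l => csum (fun m => A (sh x m) (l - m) * B x m).

Lemma shift_bij (m : G) : bijective (fun l : G => l - m).
Proof. by exists (fun l => l + m) => l; rewrite ?subrK ?addrK. Qed.

Lemma cmul_sle s M N A B x : 0 <= s -> bd s M A -> bd s N B ->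
  sums_le (fun p : G * G => ew s p.1 * cabs (A (sh x p.2) (p.1 - p.2) * B x p.2)) (M * N).
Proof.
move=> s0 AM BN; have M0 := bd_ge0 x AM.
apply: (@sle_swap _ _ _ (fun m l : G => ew s l * cabs (A (sh x m) (l - m) * B x m))).
apply: (@sle_fub _ _ _ (fun m l : G => ew s l * cabs (A (sh x m) (l - m) * B x m))
   (fun m => M * (ew s m * cabs (B x m)))).
- by move=> m l; rewrite mulr_ge0 ?ew_ge0 ?cabs_ge0.
- move=> m; have [A1 _] := AM (sh x m).
  have c0 : 0 <= ew s m * cabs (B x m) by rewrite mulr_ge0 ?ew_ge0 ?cabs_ge0.
  have := sleZ c0 (sle_inj (bij_inj (shift_bij m)) A1); rewrite [_ * M]mulrC.
  apply: sle_le => l /=; rewrite cabsM.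
  apply: le_trans (ler_wpM2r _ (ew_sub l m s0)) _; first by rewrite mulr_ge0 ?cabs_ge0.
  by rewrite le_eqVlt; apply/orP; left; apply/eqP; ring.
- by apply: sleZ => //; have [] := BN x.
Qed.

Lemma cmul_smb2 s M N A B x : 0 <= s -> bd s M A -> bd s N B ->
  summable_c (fun p : G * G => A (sh x p.2) (p.1 - p.2) * B x p.2).
Proof.
move=> s0 AM BN; exists (M * N); apply: sle_le (cmul_sle x s0 AM BN) => p.
by rewrite ler_peMl ?cabs_ge0 ?ew_ge1.
Qed.

Lemma cmul_smb s M N A B x l : 0 <= s -> bd s M A -> bd s N B ->
  summable_c (fun m => A (sh x m) (l - m) * B x m).
Proof.
move=> s0 AM BN.
exact: (@smb_row _ _ _ (fun l m => A (sh x m) (l - m) * B x m)) (cmul_smb2 x s0 AM BN).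
Qed.

Lemma bd_cmul s M N A B : 0 <= s -> bd s M A -> bd s N B -> bd s (M * N) (cmul A B).
Proof.
move=> s0 AM BN x; split.
  have := @sle_csum _ _ _ (fun l m => (ew s l)%:C%C * (A (sh x m) (l - m) * B x m)) (M * N).
  have E (l m : G) : cabs ((ew s l)%:C%C * (A (sh x m) (l - m) * B x m)) =
      ew s l * cabs (A (sh x m) (l - m) * B x m).
    by rewrite cabsM cabs_real ger0_norm// ew_ge0.
  move=> H; apply: sle_le (H _); last first.
    by apply: sle_le (cmul_sle x s0 AM BN) => p; rewrite E.
  move=> l; rewrite csumZ; last exact: cmul_smb s0 AM BN.
  by rewrite cabsM cabs_real ger0_norm// ew_ge0.
move=> l nl; rewrite /cmul -[RHS](csum0 R G); apply: eq_csum => m.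
have [bm|bm] := boolP (al x m); last by have [_ ->//] := BN x; rewrite mulr0.
have [bl|bl] := boolP (al (sh x m) (l - m)); last first.
  by have [_ ->//] := AM (sh x m); rewrite mul0r.
by case/negP: nl; have := alD bm bl; rewrite addrC subrK.
Qed.

Lemma cmulDl s M M' N A A' B : 0 <= s -> bd s M A -> bd s M' A' -> bd s N B ->
  cmul (fun x l => A x l + A' x l) B = (fun x l => cmul A B x l + cmul A' B x l).
Proof.
move=> s0 AM A'M BN; apply: funext => x; apply: funext => l.
rewrite /cmul -csumD; [|exact: cmul_smb s0 AM BN|exact: cmul_smb s0 A'M BN].
by apply: eq_csum => m; rewrite mulrDl.
Qed.

Lemma cmulDr s M N N' A B B' : 0 <= s -> bd s M A -> bd s N B -> bd s N' B' ->
  cmul A (fun x l => B x l + B' x l) = (fun x l => cmul A B x l + cmul A B' x l).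
Proof.
move=> s0 AM BN B'N; apply: funext => x; apply: funext => l.
rewrite /cmul -csumD; [|exact: cmul_smb s0 AM BN|exact: cmul_smb s0 AM B'N].
by apply: eq_csum => m; rewrite mulrDr.
Qed.

Lemma cmulNl s M N A B : 0 <= s -> bd s M A -> bd s N B ->
  cmul (fun x l => - A x l) B = (fun x l => - cmul A B x l).
Proof.
move=> s0 AM BN; apply: funext => x; apply: funext => l.
rewrite /cmul -csumN; last exact: cmul_smb s0 AM BN.
by apply: eq_csum => m; rewrite mulNr.
Qed.

Lemma cmulNr s M N A B : 0 <= s -> bd s M A -> bd s N B ->
  cmul A (fun x l => - B x l) = (fun x l => - cmul A B x l).
Proof.
move=> s0 AM BN; apply: funext => x; apply: funext => l.
rewrite /cmul -csumN; last exact: cmul_smb s0 AM BN.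
by apply: eq_csum => m; rewrite mulrN.
Qed.

Lemma cmul_diagr s M N A B (c : X -> C) : 0 <= s -> bd s M A -> bd s N B ->
  cmul A (fun x l => B x l * c x) = (fun x l => cmul A B x l * c x).
Proof.
move=> s0 AM BN; apply: funext => x; apply: funext => l.
rewrite /cmul -csumZr; last exact: cmul_smb s0 AM BN.
by apply: eq_csum => m; rewrite mulrA.
Qed.

Lemma cmul1r A : cmul A ido = A.
Proof.
apply: funext => x; apply: funext => l; rewrite /cmul -[RHS](csum_single (0 : G)).
apply: eq_csum => m; rewrite /ido; case: eqP => [->|_]; last by rewrite mulr0.
by rewrite sh0 subr0 mulr1.
Qed.

Lemma cmul1l B : cmul ido B = B.
Proof.
apply: funext => x; apply: funext => l; rewrite /cmul -[RHS](csum_single l).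
apply: eq_csum => m; rewrite /ido subr_eq0 eq_sym.
by case: eqP => [->|_]; rewrite ?mul1r ?mul0r.
Qed.

Lemma cmulA s M N K A B F : 0 <= s -> bd s M A -> bd s N B -> bd s K F ->
  cmul (cmul A B) F = cmul A (cmul B F).
Proof.
move=> s0 AM BN FK; apply: funext => x; apply: funext => l.
have M0 := bd_ge0 x AM.
pose f (n m : G) := A (sh x n) (l - n) * (B (sh x m) (n - m) * F x m).
have fs : summable_c (fun p : G * G => f p.1 p.2).
  have := sleZ M0 (cmul_sle x s0 BN FK) => H; exists (M * (N * K)); apply: sle_le H => p.
  rewrite /f cabsM ler_pM ?cabs_ge0//; last by rewrite ler_peMl ?cabs_ge0 ?ew_ge1.
  have [A1 _] := AM (sh x p.1); apply: le_trans (sle_term (l - p.1) A1).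
  by rewrite ler_peMl ?cabs_ge0 ?ew_ge1.
transitivity (csum (fun n => csum (f n))); last first.
  by apply: eq_csum => n; rewrite /f csumZ//; exact: cmul_smb s0 BN FK.
rewrite csum_swap//; apply: eq_csum => m.
rewrite /cmul -csumZr; last exact: cmul_smb s0 AM BN.
rewrite (csum_bij _ (shift_bij m)); apply: eq_csum => n /=.
by rewrite shD /f addrC subrK opprB addrA subrK mulrA.
Qed.

Fixpoint powo F k : opT := if k is k'.+1 then cmul F (powo F k') else ido.

Lemma bd_powo s f F k : 0 <= s -> bd s f F -> bd s (f ^+ k) (powo F k).
Proof.
move=> s0 Ff; elim: k => [|k ih] /=; first by rewrite expr0; exact: bd_ido.
by rewrite exprS; exact: bd_cmul.
Qed.

Lemma powoSr s f F k : 0 <= s -> bd s f F -> powo F k.+1 = cmul (powo F k) F.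
Proof.
move=> s0 Ff; elim: k => [|k ih]; first by rewrite /= cmul1r cmul1l.
by rewrite -[LHS]/(cmul F (powo F k.+1)) [X in cmul F X = _]ih -(cmulA s0 Ff (bd_powo k s0 Ff) Ff).
Qed.

Definition neum F : opT := fun x l => csum (fun k => powo F k x l).

Lemma sle_geom (f : R) : 0 <= f -> f < 1 -> sums_le (fun k => f ^+ k) (1 - f)^-1.
Proof.
move=> f0 f1; apply: sle_nat => [k|n]; first exact: exprn_ge0.
have f1' : 0 < 1 - f by rewrite subr_gt0.
rewrite big_mkord -(ler_pM2l f1') mulfV ?gt_eqF//.
have := subrX1 f n; have := exprn_ge0 n f0; lra.
Qed.

Section Neumann.
Variables (s f : R) (F : opT).
Hypotheses (s0 : 0 <= s) (Ff : bd s f F) (f1 : f < 1).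

Lemma powo_sle x : sums_le (fun p : nat * G => ew s p.2 * cabs (powo F p.1 x p.2)) (1 - f)^-1.
Proof.
have f0 := bd_ge0 x Ff.
apply: (@sle_fub _ _ _ (fun k l => ew s l * cabs (powo F k x l)) _ _ _ _ (sle_geom f0 f1)).
- by move=> *; rewrite mulr_ge0 ?ew_ge0 ?cabs_ge0.
- by move=> k; have [] := bd_powo k s0 Ff x.
Qed.

Lemma powo_col x l : sums_le (fun k => ew s l * cabs (powo F k x l)) (1 - f)^-1.
Proof.
apply: (@sle_row _ _ _ (fun (l : G) k => ew s l * cabs (powo F k x l)) _ l).
  by move=> *; rewrite mulr_ge0 ?ew_ge0 ?cabs_ge0.
exact: (@sle_swap _ _ _ (fun k l => ew s l * cabs (powo F k x l))) (powo_sle x).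
Qed.

Lemma powo_smb x l : summable_c (fun k => powo F k x l).
Proof.
exists (1 - f)^-1; apply: sle_le (powo_col x l) => k.
by rewrite ler_peMl ?cabs_ge0 ?ew_ge1.
Qed.

Lemma bd_neum : bd s (1 - f)^-1 (neum F).
Proof.
move=> x; split.
  have H := @sle_csum _ _ _ (fun l k => (ew s l)%:C%C * powo F k x l) (1 - f)^-1.
  apply: sle_le (H _).
    move=> l; rewrite csumZ; last exact: powo_smb.
    by rewrite cabsM cabs_real ger0_norm// ew_ge0.
  have := @sle_swap _ _ _ (fun k l => ew s l * cabs (powo F k x l)) _ (powo_sle x).
  apply: sle_le => p; by rewrite cabsM cabs_real ger0_norm// ew_ge0.
move=> l nl; rewrite /neum -[RHS](csum0 R nat); apply: eq_csum => k.
by have [_ ->] := bd_powo k s0 Ff x.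
Qed.

Lemma neum_natS x l : neum F x l = ido x l + csum (fun k => powo F k.+1 x l).
Proof. by rewrite /neum csum_natS//; exact: powo_smb. Qed.

Lemma cmul_neum : cmul F (neum F) = (fun x l => neum F x l - ido x l).
Proof.
apply: funext => x; apply: funext => l; rewrite neum_natS addrAC subrr add0r.
rewrite /= /cmul.
have f0 := bd_ge0 x Ff.
transitivity (csum (fun m => csum (fun k => F (sh x m) (l - m) * powo F k x m))).
  by apply: eq_csum => m; rewrite csumZ//; exact: powo_smb.
rewrite csum_swap//; exists (f * (1 - f)^-1).
have := sleZ f0 (@sle_swap _ _ _ (fun k l => ew s l * cabs (powo F k x l)) _ (powo_sle x)).
apply: sle_le => p /=; rewrite cabsM ler_pM ?cabs_ge0//.
  apply: le_trans (sle_term (l - p.1) (proj1 (Ff (sh x p.1)))).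
  by rewrite ler_peMl ?cabs_ge0 ?ew_ge1.
by rewrite ler_peMl ?cabs_ge0 ?ew_ge1.
Qed.

Lemma neum_cmul : cmul (neum F) F = (fun x l => neum F x l - ido x l).
Proof.
apply: funext => x; apply: funext => l; rewrite neum_natS addrAC subrr add0r.
have f0 := bd_ge0 x Ff.
rewrite [LHS](_ : _ = csum (fun m => csum (fun k => powo F k (sh x m) (l - m) * F x m))); last first.
  by apply: eq_csum => m; rewrite /neum csumZr//; exact: powo_smb.
rewrite csum_swap.
  by apply: eq_csum => k; rewrite (powoSr k s0 Ff).
exists ((1 - f)^-1 * f).
apply: (@sle_fub _ _ _ (fun m k => cabs (powo F k (sh x m) (l - m) * F x m))
  (fun m => (1 - f)^-1 * (ew s m * cabs (F x m)))).
- by move=> *; exact: cabs_ge0.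
- move=> m; have := sleZ (mulr_ge0 (ew_ge0 s m) (cabs_ge0 (F x m))) (powo_col (sh x m) (l - m)).
  rewrite [_ * _^-1]mulrC; apply: sle_le => k; rewrite cabsM mulrC.
  rewrite ler_pM ?cabs_ge0// ler_peMl ?cabs_ge0 ?ew_ge1//.
- apply: sleZ; last by have [] := Ff x.
  by rewrite invr_ge0 subr_ge0 ltW.
Qed.

End Neumann.

End Algebra.

(** * The KAM iteration at a fixed frequency *)

Section KamStep.
Variables (R : realType) (d : nat) (X : Type).
Notation G := ('rV[int]_d).
Variables (sh : X -> G -> X) (al : X -> G -> bool).
Hypothesis sh0 : forall x, sh x 0 = x.
Hypothesis shD : forall x l m, sh (sh x l) m = sh x (l + m).
Hypothesis al0 : forall x, al x 0.
Hypothesis alD : forall x l m, al x l -> al (sh x l) m -> al x (l + m).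
Notation C := R[i].
Notation opT := (opT R d X).
Notation cmul := (cmul sh).
Notation bd := (@bd R d X al).
Variables (th : G -> C) (E : X -> C) (V : opT).
Hypothesis thB : forall l m, th (l - m) = th l - th m.

(* One KAM step: lam' = lam + P(0), F = - P/divisor on 0 < |l| <= M,
   P' = (1 + F)^-1 (P F - F P(0) + tail P), W' = W (1 + F). *)
Definition divisor (lam : X -> C) : opT :=
  fun x l => th l + E (sh x l) - E x + lam (sh x l) - lam x.

Definition hom (M : nat) (lam : X -> C) (P : opT) : opT :=
  fun x l => if (l != 0) && (n1 l <= M)%N then - P x l / divisor lam x l else 0.

Definition tail (M : nat) (P : opT) : opT := fun x l => if (M < n1 l)%N then P x l else 0.

Definition remainder M lam P : opT :=
  let F := hom M lam P in
  fun x l => cmul P F x l + (- (F x l * P x 0) + tail M P x l).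

Definition nextP M lam P : opT :=
  cmul (neum sh (fun x l => - hom M lam P x l)) (remainder M lam P).

Definition nextG M lam P (W : opT) : opT :=
  fun x l => W x l + cmul W (hom M lam P) x l.

(** W conjugates the operator with diagonal th + E and coupling V to the diagonal E + lam up to the
    error P; with P = 0 the columns of W are exact eigenvectors. *)
Definition intertwines (lam : X -> C) (P W : opT) := forall x l,
  (th l + E (sh x l)) * W x l + cmul V W x l = W x l * (E x + lam x) + cmul W P x l.

Definition nonres M cg lam := forall x l, al x l -> l != 0 -> (n1 l <= M)%N ->
  cg <= cabs (divisor lam x l).

Variables (M : nat) (lam : X -> C) (P W : opT) (s s' p g v cg f : R).
Hypotheses (s'0 : 0 <= s') (ss : s' <= s) (cg0 : 0 < cg).
Hypotheses (Pp : bd s p P) (Wg : bd s g W) (Vv : bd s v V).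
Hypotheses (nr : nonres M cg lam) (fE : p / cg <= f) (f1 : f < 1).
Hypothesis itw : intertwines lam P W.
Let F := hom M lam P.
Let s0 : 0 <= s. Proof. exact: le_trans ss. Qed.

Lemma bd_hom : bd s f F.
Proof.
move=> x; have [P1 P2] := Pp x; split; last first.
  by move=> l nl; rewrite /F /hom P2// oppr0 mul0r; case: ifP.
have H : sums_le (fun l => ew s l * cabs (F x l)) (cg^-1 * p).
  have cgi : 0 <= cg^-1 by rewrite invr_ge0 ltW.
  apply: sle_le (sleZ cgi P1) => l; rewrite mulrCA ler_wpM2l ?ew_ge0//.
  rewrite /F /hom; case: ifPn => [/andP[l0 lM]|_]; last first.
    by rewrite cabs0 mulr_ge0 ?cabs_ge0.
  have [bl|bl] := boolP (al x l); last by rewrite P2// oppr0 mul0r cabs0 mulr0.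
  rewrite cabsM cabsN cabsV mulrC ler_wpM2r ?cabs_ge0//.
  have := nr bl l0 lM => H; rewrite lef_pV2 ?posrE//.
  exact: lt_le_trans cg0 H.
by apply: sle_leM H; rewrite mulrC.
Qed.

(** The homological equation freed of its division, so that it holds at every l: modes that are not
    allowed give 0 = 0 because P vanishes there. *)
Lemma homE x l : divisor lam x l * F x l + P x l = (if l == 0 then P x 0 else 0) + tail M P x l.
Proof.
rewrite /F /hom /tail; have [->|l0] /= := eqVneq l 0.
  by rewrite n1_0 ltn0 mulr0 add0r addr0.
rewrite leqNgt; case: ltnP => lM /=; first by rewrite mulr0.
have [bl|bl] := boolP (al x l); last first.
  by have [_ ->//] := Pp x; rewrite oppr0 mul0r mulr0 !addr0.
have D0 : divisor lam x l != 0.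
  apply/eqP => D; have := nr bl l0 lM; rewrite D cabs0.
  by move=> /(lt_le_trans cg0); rewrite ltxx.
by rewrite addr0 mulrC divfK// addNr.
Qed.

Lemma bd_tail : bd s' (expR (- (s - s') * M%:R) * p) (tail M P).
Proof.
move=> x; have [P1 P2] := Pp x; split; last by move=> l nl; rewrite /tail P2// if_same.
apply: sle_le (sleZ (expR_ge0 _) P1) => l; rewrite /tail.
case: ifPn => [Ml|_]; last first.
  by rewrite cabs0 mulr0 !mulr_ge0 ?expR_ge0 ?cabs_ge0.
rewrite mulrA ler_wpM2r ?cabs_ge0// -expRD ler_expR.
have : (s - s') * M%:R <= (s - s') * (n1 l)%:R.
  by rewrite ler_wpM2l ?subr_ge0// ler_nat ltnW.
lra.
Qed.

Lemma diag_bound x : cabs (P x 0) <= p.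
Proof. by have := bd_term x 0 Pp; rewrite ew0 mulr1. Qed.

Lemma bd_remainder : bd s' (p * f + (f * p + expR (- (s - s') * M%:R) * p)) (remainder M lam P).
Proof.
case: (pselect (exists x : X, True)) => [[x0 _]|nx]; last first.
  by move=> x; case: nx; exists x.
have p0 := bd_ge0 x0 Pp.
apply: bdD.
  apply: (bd_le ss (lexx _)); exact: (bd_cmul alD s0 Pp bd_hom).
apply: bdD bd_tail; apply: bdN; apply: (bd_le ss (lexx _)).
by apply: bd_mulr bd_hom => // x; exact: diag_bound.
Qed.

Lemma bd_neumF : bd s (1 - f)^-1 (neum sh (fun x l => - F x l)).
Proof. exact: (bd_neum al0 alD s0 (bdN bd_hom) f1). Qed.

Lemma bd_nextP : bd s' ((1 - f)^-1 * (p * f + (f * p + expR (- (s - s') * M%:R) * p)))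
  (nextP M lam P).
Proof.
apply: (bd_cmul alD s'0 _ bd_remainder).
exact: (bd_le ss (lexx _)) bd_neumF.
Qed.

(** Undoes the Neumann inverse inside [nextP]; the conjugation identity consumes the new error only
    in this form. *)
Lemma nextPE x l : nextP M lam P x l + cmul F (nextP M lam P) x l = remainder M lam P x l.
Proof.
have NE := cmul_neum al0 alD s0 (bdN bd_hom) f1.
have NF := bd_neumF; have Fs := bd_le ss (lexx _) bd_hom.
have NF' := bd_le ss (lexx _) NF.
rewrite -(cmulA shD s'0 Fs NF' bd_remainder).
have E1 : cmul F (neum sh (fun x l => - F x l)) =
    (fun x l => ido R x l + - neum sh (fun x l => - F x l) x l).
  apply: funext => y; apply: funext => k.
  have := congr1 (fun h : opT => h y k) NE; rewrite (cmulNl _ s0 bd_hom NF) => H.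
  by rewrite -[LHS]opprK H opprB.
have I := bd_ido al0 s'.
rewrite E1 (cmulDl _ s'0 I (bdN NF') bd_remainder) (cmulNl _ s'0 NF' bd_remainder) cmul1l.
by rewrite /nextP addrCA subrr addr0.
Qed.

(** Multiplication by th + E is unbounded, so it cannot be composed with W and F inside the algebra.
    [homE] rewrites its product with F as the bounded expression [Y], and the identity is then
    checked term by term under the convolution sum. *)
Lemma intertwines_next :
  intertwines (fun x => lam x + P x 0) (nextP M lam P) (nextG M lam P W).
Proof.
move=> x l.
have Fs := bd_le ss (lexx _) bd_hom; have Ws := bd_le ss (lexx _) Wg.
have Vs := bd_le ss (lexx _) Vv; have Ps := bd_le ss (lexx _) Pp.
have WF := bd_cmul alD s'0 Ws Fs.
have dg : bd s' p (fun x l => if l == 0 then P x 0 else 0).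
  move=> y; split.
    have := sle_single (0 : G) (le_trans (cabs_ge0 _) (diag_bound y)).
    apply: sle_le => k; case: eqP => [->|_]; last by rewrite cabs0 mulr0.
    by rewrite ew0 mul1r diag_bound.
  by move=> k nk; case: eqP nk => // ->; rewrite al0.
pose Y : opT := fun x l => F x l * (E x + lam x) +
   ((if l == 0 then P x 0 else 0) + (tail M P x l + - P x l)).
have YE y k : Y y k = (th k + E (sh y k) + lam (sh y k)) * F y k.
  rewrite /Y; have := homE y k; rewrite /divisor => H.
  have -> : (if k == 0 then P y 0 else 0) + (tail M P y k + - P y k) =
    (th k + E (sh y k) - E y + lam (sh y k) - lam y) * F y k by rewrite addrA -H; ring.
  by ring.
have key : (th l + E (sh x l)) * cmul W F x l + cmul (cmul V W) F x l =
    cmul W Y x l + cmul (cmul W P) F x l.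
  have a1 := cmul_smb sh x l s'0 Ws Fs.
  have a2 := cmul_smb sh x l s'0 (bd_cmul alD s'0 Vs Ws) Fs.
  have a3 := cmul_smb sh x l s'0 (bd_cmul alD s'0 Ws Ps) Fs.
  (* Summability comes from the equation for W itself: termwise [W Y] is a combination of three
     products already known to be summable. *)
  have a4 : summable_c (fun m => W (sh x m) (l - m) * Y x m).
    have q := smbD (smbD (smbZ (th l + E (sh x l)) a1) a2) (smbN a3).
    case: q => N qN; exists N; apply: sle_le qN => m; rewrite le_eqVlt; apply/orP; left.
    apply/eqP; congr cabs; rewrite YE.
    have := itw (sh x m) (l - m); rewrite shD [m + _]addrC subrK thB => H.
    have -> : cmul V W (sh x m) (l - m) = W (sh x m) (l - m) * (E (sh x m) + lam (sh x m)) +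
      cmul W P (sh x m) (l - m) - (th l - th m + E (sh x l)) * W (sh x m) (l - m).
      by rewrite -H; ring.
    by ring.
  have u (A B : opT) : cmul A B x l = csum (fun m => A (sh x m) (l - m) * B x m) by [].
  rewrite (u W F) (u (cmul V W) F) (u W Y) (u (cmul W P) F).
  rewrite -(csumZ _ a1) -(csumD (smbZ _ a1) a2) -(csumD a4 a3); apply: eq_csum => m; rewrite YE.
  have := itw (sh x m) (l - m); rewrite shD [m + _]addrC subrK thB => H.
  have -> : cmul V W (sh x m) (l - m) = W (sh x m) (l - m) * (E (sh x m) + lam (sh x m)) +
      cmul W P (sh x m) (l - m) - (th l - th m + E (sh x l)) * W (sh x m) (l - m).
    by rewrite -H; ring.
  by ring.
have Ft : bd s' (expR (- (s - s') * M%:R) * p) (tail M P) by exact: bd_tail.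
have WP := bd_cmul alD s'0 Ws Ps.
have WY : cmul W Y x l = cmul W F x l * (E x + lam x) +
    (W x l * P x 0 + (cmul W (tail M P) x l - cmul W P x l)).
  have b1 := cmul_smb sh x l s'0 Ws Fs; have b2 := cmul_smb sh x l s'0 Ws dg.
  have b3 := cmul_smb sh x l s'0 Ws Ft; have b4 := cmul_smb sh x l s'0 Ws Ps.
  have b5 : summable_c (fun m => W (sh x m) (l - m) * F x m * (E x + lam x)).
    by have := smbZ (E x + lam x) b1; under eq_fun do rewrite mulrC.
  rewrite [LHS](_ : _ = csum (fun m => W (sh x m) (l - m) * F x m * (E x + lam x) +
     (W (sh x m) (l - m) * (if m == 0 then P x 0 else 0) +
     (W (sh x m) (l - m) * tail M P x m - W (sh x m) (l - m) * P x m)))); last first.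
    apply: eq_csum => m; rewrite /Y; move: (if _ then _ else _) => z.
    by ring.
  rewrite csumD//; last by apply: smbD => //; apply: smbD => //; exact: smbN.
  rewrite csumD//; last by apply: smbD => //; exact: smbN.
  rewrite csumB// csumZr//; congr (_ + (_ + _)).
  rewrite -[RHS](csum_single (0 : G)); apply: eq_csum => m.
  by case: eqP => [->|_]; rewrite ?mulr0// sh0 subr0.
have Q' := bd_nextP; have PF := bd_cmul alD s'0 Ps Fs.
have FQ' := bd_cmul alD s'0 Fs Q'.
have Fd : bd s' (f * p) (fun x l => F x l * P x 0).
  apply: bd_mulr Fs; first exact: diag_bound.
  exact: le_trans (cabs_ge0 _) (diag_bound x).
have HP : cmul W (nextP M lam P) x l + cmul W (cmul F (nextP M lam P)) x l =
    cmul W (cmul P F) x l - cmul W F x l * P x 0 + cmul W (tail M P) x l.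
  have := congr1 (fun A : opT => A x l) (cmulDr _ s'0 Ws Q' FQ') => /= <-.
  have -> : (fun x0 l0 => nextP M lam P x0 l0 + cmul F (nextP M lam P) x0 l0) = remainder M lam P.
    by apply: funext => y; apply: funext => k; exact: nextPE.
  rewrite /remainder -/F (cmulDr _ s'0 Ws PF (bdD (bdN Fd) Ft)) (cmulDr _ s'0 Ws (bdN Fd) Ft).
  by rewrite (cmulNr _ s'0 Ws Fd) (cmul_diagr _ _ s'0 Ws Fs) addrA.
rewrite /nextG -/F.
rewrite (cmulDr _ s'0 Vs Ws WF) (cmulDl _ s'0 Ws WF Q').
rewrite -(cmulA shD s'0 Vs Ws Fs) (cmulA shD s'0 Ws Fs Q').
rewrite addrA -addrA mulrDr addrACA (itw x l).
have -> : (th l + E (sh x l)) * cmul W F x l + cmul (cmul V W) F x l =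
   cmul W F x l * (E x + lam x) + (W x l * P x 0 +
     (cmul W (tail M P) x l - cmul W P x l)) + cmul W (cmul P F) x l.
  by rewrite key WY (cmulA shD s'0 Ws Ps Fs).
rewrite -addrA HP; ring.
Qed.

End KamStep.

Lemma half_pow_lim (R : realType) (x K : R) : (forall n : nat, x <= K * 2 ^- n) -> x <= 0.
Proof.
move=> H; rewrite leNgt; apply/negP => x0.
have K0 : 0 < K by have := H 0; rewrite expr0 invr1 mulr1; exact: lt_le_trans.
have [n Hn] : exists n : nat, K / x < n%:R.
  by exists (Num.truncn (K / x)).+1; exact: truncnS_gt.
have n2 : n%:R < 2 ^+ n :> R by rewrite -natrX ltr_nat ltn_expl.
have := H n; rewrite ler_pdivlMr ?exprn_gt0// leNgt => /negP; apply.
by rewrite mulrC -ltr_pdivrMr// (lt_trans Hn).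
Qed.

Lemma sle_half (R : realType) : sums_le (fun k => 2 ^- k : R) 2.
Proof.
have h1 : 0 <= 2^-1 :> R by rewrite invr_ge0.
have h2 : 2^-1 < 1 :> R by lra.
have := sle_geom h1 h2; have -> : (1 - 2^-1)^-1 = 2 :> R by field; lra.
by apply: sle_le => k; rewrite exprVn.
Qed.

Section OpSeries.
Variables (R : realType) (d : nat) (X : Type).
Notation G := ('rV[int]_d).
Variables (al : X -> G -> bool).
Notation opT := (opT R d X).
Variables (A : nat -> opT) (c : nat -> R) (s S : R).
Hypotheses (s0 : 0 <= s) (Ac : forall k, bd al s (c k) (A k)) (cS : sums_le c S).

Lemma opser_sle x : sums_le (fun p : nat * G => ew s p.2 * cabs (A p.1 x p.2)) S.
Proof.
apply: (@sle_fub _ _ _ (fun k l => ew s l * cabs (A k x l)) _ _ _ _ cS).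
- by move=> *; rewrite mulr_ge0 ?ew_ge0 ?cabs_ge0.
- by move=> k; have [] := Ac k x.
Qed.

Lemma opser_smb x l : summable_c (fun k => A k x l).
Proof.
exists S; apply: sle_le (cS) => k; apply: le_trans (sle_term l (proj1 (Ac k x))).
by rewrite ler_peMl ?cabs_ge0 ?ew_ge1.
Qed.

Lemma bd_opser : bd al s S (fun x l => csum (fun k => A k x l)).
Proof.
move=> x; split.
  have H := @sle_csum _ _ _ (fun l k => (ew s l)%:C%C * A k x l) S.
  apply: sle_le (H _).
    move=> l; rewrite csumZ; last exact: opser_smb.
    by rewrite cabsM cabs_real ger0_norm// ew_ge0.
  have := @sle_swap _ _ _ (fun k l => ew s l * cabs (A k x l)) _ (opser_sle x).
  by apply: sle_le => p; rewrite cabsM cabs_real ger0_norm// ew_ge0.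
move=> l nl; rewrite -[RHS](csum0 R nat); apply: eq_csum => k.
by have [_ ->] := Ac k x.
Qed.

End OpSeries.

Section Iteration.
Variables (R : realType) (d : nat) (X : Type).
Notation G := ('rV[int]_d).
Variables (sh : X -> G -> X) (al : X -> G -> bool).
Hypothesis sh0 : forall x, sh x 0 = x.
Hypothesis shD : forall x l m, sh (sh x l) m = sh x (l + m).
Hypothesis al0 : forall x, al x 0.
Hypothesis alD : forall x l m, al x l -> al (sh x l) m -> al x (l + m).
Notation C := R[i].
Notation opT := (opT R d X).
Notation cmul := (cmul sh).
Notation ido := (@ido R d X).
Notation bd := (@bd R d X al).
Variables (th : G -> C) (E : X -> C) (V : opT).
Hypothesis thB : forall l m, th (l - m) = th l - th m.
Variable C0 : nat.

Definition kcut n : nat := (C0 * 2 ^ n)%N.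

Fixpoint kam n : (X -> C) * (opT * opT) :=
  if n is m.+1 then
    let: (lam, (P, W)) := kam m in
    (fun x => lam x + P x 0,
     (nextP sh th E (kcut m) lam P, nextG sh th E (kcut m) lam P W))
  else (fun=> 0, (V, ido)).

Definition klam n := (kam n).1.
Definition kP n := (kam n).2.1.
Definition kW n := (kam n).2.2.

Lemma klamS n x : klam n.+1 x = klam n x + kP n x 0.
Proof. by rewrite /klam /kP /=; case: (kam n) => ? [? ?]. Qed.

Lemma kPS n : kP n.+1 = nextP sh th E (kcut n) (klam n) (kP n).
Proof. by rewrite /klam /kP /=; case: (kam n) => ? [? ?]. Qed.

Lemma kWS n : kW n.+1 = nextG sh th E (kcut n) (klam n) (kP n) (kW n).
Proof. by rewrite /klam /kP /kW /=; case: (kam n) => ? [? ?]. Qed.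

Variables (a p0 gam : R) (tau : nat).
Hypotheses (a0 : 0 < a) (gam0 : 0 < gam) (C0pos : (0 < C0)%N).
Hypothesis (Vp : bd a p0 V).

Variables rho f0 : R.
Hypothesis rhoE : rho = 2 ^- tau.+1.
(** Shrinks from a to a/2. The loss at step n is (a/4) 2^-n, and its product with the cutoff C0 2^n
    does not depend on n, so one condition on C0 controls the tail at every step. *)
Definition width n : R := a / 2 * (1 + 2 ^- n).
Hypothesis f0E : f0 = C0%:R ^+ tau * p0 / gam.
Hypotheses (f0rho : f0 <= rho / 16) (tailrho : expR (- (a / 4) * C0%:R) <= rho / 8).
Hypothesis p00 : 0 <= p0.

Definition threshold n : R := gam / (kcut n)%:R ^+ tau.

Definition good n := nonres sh al th E (kcut n) (threshold n) (klam n).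

Let rho0 : 0 < rho. Proof. by rewrite rhoE invr_gt0 exprn_gt0. Qed.
Let rho1 : rho <= 1.
Proof. by rewrite rhoE invf_le1 ?exprn_gt0// exprn_ege1// ler1n. Qed.
Let h0 n : 0 < 2 ^- n :> R. Proof. by rewrite invr_gt0 exprn_gt0. Qed.
Let h1 n : 2 ^- n <= 1 :> R.
Proof. by rewrite invf_le1 ?exprn_gt0// exprn_ege1// ler1n. Qed.
Let f00 : 0 <= f0. Proof. by rewrite f0E !mulr_ge0 ?exprn_ge0// invr_ge0 ltW. Qed.
Let hS n : 2 ^- n.+1 = 2 ^- n / 2 :> R.
Proof. by rewrite exprS invfM mulrC. Qed.

Let rhoh n : rho ^+ n <= 2 ^- n.
Proof.
rewrite -exprVn lerXn2r ?nnegrE ?invr_ge0 ?(ltW rho0)// rhoE exprS invfM ler_piMr ?invr_ge0//.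
Qed.

Lemma width_ge n : a / 2 <= width n.
Proof. rewrite /width ler_peMr//; last by have := h0 n; lra. by rewrite divr_ge0// ltW. Qed.

Lemma width_gt0 n : 0 < width n.
Proof. by apply: lt_le_trans (width_ge n); rewrite divr_gt0. Qed.

Lemma threshold_gt0 n : 0 < threshold n.
Proof. by rewrite divr_gt0// exprn_gt0// ltr0n muln_gt0 C0pos expn_gt0. Qed.

(** Explains rho = 2^-(tau+1): a factor 2^-tau per step pays for the falling threshold, and the
    remaining 1/2 makes the increments of W summable. *)
Lemma kam_ratio n : p0 * rho ^+ n / threshold n <= f0 * 2 ^- n.
Proof.
rewrite /threshold invf_div f0E /kcut natrM exprMn natrX.
rewrite le_eqVlt; apply/orP; left; apply/eqP.
have -> : rho ^+ n = 2 ^- n * (2 ^+ n ^+ tau)^-1.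
  by rewrite rhoE exprVn -exprM mulSn exprD invfM -[2 ^+ n ^+ tau]exprM mulnC.
have g0 : gam != 0 by rewrite gt_eqF.
have e1 : 2 ^+ n != 0 :> R by rewrite expf_neq0.
have e2 : 2 ^+ n ^+ tau != 0 :> R by rewrite expf_neq0.
by field; rewrite e1 g0.
Qed.

Lemma kam_inv n : (forall k, (k < n)%N -> good k) ->
  [/\ bd (width n) (p0 * rho ^+ n) (kP n),
      bd (width n) (4 * f0 * (1 - 2 ^- n)) (fun x l => kW n x l - ido x l) &
      intertwines sh th E V (klam n) (kP n) (kW n)].
Proof.
elim: n => [|n ih] H.
  split.
  - by rewrite expr0 mulr1 /width expr0 invr1; have -> : a / 2 * (1 + 1) = a by lra.
  - rewrite expr0 invr1 subrr mulr0 => x; split.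
      by apply: sle0 => // l; rewrite /kW/= subrr cabs0 mulr0.
    by move=> l _; rewrite /kW/= subrr.
  - move=> x l; rewrite /kW /kP /klam/= cmul1l cmul1r// addr0; congr (_ + _).
    rewrite /ido; case: eqP => [->|_]; last by rewrite mulr0 mul0r.
    by rewrite sh0 mulr1 mul1r -(subrr 0) thB subrr add0r.
have [Pn Wn In] := ih (fun k kn => H k (ltnW kn)).
have gn := H n (ltnSn n).
pose f := f0 * 2 ^- n.
have f0' : 0 <= f by rewrite mulr_ge0// ltW.
have ff0 : f <= f0 by rewrite ler_piMr.
have f16 : f <= 1 / 16.
  by apply: le_trans ff0 _; move: f0rho rho1 => e1 e2; lra.
have f1 : f < 1 by lra.
have fE : p0 * rho ^+ n / threshold n <= f by exact: kam_ratio.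
have ws : width n.+1 <= width n.
  by rewrite ler_wpM2l ?divr_ge0 ?ltW// ltrD2l hS ltr_pdivrMr//; have := h0 n; lra.
have wd : expR (- (width n - width n.+1) * (kcut n)%:R) <= rho / 8.
  apply: le_trans tailrho; rewrite ler_expR /width hS /kcut natrM natrX.
  have -> : - (a / 2 * (1 + 2 ^- n) - a / 2 * (1 + 2 ^- n / 2)) * (C0%:R * 2 ^+ n) =
    - (a / 4) * C0%:R * (2 ^- n * 2 ^+ n) :> R by field.
  by rewrite mulVf ?mulr1// expf_neq0.
have In1 : bd (width n) (1 + 4 * f0 * (1 - 2 ^- n)) (kW n).
  have := bdD (bd_ido (R := R) al0 (width n)) Wn; apply: bd_dom => x l.
  by rewrite addrC subrK.
have sn := ltW (width_gt0 n.+1).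
split.
- have NP := (bd_nextP al0 alD sn ws (threshold_gt0 n) Pn gn fE f1).
  rewrite kPS; apply: (bd_le (lexx _) _ NP).
  have pr : 0 <= p0 * rho ^+ n by rewrite mulr_ge0// exprn_ge0// ltW.
  rewrite exprS [rho * _]mulrC [p0 * (_ * rho)]mulrA; set q := p0 * rho ^+ n in pr *.
  set e := expR _ in wd *.
  (* Both 2 f and the tail factor e are at most rho/8, and 1 - f >= 15/16 absorbs the Neumann
     factor, so the new error is at most rho times the old one. *)
  have ->: q * f + (f * q + e * q) = q * (2 * f + e) by ring.
  rewrite mulrCA ler_wpM2l// mulrC ler_pdivrMr ?subr_gt0//.
  have e3 := ler_wpM2l (ltW rho0) f16.
  by move: f0rho rho0 => e1 e2; lra.
- rewrite kWS; have B := bd_cmul alD (ltW (width_gt0 n)) In1 (bd_hom (threshold_gt0 n) Pn gn fE).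
  have K := bd_le ws _ (bdD Wn B); apply: bd_dom (K _ _).
    move=> x l; rewrite le_eqVlt /nextG; apply/orP; left; apply/eqP; congr cabs.
    by rewrite addrAC.
  have E1 : 4 * f0 * (1 - 2 ^- n.+1) = 4 * f0 * (1 - 2 ^- n) + 2 * f.
    by rewrite hS /f; field; rewrite expf_neq0.
  rewrite E1 lerD2l ler_wpM2r//.
  have : 4 * f0 * (1 - 2 ^- n) <= 4 * f0 * 1.
    by rewrite ler_wpM2l ?mulr_ge0//; have := h0 n; lra.
  by move: f0rho rho1 => e1 e2; lra.
- rewrite kPS kWS.
  have -> : klam n.+1 = (fun x => klam n x + kP n x 0) by apply: funext => x; exact: klamS.
  have V' : bd (width n) p0 V.
    apply: bd_le Vp => //; rewrite /width -{2}[a]mulr1.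
    have -> : a / 2 * (1 + 2 ^- n) = a * ((1 + 2 ^- n) / 2) by field.
    by rewrite ler_wpM2l ?(ltW a0)//; have := h1 n; lra.
  exact: (intertwines_next sh0 shD al0 alD thB sn ws (threshold_gt0 n) Pn In1 V' gn fE f1 In).
Qed.

Lemma kP_bound n x : (forall k, (k < n)%N -> good k) -> cabs (kP n x 0) <= p0 * rho ^+ n.
Proof. by move=> H; have [Pn _ _] := kam_inv H; have := bd_term x 0 Pn; rewrite ew0 mulr1. Qed.

Lemma kW_bound n : (forall k, (k < n)%N -> good k) ->
  bd (a / 2) (4 * f0) (fun x l => kW n x l - ido x l).
Proof.
move=> H; have [_ Wn _] := kam_inv H; apply: bd_le Wn; first exact: width_ge.
by rewrite ler_piMr ?mulr_ge0//; have := h0 n; lra.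
Qed.

Lemma kW_bound2 n : (forall k, (k < n)%N -> good k) -> bd (a / 2) 2 (kW n).
Proof.
move=> H; have K := bdD (bd_ido (R := R) al0 (a / 2)) (kW_bound H).
have h : 1 + 4 * f0 <= 2 by move: f0rho rho1 => e1 e2; lra.
by apply: bd_dom (bd_le (lexx _) h K) => x l; rewrite addrC subrK.
Qed.

Lemma kresidual n x l : (forall k, (k < n)%N -> good k) ->
  (th l + E (sh x l)) * kW n x l + cmul V (kW n) x l - kW n x l * (E x + klam n x)
   = cmul (kW n) (kP n) x l.
Proof. by move=> H; have [_ _ In] := kam_inv H; rewrite (In x l) addrAC subrr add0r. Qed.

Lemma bd_kresidual n : (forall k, (k < n)%N -> good k) ->
  bd (a / 2) (2 * (p0 * rho ^+ n)) (cmul (kW n) (kP n)).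
Proof.
move=> H; have [Pn _ _] := kam_inv H.
have a2 : 0 <= a / 2 by rewrite divr_ge0// ltW.
apply: (bd_cmul alD a2 (kW_bound2 H)); exact: bd_le (width_ge n) (lexx _) Pn.
Qed.

Section Limit.
Hypothesis allgood : forall n, good n.
Let ag n : forall k, (k < n)%N -> good k. Proof. by []. Qed.

Lemma bd_kWdiff n : bd (a / 2) (4 * f0 * 2 ^- n) (fun x l => kW n.+1 x l - kW n x l).
Proof.
have [Pn Wn In] := kam_inv (@ag n); have gn := @allgood n.
have fE := kam_ratio n.
have B := bd_hom (threshold_gt0 n) Pn gn fE.
have a2 : 0 <= a / 2 by rewrite divr_ge0// ltW.
have B' := bd_cmul alD a2 (kW_bound2 (@ag n)) (bd_le (width_ge n) (lexx _) B).
apply: bd_dom (bd_le (lexx _) _ B').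
  move=> x l; rewrite kWS /nextG addrAC subrr add0r; exact: lexx.
by rewrite mulrA ler_wpM2r ?(ltW (h0 n))// ler_wpM2r//; lra.
Qed.

Definition limlam x : C := csum (fun n => kP n x 0).
Definition limW : opT := fun x l => ido x l + csum (fun n => kW n.+1 x l - kW n x l).

Let smbW m x l : summable_c (fun n => kW (m + n).+1 x l - kW (m + n) x l).
Proof.
have H k := bd_kWdiff (m + k)%N.
have a2 : 0 <= a / 2 by rewrite divr_ge0// ltW.
apply: (@opser_smb _ _ _ _ (fun k x l => kW (m + k).+1 x l - kW (m + k) x l) _ _ (4 * f0 * 2) a2 H).
apply: sle_le (sleZ _ (@sle_half R)) => [k|]; last by rewrite mulr_ge0.
rewrite ler_wpM2l ?mulr_ge0// lef_pV2 ?posrE ?exprn_gt0//.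
by rewrite ler_weXn2l ?ler1n// leq_addl.
Qed.

Let smbP m x : summable_c (fun n => kP (m + n) x 0).
Proof.
exists (p0 * 2); apply: sle_le (sleZ p00 (@sle_half R)) => n.
apply: le_trans (kP_bound x (@ag (m + n)%N)) _; rewrite ler_wpM2l//.
apply: le_trans (rhoh n); rewrite exprD ler_piMl ?exprn_ge0 ?(ltW rho0)//.
by rewrite exprn_ile1// ltW.
Qed.

Lemma limW_tail n x l : limW x l - kW n x l = csum (fun k => kW (n + k).+1 x l - kW (n + k) x l).
Proof.
elim: n => [|n ih].
  by rewrite /limW /kW/= addrAC subrr add0r; apply: eq_csum => k; rewrite add0n.
have := csum_natS (smbW n x l); rewrite -ih addn0 => H.
have -> : limW x l - kW n.+1 x l = (limW x l - kW n x l) - (kW n.+1 x l - kW n x l) by ring.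
by rewrite H addrAC subrr add0r; apply: eq_csum => k; rewrite addSnnS.
Qed.

Lemma limlam_tail n x : limlam x - klam n x = csum (fun k => kP (n + k) x 0).
Proof.
elim: n => [|n ih]; first by rewrite /klam/= subr0; apply: eq_csum => k; rewrite add0n.
have := csum_natS (smbP n x); rewrite -ih addn0 klamS => H.
by rewrite opprD addrA H addrAC subrr add0r; apply: eq_csum => k; rewrite addSnnS.
Qed.

Lemma bd_limW_tail n : bd (a / 2) (8 * f0 * 2 ^- n) (fun x l => limW x l - kW n x l).
Proof.
have a2 : 0 <= a / 2 by rewrite divr_ge0// ltW.
have H k := bd_kWdiff (n + k)%N.
have S : sums_le (fun k => 4 * f0 * 2 ^- (n + k)) (8 * f0 * 2 ^- n).
  have := sleZ (mulr_ge0 (mulr_ge0 (ler0n R 4) f00) (ltW (h0 n))) (@sle_half R).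
  have -> : 4 * f0 * 2 ^- n * 2 = 8 * f0 * 2 ^- n by ring.
  by apply: sle_le => k; rewrite exprD invfM mulrA.
apply: bd_dom (bd_opser a2 H S) => x l; rewrite limW_tail; exact: lexx.
Qed.

Lemma limlam_bound n x : cabs (limlam x - klam n x) <= 2 * p0 * rho ^+ n.
Proof.
rewrite limlam_tail; apply: csum_le.
have := sleZ (mulr_ge0 p00 (exprn_ge0 n (ltW rho0))) (@sle_half R).
have -> : p0 * rho ^+ n * 2 = 2 * p0 * rho ^+ n by ring.
apply: sle_le => k; apply: le_trans (kP_bound x (@ag (n + k)%N)) _.
by rewrite exprD mulrA ler_wpM2l ?mulr_ge0 ?exprn_ge0 ?(ltW rho0).
Qed.

Lemma bd_limW : bd (a / 2) (8 * f0) (fun x l => limW x l - ido x l).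
Proof. by have := bd_limW_tail 0; rewrite expr0 invr1 mulr1. Qed.

(** The limit is taken entry by entry: at a fixed (x, l) the unbounded factor th + E is just a
    number, and each error term is of order 2^-n. *)
Lemma limW_intertwines x l :
  (th l + E (sh x l)) * limW x l + cmul V limW x l = limW x l * (E x + limlam x).
Proof.
have a2 : 0 <= a / 2 by rewrite divr_ge0// ltW.
have V' : bd (a / 2) p0 V by apply: bd_le Vp => //; lra.
set lhs := LHS; set rhs := RHS; apply/eqP; rewrite -subr_eq0; apply/eqP; apply: cabs_eq0.
apply/eqP; rewrite eq_le cabs_ge0 andbT.
pose K := cabs (th l + E (sh x l)) * (8 * f0) + p0 * (8 * f0) + 8 * f0 * cabs (E x + limlam x)
  + 2 * (2 * p0) + 2 * p0.
apply: (@half_pow_lim _ _ K) => n.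
have wt := bd_limW_tail n.
have ent (A : opT) M : bd (a / 2) M A -> cabs (A x l) <= M.
  move=> /(_ x) [/(sle_term l) h _]; apply: le_trans h.
  by rewrite ler_peMl ?cabs_ge0 ?ew_ge1.
have t1 := ent _ _ wt; have t2 := ent _ _ (bd_cmul alD a2 V' wt).
have t3 := ent _ _ (bd_kresidual (@ag n)); have t4 := limlam_bound n x.
have t5 := ent _ _ (kW_bound2 (@ag n)).
have rn := rhoh n.
have E1 : cmul V (fun x l => limW x l - kW n x l) x l = cmul V limW x l - cmul V (kW n) x l.
  have kam_col : bd (a / 2) (8 * f0 + 1) limW.
    apply: bd_dom (bdD bd_limW (bd_ido (R := R) al0 (a / 2))) => y k; rewrite subrK; exact: lexx.
  have := congr1 (fun A : opT => A x l) (cmulDr sh a2 V' kam_col (bdN (kW_bound2 (@ag n)))) => /= ->.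
  by rewrite (cmulNr _ a2 V' (kW_bound2 (@ag n))).
have -> : lhs - rhs = (th l + E (sh x l)) * (limW x l - kW n x l)
   + cmul V (fun x l => limW x l - kW n x l) x l - (limW x l - kW n x l) * (E x + limlam x)
   + (- (kW n x l * (limlam x - klam n x)) + cmul (kW n) (kP n) x l).
  by rewrite -(kresidual x l (@ag n)) E1 /lhs /rhs; ring.
rewrite (le_trans (cabsD _ _))//.
have u1 := cabsB ((th l + E (sh x l)) * (limW x l - kW n x l)
   + cmul V (fun x l => limW x l - kW n x l) x l) ((limW x l - kW n x l) * (E x + limlam x)).
have u2 := cabsD ((th l + E (sh x l)) * (limW x l - kW n x l)) (cmul V (fun x l => limW x l - kW n x l) x l).
have u3 := cabsD (- (kW n x l * (limlam x - klam n x))) (cmul (kW n) (kP n) x l).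
rewrite cabsN !cabsM in u1 u2 u3.
have v1 := ler_wpM2l (cabs_ge0 (th l + E (sh x l))) t1.
have v2 := ler_wpM2r (cabs_ge0 (E x + limlam x)) t1.
have v3 : cabs (kW n x l) * cabs (limlam x - klam n x) <= 2 * (2 * p0 * rho ^+ n).
  by rewrite ler_pM ?cabs_ge0.
have v4 : p0 * rho ^+ n <= p0 * 2 ^- n by rewrite ler_wpM2l.
rewrite /K; set h := 2 ^- n in t1 t2 v1 v2 v4 *; set c1 := cabs _ in u1 *; lra.
Qed.

End Limit.
End Iteration.

(** * Convolution of weighted sequences *)

Section Convolution.
Variables (R : realType) (d : nat).
Notation G := ('rV[int]_d).
Notation C := R[i].
Implicit Types (u v w : G -> C) (s M N : R).

Definition gconv u v l : C := csum (fun m => u (l - m) * v m).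
Definition weighted_le s M u := sums_le (fun l => ew s l * cabs (u l)) M.

(** Sequences are operators with a single column and trivial shift, so that convolution estimates
    are instances of those for [cmul]. *)
Let ush (x : unit) (l : G) := x.
Let ual (x : unit) (l : G) := true.

Let nb_bd s M u : weighted_le s M u -> bd ual s M (fun (_ : unit) l => u l).
Proof. by move=> H x; split. Qed.

Lemma nb_conv s M N u v : 0 <= s -> weighted_le s M u -> weighted_le s N v -> weighted_le s (M * N) (gconv u v).
Proof.
move=> s0 /nb_bd uM /nb_bd vN.
by have [] := @bd_cmul _ _ _ ush ual (fun _ _ _ _ _ => isT) _ _ _ _ _ s0 uM vN tt.
Qed.

Lemma conv_smb s M N u v l : 0 <= s -> weighted_le s M u -> weighted_le s N v -> summable_c (fun m => u (l - m) * v m).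
Proof.
move=> s0 /nb_bd uM /nb_bd vN.
exact: (@cmul_smb _ _ _ ush ual _ _ _ _ _ tt l s0 uM vN).
Qed.

Lemma conv_smb2 s M N u v : 0 <= s -> weighted_le s M u -> weighted_le s N v ->
  sums_le (fun p : G * G => ew s p.1 * cabs (u (p.1 - p.2) * v p.2)) (M * N).
Proof.
move=> s0 /nb_bd uM /nb_bd vN.
exact: (@cmul_sle _ _ _ ush ual _ _ _ _ _ tt s0 uM vN).
Qed.

Lemma nb_smb s M u : 0 <= s -> weighted_le s M u -> summable_c u.
Proof.
move=> s0 H; exists M; apply: sle_le H => l.
by rewrite ler_peMl ?cabs_ge0 ?ew_ge1.
Qed.

Lemma nb_le s s' M N u : s' <= s -> M <= N -> weighted_le s M u -> weighted_le s' N u.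
Proof.
move=> ss MN H; apply: sle_leM MN _; apply: sle_le H => l.
by rewrite ler_wpM2r ?cabs_ge0 ?ew_le.
Qed.

Lemma nb_dom s M u v : (forall l, cabs (u l) <= cabs (v l)) -> weighted_le s M v -> weighted_le s M u.
Proof. by move=> uv; apply: sle_le => l; rewrite ler_wpM2l ?ew_ge0. Qed.

Lemma nb_term s M u l : 0 <= s -> weighted_le s M u -> cabs (u l) <= M.
Proof.
move=> s0 /(sle_term l); apply: le_trans.
by rewrite ler_peMl ?cabs_ge0 ?ew_ge1.
Qed.

Lemma nbD s M N u v : weighted_le s M u -> weighted_le s N v -> weighted_le s (M + N) (fun l => u l + v l).
Proof.
move=> uM vN; apply: sle_le (sleD uM vN) => l.
by rewrite -mulrDr ler_wpM2l ?ew_ge0// cabsD.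
Qed.

Lemma nb_weight s s' Q M u (b : G -> R) : 0 <= Q -> (forall l, 0 <= b l <= Q * ew s' l) ->
  weighted_le (s + s') M u -> sums_le (fun l => ew s l * (b l * cabs (u l))) (Q * M).
Proof.
move=> Q0 bQ uM; apply: sle_le (sleZ Q0 uM) => l.
have /andP[b0 bl] := bQ l.
have -> : ew (s + s') l = ew s l * ew s' l by rewrite /ew mulrDl expRD.
rewrite [leRHS](_ : _ = ew s l * (Q * ew s' l * cabs (u l))); last by ring.
by rewrite ler_wpM2l ?ew_ge0// ler_wpM2r ?cabs_ge0.
Qed.

Lemma ewD2 (a b : R) (l : G) : ew (a + b) l = ew a l * ew b l.
Proof. by rewrite /ew mulrDl expRD. Qed.

Definition restr (T : G -> bool) u l : C := if T l then u l else 0.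

Lemma nb_restr s M T u : weighted_le s M u -> weighted_le s M (restr T u).
Proof. by apply: nb_dom => l; rewrite /restr; case: ifP; rewrite ?cabs0 ?cabs_ge0. Qed.

End Convolution.

Section Odd.
Variables (R : realType) (d : nat).
Notation G := ('rV[int]_d).

Lemma csum_odd (f : G -> R[i]) : summable_c f -> (forall l, f (- l) = - f l) -> csum f = 0.
Proof.
move=> fs fo; have Nb : bijective (fun l : G => - l) by exists (fun l => - l) => l; rewrite opprK.
have : csum f = - csum f.
  rewrite {1}(csum_bij _ Nb) -csumN//; apply: eq_csum => l /=; exact: fo.
move=> /eqP; rewrite -subr_eq0 opprK -mulr2n mulrn_eq0/= => /eqP; exact.
Qed.
End Odd.

(** * A posteriori estimates for an approximate eigenvector *)

Section Eigvec.
Variables (R : realType) (d : nat).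
Notation G := ('rV[int]_d).
Notation C := R[i].
Variables (S z : G -> bool) (th be w2 : G -> R) (V W r : G -> C) (lam : C).
Variables (t Q p0 eps eta gam : R).
Hypothesis t0 : 0 < t.
Hypothesis Q1 : 1 <= Q.
Hypothesis z0 : z 0.
Hypothesis zB : forall l m, z l -> z m -> z (l - m).
Hypothesis zN : forall l, z (- l) = z l.
Hypothesis thQ : forall l, `|th l| <= Q * ew t l.
Hypothesis w2Q : forall l, `|w2 l| <= Q * ew t l.
Hypothesis th0 : th 0 = 0.
Hypothesis beN : forall l, be (- l) = - be l.
Hypothesis zbe : forall l, z l -> be l = 0.
Hypothesis zw2 : forall l, z l -> w2 l = 0.
Hypothesis VN : forall l, V (- l) = ((V l)^*)%C.
Hypothesis zV : forall l, z l -> V l = 0.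
Hypothesis dio : forall l, l != 0 -> gam <= Q * ew t l * `|th l|.
Hypothesis gam01 : 0 < gam <= 1.
Hypothesis eps01 : 0 <= eps <= 1 / 2.
Hypothesis p0e : 0 <= p0 <= eps * gam.
Hypothesis etae : 0 <= eta <= 2 * eps.
Hypothesis lam1 : cabs lam <= 1.
Hypothesis S0 : S 0.
Hypothesis SN : forall l, S (- l) = S l.
Hypothesis WS : forall l, ~~ S l -> W l = 0.
Hypothesis Vp : weighted_le (8 * t) p0 V.
Hypothesis We : weighted_le (8 * t) eps (fun l => W l - (if l == 0 then 1 else 0)).
Hypothesis re : weighted_le (8 * t) eta r.
Hypothesis eqn : forall l, S l ->
  ((th l + be l + w2 l)%:C%C - lam) * W l + gconv V W l = r l.

Let kt (k : R) : 0 <= k -> 0 <= k * t. Proof. by move=> k0; rewrite mulr_ge0// ltW. Qed.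

Lemma p0_le_eps : p0 <= eps.
Proof.
have /andP[_ h] := p0e; apply: le_trans h _; have /andP[e0 _] := eps01.
by rewrite ler_piMr//; case/andP: gam01.
Qed.

Definition off (u : G -> C) : G -> C := restr (fun l => l != 0) u.

Lemma nb_offW k : 0 <= k <= 8 -> weighted_le (k * t) eps (off W).
Proof.
move=> /andP[k0 k8]; apply: nb_dom (nb_le (s' := k * t) _ (lexx _) We) => [l|].
  have -> : off W l = if l == 0 then 0 else W l by rewrite /off /restr; case: (l == 0).
  by case: eqP => _; rewrite ?cabs0 ?cabs_ge0 ?subr0.
by rewrite ler_pM2r.
Qed.

Lemma nbW k : 0 <= k <= 8 -> weighted_le (k * t) (1 + eps) W.
Proof.
move=> /andP[k0 k8].
have H1 : weighted_le (k * t) 1 (fun l : G => if l == 0 then 1 else 0 : C).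
  apply: sle_le (sle_single (0 : G) (@ler01 R)) => l.
  by case: eqP => [->|_]; rewrite ?ew0 ?cabs1 ?cabs0 ?mul1r ?mulr0.
have H2 := nb_le (s' := k * t) _ (lexx _) We.
apply: nb_dom (nbD H1 (H2 _)) => [l|]; last by rewrite ler_pM2r.
by rewrite addrC subrK.
Qed.

Lemma W0_close : cabs (W 0 - 1) <= eps.
Proof. by have := nb_term 0 (kt (ler0n R 8)) We; rewrite eqxx. Qed.

Lemma W0_ge : 1 / 2 <= cabs (W 0).
Proof.
have h := W0_close; have := cabsB (W 0) (W 0 - 1); rewrite opprB addrC subrK cabs1.
by case/andP: eps01 => _ e2; lra.
Qed.

Lemma nbV k : 0 <= k <= 8 -> weighted_le (k * t) p0 V.
Proof. by move=> /andP[k0 k8]; apply: nb_le Vp => //; rewrite ler_pM2r. Qed.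

Lemma beW l : S l -> (be l)%:C%C * W l =
  r l - gconv V W l - ((th l + w2 l)%:C%C - lam) * W l.
Proof. by move=> Sl; rewrite -(eqn Sl) !rmorphD/=; ring. Qed.

Definition P1c := 8 * Q * eps.

(** Solve the equation for be W: the convolution is of size p0, the residual of size eta, and th +
    w2 - lam costs only Q e^(t n1), paid from the spare weight. *)
Lemma nb_beta : sums_le (fun l => ew (4 * t) l * ((`|be l| + 1) * cabs (off W l))) P1c.
Proof.
have /andP[e0 e2] := eps01; have /andP[q0 q1] := p0e; have /andP[n0 n1] := etae.
have Q0 : 0 <= Q by apply: le_trans Q1.
have B1 : weighted_le (4 * t) (p0 * (1 + eps)) (gconv V W).
  by apply: nb_conv; [exact: kt|apply: nbV; lra|apply: nbW; lra].
have B2 : weighted_le (4 * t) eta r by apply: nb_le re => //; rewrite ler_pM2r//; lra.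
have B3 : sums_le (fun l => ew (4 * t) l * (ew t l * (2 * Q + 2) * cabs (off W l))) ((2 * Q + 2) * eps).
  apply: (@nb_weight _ _ (4 * t) t); first lra.
    move=> l; rewrite mulrC lexx andbT mulr_ge0 ?ew_ge0//; lra.
  have -> : 4 * t + t = 5 * t by ring.
  by apply: nb_offW; lra.
have B := sleD (sleD B2 B1) B3.
have c : eta + p0 * (1 + eps) + (2 * Q + 2) * eps <= P1c.
  have pe := p0_le_eps; have : p0 * (1 + eps) <= 2 * eps by nra.
  have : eps <= Q * eps by rewrite ler_peMl.
  rewrite /P1c; lra.
apply: sle_leM c _; apply: sle_le B => l.
rewrite -!mulrDr ler_wpM2l ?ew_ge0// /off /restr.
case: ifPn => l0; last by rewrite cabs0 !mulr0 addr0 addr_ge0 ?cabs_ge0.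
have [Sl|Sl] := boolP (S l); last by rewrite WS// cabs0 !mulr0 addr0 addr_ge0 ?cabs_ge0.
have h1 : `|be l| * cabs (W l) <= cabs (r l) + cabs (gconv V W l) + (2 * Q * ew t l + 1) * cabs (W l).
  rewrite -(cabs_real (be l)) -cabsM (beW Sl).
  rewrite (le_trans (cabsB _ _))// lerD ?cabsB// cabsM ler_wpM2r ?cabs_ge0//.
  rewrite (le_trans (cabsB _ _))// lerD// cabs_real (le_trans (ler_normD _ _))//.
  by have := thQ l; have := w2Q l; lra.
have e1 := ew_ge1 l (ltW t0).
have c0 := cabs_ge0 (W l).
have : cabs (W l) <= ew t l * cabs (W l) by rewrite ler_peMl.
by move: h1; lra.
Qed.

Lemma nb_gain (T : G -> bool) D : 0 < D -> (forall l, T l -> D <= Q * ew t l * (`|be l| + 1)) ->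
  weighted_le (3 * t) (Q * P1c / D) (restr T (off W)).
Proof.
move=> D0 TD; have Q0 : 0 <= Q by apply: le_trans Q1.
have QD : 0 <= Q / D by rewrite divr_ge0// ltW.
have := sleZ QD nb_beta.
have -> : Q / D * P1c = Q * P1c / D by rewrite mulrAC.
have e43 : 4 * t = 3 * t + t by ring.
apply: sle_le => l; rewrite e43 ewD2.
rewrite /restr; case: ifPn => Tl; last first.
  by rewrite cabs0 mulr0 !mulr_ge0 ?ew_ge0 ?cabs_ge0 ?addr_ge0// invr_ge0 ltW.
have h := TD l Tl; rewrite -ler_pdivrMr// in h.
have -> : Q / D * (ew (3 * t) l * ew t l * ((`|be l| + 1) * cabs (off W l))) =
  ew (3 * t) l * (Q * ew t l * (`|be l| + 1) / D * cabs (off W l)) by ring.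
rewrite ler_wpM2l ?ew_ge0// ler_peMl ?cabs_ge0// ler_pdivlMr// mul1r.
exact: TD.
Qed.

Variable D : R.
Hypothesis D0 : 0 < D.
Hypothesis Dgain : forall l, S l -> ~~ z l -> D <= Q * ew t l * (`|be l| + 1).

Let nzS l := S l && ~~ z l.
Let Wn := restr nzS (off W).

Lemma nb_Wn : weighted_le (3 * t) (Q * P1c / D) Wn.
Proof. by apply: nb_gain => // l /andP[]; exact: Dgain. Qed.

(** Flat modes form a group on which V vanishes, so a flat l is coupled only to non-flat modes, and
    there W has gained 1/D. *)
Lemma convWz l : S l -> z l -> gconv V W l = gconv V Wn l.
Proof.
move=> Sl zl; apply: eq_csum => m; rewrite /Wn /nzS /restr /off /restr.
have [Sm|Sm] /= := boolP (S m); last by rewrite WS// !mulr0.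
have [zm|zm] /= := boolP (z m); first by rewrite zV ?mul0r//; exact: zB.
by case: eqP zm => // ->; rewrite z0.
Qed.

Lemma nb_convWn : weighted_le (3 * t) (p0 * (Q * P1c / D)) (gconv V Wn).
Proof. by apply: nb_conv nb_Wn; [exact: kt|apply: nbV; lra]. Qed.

(** At l = 0 all diagonal terms except lam vanish, so lam W(0) is (V W)(0) minus the residual, and
    W(0) is at least 1/2 in modulus. *)
Lemma lam_bound : cabs lam <= 2 * (p0 * (Q * P1c / D) + eta).
Proof.
have H : cabs (lam * W 0) <= p0 * (Q * P1c / D) + eta.
  have := eqn S0; rewrite th0 zbe// zw2// !addr0 sub0r convWz// => h.
  have -> : lam * W 0 = gconv V Wn 0 - r 0 by rewrite -h; ring.
  rewrite (le_trans (cabsB _ _))// lerD//; first exact: nb_term (kt (ler0n R 3)) nb_convWn.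
  exact: nb_term (kt (ler0n R 8)) re.
rewrite cabsM in H; have := W0_ge; have := cabs_ge0 lam; nra.
Qed.

Definition P2c := (Q * P1c + 3 * Q * Q * P1c) / D + 3 * Q * eta / gam.

(** Non-flat modes gain 1/D from be. Flat modes have be = 0, and their equation is divided by om.l
    instead; the factor 1/gam lost there is repaid by p0 <= eps gam, except on the residual, whence
    the term eta/gam in [P2c]. *)
Lemma sum_offW : weighted_le 0 P2c (off W).
Proof.
have /andP[e0 e2] := eps01; have /andP[q0 q1] := p0e; have /andP[n0 n1] := etae.
have /andP[g0 g1] := gam01.
have Q0 : 0 <= Q by apply: le_trans Q1.
have P0 : 0 <= Q * P1c / D by rewrite !mulr_ge0// invr_ge0 ltW.
pose c := p0 * (Q * P1c / D).
have c0 : 0 <= c by rewrite mulr_ge0.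
pose Wz := restr (fun l => S l && z l) (off W).
have h1 : weighted_le t (c + eta + 2 * (c + eta) * eps) (fun l => - gconv V Wn l + r l + lam * off W l).
  apply: nbD; first apply: nbD.
  - apply: nb_dom (nb_le (s' := t) _ (lexx _) nb_convWn) => [l|]; first by rewrite cabsN.
    by rewrite ler_peMl ?(ltW t0)//; lra.
  - by apply: nb_le re => //; rewrite ler_peMl ?(ltW t0)//; lra.
  - have b1 : 0 <= 2 * (c + eta) by rewrite mulr_ge0// addr_ge0.
    have := @nb_offW 1; rewrite mul1r => h; have := sleZ b1 (h _); move=> {h} h.
    apply: sle_le (h _) => [l|]; last by lra.
    by rewrite cabsM mulrCA ler_wpM2r ?mulr_ge0 ?ew_ge0 ?cabs_ge0//; exact: lam_bound.
have h2 : weighted_le 0 (Q / gam * (c + eta + 2 * (c + eta) * eps)) Wz.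
  have Qg : 0 <= Q / gam by rewrite divr_ge0// ltW.
  apply: sle_le (sleZ Qg h1) => l; rewrite /ew mul0r expR0 mul1r.
  rewrite /Wz /restr; case: ifPn => [/andP[Sl zl]|_]; last first.
    by rewrite cabs0 mulr_ge0// mulr_ge0 ?cabs_ge0 ?expR_ge0.
  rewrite /off /restr; case: ifPn => l0; last by rewrite cabs0 mulr_ge0// mulr_ge0 ?cabs_ge0 ?expR_ge0.
  have := eqn Sl; rewrite zbe// zw2// !addr0 convWz// => E1.
  have -> : - gconv V Wn l + r l + lam * W l = (th l)%:C%C * W l by rewrite -E1; ring.
  rewrite cabsM cabs_real -/(ew t l).
  have -> : Q / gam * (ew t l * (`|th l| * cabs (W l))) = Q * ew t l * `|th l| / gam * cabs (W l).
    by ring.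
  by rewrite ler_peMl ?cabs_ge0// ler_pdivlMr// mul1r; exact: dio.
have h3 := nb_le (s' := 0) (kt (ler0n R 3)) (lexx _) nb_Wn.
apply: nb_dom (nb_le (lexx _) _ (nbD h3 h2)) => [l|].
  rewrite /Wn /Wz /restr /nzS; case: (boolP (S l)) => Sl /=; last by rewrite /off /restr WS ?if_same// addr0.
  by case: (z l); rewrite /= ?add0r ?addr0.
have -> : P2c = Q * P1c / D + 3 * (Q * (Q * P1c / D)) + 3 * (Q / gam * eta).
  by rewrite /P2c; ring.
have -> : c + eta + 2 * (c + eta) * eps = (1 + 2 * eps) * (c + eta) by ring.
have : Q / gam * ((1 + 2 * eps) * (c + eta)) <= Q / gam * (2 * (c + eta)).
  apply: ler_wpM2l; first by rewrite divr_ge0// ltW.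
  by apply: ler_wpM2r; [exact: addr_ge0|lra].
have : Q / gam * c <= Q * (Q * P1c / D).
  have -> : Q / gam * c = Q * (p0 / gam * (Q * P1c / D)) by rewrite /c; ring.
  rewrite ler_wpM2l// ler_piMl// ler_pdivrMr// mul1r (le_trans q1)//.
  by rewrite ler_piMl// ltW//; lra.
have : 0 <= Q / gam * eta by rewrite mulr_ge0// divr_ge0// ltW.
have : 0 <= Q * (Q * P1c / D) by rewrite mulr_ge0.
have -> : Q / gam * (2 * (c + eta)) = 2 * (Q / gam * c) + 2 * (Q / gam * eta) by ring.
lra.
Qed.

Variables (T : G -> bool) (D' pT : R).
Hypothesis D'0 : 0 < D'.
Hypothesis TN : forall l, T (- l) = T l.
Hypothesis TS : forall l, T l -> S l.
Hypothesis Tn0 : forall l, T l -> l != 0.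
Hypothesis Tgain : forall l, T l -> D' <= Q * ew t l * (`|be l| + 1).
Hypothesis VT : weighted_le (8 * t) pT (restr T V).

Definition Jc := 2 * Q / D' * (eta + p0 * P2c + (2 * Q + 1) * (Q * P1c / D'))
  + 2 * Q * Q / D' ^+ 2 * eps.

Let g (x : R) := x / (x ^+ 2 + 1).
Let h (x : R) := (x ^+ 2 + 1)^-1.

Let sq1 (x : R) : 0 < x ^+ 2 + 1. Proof. by rewrite ltr_wpDl// sqr_ge0. Qed.

Let gh x : g x * x + h x = 1.
Proof. by rewrite /g /h; have := sq1 x; move=> q; field; rewrite gt_eqF. Qed.

Let g_le l : T l -> `|g (be l)| <= 2 * Q / D' * ew t l.
Proof.
move=> Tl; have := Tgain Tl; set b := be l; set E := ew t l => H.
rewrite /g normrM normfV (ger0_norm (ltW (sq1 b))) ler_pdivrMr//.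
have -> : 2 * Q / D' * E * (b ^+ 2 + 1) = (Q * E) / D' * (2 * (b ^+ 2 + 1)) by ring.
rewrite -[b ^+ 2]real_normK ?num_real//; set x := `|b| in H *.
have x0 : 0 <= x by exact: normr_ge0.
have : 1 <= Q * E / D' * (x + 1) by rewrite mulrAC ler_pdivlMr// mul1r.
have : 0 <= Q * E / D' by rewrite !mulr_ge0 ?ew_ge0 ?invr_ge0 ?(ltW D'0)//; exact: le_trans Q1.
move: (Q * E / D') => y y0 yx.
have : x * 1 <= x * (y * (x + 1)) by rewrite ler_wpM2l.
have : y * (x * (x + 1)) <= y * (2 * (x ^+ 2 + 1)) by rewrite ler_wpM2l//; nra.
by rewrite mulr1 mulrCA => h1 h2; exact: le_trans h2 h1.
Qed.

Let h_le l : T l -> h (be l) <= 2 * Q * Q / D' ^+ 2 * ew (2 * t) l.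
Proof.
move=> Tl; have := Tgain Tl; have e2 : 2 * t = t + t by ring.
rewrite e2 ewD2; set b := be l; set E := ew t l => H.
rewrite /h -div1r ler_pdivrMr//.
have -> : 2 * Q * Q / D' ^+ 2 * (E * E) * (b ^+ 2 + 1) = (Q * E / D') ^+ 2 * (2 * (b ^+ 2 + 1)).
  by field; rewrite gt_eqF.
rewrite -[b ^+ 2]real_normK ?num_real//; set x := `|b| in H *.
have x0 : 0 <= x by exact: normr_ge0.
have yx : 1 <= Q * E / D' * (x + 1) by rewrite mulrAC ler_pdivlMr// mul1r.
have : 1 <= (Q * E / D' * (x + 1)) ^+ 2 by rewrite exprn_ege1.
move=> /le_trans; apply; rewrite exprMn ler_wpM2l ?sqr_ge0//.
by have := sqr_ge0 (x - 1); nra.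
Qed.

(* W = g(be) (be W) + h(be) W with g(t) = t/(t^2+1) odd and h(t) = 1/(t^2+1); the
   zeroth order of the first term is the sum of |V(m)|^2 g(be m), which vanishes. *)
Lemma J_bound : cabs (csum (restr T (fun m => V (- m) * W m))) <= pT * Jc.
Proof.
have /andP[e0 e2] := eps01; have /andP[q0 q1] := p0e; have /andP[n0 n1] := etae.
have Q0 : 0 <= Q by apply: le_trans Q1.
pose f2 := restr T (fun m => - ((g (be m))%:C%C * (V (- m) * V m) * W 0)).
pose f1 := restr T (fun m => V (- m) *
   ((g (be m))%:C%C * (r m - gconv V (off W) m - ((th m + w2 m)%:C%C - lam) * W m)
    + (h (be m))%:C%C * W m)).
have PW : weighted_le 0 (Q * P1c / D') (restr T (off W)).
  apply: nb_le (nb_gain D'0 Tgain) => //; exact: kt.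
have V0 : weighted_le 0 pT (restr T V) by apply: nb_le VT => //; exact: kt.
have Kp : 0 <= Jc.
  have P1p : 0 <= P1c by rewrite /P1c !mulr_ge0.
  have P2p : 0 <= P2c by exact: sle_ge0 sum_offW.
  rewrite /Jc addr_ge0 ?mulr_ge0 ?invr_ge0 ?exprn_ge0 ?(ltW D'0)// addr_ge0//.
    by rewrite addr_ge0// mulr_ge0.
  by rewrite !mulr_ge0 ?invr_ge0 ?(ltW D'0)//; lra.
have B1 : sums_le (fun m => cabs (f1 m)) (pT * Jc).
  rewrite [pT * _]mulrC; apply: sle_le (sleZ Kp VT) => m.
  rewrite /f1 /restr; case: ifPn => Tm; last by rewrite cabs0 !mulr0.
  rewrite cabsM VN cabs_conj.
  have k1 : cabs (r m) <= eta by exact: nb_term (kt (ler0n R 8)) re.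
  have k2 : cabs (gconv V (off W) m) <= p0 * P2c.
    apply: (@nb_term _ _ 0) => //; apply: nb_conv => //; last exact: sum_offW.
    by apply: nb_le Vp => //; exact: kt.
  have k3 : cabs (W m) <= Q * P1c / D'.
    by have := nb_term m (lexx 0) PW; rewrite /restr Tm /off /restr Tn0.
  have k3' : cabs (W m) <= eps.
    by have := nb_term m (kt (ler0n R 8)) We; rewrite (negbTE (Tn0 Tm)) subr0.
  have k4 : cabs ((th m + w2 m)%:C%C - lam) <= (2 * Q + 1) * ew t m.
    rewrite (le_trans (cabsB _ _))// cabs_real.
    have := ler_normD (th m) (w2 m); have := thQ m; have := w2Q m; have := ew_ge1 m (ltW t0).
    by move: lam1; lra.
  have E1 := ew_ge1 m (ltW t0).
  have k5 : cabs ((g (be m))%:C%C * (r m - gconv V (off W) m - ((th m + w2 m)%:C%C - lam) * W m)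
    + (h (be m))%:C%C * W m) <= ew (2 * t) m * Jc.
    rewrite (le_trans (cabsD _ _))// !cabsM !cabs_real (ger0_norm (x := h _)); last first.
      by rewrite invr_ge0 ltW.
    have w1 : cabs (r m - gconv V (off W) m - ((th m + w2 m)%:C%C - lam) * W m) <=
        ew t m * (eta + p0 * P2c + (2 * Q + 1) * (Q * P1c / D')).
      rewrite (le_trans (cabsB _ _))// cabsM.
      have w4 : cabs ((th m + w2 m)%:C%C - lam) * cabs (W m) <= (2 * Q + 1) * ew t m * (Q * P1c / D').
        by rewrite ler_pM ?cabs_ge0.
      have w5 : cabs (r m - gconv V (off W) m) <= eta + p0 * P2c.
        by rewrite (le_trans (cabsB _ _))// lerD.
      have w6 : eta + p0 * P2c <= ew t m * (eta + p0 * P2c).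
        by rewrite ler_peMl// (le_trans _ w5)// cabs_ge0.
      lra.
    have g1 := ler_pM (normr_ge0 _) (cabs_ge0 _) (g_le Tm) w1.
    have h1 : h (be m) * cabs (W m) <= 2 * Q * Q / D' ^+ 2 * ew (2 * t) m * eps.
      by rewrite ler_pM ?cabs_ge0 ?h_le// invr_ge0 ltW.
    apply: le_trans (lerD g1 h1) _.
    have -> : 2 * t = t + t by ring.
    by rewrite ewD2 /Jc le_eqVlt; apply/orP; left; apply/eqP; ring.
  have k6 : ew (2 * t) m <= ew (8 * t) m by rewrite ew_le// ler_pM2r//; lra.
  have k7 := ler_wpM2r Kp k6.
  rewrite [leRHS](_ : _ = cabs (V m) * (ew (8 * t) m * Jc)); last by ring.
  by rewrite ler_wpM2l ?cabs_ge0// (le_trans k5).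
have g_abs x : `|g x| <= 1.
  rewrite /g normrM normfV (ger0_norm (ltW (sq1 x))) ler_pdivrMr// mul1r.
  rewrite -[x ^+ 2]real_normK ?num_real//; have := sqr_ge0 (`|x| - 1).
  have := normr_ge0 x; nra.
have f2s : summable_c f2.
  exists (p0 * cabs (W 0) * pT).
  have c0 : 0 <= p0 * cabs (W 0) by rewrite mulr_ge0 ?cabs_ge0.
  apply: sle_le (sleZ c0 V0) => m; rewrite /f2 /restr.
  case: ifP => _; last by rewrite cabs0 !mulr0.
  rewrite cabsN !cabsM cabs_real VN cabs_conj /ew mul0r expR0 mul1r.
  have v1 : cabs (V m) <= p0 by exact: nb_term (kt (ler0n R 8)) Vp.
  have := ler_pM (normr_ge0 _) (cabs_ge0 _) (g_abs (be m)) v1; rewrite mul1r => u1.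
  have u2 := ler_wpM2r (mulr_ge0 (cabs_ge0 (V m)) (cabs_ge0 (W 0))) u1.
  rewrite [leLHS](_ : _ = `|g (be m)| * cabs (V m) * (cabs (V m) * cabs (W 0))); last by ring.
  by apply: le_trans u2 _; rewrite le_eqVlt; apply/orP; left; apply/eqP; ring.
have f2z : csum f2 = 0.
  apply: csum_odd f2s _ => l; rewrite /f2 /restr TN; case: ifP => _; last by rewrite oppr0.
  by rewrite beN /g sqrrN mulNr rmorphN/= opprK [V l * _]mulrC; ring.
rewrite (_ : csum _ = csum f1 + csum f2); first by rewrite f2z addr0; exact: csum_le B1.
rewrite -csumD//; last by exists (pT * Jc).
apply: eq_csum => m; rewrite /f1 /f2 /restr; case: ifPn => Tm; last by rewrite addr0.
have cv : gconv V W m = gconv V (off W) m + V m * W 0.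
  have -> : V m * W 0 = gconv V (fun l => if l == 0 then W 0 else 0) m.
    rewrite /gconv -(csum_single (0 : G) (V m * W 0)); apply: eq_csum => k.
    by case: eqP => [->|_]; rewrite ?mulr0// subr0.
  have s1 : weighted_le 0 (cabs (W 0)) (fun l : G => if l == 0 then W 0 else 0).
    apply: sle_le (sle_single (0 : G) (cabs_ge0 (W 0))) => l.
    by case: eqP => _; rewrite ?cabs0 ?mulr0// /ew mul0r expR0 mul1r.
  have Vz : weighted_le 0 p0 V by apply: nb_le Vp => //; exact: kt.
  rewrite /gconv -csumD; [|exact: conv_smb (lexx 0) Vz sum_offW|exact: conv_smb (lexx 0) Vz s1].
  apply: eq_csum => k; rewrite -mulrDr; congr (_ * _); rewrite /off /restr.
  by case: eqP => [->|_]; rewrite /= ?add0r ?addr0.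
have := gh (be m) => /(congr1 (fun x => x%:C%C)); rewrite rmorphD rmorphM/= => E1.
have -> : V (- m) * W m = V (- m) * ((g (be m))%:C%C * ((be m)%:C%C * W m) + (h (be m))%:C%C * W m).
  by rewrite -[in LHS](mul1r (W m)) -[1 in LHS]/(1%:C%C) -E1; ring.
by rewrite (beW (TS Tm)) cv; ring.
Qed.

End Eigvec.

(** * Comparison of two eigenvector equations *)

Section Wronskian.
Variables (R : realType) (d : nat).
Notation G := ('rV[int]_d).
Notation C := R[i].
Variables (S' : G -> bool) (dd dd' : G -> R) (V W W' r r' : G -> C) (lam lam' : C).
Variables (p w w' e e' : R).
Hypothesis VN : forall l, V (- l) = ((V l)^*)%C.
Hypothesis W'S : forall l, ~~ S' l -> W' l = 0.
Hypotheses (Vp : weighted_le 0 p V) (Ww : weighted_le 0 w W) (W'w : weighted_le 0 w' W') (re : weighted_le 0 e r) (re' : weighted_le 0 e' r').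
Hypothesis eqn : forall l, S' l -> ((dd l)%:C%C - lam) * W l + gconv V W l = r l.
Hypothesis eqn' : forall l, S' l -> ((dd' l)%:C%C - lam') * W' l + gconv V W' l = r' l.

Let cj (u : G -> C) l : C := ((u l)^*)%C.

Let nb_cj M u : weighted_le 0 M u -> weighted_le 0 M (cj u).
Proof. by apply: nb_dom => l; rewrite cabs_conj. Qed.

Let smbM (u v : G -> C) M N : weighted_le 0 M u -> weighted_le 0 N v -> summable_c (fun l => u l * v l).
Proof.
move=> uM vN; have M0 := sle_ge0 uM; exists (M * N).
apply: sle_le (sleZ M0 vN) => l; rewrite cabsM /ew mul0r expR0 mul1r.
by rewrite ler_wpM2r ?cabs_ge0//; exact: nb_term uM.
Qed.

Lemma wronskian_smb : summable_c (fun l => cj W' l * W l).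
Proof. exact: smbM (nb_cj W'w) Ww. Qed.

Hypothesis ddW : summable_c (fun l => (dd l - dd' l)%:C%C * (cj W' l * W l)).

(** Pair the first equation with the conjugate of W' and the conjugate of the second with W. By [VN]
    the operator V is Hermitian, so its terms cancel on the modes S' of W'; what survives is the
    difference of the diagonals, the coupling to modes of W outside S', and the residuals. *)
Lemma wronskian :
  (lam - (lam'^*)%C) * csum (fun l => cj W' l * W l) =
  csum (fun l => (dd l - dd' l)%:C%C * (cj W' l * W l)) +
  (csum (fun l => cj W' l * gconv V (restr (fun m => ~~ S' m) W) l) +
  (csum (fun l => restr S' W l * cj r' l) - csum (fun l => cj W' l * r l))).
Proof.
have Ws : weighted_le 0 w (restr S' W) by exact: nb_restr.
have Wo : weighted_le 0 w (restr (fun m => ~~ S' m) W) by exact: nb_restr.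
have CS := nb_conv (lexx 0) Vp Ws; have CO := nb_conv (lexx 0) Vp Wo.
have C' := nb_conv (lexx 0) Vp W'w.
have s1 := smbM (nb_cj W'w) CO; have s2 := smbM Ws (nb_cj re').
have s3 := smbM (nb_cj W'w) re; have s4 := smbM (nb_cj W'w) CS.
have s5 := smbM Ws (nb_cj C').
have sw : csum (fun l => cj W' l * gconv V (restr S' W) l) =
    csum (fun l => restr S' W l * cj (gconv V W') l).
  have k (u v : G -> C) M N : weighted_le 0 M u -> weighted_le 0 N v ->
      summable_c (fun p : G * G => u p.1 * (V (p.1 - p.2) * v p.2)).
    move=> uM vN; have H := conv_smb2 (lexx 0) Vp vN; have M0 := sle_ge0 uM.
    exists (M * (p * N)); apply: sle_le (sleZ M0 H) => q; rewrite cabsM.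
    rewrite /ew mul0r expR0 mul1r ler_wpM2r ?cabs_ge0//; exact: nb_term uM.
  transitivity (csum (fun l => csum (fun m => cj W' l * (V (l - m) * restr S' W m)))).
    by apply: eq_csum => l; rewrite csumZ//; exact: conv_smb (lexx 0) Vp Ws.
  rewrite csum_swap; last exact: k (nb_cj W'w) Ws.
  apply: eq_csum => m; rewrite /cj /gconv -csum_conj; last exact: conv_smb (lexx 0) Vp W'w.
  rewrite -csumZ; last first.
    have [M HM] := conv_smb m (lexx 0) Vp W'w; exists M.
    by apply: sle_le HM => l; rewrite cabs_conj.
  apply: eq_csum => l; rewrite rmorphM/= -VN opprB; ring.
have pt l : (lam - (lam'^*)%C) * (cj W' l * W l) =
    (dd l - dd' l)%:C%C * (cj W' l * W l) + (cj W' l * gconv V (restr (fun m => ~~ S' m) W) l +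
    (restr S' W l * cj r' l - cj W' l * r l)) +
    (cj W' l * gconv V (restr S' W) l - restr S' W l * cj (gconv V W') l).
  have cW : gconv V W l = gconv V (restr S' W) l + gconv V (restr (fun m => ~~ S' m) W) l.
    rewrite /gconv -csumD; [|exact: conv_smb (lexx 0) Vp Ws|exact: conv_smb (lexx 0) Vp Wo].
    apply: eq_csum => m; rewrite -mulrDr /restr; congr (_ * _).
    by case: (S' m); rewrite /= ?addr0 ?add0r.
  have [Sl|Sl] := boolP (S' l); last first.
    by rewrite /cj W'S// /restr (negbTE Sl) conjc0 !(mul0r, mulr0) !(addr0, subr0, oppr0).
  have -> : restr S' W l = W l by rewrite /restr Sl.
  rewrite /cj -(eqn' Sl) -(eqn Sl) cW.
  have -> : ((((dd' l)%:C%C - lam') * W' l + gconv V W' l)^*)%C =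
    ((dd' l)%:C%C - (lam'^*)%C) * ((W' l)^*)%C + ((gconv V W' l)^*)%C.
    by rewrite cjD cjM cjB cj_real.
  by rewrite rmorphB/=; ring.
rewrite -csumZ; last exact: wronskian_smb.
rewrite (eq_csum pt) csumD; first last.
- by apply: smbD => //; exact: smbN.
- by apply: smbD => //; apply: smbD => //; apply: smbD => //; exact: smbN.
rewrite csumB// sw subrr addr0 csumD//; last by apply: smbD => //; apply: smbD => //; exact: smbN.
rewrite csumD//; last by apply: smbD => //; exact: smbN.
by rewrite csumB.
Qed.

End Wronskian.

(** * Arithmetic of the generators *)

Section Plane.
Variable R : realType.
Implicit Types (u v w j : 'rV[int]_2).

Definition det2 v w : int := v 0 0 * w 0 1 - v 0 1 * w 0 0.

Lemma lift01 : lift ord0 (ord0 : 'I_1) = 1 :> 'I_2.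
Proof. exact: val_inj. Qed.

Lemma dotZ2 u v : dotZ u v = u 0 0 * v 0 0 + u 0 1 * v 0 1.
Proof. by rewrite /dotZ !big_ord_recl big_ord0 addr0 lift01. Qed.

Lemma n1_2 u : n1 u = (`|u 0%R 0%R| + `|u 0%R 1%R|)%N.
Proof. by rewrite /n1 !big_ord_recl big_ord0 addn0 lift01. Qed.

Lemma row2P u v : u 0 0 = v 0 0 -> u 0 1 = v 0 1 -> u = v.
Proof.
move=> h0 h1; apply/rowP => i; have [->|[->|//]] : i = 0 \/ i = 1 \/ False.
  by case: i => -[|[|//]] ?; [left|right; left]; exact: val_inj.
- exact: h0.
- exact: h1.
Qed.

Lemma sqnormZ_ge0 n (u : 'rV[int]_n) : 0 <= sqnormZ u.
Proof. by apply: sumr_ge0 => i _; rewrite -expr2 sqr_ge0. Qed.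

Lemma sqnormZ_gt0 n (u : 'rV[int]_n) : u != 0 -> 0 < sqnormZ u.
Proof.
move=> u0; rewrite lt0r sqnormZ_ge0 andbT; apply: contra u0 => /eqP.
move=> /psumr_eq0P H; apply/eqP/rowP => i; rewrite mxE.
have := H (fun i _ => ltac:(by rewrite -expr2 sqr_ge0)) i isT.
by move=> /eqP; rewrite mulf_eq0 orbb => /eqP.
Qed.

Lemma sqnormZ_R n (u : 'rV[int]_n) :
  (sqnormZ u)%:~R = \sum_i ((`|u 0%R i|%N)%:R : R) ^+ 2.
Proof.
rewrite /sqnormZ /dotZ rmorph_sum/=; apply: eq_bigr => i _.
by rewrite natr_absz -rmorphXn/= real_normK ?num_real// expr2.
Qed.

Lemma enormZ_n1 n (u : 'rV[int]_n) : enormZ R u <= (n1 u)%:R.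
Proof.
rewrite /enormZ -[leRHS]ger0_norm// -sqrtr_sqr ler_wsqrtr// sqnormZ_R.
apply: (@le_trans _ _ (\sum_i (n1 u)%:R * ((`|u 0%R i|%N)%:R : R))).
  apply: ler_sum => i _; rewrite expr2 ler_wpM2r// ler_nat; exact: n1_entry.
by rewrite -mulr_sumr /n1 natr_sum expr2.
Qed.

Lemma entry_enormZ n (u : 'rV[int]_n) i : (`|u 0%R i|%N)%:R <= enormZ R u.
Proof.
rewrite /enormZ -[leLHS]ger0_norm// -sqrtr_sqr ler_wsqrtr// sqnormZ_R.
by rewrite (bigD1 i)//= lerDl; apply: sumr_ge0 => k _; rewrite sqr_ge0.
Qed.

Lemma n1_enormZ n (u : 'rV[int]_n) : (n1 u)%:R <= n%:R * enormZ R u.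
Proof.
rewrite /n1 natr_sum -[n in n%:R](card_ord n) mulr_natl -sumr_const.
by apply: ler_sum => i _; exact: entry_enormZ.
Qed.

Lemma enormZ_ge1 n (u : 'rV[int]_n) : u != 0 -> 1 <= enormZ R u.
Proof.
move=> /sqnormZ_gt0 h; rewrite /enormZ -[leLHS]sqrtr1 ler_wsqrtr//.
by rewrite -[1]/(1%:~R) ler_int; lia.
Qed.

Lemma sqr_enormZ n (u : 'rV[int]_n) : enormZ R u ^+ 2 = (sqnormZ u)%:~R.
Proof. by rewrite sqr_sqrtr// ler0z sqnormZ_ge0. Qed.

Lemma jap_ge1 (x : R) : 1 <= jap x. Proof. by rewrite le_max lexx. Qed.
Lemma jap_gt0 (x : R) : 0 < jap x. Proof. exact: lt_le_trans (jap_ge1 x). Qed.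
Lemma jap_le (x : R) : jap x <= 1 + `|x|.
Proof. by rewrite ge_max lerDl normr_ge0 lerDr ler01. Qed.

Lemma n1_japZ n (u : 'rV[int]_n) : 1 + (n1 u)%:R <= (1 + n%:R) * japZ R u.
Proof.
rewrite mulrDl mul1r lerD ?jap_ge1//; apply: le_trans (n1_enormZ u) _.
by rewrite ler_wpM2l// /japZ /jap le_max ler_norm orbT.
Qed.

Definition e1 : 'rV[int]_2 := \row_i (i == 0)%:R.

Lemma gen_e1 : is_generator e1.
Proof. by left; rewrite !mxE. Qed.
Lemma gen_e2 : is_generator e2.
Proof. by right; rewrite !mxE. Qed.

Lemma gen_coprime v : is_generator v -> coprimez (v 0 0) (v 0 1).
Proof. by rewrite /coprimez; move=> [[-> _]|[-> ->]]. Qed.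

Lemma prim w : w != 0 -> exists v (n : int), [/\ is_generator v, n != 0 & w = n *: v].
Proof.
move=> w0; set g := gcdz (w 0 0) (w 0 1).
have g0 : g != 0.
  apply: contra w0; rewrite /g gcdz_eq0 => /andP[/eqP a /eqP b].
  by apply/eqP/row2P; rewrite mxE.
have ex : w 0 0 = divz (w 0 0) g * g by rewrite divzK// dvdz_gcdl.
have ey : w 0 1 = divz (w 0 1) g * g by rewrite divzK// dvdz_gcdr.
move: ex ey; set x := divz _ _; set y := divz _ _ => ex ey.
have cop : gcdz x y = 1.
  have g0' : 0 <= g by rewrite /g.
  have := mulz_gcdl x y g; rewrite -ex -ey -/g gez0_abs// => H.
  by apply: (mulIf g0); rewrite H mul1r.
have [x0|x0|x0] := ltgtP x 0.
- exists (\row_i (if i == 0 then - x else - y)), (- g); split; last 2 first.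
  + by rewrite oppr_eq0.
  + by apply: row2P; rewrite !mxE/= mulrNN mulrC.
  by left; rewrite !mxE/= oppr_gt0 gcdNz gcdzN.
- exists (\row_i (if i == 0 then x else y)), g; split => //.
    by left; rewrite !mxE.
  by apply: row2P; rewrite !mxE/= mulrC.
- exists e2, (y * g); split.
  + exact: gen_e2.
  + rewrite mulf_neq0//; apply/eqP => y0.
    by move: cop; rewrite x0 y0.
  + by apply: row2P; rewrite !mxE/= ?mulr0 ?mulr1// ex x0 mul0r.
Qed.

Lemma parallel v w : coprimez (v 0 0) (v 0 1) -> det2 v w = 0 -> exists n : int, w = n *: v.
Proof.
rewrite /coprimez /det2 => /eqP c h; have [a [b]] := Bezoutz (v 0 0) (v 0 1); rewrite c => e.
have h' : v 0 0 * w 0 1 = v 0 1 * w 0 0 by apply/eqP; rewrite -subr_eq0 h.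
(* For Bezout coefficients a, b of v the form a x + b y equals 1 at v, so at w it reads off the
   multiple. *)
exists (a * w 0 0 + b * w 0 1); apply: row2P; rewrite mxE.
  transitivity ((a * v 0 0 + b * v 0 1) * w 0 0); first by rewrite e mul1r.
  have -> : (a * w 0 0 + b * w 0 1) * v 0 0 = a * w 0 0 * v 0 0 + b * (v 0 0 * w 0 1) by ring.
  by rewrite h'; ring.
transitivity ((a * v 0 0 + b * v 0 1) * w 0 1); first by rewrite e mul1r.
have -> : (a * w 0 0 + b * w 0 1) * v 0 1 = a * (v 0 1 * w 0 0) + b * w 0 1 * v 0 1 by ring.
by rewrite -h'; ring.
Qed.

Lemma dotZC n (u v : 'rV[int]_n) : dotZ u v = dotZ v u.
Proof. by apply: eq_bigr => i _; rewrite mulrC. Qed.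
Lemma dotZDr n (u v w : 'rV[int]_n) : dotZ u (v + w) = dotZ u v + dotZ u w.
Proof. by rewrite /dotZ -big_split/=; apply: eq_bigr => i _; rewrite mxE mulrDr. Qed.
Lemma dotZZr n (a : int) (u v : 'rV[int]_n) : dotZ u (a *: v) = a * dotZ u v.
Proof. by rewrite /dotZ mulr_sumr; apply: eq_bigr => i _; rewrite mxE mulrCA. Qed.
Lemma dotZNr n (u v : 'rV[int]_n) : dotZ u (- v) = - dotZ u v.
Proof. by rewrite -scaleN1r dotZZr mulN1r. Qed.
Lemma dotZ0r n (u : 'rV[int]_n) : dotZ u 0 = 0.
Proof. by rewrite /dotZ big1// => i _; rewrite mxE mulr0. Qed.

Lemma sqnormZD n (u v : 'rV[int]_n) : sqnormZ (u + v) = sqnormZ u + 2 * dotZ u v + sqnormZ v.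
Proof.
by rewrite /sqnormZ dotZDr !(dotZC (u + v)) !dotZDr (dotZC v u); ring.
Qed.

Variable delta : R.
Hypothesis delta0 : 0 < delta.

Lemma admissible1 j v : j != 0 -> is_generator v -> enormZ R v = 1 -> admissible delta j v.
Proof.
move=> j0 gv v1; split => //; rewrite v1 -(powRr0 (enormZ R j)).
by rewrite (ler_powR (enormZ_ge1 j0))// ltW.
Qed.

Lemma enormZ_e1 : enormZ R e1 = 1.
Proof. by rewrite /enormZ /sqnormZ dotZ2 !mxE/= mulr0 addr0 mulr1 sqrtr1. Qed.

(** Three successive minima over natural numbers: of |w.j|, of the first entry, of the second entry.
    The first entry of a generator is nonnegative, so its absolute value is faithful; the second may
    be negative and is shifted by a bound B on admissible vectors. *)
Lemma vgen_ex j : j != 0 -> exists v, is_vgen delta j v.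
Proof.
move=> j0.
have min (P : 'rV[int]_2 -> Prop) (f : 'rV[int]_2 -> nat) : (exists v, P v) ->
    exists2 v, P v & forall w, P w -> (f v <= f w)%N.
  move=> [v Pv]; have ex : exists n, `[< exists2 w, P w & f w = n >].
    by exists (f v); apply/asboolP; exists v.
  case: (ex_minnP ex) => n /asboolP[w Pw fw] H; exists w => // u Pu.
  by rewrite fw; apply: H; apply/asboolP; exists u.
have [v av vm] := min (admissible delta j) (fun v => `|dotZ v j|%N)
   (ex_intro _ _ (admissible1 j0 gen_e1 enormZ_e1)).
have [u [au uv] um] := min (fun w => admissible delta j w /\ `|dotZ w j|%N = `|dotZ v j|%N)
   (fun w => `|w 0%R 0%R|%N) (ex_intro _ v (conj av erefl)).
pose B := (Num.truncn (enormZ R j `^ delta)).+1.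
have bnd w : admissible delta j w -> (`|w 0%R 1%R| < B)%N.
  move=> [_ h]; rewrite -(ltr_nat R); apply: le_lt_trans (entry_enormZ w 1) _.
  by apply: le_lt_trans h _; exact: truncnS_gt.
have [x [[ax xv] xu] xm] := min (fun w => (admissible delta j w /\ `|dotZ w j|%N = `|dotZ v j|%N) /\
    `|w 0%R 0%R|%N = `|u 0%R 0%R|%N) (fun w => `|(w 0%R 1%R + B%:Z)%R|%N)
    (ex_intro _ u (conj (conj au uv) erefl)).
have pos w : is_generator w -> 0 <= w 0 0 by move=> [[_ /ltW]|[-> _]].
exists x; split => // w aw; split; first by have := vm w aw; rewrite -xv; lia.
move=> e; have ew : `|dotZ w j|%N = `|dotZ v j|%N by rewrite -xv; lia.
have h1 := um w (conj aw ew).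
have pw := pos w aw.1; have px := pos x ax.1.
rewrite /lexZ2; have [lt|ge] := ltP (x 0 0) (w 0 0) => //=.
have e0 : x 0 0 = w 0 0 by lia.
have e3 : `|w 0%R 0%R|%N = `|u 0%R 0%R|%N by rewrite -xu e0.
rewrite e0 eqxx/=; have := xm w (conj (conj aw ew) e3).
have := bnd w aw; have := bnd x ax; lia.
Qed.

Lemma vgenP j : j != 0 -> is_vgen delta j (vgen delta j).
Proof.
move=> j0; rewrite /vgen (negbTE j0); have [v vj] := vgen_ex j0.
exact: (@xgetPex _ _ [set v | is_vgen delta j v] (ex_intro _ v vj)).
Qed.

Lemma vgen_generator j : is_generator (vgen delta j).
Proof.
have [->|j0] := eqVneq j 0; last by have [[]] := vgenP j0.
by rewrite /vgen eqxx; exact: gen_e2.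
Qed.

Lemma vgen_min j w : j != 0 -> is_generator w -> enormZ R w <= enormZ R j `^ delta ->
  `|bgen delta j| <= `|dotZ w j|.
Proof.
move=> j0 gw wj; rewrite /bgen dotZC; have [_ /(_ w)] := vgenP j0.
by case=> //; split.
Qed.

(** The vector (1, 0) is admissible for every j, hence a competitor in the minimum. *)
Lemma bgen_le j : (`|bgen delta j|%:~R : R) <= enormZ R j.
Proof.
have [->|j0] := eqVneq j 0.
  rewrite /bgen /dotZ big1 ?normr0 ?sqrtr_ge0// => i _; by rewrite mxE mul0r.
have [_ a1] := admissible1 j0 gen_e1 enormZ_e1.
have := vgen_min j0 gen_e1 a1; rewrite -(ler_int R) => /le_trans; apply.
rewrite dotZ2 !mxE/= mul1r mul0r addr0; have := entry_enormZ j 0.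
by rewrite natr_absz.
Qed.

End Plane.

Lemma ler_norm_mull (n x : int) : n != 0 -> `|x| <= `|n * x|.
Proof. by move=> n0; rewrite normrM ler_peMl//; lia. Qed.

(** Cramer's rule for an entry x of j with determinant D: y and q are the products of j with two
    independent vectors, p and r are entries of these vectors. Integrality gives |D| >= 1. *)
Lemma cramer_bound (x y D p q r : int) (W U : nat) : x * D = y * p - q * r -> D != 0 ->
  `|y| <= `|q| -> (`|p| <= W)%N -> (`|r| <= U)%N -> (`|x| <= `|q| * (W + U))%N.
Proof.
move=> H D0 yq pW rU.
have : (`|x| <= `|(x * D)%R|)%N by rewrite abszM leq_pmulr// absz_gt0.
move=> /leq_trans; apply; rewrite H.
have : (`|(y * p - q * r)%R| <= `|(y * p)%R| + `|(q * r)%R|)%N.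
  by move: (y * p) (q * r) => u v; lia.
move=> /leq_trans; apply; rewrite !abszM mulnDr leq_add// leq_mul//; lia.
Qed.

(** * Lower bounds for the slope 2 j.momentum(l) *)

Section Gains.
Variables (R : realType) (d : nat) (K : 'M[int]_(d, 2)).
Notation G := ('rV[int]_d).
Notation mom := (momentum K).

Lemma momD l m : mom (l + m) = mom l + mom m.
Proof. by rewrite /momentum -big_split/=; apply: eq_bigr => i _; rewrite mxE scalerDl. Qed.

Lemma mom0 : mom 0 = 0.
Proof. by rewrite /momentum big1// => i _; rewrite mxE scale0r. Qed.

Lemma momN l : mom (- l) = - mom l.
Proof. by apply/eqP; rewrite -subr_eq0 opprK -momD addNr mom0. Qed.

Lemma momB l m : mom (l - m) = mom l - mom m.
Proof. by rewrite momD momN. Qed.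

Definition mom_bound : nat := (\sum_i \sum_c `|K i c|%N)%N.

Lemma n1_mom l : (n1 (mom l) <= mom_bound * n1 l)%N.
Proof.
have e c : (`|mom l 0%R c|%N <= n1 l * \sum_i `|K i c|%N)%N.
  rewrite /momentum summxE.
  apply: (@leq_trans (\sum_i `|l 0%R i|%N * `|K i c|%N)%N).
    elim/big_ind2: _ => //= [x y z t h1 h2|i _].
      by apply: leq_trans (leq_add h1 h2); lia.
    by rewrite !mxE abszM.
  rewrite big_distrr/=; apply: leq_sum => i _; rewrite leq_mul2r n1_entry orbT//.
rewrite {1}/n1 /mom_bound exchange_big/= mulnC big_distrr/=; apply: leq_sum => c _.
exact: e.
Qed.

Variable delta : R.
Hypothesis delta01 : 0 < delta < 1 / 2.

(** Larger than 1/delta, so that |j|^delta <= x forces |j| <= x^k. *)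
Let k : nat := (Num.truncn delta^-1).+1.
Let kdelta : 1 <= delta * k%:R.
Proof.
case/andP: delta01 => d0 _; rewrite mulrC -ler_pdivrMr// div1r ltW//; exact: truncnS_gt.
Qed.

Let big_mom (j : 'rV[int]_2) (x : R) : j != 0 -> enormZ R j `^ delta <= x -> enormZ R j <= x ^+ k.
Proof.
move=> j0 h; have j1 := enormZ_ge1 R j0.
have : enormZ R j <= enormZ R j `^ (delta * k%:R).
  rewrite -[leLHS]powRr1 ?sqrtr_ge0//; exact: ler_powR.
move=> /le_trans; apply; rewrite powRrM powR_mulrn ?powR_ge0//.
by rewrite lerXn2r ?nnegrE ?powR_ge0// (le_trans _ h)// powR_ge0.
Qed.

Let mom_le l : (n1 (mom l))%:R <= mom_bound%:R * (1 + (n1 l)%:R) :> R.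
Proof.
by rewrite (@le_trans _ _ (mom_bound%:R * (n1 l)%:R))// -?natrM ?ler_nat ?n1_mom// natrM ler_wpM2l// lerDr.
Qed.

(** Either the generator parallel to [mom l] competes in the minimum defining b(j), and b(j) is
    bounded by the slope; or it is longer than |j|^delta, and then |j|, hence b(j), is polynomial in
    l. *)
Lemma gain_b (j : 'rV[int]_2) l : mom l != 0 ->
  jap (bgen delta j)%:~R <= (1 + mom_bound%:R * (1 + (n1 l)%:R)) ^+ k * (`|(2 * dotZ j (mom l))%:~R| + 1) :> R.
Proof.
move=> m0; case/andP: (delta01) => d0 _.
have X1 : 1 <= (1 + mom_bound%:R * (1 + (n1 l)%:R)) ^+ k :> R.
  by rewrite exprn_ege1// lerDl mulr_ge0// addr_ge0.
have [->|j0] := eqVneq j 0.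
  have -> : bgen delta (0 : 'rV[int]_2) = 0 by rewrite /bgen dotZC dotZ0r.
  by rewrite /jap normr0 max_l// mulr_ege1// lerDr.
have [v [n [gv n0 E]]] := prim m0.
have [vj|vj] := leP (enormZ R v) (enormZ R j `^ delta).
  have h := vgen_min d0 j0 gv vj.
  have : `|bgen delta j| <= `|2 * dotZ j (mom l)|.
    apply: le_trans h _; rewrite E dotZZr (dotZC j v); apply: le_trans (ler_norm_mull _ n0) _.
    exact: ler_norm_mull.
  rewrite -(ler_int R) !intr_norm => h1.
  have : jap (bgen delta j)%:~R <= `|(2 * dotZ j (mom l))%:~R| + 1 :> R.
    by rewrite (le_trans (jap_le _))// addrC lerD2r.
  by move=> /le_trans; apply; rewrite ler_peMl// addr_ge0.
have vw : enormZ R v <= 1 + mom_bound%:R * (1 + (n1 l)%:R).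
  apply: (@le_trans _ _ (n1 v)%:R); first exact: enormZ_n1.
  apply: (@le_trans _ _ (n1 (mom l))%:R).
    rewrite ler_nat E /n1; apply: leq_sum => i _; by rewrite mxE abszM leq_pmull// absz_gt0.
  by rewrite (le_trans (mom_le l))// lerDr.
have := big_mom j0 (le_trans (ltW vj) vw) => h2.
have h3 : jap (bgen delta j)%:~R <= (1 + mom_bound%:R * (1 + (n1 l)%:R)) ^+ k :> R.
  by rewrite /jap ge_max X1 (le_trans _ h2)// -intr_norm bgen_le.
by apply: le_trans h3 _; rewrite ler_peMr// ?lerDr// (le_trans _ X1).
Qed.

(** Two independent vectors determine j from its products with them. Here they are v(j), with
    product at most |j.mom l| by minimality and length at most |j|^delta, and [mom l]. If the
    generator along [mom l] is too long to compete in that minimum, |j| is already polynomial in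
    l. *)
Lemma gain_j (j : 'rV[int]_2) l : det2 (vgen delta j) (mom l) != 0 ->
  japZ R j `^ (1 - 2 * delta) <=
    4 * (1 + mom_bound%:R * (1 + (n1 l)%:R)) ^+ k.+1 * (`|(2 * dotZ j (mom l))%:~R| + 1).
Proof.
case/andP: (delta01) => d0 d1 det0.
have Y1 : 1 <= 1 + mom_bound%:R * (1 + (n1 l)%:R) :> R by rewrite lerDl mulr_ge0// addr_ge0.
have X1 m : 1 <= (1 + mom_bound%:R * (1 + (n1 l)%:R)) ^+ m :> R by exact: exprn_ege1.
set Y := 1 + mom_bound%:R * (1 + (n1 l)%:R) in Y1 X1 *.
pose be : R := `|(2 * dotZ j (mom l))%:~R|; have b0 : 0 <= be by exact: normr_ge0.
change (japZ R j `^ (1 - 2 * delta) <= 4 * Y ^+ k.+1 * (be + 1)).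
have [j0|j0] := eqVneq j 0.
  have -> : japZ R j = 1 by rewrite /japZ /enormZ j0 /sqnormZ dotZ0r sqrtr0 /jap normr0 max_l.
  rewrite powR1; have := X1 k.+1; nra.
have j1 := enormZ_ge1 R j0.
have jE : japZ R j = enormZ R j by rewrite /japZ /jap ger0_norm ?sqrtr_ge0// max_r.
rewrite jE.
have m0 : mom l != 0 by apply: contra det0 => /eqP ->; rewrite /det2 !mxE !mulr0 subrr.
have [v [n [gv n0 E]]] := prim m0.
have pj : enormZ R j `^ (1 - 2 * delta) <= enormZ R j.
  by rewrite -[leRHS]powRr1 ?sqrtr_ge0//; apply: (ler_powR j1); lra.
have [vj|vj] := leP (enormZ R v) (enormZ R j `^ delta); last first.
  have vw : enormZ R v <= Y.
    apply: (@le_trans _ _ (n1 v)%:R); first exact: enormZ_n1.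
    apply: (@le_trans _ _ (n1 (mom l))%:R).
      rewrite ler_nat E /n1; apply: leq_sum => i _; by rewrite mxE abszM leq_pmull// absz_gt0.
    by rewrite (le_trans (mom_le l))// lerDr.
  have h2 := big_mom j0 (le_trans (ltW vj) vw).
  have h3 : Y ^+ k <= Y ^+ k.+1 by rewrite ler_weXn2l.
  have := X1 k.+1; nra.
set w := mom l in E m0 det0 be b0 *; set u := vgen delta j in det0 *.
have gu : is_generator u by exact: vgen_generator.
have [[_ uj] _] := vgenP d0 j0.
have h := vgen_min d0 j0 gv vj.
have hw : `|dotZ j u| <= `|dotZ j w|.
  apply: (le_trans h); rewrite E dotZZr (dotZC j v); exact: ler_norm_mull.
have key c : (`|j 0%R c|%N <= `|dotZ j w|%N * (n1 w + n1 u))%N.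
  have a0 : j 0 0 * det2 u w = dotZ j u * w 0 1 - dotZ j w * u 0 1 by rewrite !dotZ2 /det2; ring.
  have a1 : j 0 1 * det2 u w = dotZ j w * u 0 0 - dotZ j u * w 0 0 by rewrite !dotZ2 /det2; ring.
  have eu := n1_entry u; have ew := n1_entry w.
  have cc : c = 0 \/ c = 1.
    by case: c => -[|[|//]] ?; [left|right]; exact: val_inj.
  have ab := cramer_bound.
  case: cc => ->.
    exact: ab a0 det0 hw (ew 1) (eu 1).
  have a1' : j 0 1 * (- det2 u w) = dotZ j u * w 0 0 - dotZ j w * u 0 0 by rewrite mulrN a1; ring.
  by apply: ab a1' _ hw (ew 0) (eu 0); rewrite oppr_eq0.
have ej : enormZ R j <= be * (Y + 2 * enormZ R j `^ delta).
  apply: le_trans (enormZ_n1 R j) _; rewrite n1_2.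
  have kk : (`|j 0%R 0%R| + `|j 0%R 1%R| <= 2 * `|dotZ j w| * (n1 w + n1 u))%N.
    by rewrite -mulnA mul2n -addnn leq_add.
  have : ((`|j 0%R 0%R| + `|j 0%R 1%R|)%N%:R : R) <= (2 * `|dotZ j w|)%N%:R * (n1 w + n1 u)%N%:R.
    by rewrite -natrM ler_nat.
  move=> /le_trans; apply.
  have -> : be = (2 * `|dotZ j w|)%N%:R 
    by rewrite /be rmorphM/= normrM (ger0_norm (ler0n R 2)) natrM natr_absz intr_norm.
  rewrite ler_wpM2l// natrD lerD//; first by rewrite (le_trans (mom_le l))// lerDr.
  by apply: le_trans (n1_enormZ R u) _; rewrite ler_wpM2l.
have q1 : 1 <= enormZ R j `^ delta.
  by rewrite -(powRr0 (enormZ R j)); apply: (ler_powR j1); exact: ltW.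
have e2 : enormZ R j `^ (1 - 2 * delta) * enormZ R j `^ delta <= enormZ R j.
  rewrite -powRD; last by apply/implyP => _; rewrite gt_eqF// (lt_le_trans _ j1).
  by rewrite -[leRHS]powRr1 ?sqrtr_ge0//; apply: (ler_powR j1); lra.
have e3 : enormZ R j `^ (1 - 2 * delta) <= be * (Y + 2).
  have q0 : 0 < enormZ R j `^ delta by exact: lt_le_trans q1.
  rewrite -(ler_pM2r q0); apply: le_trans e2 _; apply: le_trans ej _.
  by rewrite -mulrA ler_wpM2l// [leRHS]mulrDl lerD2r ler_peMr// (le_trans _ Y1).
apply: le_trans e3 _.
have h4 : Y <= Y ^+ k.+1 by rewrite -[leLHS]expr1 ler_weXn2l.
have h5 : Y + 2 <= 4 * Y ^+ k.+1 by lra.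
have h6 : 0 <= 4 * Y ^+ k.+1 by rewrite mulr_ge0// (le_trans _ (X1 _)).
by rewrite mulrC ler_pM// ?lerDl// ltW//; lra.
Qed.

End Gains.

(** * Columns of the full and of the reduced problems *)

Section Index.
Variables (R : realType) (d : nat) (K : 'M[int]_(d, 2)).
Notation G := ('rV[int]_d).
Notation mom := (momentum K).
Notation C := R[i].

(* [inl j] is the j-th column of the full problem; [inr (v, b)] is the column of
   the problem that keeps only the modes with momentum parallel to v, in which
   j enters only through b = j . v. *)
Definition Idx : Type := ('rV[int]_2 + 'rV[int]_2 * int)%type.

Definition idx_shift (x : Idx) (l : G) : Idx :=
  match x with
  | inl j => inl (j + mom l)
  | inr (v, b) => inr (v, b + dotZ v (mom l))
  end.

(** For primitive v a momentum parallel to v is an integer multiple of v. For any other v only l = 0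
    is kept, so that the reduced problem makes sense, and is trivial, for every pair (v, b). *)
Definition idx_allowed (x : Idx) (l : G) : bool :=
  match x with
  | inl _ => true
  | inr (v, _) => (l == 0) || (coprimez (v 0 0) (v 0 1) && (det2 v (mom l) == 0))
  end.

(** b^2 / |v|^2 is the energy of the component of j along v. The allowed modes leave the orthogonal
    component unchanged, so energy differences agree with those of the full problem. *)
Definition idx_energy (x : Idx) : R :=
  match x with
  | inl j => (sqnormZ j)%:~R
  | inr (v, b) => b%:~R ^+ 2 / (sqnormZ v)%:~R
  end.

Definition idx_slope (x : Idx) (l : G) : R :=
  match x with
  | inl j => (2 * dotZ j (mom l))%:~R
  | inr (v, b) => (2 * b * dotZ v (mom l))%:~R / (sqnormZ v)%:~R
  end.

Definition mom_sq (l : G) : R := (sqnormZ (mom l))%:~R.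
Definition flat (l : G) : bool := mom l == 0.

Lemma ish0 x : idx_shift x 0 = x.
Proof. by case: x => [j|[v b]] /=; rewrite mom0 ?dotZ0r addr0. Qed.

Lemma ishD x l m : idx_shift (idx_shift x l) m = idx_shift x (l + m).
Proof. by case: x => [j|[v b]] /=; rewrite momD ?dotZDr addrA. Qed.

Lemma det2D v (w u : 'rV[int]_2) : det2 v (w + u) = det2 v w + det2 v u.
Proof. by rewrite /det2 !mxE; ring. Qed.
Lemma det2N v (w : 'rV[int]_2) : det2 v (- w) = - det2 v w.
Proof. by rewrite /det2 !mxE; ring. Qed.

Lemma ial0 x : idx_allowed x 0.
Proof. by case: x => [//|[v b]] /=; rewrite eqxx. Qed.

Lemma ial_sh x l m : idx_allowed (idx_shift x l) m = idx_allowed x m.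
Proof. by case: x => [//|[v b]]. Qed.

Lemma ialN x l : idx_allowed x (- l) = idx_allowed x l.
Proof. by case: x => [//|[v b]] /=; rewrite oppr_eq0 momN det2N oppr_eq0. Qed.

Lemma ialD' x l m : idx_allowed x l -> idx_allowed x m -> idx_allowed x (l + m).
Proof.
case: x => [//|[v b]] /= /orP[/eqP->|/andP[c /eqP h]] /orP[/eqP->|/andP[c' /eqP h']].
- by rewrite addr0 eqxx.
- by rewrite add0r c' h' eqxx orbT.
- by rewrite addr0 c h eqxx orbT.
- by rewrite c momD det2D h h' addr0 eqxx orbT.
Qed.

Lemma ialD x l m : idx_allowed x l -> idx_allowed (idx_shift x l) m -> idx_allowed x (l + m).
Proof. by rewrite ial_sh; exact: ialD'. Qed.

Lemma coprime_neq0 (v : 'rV[int]_2) : coprimez (v 0 0) (v 0 1) -> v != 0.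
Proof. by move=> c; apply/eqP => v0; move: c; rewrite v0 !mxE. Qed.

Lemma sqnormZ_neq0 (v : 'rV[int]_2) : v != 0 -> (sqnormZ v)%:~R != 0 :> R.
Proof. by move=> /sqnormZ_gt0; rewrite intr_eq0 => /lt0r_neq0. Qed.

Lemma ien_sh x l : idx_allowed x l -> idx_energy (idx_shift x l) - idx_energy x = idx_slope x l + mom_sq l.
Proof.
case: x => [j _|[v b]] /=.
  by rewrite sqnormZD /mom_sq !rmorphD/=; ring.
case/orP=> [/eqP->|/andP[c /eqP h]].
  by rewrite /mom_sq mom0 dotZ0r /sqnormZ dotZ0r mulr0 !addr0 subrr mul0r.
have [n E] := parallel c h.
have v0 := sqnormZ_neq0 (coprime_neq0 c).
rewrite /mom_sq E dotZZr -/(sqnormZ v) /sqnormZ dotZZr (dotZC (n *: v)) dotZZr -/(sqnormZ v).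
by rewrite !(rmorphD, rmorphM)/=; field.
Qed.

(** Needed for the reduced columns too, so that each small divisor is om.l plus an integer plus
    corrections: with momentum n v the slope is 2 b n. *)
Lemma ibet_int x l : idx_allowed x l -> exists n : int, idx_slope x l = n%:~R.
Proof.
case: x => [j _|[v b]] /=; first by eexists.
case/orP=> [/eqP->|/andP[c /eqP h]].
  by exists 0; rewrite mom0 dotZ0r mulr0 mul0r.
have [n E] := parallel c h; have v0 := sqnormZ_neq0 (coprime_neq0 c).
exists (2 * b * n); rewrite E dotZZr -/(sqnormZ v) !rmorphM/=; field.
exact: v0.
Qed.

Lemma ibetN x l : idx_slope x (- l) = - idx_slope x l.
Proof. by case: x => [j|[v b]] /=; rewrite momN dotZNr mulrN rmorphN ?mulNr. Qed.

Lemma iz_bet x l : flat l -> idx_slope x l = 0.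
Proof. by case: x => [j|[v b]] /= /eqP ->; rewrite dotZ0r mulr0 ?mul0r. Qed.

Lemma iz_w2 l : flat l -> mom_sq l = 0.
Proof. by move=> /eqP h; rewrite /mom_sq h /sqnormZ dotZ0r. Qed.

(** A nonzero multiple of v is at least as long as v. This is where the decay in |v| originates:
    only modes l of size comparable to |v| couple. *)
Lemma ial_size v b l : idx_allowed (inr (v, b)) l -> ~~ flat l -> enormZ R v <= (mom_bound K)%:R * (n1 l)%:R.
Proof.
move=> /= /orP[/eqP ->|/andP[c /eqP h] zl]; first by rewrite /flat mom0 eqxx.
have [n E] := parallel c h.
apply: (@le_trans _ _ (n1 v)%:R); first exact: enormZ_n1.
rewrite -natrM ler_nat; apply: leq_trans (n1_mom K l).
have n0 : n != 0 by apply: contra zl => /eqP n0; rewrite /flat E n0 scale0r.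
by rewrite E /n1; apply: leq_sum => i _; rewrite mxE abszM leq_pmull// absz_gt0.
Qed.

Variable delta : R.
Hypothesis delta01 : 0 < delta < 1 / 2.

Definition idx_b (x : Idx) : int :=
  match x with inl j => bgen delta j | inr (_, b) => b end.

(* The constant Q absorbs every polynomial loss into the weight ew t. *)
Record absorbs (t Q : R) (tau : nat) : Prop := Absorbs {
  ab_Q1 : 1 <= Q;
  ab_n1 : forall l : G, (n1 l)%:R <= Q * ew t l;
  ab_w2 : forall l : G, mom_sq l <= Q * ew t l;
  ab_tau : forall l : G, (1 + n1 l)%:R ^+ tau <= Q * ew t l;
  ab_b : forall x l, idx_allowed x l -> ~~ flat l ->
    jap (idx_b x)%:~R <= Q * ew t l * (`|idx_slope x l| + 1);
  ab_j : forall j l, det2 (vgen delta j) (mom l) != 0 ->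
    japZ R j `^ (1 - 2 * delta) <= Q * ew t l * (`|idx_slope (inl j) l| + 1) }.

Lemma absorbs_ex t tau : 0 < t -> exists Q, absorbs t Q tau.
Proof.
move=> t0.
have [C1 [C10 H1]] := @exp_poly R 1 _ t0.
have [Ct [Ct0 Ht]] := @exp_poly R tau _ t0.
have t20 : 0 < t / 2 by rewrite divr_gt0.
pose A : R := 1 + (mom_bound K)%:R.
have A1 : 1 <= A by rewrite /A lerDl.
pose k := (Num.truncn delta^-1).+1.
have [Ck [Ck0 Hk]] := @exp_poly R k.+1 _ t0.
have [C2 [C20 H2]] := @exp_poly R 2 _ t0.
(* The summands serve [ab_Q1], [ab_n1], [ab_tau] and [ab_w2]; the last one serves both gains [ab_b]
   and [ab_j]. *)
pose Q : R := 1 + C1 + Ct + A ^+ 2 * C2 + 4 * A ^+ k.+1 * Ck.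
have A0 : 0 <= A by exact: le_trans A1.
have p2 : 0 <= A ^+ 2 * C2 by rewrite mulr_ge0 ?exprn_ge0 ?(ltW C20).
have pk : 0 <= 4 * A ^+ k.+1 * Ck by rewrite mulr_ge0 ?(ltW Ck0)// mulr_ge0 ?exprn_ge0.
have le (c : R) (l : G) : c <= Q -> c * ew t l <= Q * ew t l by move=> cQ; rewrite ler_wpM2r// ew_ge0.
have An (l : G) : 1 + (mom_bound K)%:R * (1 + (n1 l)%:R) <= A * (1 + n1 l)%:R :> R.
  by rewrite natrD /A mulrDl mul1r lerD2r lerDl.
have Xk (l : G) : 4 * (1 + (mom_bound K)%:R * (1 + (n1 l)%:R)) ^+ k.+1 <= Q * ew t l.
  apply: (@le_trans _ _ (4 * A ^+ k.+1 * Ck * ew t l)); last by apply: le; rewrite /Q; lra.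
  have e4 : 4 * A ^+ k.+1 * Ck * ew t l = 4 * (A ^+ k.+1 * (Ck * ew t l)) by ring.
  rewrite e4 ler_wpM2l//; apply: (@le_trans _ _ ((A * (1 + n1 l)%:R) ^+ k.+1)).
    by rewrite lerXn2r ?nnegrE ?An ?mulr_ge0 ?addr_ge0 ?mulr_ge0 ?addr_ge0.
  by rewrite exprMn ler_wpM2l ?exprn_ge0.
exists Q; split.
- by rewrite /Q; lra.
- move=> l; apply: (@le_trans _ _ (C1 * ew t l)); last by apply: le; rewrite /Q; lra.
  by apply: le_trans (H1 (n1 l)); rewrite expr1 ler_nat leq_addl.
- move=> l; apply: (@le_trans _ _ (A ^+ 2 * C2 * ew t l)); last by apply: le; rewrite /Q; lra.
  rewrite /mom_sq -sqr_enormZ -mulrA; apply: (@le_trans _ _ ((A * (1 + n1 l)%:R) ^+ 2)).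
    rewrite lerXn2r ?nnegrE ?sqrtr_ge0 ?mulr_ge0//.
    apply: le_trans (enormZ_n1 R _) _; apply: (@le_trans _ _ ((mom_bound K)%:R * (n1 l)%:R)).
      by rewrite -natrM ler_nat n1_mom.
    by rewrite ler_pM// ?ler_nat ?leq_addl// /A lerDr.
  by rewrite exprMn ler_wpM2l ?exprn_ge0.
- move=> l; apply: (@le_trans _ _ (Ct * ew t l)); last by apply: le; rewrite /Q; lra.
  exact: Ht.
- move=> x l; have Y1 : 1 <= 1 + (mom_bound K)%:R * (1 + (n1 l)%:R) :> R.
    by rewrite lerDl mulr_ge0// addr_ge0.
  case: x => [j _|[v b]] zl /=.
    apply: le_trans (gain_b delta01 j zl) _; rewrite ler_wpM2r ?addr_ge0//.
    apply: le_trans (Xk l); apply: (@le_trans _ _ ((1 + (mom_bound K)%:R * (1 + (n1 l)%:R)) ^+ k.+1)).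
      by rewrite ler_weXn2l.
    by rewrite ler_peMl// ?ler1n// exprn_ge0// (le_trans _ Y1).
  move=> nz; case/orP: zl => [/eqP l0|/andP[c /eqP h]].
    by move: nz; rewrite /flat l0 mom0 eqxx.
  have [n E] := parallel c h; have v0 := sqnormZ_neq0 (coprime_neq0 c).
  have n0 : n != 0 by apply: contra nz => /eqP n0; rewrite /flat E n0 scale0r.
  have -> : (2 * b * dotZ v (mom l))%:~R / (sqnormZ v)%:~R = (2 * b * n)%:~R :> R.
    by rewrite E dotZZr -/(sqnormZ v) !rmorphM/=; field.
  have h1 : `|b| <= `|2 * b * n| by rewrite mulrC mulrA; apply: ler_norm_mull; rewrite mulf_neq0.
  have h2 : jap (b%:~R) <= `|(2 * b * n)%:~R| + 1 :> R.
    rewrite (le_trans (jap_le _))// addrC lerD2r -!intr_norm ler_int; exact: h1.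
  apply: le_trans h2 _; rewrite ler_peMl ?addr_ge0//.
  by apply: le_trans (Xk l); rewrite mulr_ege1 ?ler1n// exprn_ege1.
- move=> j l h; apply: le_trans (gain_j delta01 h) _.
  by rewrite ler_wpM2r ?addr_ge0// ; exact: Xk.
Qed.

End Index.

(** * Decay, Lipschitz dependence and comparison of the eigenvalues *)

Section Apost.
Variables (R : realType) (d : nat) (K : 'M[int]_(d, 2)).
Notation G := ('rV[int]_d).
Notation mom := (momentum K).
Notation C := R[i].
Notation idx_allowed := (idx_allowed K).
Notation idx_slope := (idx_slope R K).
Notation mom_sq := (mom_sq R K).
Notation flat := (flat K).
Variables (delta t Q : R) (tau : nat) (V : G -> C) (p0 eps eta gam : R).

Definition dioph (om : 'rV[R]_d) : Prop :=
  forall l : G, l != 0 -> gam <= (1 + n1 l)%:R ^+ tau * `|dotRZ om l|.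

Definition approx_eigen (om : 'rV[R]_d) (lam : Idx -> C) (W : Idx -> G -> C) : Prop :=
  forall x, [/\ forall l, ~~ idx_allowed x l -> W x l = 0,
    weighted_le (8 * t) eps (fun l => W x l - (if l == 0 then 1 else 0)),
    cabs (lam x) <= 1 &
    exists2 r, weighted_le (8 * t) eta r & forall l, idx_allowed x l ->
      ((dotRZ om l + idx_slope x l + mom_sq l)%:C%C - lam x) * W x l + gconv V (W x) l = r l].

Hypothesis delta01 : 0 < delta < 1 / 2.
Hypothesis t0 : 0 < t.
Hypothesis ab : absorbs K delta t Q tau.
Hypothesis VN : forall l, V (- l) = ((V l)^*)%C.
Hypothesis zV : forall l, flat l -> V l = 0.
Hypothesis gam01 : 0 < gam <= 1.
Hypothesis eps01 : 0 <= eps <= 1 / 4.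
Hypothesis p0e : 0 <= p0 <= eps * gam.
Hypothesis etae : 0 <= eta <= 2 * eps.
Hypothesis Vp : weighted_le (16 * t) p0 V.

Let mu := 1 - 2 * delta.
(** Half of the weight 16 t of V remains as the weight of the eigenvectors; the other half is turned
    into decay in |v| through [ial_size]. The 1 keeps the denominator positive. *)
Definition decay_rate : R := 8 * t / (1 + (mom_bound K)%:R).
(** 1000 is a round bound for all the numerical factors collected in this section. *)
Definition loss_const : R := 1000 * Q ^+ 4.

Let Q1 : 1 <= Q. Proof. by case: ab. Qed.
Let Q0 : 0 <= Q. Proof. exact: le_trans Q1. Qed.
Let eps2 : 0 <= eps <= 1 / 2.
Proof. by case/andP: eps01 => h1 h2; rewrite h1/=; lra. Qed.
Let V8 : weighted_le (8 * t) p0 V.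
Proof. by apply: nb_le Vp => //; rewrite ler_pM2r//; lra. Qed.
Let V0 : weighted_le 0 p0 V.
Proof. by apply: nb_le Vp => //; rewrite mulr_ge0// ltW. Qed.

Lemma dotRZ_le (om : 'rV[R]_d) l M : (forall i, `|om 0 i| <= M) -> `|dotRZ om l| <= M * (n1 l)%:R.
Proof.
move=> oM; rewrite /dotRZ (le_trans (ler_norm_sum _ _ _))// /n1 natr_sum mulr_sumr.
by apply: ler_sum => i _; rewrite normrM natr_absz intr_norm ler_wpM2r.
Qed.

Lemma cube_le (om : 'rV[R]_d) : cube om -> forall i, `|om 0 i| <= 1.
Proof. by move=> h i; rewrite ler_norml; exact: h. Qed.

Lemma dotRZ0 (om : 'rV[R]_d) : dotRZ om 0 = 0.
Proof. by rewrite /dotRZ big1// => i _; rewrite mxE mulr0. Qed.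

Lemma Jc_le D D' : 1 <= D -> 1 <= D' ->
  Jc Q p0 eps eta gam D D' <= 200 * Q ^+ 4 * (eps / (D * D') + eps / D' ^+ 2 + eta).
Proof.
move=> D1 D1'; case/andP: gam01 => g0 g1; case/andP: eps01 => e0 e1.
case/andP: p0e => q0 q1; case/andP: etae => n0 n1.
have D0 : 0 < D by exact: lt_le_trans D1.
have D0' : 0 < D' by exact: lt_le_trans D1'.
rewrite /Jc /P2c /P1c.
set u := D^-1; set w := D'^-1.
have u0 : 0 <= u by rewrite invr_ge0 ltW.
have w0 : 0 <= w by rewrite invr_ge0 ltW.
have w1 : w <= 1 by rewrite invf_le1.
have -> : 2 * Q / D' * (eta + p0 * ((Q * (8 * Q * eps) + 3 * Q * Q * (8 * Q * eps)) / D + 3 * Q * eta / gam)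
    + (2 * Q + 1) * (Q * (8 * Q * eps) / D')) + 2 * Q * Q / D' ^+ 2 * eps =
  2 * Q * w * eta + p0 * (16 * Q ^+ 3 + 48 * Q ^+ 4) * (eps * u * w)
   + 6 * Q ^+ 2 * w * (p0 / gam) * eta
   + (32 * Q ^+ 4 + 16 * Q ^+ 3 + 2 * Q ^+ 2) * (eps * (w * w)).
  by rewrite /u /w; field; rewrite !gt_eqF.
have -> : eps / (D * D') + eps / D' ^+ 2 + eta = eps * u * w + eps * (w * w) + eta.
  by rewrite /u /w; field; rewrite !gt_eqF.
have q2 : Q <= Q ^+ 4 by rewrite -[leLHS]expr1 ler_weXn2l.
have q3 : Q ^+ 2 <= Q ^+ 4 by rewrite ler_weXn2l.
have q4 : Q ^+ 3 <= Q ^+ 4 by rewrite ler_weXn2l.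
have x0 : 0 <= Q ^+ 4 by rewrite exprn_ge0.
have p1 : p0 <= 1 by have := p0_le_eps gam01 eps2 p0e; lra.
have pg : p0 / gam <= 1 by rewrite ler_pdivrMr// mul1r; nra.
have pg0 : 0 <= p0 / gam by rewrite divr_ge0// ltW.
have a0 : 0 <= eps * u * w by rewrite !mulr_ge0.
have b0 : 0 <= eps * (w * w) by rewrite !mulr_ge0.
have t1 : 2 * Q * w * eta <= 2 * Q ^+ 4 * eta.
  by apply: ler_wpM2r => //; rewrite -mulrA ler_wpM2l//; apply: le_trans q2; rewrite ler_piMr.
have t2 : p0 * (16 * Q ^+ 3 + 48 * Q ^+ 4) * (eps * u * w) <= 64 * Q ^+ 4 * (eps * u * w).
  apply: ler_wpM2r => //; apply: (@le_trans _ _ (1 * (16 * Q ^+ 3 + 48 * Q ^+ 4))); last lra.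
  by rewrite ler_wpM2r// addr_ge0// mulr_ge0// exprn_ge0.
have t3 : 6 * Q ^+ 2 * w * (p0 / gam) * eta <= 6 * Q ^+ 4 * eta.
  have -> : 6 * Q ^+ 2 * w * (p0 / gam) * eta = 6 * (Q ^+ 2 * (w * (p0 / gam))) * eta by ring.
  apply: ler_wpM2r => //; apply: ler_wpM2l => //.
  by apply: le_trans q3; rewrite ler_piMr ?exprn_ge0// mulr_ile1.
have t4 : (32 * Q ^+ 4 + 16 * Q ^+ 3 + 2 * Q ^+ 2) * (eps * (w * w)) <= 50 * Q ^+ 4 * (eps * (w * w)).
  by apply: ler_wpM2r => //; lra.
have y1 : 0 <= Q ^+ 4 * (eps * u * w) by rewrite mulr_ge0.
have y2 : 0 <= Q ^+ 4 * (eps * (w * w)) by rewrite mulr_ge0.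
have y3 : 0 <= Q ^+ 4 * eta by rewrite mulr_ge0.
lra.
Qed.

Section Freq.
Variables (om : 'rV[R]_d) (lam : Idx -> C) (W : Idx -> G -> C).
Hypotheses (omc : cube om) (dio : dioph om) (sol : approx_eigen om lam W).

Let thQ l : `|dotRZ om l| <= Q * ew t l.
Proof.
apply: le_trans (dotRZ_le l (cube_le omc)) _; rewrite mul1r; exact: (ab_n1 ab).
Qed.
Let w2Q l : `|mom_sq l| <= Q * ew t l.
Proof. by rewrite ger0_norm ?ler0z ?sqnormZ_ge0//; exact: (ab_w2 ab). Qed.
Let dio' l : l != 0 -> gam <= Q * ew t l * `|dotRZ om l|.
Proof.
by move=> l0; apply: le_trans (dio l0) _; rewrite ler_wpM2r//; exact: (ab_tau ab).
Qed.
Let z0 : flat 0. Proof. by rewrite /flat mom0. Qed.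
Let zB l m : flat l -> flat m -> flat (l - m).
Proof. by rewrite /flat momB => /eqP -> /eqP ->; rewrite subrr. Qed.

Lemma apost_off x : weighted_le 0 (P2c Q eps eta gam (jap (idx_b delta x)%:~R)) (off (W x)).
Proof.
have [WS We lam1 [r re eqn]] := sol x.
apply: (sum_offW t0 Q1 z0 zB thQ w2Q (dotRZ0 om) (@iz_bet R d K x) (@iz_w2 R d K) zV dio'
  gam01 eps2 p0e etae lam1 (ial0 K x) WS V8 We re eqn (jap_gt0 _)).
exact: (ab_b ab).
Qed.

Lemma apost_gain x (T : G -> bool) D' : 0 < D' ->
  (forall l, T l -> D' <= Q * ew t l * (`|idx_slope x l| + 1)) ->
  weighted_le 0 (Q * P1c Q eps / D') (restr T (off (W x))).
Proof.
move=> D'0 Tg; have [WS We lam1 [r re eqn]] := sol x.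
have := nb_gain t0 Q1 thQ w2Q gam01 eps2 p0e etae lam1 WS V8 We re eqn D'0 Tg.
by apply: nb_le => //; rewrite mulr_ge0// ltW.
Qed.

Lemma apost_J x (T : G -> bool) D' pT : 1 <= D' -> (forall l, T (- l) = T l) ->
  (forall l, T l -> idx_allowed x l) -> (forall l, T l -> l != 0) ->
  (forall l, T l -> D' <= Q * ew t l * (`|idx_slope x l| + 1)) ->
  weighted_le (8 * t) pT (restr T V) -> 0 <= pT ->
  cabs (csum (restr T (fun m => V (- m) * W x m))) <=
  pT * (200 * Q ^+ 4 * (eps / (jap (idx_b delta x)%:~R * D') + eps / D' ^+ 2 + eta)).
Proof.
move=> D1 TN TS Tn0 Tg VT pT0; have [WS We lam1 [r re eqn]] := sol x.
have := J_bound t0 Q1 z0 zB thQ w2Q (dotRZ0 om) (@ibetN R d K x) (@iz_bet R d K x) (@iz_w2 R d K)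
  VN zV dio' gam01 eps2 p0e etae lam1 (ial0 K x) WS V8 We re eqn (jap_gt0 _) (ab_b ab (x := x))
  (lt_le_trans ltr01 D1) TN TS Tn0 Tg VT.
move=> /le_trans; apply; rewrite ler_wpM2l//; apply: Jc_le => //; exact: jap_ge1.
Qed.

(** The estimate [apost_J] on all non-flat allowed modes, with both gains equal to <b>: the odd
    cancellation yields <b>^-2, and the mass of V on these modes, measured with the spare weight,
    yields the exponential. *)
Lemma lam_reduced v b : cabs (lam (inr (v, b))) <=
  loss_const * (p0 * eps) / jap b%:~R ^+ 2 * expR (- decay_rate * enormZ R v) + loss_const * eta.
Proof.
set x : Idx := inr (v, b).
have [WS We lam1 [r re eqn]] := sol x.
case/andP: eps01 => e0 e1; case/andP: p0e => q0 q1; case/andP: etae => n0 n1'.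
pose T l := idx_allowed x l && ~~ flat l.
set B := jap b%:~R; have B1 : 1 <= B by exact: jap_ge1.
have B0 : 0 < B by exact: jap_gt0.
set ek := expR (- decay_rate * enormZ R v).
have ek0 : 0 <= ek by exact: expR_ge0.
have VT : weighted_le (8 * t) (p0 * ek) (restr T V).
  rewrite [p0 * _]mulrC; apply: sle_le (sleZ ek0 Vp) => l.
  rewrite /restr; case: ifPn => [/andP[al zl]|_]; last first.
    rewrite cabs0 mulr0; apply: mulr_ge0; first exact: ek0.
    by apply: mulr_ge0; [exact: ew_ge0|exact: cabs_ge0].
  rewrite mulrA ler_wpM2r ?cabs_ge0// /ek /ew -expRD ler_expR.
  have := ial_size R al zl => h.
  have c0 : 0 < 1 + (mom_bound K)%:R :> R by rewrite ltr_wpDr.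
  have : decay_rate * enormZ R v <= 8 * t * (n1 l)%:R.
    rewrite /decay_rate mulrAC ler_pdivrMr// -[leRHS]mulrA.
    apply: ler_wpM2l; first by rewrite mulr_ge0// ltW.
    by apply: le_trans h _; rewrite [leRHS]mulrC ler_wpM2r// lerDr.
  lra.
have J := apost_J B1 (x := x) (T := T) _ _ _ _ VT (mulr_ge0 q0 ek0).
have JJ : cabs (csum (restr T (fun m => V (- m) * W x m))) <=
  p0 * ek * (200 * Q ^+ 4 * (2 * eps / B ^+ 2 + eta)).
  have -> : 2 * eps / B ^+ 2 + eta = eps / (jap (idx_b delta x)%:~R * B) + eps / B ^+ 2 + eta.
    by rewrite /= -/B; field; rewrite gt_eqF.
  apply: J.
  - by move=> l; rewrite /T ialN /flat momN oppr_eq0.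
  - by move=> l /andP[].
  - by move=> l /andP[_]; apply: contra => /eqP ->.
  - by move=> l /andP[al zl]; exact: (ab_b ab al zl).
have E : lam x * W x 0 = csum (restr T (fun m => V (- m) * W x m)) - r 0.
  have := eqn 0 (ial0 K x); rewrite dotRZ0 (iz_bet R x z0) (iz_w2 R z0) !addr0 sub0r => <-.
  have -> : gconv V (W x) 0 = csum (restr T (fun m => V (- m) * W x m)).
    apply: eq_csum => m; rewrite sub0r /restr /T; case: ifPn => // /nandP[al|].
      by rewrite WS ?mulr0.
    by rewrite negbK => zm; rewrite zV ?mul0r// /flat momN oppr_eq0.
  ring.
have W0 := W0_ge t0 eps2 We.
have H : cabs (lam x) * cabs (W x 0) <= p0 * ek * (200 * Q ^+ 4 * (2 * eps / B ^+ 2 + eta)) + eta.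
  rewrite -cabsM E (le_trans (cabsB _ _))// lerD//.
  by apply: nb_term re; rewrite mulr_ge0// ltW.
have H2 : cabs (lam x) <= 2 * (p0 * ek * (200 * Q ^+ 4 * (2 * eps / B ^+ 2 + eta)) + eta).
  by have := cabs_ge0 (lam x); nra.
apply: le_trans H2 _; rewrite /loss_const.
have -> : 1000 * Q ^+ 4 * (p0 * eps) / B ^+ 2 * ek = 1000 * Q ^+ 4 * (p0 * ek * (eps / B ^+ 2)) by ring.
have -> : 2 * eps / B ^+ 2 = 2 * (eps / B ^+ 2) by ring.
set y := eps / B ^+ 2; have y0 : 0 <= y by rewrite divr_ge0// exprn_ge0// ltW.
have x1 : 1 <= Q ^+ 4 by exact: exprn_ege1.
have pk1 : p0 * ek <= 1.
  have ek1 : ek <= 1 by rewrite -expR0 ler_expR mulNr oppr_le0 mulr_ge0 ?sqrtr_ge0// divr_ge0// mulr_ge0// ltW.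
  have p1 : p0 <= 1 by have := p0_le_eps gam01 eps2 p0e; lra.
  by rewrite mulr_ile1.
have pk0 : 0 <= p0 * ek by rewrite mulr_ge0.
have m1 : p0 * ek * (Q ^+ 4 * eta) <= Q ^+ 4 * eta by rewrite ler_piMl// mulr_ge0// (le_trans _ x1).
have m2 : eta <= Q ^+ 4 * eta by rewrite ler_peMl.
have m3 : 0 <= Q ^+ 4 * (p0 * ek * y).
  by apply: mulr_ge0; [rewrite exprn_ge0|rewrite mulr_ge0].
have -> : 2 * (p0 * ek * (200 * Q ^+ 4 * (2 * y + eta)) + eta) =
  800 * (Q ^+ 4 * (p0 * ek * y)) + 400 * (p0 * ek * (Q ^+ 4 * eta)) + 2 * eta by ring.
lra.
Qed.

End Freq.
Section Pair.
Variables (om om' : 'rV[R]_d) (lam lam' : Idx -> C) (W W' : Idx -> G -> C).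
Hypotheses (omc : cube om) (dio : dioph om) (sol : approx_eigen om lam W).
Hypotheses (omc' : cube om') (dio' : dioph om') (sol' : approx_eigen om' lam' W').
Variables (x x' : Idx).

Let nbW1 (o : 'rV[R]_d) la U y : approx_eigen o la U -> weighted_le 0 (1 + eps) (U y).
Proof.
by move=> s; have [_ We _ _] := s y; have := nbW t0 We (k := 0); rewrite mul0r; apply; lra.
Qed.

Let k0 : 0 <= 8 * t. Proof. by rewrite mulr_ge0// ltW. Qed.

Let nb_delta (o : 'rV[R]_d) la U y : approx_eigen o la U ->
  weighted_le 0 eps (fun l => U y l - (if l == 0 then 1 else 0)).
Proof. by move=> s; have [_ We _ _] := s y; exact: nb_le We. Qed.

Let prod (u v : G -> C) M N : weighted_le 0 M u -> weighted_le 0 N v ->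
  sums_le (fun l => cabs (((u l)^*)%C * v l)) (M * N).
Proof.
move=> uM vN; have M0 := sle_ge0 uM; apply: sle_le (sleZ M0 vN) => l.
rewrite cabsM cabs_conj /ew mul0r expR0 mul1r ler_wpM2r ?cabs_ge0//; exact: nb_term uM.
Qed.

(** Both eigenvectors are within eps <= 1/4 of the unit vector at l = 0. The bound allows division
    in the Wronskian identity. *)
Lemma overlap_ge : 1 / 3 <= cabs (csum (fun l => ((W' x' l)^*)%C * W x l)).
Proof.
case/andP: eps01 => e0 e1.
have n1 := nb_delta x' sol'; have n2 := nbW1 x sol; have n3 := nb_delta x sol.
have -> : csum (fun l => ((W' x' l)^*)%C * W x l) = W x 0 +
  csum (fun l => ((W' x' l - (if l == 0 then 1 else 0))^*)%C * W x l).
  rewrite -[W x 0](csum_single (0 : G)) -csumD; last 2 first.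
  - exists (cabs (W x 0)); apply: sle_le (sle_single (0 : G) (cabs_ge0 (W x 0))) => l.
    by case: eqP; rewrite ?cabs0.
  - by eexists; exact: prod n1 n2.
  apply: eq_csum => l; rewrite cjB; have [->|_] := eqVneq l 0.
    by rewrite (cj_real (1 : R)) mulrBl mul1r addrC subrK.
  by rewrite (cj_real (0 : R)) subr0 add0r.
have h1 := csum_le (prod n1 n2).
have h2 : cabs (W x 0 - 1) <= eps by have := nb_term 0 (lexx 0) n3; rewrite eqxx.
set S := csum _ in h1 *.
have h3 := cabsB (W x 0 + S) (W x 0 - 1 + S).
have h4 := cabsD (W x 0 - 1) S.
have e3 : W x 0 + S - (W x 0 - 1 + S) = 1 by ring.
move: h3; rewrite e3 cabs1; nra.
Qed.

Let tail_r (u r : G -> C) M : weighted_le 0 M u -> M <= 1 + eps -> weighted_le (8 * t) eta r ->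
  cabs (csum (fun l => ((u l)^*)%C * r l)) <= 5 / 4 * eta.
Proof.
move=> uM M1 re; have re0 : weighted_le 0 eta r by exact: nb_le re.
apply: le_trans (csum_le (prod uM re0)) _; apply: ler_wpM2r; first by case/andP: etae.
by case/andP: eps01; lra.
Qed.

(** The diagonals differ by (om - om').l, which vanishes at l = 0; elsewhere both W and W' are of
    size eps, hence the square. The conjugate on lam' makes the case of one frequency a statement
    about reality. *)
Lemma lam_lip h : x = x' -> 0 <= h -> (forall i, `|om 0 i - om' 0 i| <= h) ->
  cabs (lam x - ((lam' x')^*)%C) <= loss_const * (eps ^+ 2 * h + eta).
Proof.
move=> xx h0 oh; case/andP: eps01 => e0 e1; case/andP: etae => n0 n1.
have [WS We _ [r re eqn]] := sol x; have [WS' We' _ [r' re' eqn']] := sol' x'.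
rewrite -xx in WS' eqn' *.
have Wn := nbW1 x sol; have Wn' := nbW1 x' sol'.
have S1 : sums_le (fun l => cabs ((dotRZ om l + idx_slope x l + mom_sq l -
   (dotRZ om' l + idx_slope x l + mom_sq l))%:C%C * (((W' x l)^*)%C * W x l))) (h * Q * eps * eps).
  have Wo := nb_offW t0 We (k := 1); rewrite mul1r in Wo.
  have c0 : 0 <= h * Q * eps by rewrite !mulr_ge0.
  apply: sle_le (sleZ c0 (Wo _)) => [l|]; last lra.
  rewrite cabsM cabs_real cabsM cabs_conj.
  have [->|l0] := eqVneq l 0.
    have -> : off (W x) 0 = 0 by rewrite /off /restr eqxx.
    by rewrite !dotRZ0 subrr normr0 mul0r cabs0 mulr0 mulr0.
  have -> : off (W x) l = W x l by rewrite /off /restr l0.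
  have -> : dotRZ om l + idx_slope x l + mom_sq l - (dotRZ om' l + idx_slope x l + mom_sq l) = dotRZ (om - om') l.
    rewrite opprD addrACA subrr addr0 opprD addrACA subrr addr0 /dotRZ -sumrB.
    by apply: eq_bigr => i _; rewrite !mxE mulrBl.
  have hl : `|dotRZ (om - om') l| <= h * (Q * ew t l).
    apply: le_trans (dotRZ_le (M := h) l _) _; first by move=> i; rewrite !mxE.
    by rewrite ler_wpM2l//; exact: (ab_n1 ab).
  have wl : cabs (W' x l) <= eps.
    by have := nb_term l (lexx 0) (nb_delta x sol'); rewrite (negbTE l0) subr0.
  have -> : h * Q * eps * (ew t l * cabs (W x l)) = h * (Q * ew t l) * (eps * cabs (W x l)) by ring.
  rewrite ler_pM ?mulr_ge0 ?cabs_ge0//; by rewrite ler_wpM2r ?cabs_ge0.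
have wr := wronskian VN WS' V0 Wn (nbW1 x sol') (nb_le (mulr_ge0 (ler0n R 8) (ltW t0)) (lexx _) re)
  (nb_le (mulr_ge0 (ler0n R 8) (ltW t0)) (lexx _) re') eqn eqn' (ex_intro _ _ S1).
have cr : csum (fun l => ((W' x l)^*)%C * gconv V (restr (fun m => ~~ idx_allowed x m) (W x)) l) = 0.
  rewrite -(csum0 R G); apply: eq_csum => l; rewrite /gconv.
  have -> : csum (fun m => V (l - m) * restr (fun m => ~~ idx_allowed x m) (W x) m) = 0.
    rewrite -(csum0 R G); apply: eq_csum => m; rewrite /restr; case: ifPn => [/WS ->|_]; exact: mulr0.
  by rewrite mulr0.
rewrite cr add0r in wr.
have b1 := csum_le S1.
have b2 : cabs (csum (fun l => restr (idx_allowed x) (W x) l * ((r' l)^*)%C)) <= 5 / 4 * eta.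
  have re0 : weighted_le 0 eta (fun l => ((r' l)^*)%C).
    by apply: nb_dom (nb_le k0 (lexx _) re') => l; rewrite cabs_conj.
  have Wr : weighted_le 0 (1 + eps) (fun l => ((restr (idx_allowed x) (W x) l)^*)%C).
    by apply: nb_dom (nb_restr (idx_allowed x) Wn) => l; rewrite cabs_conj.
  have := csum_le (prod Wr re0).
  under eq_csum do rewrite conjcK.
  move=> /le_trans; apply; apply: ler_wpM2r => //; lra.
have b3 := tail_r (nbW1 x sol') (lexx _) re.
have ov := overlap_ge; rewrite -xx in ov.
have H : cabs (lam x - ((lam' x)^*)%C) * (1 / 3) <= h * Q * eps * eps + (5 / 4 * eta + 5 / 4 * eta).
  apply: (@le_trans _ _ (cabs (lam x - ((lam' x)^*)%C) * cabs (csum (fun l => ((W' x l)^*)%C * W x l)))).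
    by rewrite ler_wpM2l ?cabs_ge0.
  rewrite -cabsM wr (le_trans (cabsD _ _))// lerD// (le_trans (cabsB _ _))// lerD//.
rewrite /loss_const; have q1 : 1 <= Q ^+ 4 by exact: exprn_ege1.
have q2 : Q <= Q ^+ 4 by rewrite -[leLHS]expr1 ler_weXn2l.
have y0 : 0 <= eps ^+ 2 * h by rewrite mulr_ge0// exprn_ge0.
have t1 : Q * (eps ^+ 2 * h) <= Q ^+ 4 * (eps ^+ 2 * h) by rewrite ler_wpM2r.
have t2 : eta <= Q ^+ 4 * eta by rewrite ler_peMl.
have t3 : 0 <= Q ^+ 4 * (eps ^+ 2 * h) by rewrite mulr_ge0// exprn_ge0.
have -> : 1000 * Q ^+ 4 * (eps ^+ 2 * h + eta) =
  1000 * (Q ^+ 4 * (eps ^+ 2 * h)) + 1000 * (Q ^+ 4 * eta) by ring.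
have e4 : h * Q * eps * eps = Q * (eps ^+ 2 * h) by ring.
rewrite e4 in H; lra.
Qed.

(** On the reduced modes the two diagonals coincide, so only V acting on the part of W not parallel
    to v(j) contributes. Its entry at l = 0 is treated by the odd cancellation; at the other entries
    the gain 1/<b> of W' multiplies the gain <j>^-mu of W. *)
Lemma lam_diff j : x = inl j -> x' = inr (vgen delta j, bgen delta j) -> om = om' ->
  cabs (lam x - ((lam' x')^*)%C) <= loss_const * Q * (p0 * eps *
    (1 / (jap (bgen delta j)%:~R * japZ R j `^ mu) + 1 / (japZ R j `^ mu) ^+ 2) + eta).
Proof.
set D := jap (bgen delta j)%:~R; set D' := japZ R j `^ mu.
move=> xj xv oo; case/andP: eps01 => e0 e1; case/andP: etae => n0 n1.
case/andP: p0e => q0 q1; case/andP: gam01 => g0 g1.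
have [WS We _ [r re eqn]] := sol x; have [WS' We' _ [r' re' eqn']] := sol' x'.
have Wn := nbW1 x sol; have Wn' := nbW1 x' sol'.
have D1 : 1 <= D by exact: jap_ge1.
have mu0 : 0 <= mu by rewrite /mu; case/andP: delta01 => *; lra.
have o1 : (1 : R) `^ mu = 1 by rewrite powR1.
have D1' : 1 <= D' by rewrite /D' -[leLHS]o1 ge0_ler_powR// ?nnegrE ?jap_ge1// ltW// jap_gt0.
have D0 : 0 < D by exact: lt_le_trans D1.
have D0' : 0 < D' by exact: lt_le_trans D1'.
have dl0 : 0 < delta by case/andP: delta01.
have S'eq l : idx_allowed x' l = (det2 (vgen delta j) (mom l) == 0).
  rewrite xv /= (gen_coprime (vgen_generator dl0 j))/=.
  by case: (eqVneq l 0) => // ->; rewrite mom0 /det2 !mxE !mulr0 subrr eqxx.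
have ibeq l : idx_allowed x' l -> idx_slope x l = idx_slope x' l.
  rewrite S'eq xj xv => /eqP h /=.
  have c : coprimez (vgen delta j 0 0) (vgen delta j 0 1).
    exact: gen_coprime (vgen_generator dl0 j).
  have [n E] := parallel c h; have v0 := sqnormZ_neq0 R (coprime_neq0 c).
  rewrite /bgen E !dotZZr -/(sqnormZ _) !rmorphM/=; field; exact: v0.
have Z l : ((dotRZ om l + idx_slope x l + mom_sq l) - (dotRZ om' l + idx_slope x' l + mom_sq l))%:C%C *
    (((W' x' l)^*)%C * W x l) = 0.
  have [Sl|Sl] := boolP (idx_allowed x' l); last by rewrite WS'// conjc0 mul0r mulr0.
  by rewrite ibeq// oo subrr mul0r.
have re0 : weighted_le 0 eta r by exact: nb_le re.
have re0' : weighted_le 0 eta r' by exact: nb_le re'.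
have eqx l : idx_allowed x' l -> ((dotRZ om l + idx_slope x l + mom_sq l)%:C%C - lam x) * W x l + gconv V (W x) l = r l.
  by move=> _; apply: eqn; rewrite xj.
have wr := wronskian VN WS' V0 Wn Wn' re0 re0' eqx eqn'.
have ddW : summable_c (fun l => ((dotRZ om l + idx_slope x l + mom_sq l) - (dotRZ om' l + idx_slope x' l + mom_sq l))%:C%C *
    (((W' x' l)^*)%C * W x l)) by exists 0; apply: sle0 => // l; rewrite Z cabs0.
have {}wr := wr ddW.
pose T l := ~~ idx_allowed x' l.
have TE l : T l -> D' <= Q * ew t l * (`|idx_slope x l| + 1).
  by rewrite /T S'eq xj; exact: (ab_j ab).
have s1 : csum (fun l => ((dotRZ om l + idx_slope x l + mom_sq l) - (dotRZ om' l + idx_slope x' l + mom_sq l))%:C%C *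
    (((W' x' l)^*)%C * W x l)) = 0 by rewrite -(csum0 R G); exact: eq_csum.
rewrite s1 add0r in wr.
have V8T : weighted_le (8 * t) p0 (restr T V) by exact: nb_restr.
have TN l : T (- l) = T l by rewrite /T ialN.
have Tx l : T l -> idx_allowed x l by rewrite xj.
have Tn0 l : T l -> l != 0 by apply: contraL => /eqP ->; rewrite /T negbK ial0.
have J := apost_J omc dio sol D1' TN Tx Tn0 TE V8T q0.
have Gn := apost_gain omc sol D0' TE.
have To : restr T (off (W x)) =1 restr T (W x).
  by move=> l; rewrite /restr /off /restr; case: ifP => // /Tn0 ->.
have {}Gn : weighted_le 0 (Q * P1c Q eps / D') (restr T (W x)) by apply: nb_dom Gn => l; rewrite To.
have Cn := nb_conv (lexx 0) V0 Gn.
have Off := apost_off omc' dio' sol' x'.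
have D'x : jap (idx_b delta x')%:~R = D :> R by rewrite xv.
have Dx : jap (idx_b delta x)%:~R = D :> R by rewrite xj.
rewrite D'x in Off; rewrite Dx in J.
have b1 : cabs (csum (fun l => ((W' x' l)^*)%C * gconv V (restr T (W x)) l)) <=
   (1 + eps) * (p0 * (200 * Q ^+ 4 * (eps / (D * D') + eps / D' ^+ 2 + eta))) +
   P2c Q eps eta gam D * (p0 * (Q * P1c Q eps / D')).
  have -> : csum (fun l => ((W' x' l)^*)%C * gconv V (restr T (W x)) l) =
     ((W' x' 0)^*)%C * gconv V (restr T (W x)) 0 +
     csum (fun l => ((off (W' x') l)^*)%C * gconv V (restr T (W x)) l).
    rewrite -[X in X + _](csum_single (0 : G)) -csumD; last 2 first.
    - eexists; apply: sle_le (sle_single (0 : G) (cabs_ge0 (((W' x' 0)^*)%C * gconv V (restr T (W x)) 0))) => l.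
      by case: eqP; rewrite ?cabs0.
    - by eexists; exact: prod Off Cn.
    apply: eq_csum => l; have [->|l0] := eqVneq l 0.
      have -> : off (W' x') 0 = 0 by rewrite /off /restr eqxx.
      by rewrite conjc0 mul0r addr0.
    have -> : off (W' x') l = W' x' l by rewrite /off /restr l0.
    by rewrite add0r.
  apply: le_trans (cabsD _ _) _; apply: lerD; last exact: csum_le (prod Off Cn).
  rewrite cabsM cabs_conj; apply: ler_pM; rewrite ?cabs_ge0//.
    exact: nb_term (lexx 0) Wn'.
  apply: le_trans J; rewrite le_eqVlt; apply/orP; left; apply/eqP; congr (cabs _).
  by apply: eq_csum => m; rewrite sub0r /restr; case: ifP; rewrite ?mulr0.
have b2 : cabs (csum (fun l => restr (idx_allowed x') (W x) l * ((r' l)^*)%C)) <= 5 / 4 * eta.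
  have rc : weighted_le 0 eta (fun l => ((r' l)^*)%C).
    by apply: nb_dom re0' => l; rewrite cabs_conj.
  have Wr : weighted_le 0 (1 + eps) (fun l => ((restr (idx_allowed x') (W x) l)^*)%C).
    by apply: nb_dom (nb_restr (idx_allowed x') Wn) => l; rewrite cabs_conj.
  have := csum_le (prod Wr rc).
  under eq_csum do rewrite conjcK.
  move=> /le_trans; apply; apply: ler_wpM2r => //; lra.
have b3 := tail_r Wn' (lexx _) re.
have ov := overlap_ge.
set B1 := (1 + eps) * _ in b1; set B2 := P2c _ _ _ _ _ * _ in b1.
have H : cabs (lam x - ((lam' x')^*)%C) * (1 / 3) <= (B1 + B2) + (5 / 4 * eta + 5 / 4 * eta).
  apply: (@le_trans _ _ (cabs (lam x - ((lam' x')^*)%C) * cabs (csum (fun l => ((W' x' l)^*)%C * W x l)))).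
    by rewrite ler_wpM2l ?cabs_ge0.
  rewrite -cabsM wr (le_trans (cabsD _ _))// lerD// (le_trans (cabsB _ _))// lerD//.
set u := D^-1; set w := D'^-1.
have u0 : 0 <= u by rewrite invr_ge0 ltW.
have w0 : 0 <= w by rewrite invr_ge0 ltW.
have w1 : w <= 1 by rewrite invf_le1.
set y := p0 * eps * (u * w); set z := p0 * eps * (w * w).
have y0 : 0 <= y by rewrite !mulr_ge0.
have zz0 : 0 <= z by rewrite !mulr_ge0.
have q2 : Q ^+ 4 <= Q ^+ 5 by rewrite ler_weXn2l.
have q3 : Q ^+ 3 <= Q ^+ 5 by rewrite ler_weXn2l.
have q5 : 1 <= Q ^+ 5 by exact: exprn_ege1.
have p1 : p0 <= 1 / 4 by have := p0_le_eps gam01 eps2 p0e; lra.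
have pg : p0 / gam <= 1 by rewrite ler_pdivrMr// mul1r; nra.
have pg0 : 0 <= p0 / gam by rewrite divr_ge0// ltW.
have x0 : 0 <= Q ^+ 4 by rewrite exprn_ge0.
have x3 : 0 <= Q ^+ 3 by rewrite exprn_ge0.
have x5 : 0 <= Q ^+ 5 by rewrite exprn_ge0.
have B1le : B1 <= 250 * (Q ^+ 5 * y) + 250 * (Q ^+ 5 * z) + 63 * (Q ^+ 5 * eta).
  have -> : B1 = (1 + eps) * 200 * (Q ^+ 4 * y + Q ^+ 4 * z + p0 * (Q ^+ 4 * eta)).
    by rewrite /B1 /y /z /u /w; field; rewrite !gt_eqF.
  have m1 : Q ^+ 4 * y <= Q ^+ 5 * y by rewrite ler_wpM2r.
  have m2 : Q ^+ 4 * z <= Q ^+ 5 * z by rewrite ler_wpM2r.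
  have m3 : p0 * (Q ^+ 4 * eta) <= 1 / 4 * (Q ^+ 5 * eta).
    by apply: ler_pM => //; rewrite ?mulr_ge0// ler_wpM2r.
  apply: (@le_trans _ _ (250 * (Q ^+ 4 * y + Q ^+ 4 * z + p0 * (Q ^+ 4 * eta)))).
    apply: ler_wpM2r; last lra.
    by rewrite !addr_ge0 ?mulr_ge0.
  have := mulr_ge0 x5 n0; lra.
have B2le : B2 <= 64 * (Q ^+ 5 * y) + 6 * (Q ^+ 5 * eta).
  have q4 : 64 * Q ^+ 4 + 192 * Q ^+ 5 <= 256 * Q ^+ 5 by lra.
  have -> : B2 = (64 * Q ^+ 4 + 192 * Q ^+ 5) * eps * y + 24 * Q ^+ 3 * eps * w * (p0 / gam) * eta.
    by rewrite /B2 /y /P2c /P1c /u /w; field; rewrite !gt_eqF.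
  apply: lerD.
    rewrite mulrA; apply: ler_wpM2r => //.
    apply: (@le_trans _ _ (256 * Q ^+ 5 * (1 / 4))); last lra.
    have q6 : 0 <= 64 * Q ^+ 4 + 192 * Q ^+ 5 by apply: addr_ge0; apply: mulr_ge0.
    by apply: ler_pM.
  rewrite [leRHS]mulrA; apply: ler_wpM2r => //.
  have -> : 24 * Q ^+ 3 * eps * w * (p0 / gam) = 24 * (Q ^+ 3 * eps * (w * (p0 / gam))) by ring.
  have m1 : Q ^+ 3 * eps * (w * (p0 / gam)) <= Q ^+ 3 * eps * 1.
    by rewrite ler_wpM2l ?mulr_ge0// mulr_ile1.
  have m2 : Q ^+ 3 * eps <= Q ^+ 3 * (1 / 4) by rewrite ler_wpM2l.
  lra.
have -> : loss_const * Q * (p0 * eps * (1 / (D * D') + 1 / D' ^+ 2) + eta) =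
  1000 * (Q ^+ 5 * y) + 1000 * (Q ^+ 5 * z) + 1000 * (Q ^+ 5 * eta).
  by rewrite /loss_const /y /z /u /w; field; rewrite !gt_eqF.
have m1 : eta <= Q ^+ 5 * eta by rewrite ler_peMl.
have m2 : 0 <= Q ^+ 5 * y by rewrite mulr_ge0.
have m3 : 0 <= Q ^+ 5 * z by rewrite mulr_ge0.
lra.
Qed.

End Pair.
End Apost.

(** * Operators on H^p *)

Section HpNorm.
Variables (R : realType) (p : R).
Notation J := ('rV[int]_2).
Implicit Types u v : cseq R.

Definition hpw u (j : J) : R := japZ R j `^ (2 * p) * cabs (u j) ^+ 2.
Definition l1w u (j : J) : R := cabs (u j).

Lemma hpw_ge0 u j : 0 <= hpw u j.
Proof. by rewrite mulr_ge0 ?powR_ge0// exprn_ge0// cabs_ge0. Qed.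
Lemma l1w_ge0 u j : 0 <= l1w u j. Proof. exact: cabs_ge0. Qed.

Lemma esum_fin (T : choiceType) (f : T -> R) : (forall x, 0 <= f x) ->
  (\esum_(x in [set: T]) (f x)%:E < +oo)%E <-> exists M, sums_le f M.
Proof.
move=> f0; split => [h|[M /(sleP _ f0) h]]; last exact: le_lt_trans h (ltry _).
exists (tsum f); apply/(sleP _ f0); rewrite /tsum fineK// ge0_fin_numE//.
by apply: esum_ge0 => x _; rewrite lee_fin.
Qed.

Lemma in_HpP u : in_Hp p u <-> (exists L, sums_le (l1w u) L) /\ (exists H, sums_le (hpw u) H).
Proof.
by split=> -[h1 h2]; split; apply/esum_fin => //; try exact: l1w_ge0; exact: hpw_ge0.
Qed.

Lemma Hp_normE u : Hp_norm p u = tsum (l1w u) + Num.sqrt (tsum (hpw u)).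
Proof. by []. Qed.

Lemma Hp_norm_ge0 u : 0 <= Hp_norm p u.
Proof. by rewrite Hp_normE addr_ge0 ?sqrtr_ge0// tsum_ge0// => j; exact: l1w_ge0. Qed.

Lemma in_HpD u v : in_Hp p u -> in_Hp p v -> in_Hp p (fun j => u j + v j).
Proof.
move=> /in_HpP[[L uL] [H uH]] /in_HpP[[L' vL] [H' vH]]; apply/in_HpP; split.
  by exists (L + L'); apply: sle_le (sleD uL vL) => j; exact: cabsD.
exists (2 * (H + H')); apply: sle_le (sleZ (ler0n R 2) (sleD uH vH)) => j.
have -> : 2 * (hpw u j + hpw v j) = japZ R j `^ (2 * p) * (2 * (cabs (u j) ^+ 2 + cabs (v j) ^+ 2)).
  by rewrite /hpw; ring.
apply: ler_wpM2l; first exact: powR_ge0.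
have h1 := cabsD (u j) (v j); have h2 := cabs_ge0 (u j + v j).
have h3 : cabs (u j + v j) ^+ 2 <= (cabs (u j) + cabs (v j)) ^+ 2.
  by rewrite lerXn2r ?nnegrE// (le_trans h2).
by have := sqr_ge0 (cabs (u j) - cabs (v j)); lra.
Qed.

Lemma bounded_by_ext M (A B : cseq R -> cseq R) :
  (forall u, in_Hp p u -> A u = B u) -> bounded_by p M A -> bounded_by p M B.
Proof. by move=> AB h u hu; rewrite -AB//; exact: h. Qed.

Lemma bounded_by_le M N (A : cseq R -> cseq R) : M <= N -> bounded_by p M A -> bounded_by p N A.
Proof.
move=> MN h u hu; have [h1 h2] := h u hu; split => //; apply: le_trans h2 _.
by rewrite ler_wpM2r// Hp_norm_ge0.
Qed.

End HpNorm.

Section CauchySchwarz.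
Variables (R : realType) (T : choiceType).

(** Weighted Cauchy-Schwarz from the pointwise inequality e x <= c e + e x^2 / (4 c), taken at c = N
    / (2 S). For S = 0 this c does not exist, and a large c shows that the sum N vanishes. *)
Lemma csum_CS (a : T -> R[i]) (e x : T -> R) (S H : R) : (forall l, 0 <= e l) ->
  (forall l, cabs (a l) <= e l * x l) -> sums_le e S -> sums_le (fun l => e l * x l ^+ 2) H ->
  cabs (csum a) ^+ 2 <= S * H.
Proof.
move=> e0 ax eS xH; set N := cabs (csum a).
have S0 : 0 <= S by exact: sle_ge0 eS.
have H0 : 0 <= H by exact: sle_ge0 xH.
have N0 : 0 <= N by exact: cabs_ge0.
have key c : 0 < c -> N <= c * S + c^-1 / 4 * H.
  move=> c0; apply: csum_le.
  have c4 : 0 <= c^-1 / 4 by rewrite divr_ge0// invr_ge0 ltW.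
  apply: sle_le (sleD (sleZ (ltW c0) eS) (sleZ c4 xH)) => l.
  apply: le_trans (ax l) _.
  have -> : c * e l + c^-1 / 4 * (e l * x l ^+ 2) = e l * (c + c^-1 / 4 * x l ^+ 2) by ring.
  rewrite ler_wpM2l//.
  have -> : c + c^-1 / 4 * x l ^+ 2 = x l + c * (1 - x l / c / 2) ^+ 2.
    by field; rewrite gt_eqF.
  by rewrite lerDl mulr_ge0 ?(ltW c0)// sqr_ge0.
have [->|Nn] := eqVneq N 0; first by rewrite expr0n mulr_ge0.
have Np : 0 < N by rewrite lt_def Nn.
have [SZ|Sn] := eqVneq S 0.
  have c0 : 0 < (H + 1) / N by rewrite divr_gt0// ltr_wpDl.
  have := key _ c0; rewrite SZ mulr0 add0r invf_div.
  have -> : N / (H + 1) / 4 * H = N * (H / (H + 1) / 4) by field; lra.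
  have : H / (H + 1) <= 1 by rewrite ler_pdivrMr; lra.
  nra.
have Sp : 0 < S by rewrite lt_def Sn.
have c0 : 0 < N / S / 2 by rewrite !divr_gt0.
have := key _ c0.
have -> : N / S / 2 * S + (N / S / 2)^-1 / 4 * H = N / 2 + S * H / N / 2.
  by field; rewrite Nn Sn.
move=> h; have : N / 2 <= S * H / N / 2 by lra.
rewrite ler_pM2r ?invr_gt0// ler_pdivlMr//.
Qed.

End CauchySchwarz.

Section Hop.
Variables (R : realType) (d : nat) (K : 'M[int]_(d, 2)).
Notation G := ('rV[int]_d).
Notation J := ('rV[int]_2).
Notation mom := (momentum K).
Notation C := R[i].
Notation idx_shift := (idx_shift K).

(** The operator on functions of x given by the family at phi = 0: all time modes with the same
    momentum act on the same matrix entry. Only the columns of the full problem are read. *)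
Definition hop (A : opT R d Idx) (u : cseq R) : cseq R :=
  fun j => csum (fun l => A (inl (j - mom l)) l * u (j - mom l)).

(** Pointwise decay, instead of a weighted sum, because polynomial factors in l are then absorbed by
    lowering the rate. *)
Definition exp_bounded s M (A : opT R d Idx) := forall x l, cabs (A (inl x) l) <= M * ew (- s) l.

Lemma bd_exp_bounded al s M A : @bd R d Idx al s M A -> exp_bounded s M A.
Proof. by move=> h x l; exact: bd_term h. Qed.

Lemma exp_bounded_weak s s' k : s' < s -> exists2 c : R, 0 < c & forall M N A B, 0 <= M ->
  (forall x l, cabs (B (inl x) l) <= M * (1 + n1 l)%:R ^+ k * cabs (A (inl x) l)) ->
  exp_bounded s N A -> exp_bounded s' (c * M * N) B.
Proof.
move=> ss; have sd : 0 < s - s' by rewrite subr_gt0.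
have [c [c0 Hc]] := @exp_poly R k _ sd; exists c => // M N A B M0 BA AN x l.
apply: le_trans (BA x l) _.
have AN0 := AN x l; have w0 := ew_ge0 (- s) l; have p0 : 0 <= (1 + n1 l)%:R ^+ k :> R by rewrite exprn_ge0.
have N0 : 0 <= N * ew (- s) l by exact: le_trans (cabs_ge0 _) AN0.
apply: (@le_trans _ _ (M * (c * expR ((s - s') * (n1 l)%:R)) * (N * ew (- s) l))).
  apply: ler_pM => //; rewrite ?mulr_ge0 ?cabs_ge0// ler_wpM2l//; exact: Hc.
have -> : M * (c * expR ((s - s') * (n1 l)%:R)) * (N * ew (- s) l) =
  c * M * N * (expR ((s - s') * (n1 l)%:R) * ew (- s) l) by ring.
have -> : expR ((s - s') * (n1 l)%:R) * ew (- s) l = ew (- s') l :> R.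
  by rewrite /ew -expRD; congr expR; ring.
exact: lexx.
Qed.

Lemma ewN_sle s : 0 < s -> exists2 S : R, 0 < S & sums_le (fun l : G => ew (- s) l) S.
Proof. by move=> s0; have [S [S0 HS]] := @sle_exp R d _ s0; exists S. Qed.

Lemma sqnormZD_le (u v : J) : (sqnormZ (u + v))%:~R <= 2 * (sqnormZ u)%:~R + 2 * (sqnormZ v)%:~R :> R.
Proof.
have h1 := sqnormZD u v; have h2 := sqnormZD u (- v); have h3 := sqnormZ_ge0 (u - v).
have h4 : sqnormZ (- v) = sqnormZ v by rewrite /sqnormZ dotZNr dotZC dotZNr opprK.
rewrite dotZNr h4 in h2.
have h : sqnormZ (u + v) <= 2 * sqnormZ u + 2 * sqnormZ v by rewrite h1; lra.
by rewrite -(ler_int R) rmorphD !rmorphM/= in h.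
Qed.

Lemma enormZ_mom l : enormZ R (mom l) <= (mom_bound K)%:R * (n1 l)%:R.
Proof. by apply: le_trans (enormZ_n1 R _) _; rewrite -natrM ler_nat n1_mom. Qed.

Definition mfac (l : G) : R := 2 * (1 + (mom_bound K)%:R * (n1 l)%:R).

Lemma mfac_ge1 l : 1 <= mfac l.
Proof.
have : 0 <= (mom_bound K)%:R * (n1 l)%:R :> R by rewrite mulr_ge0.
by rewrite /mfac; lra.
Qed.

(** Peetre's inequality for a shift by a momentum. *)
Lemma japZ_shift (j : J) l : japZ R j <= mfac l * japZ R (j - mom l).
Proof.
set k := j - mom l; have J1 : 1 <= japZ R k by exact: jap_ge1.
have B1 := mfac_ge1 l.
rewrite {1}/japZ {1}/jap ge_max; apply/andP; split; first exact: mulr_ege1.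
rewrite ger0_norm ?sqrtr_ge0// -(ler_pXn2r (_ : (0 < 2)%N)) ?nnegrE ?sqrtr_ge0//; last first.
  by rewrite mulr_ge0// (le_trans ler01).
rewrite sqr_enormZ exprMn; have jE : j = k + mom l by rewrite /k subrK.
rewrite {1}jE; apply: le_trans (sqnormZD_le _ _) _.
rewrite -!sqr_enormZ.
have h1 : enormZ R k <= japZ R k by rewrite /japZ /jap le_max [X in _ || (_ <= X)]ger0_norm ?lexx ?orbT ?sqrtr_ge0.
have h2 := enormZ_mom l; set y := _ * _ in h2.
have y0 : 0 <= y by rewrite mulr_ge0.
have e1 : enormZ R k ^+ 2 <= japZ R k ^+ 2 by rewrite lerXn2r ?nnegrE ?sqrtr_ge0// (le_trans ler01).
have e2 : enormZ R (mom l) ^+ 2 <= y ^+ 2 by rewrite lerXn2r ?nnegrE ?sqrtr_ge0.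
have -> : mfac l = 2 * (1 + y) by [].
have j2 : 1 <= japZ R k ^+ 2 by exact: exprn_ege1.
have y2 : 0 <= y ^+ 2 by exact: sqr_ge0.
have y3 : y ^+ 2 * 1 <= y ^+ 2 * japZ R k ^+ 2 by rewrite ler_wpM2l.
have y4 : 0 <= y * japZ R k ^+ 2 by rewrite mulr_ge0// sqr_ge0.
lra.
Qed.

Lemma shift_mom_inj (l : G) : injective (fun j : J => j - mom l).
Proof. by move=> j j' /addIr. Qed.

Section Bounded.
Variable p : R.
Hypothesis p0 : 0 < p.

Section Rate.
Variable s : R.
Hypothesis s0 : 0 < s.

Lemma hop_smb A M u L j : exp_bounded s M A -> sums_le (l1w u) L ->
  summable_c (fun l => A (inl (j - mom l)) l * u (j - mom l)).
Proof.
move=> AM uL; have [S S0 HS] := ewN_sle s0.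
have L0 : 0 <= L by exact: sle_ge0 uL.
have M0 : 0 <= M.
  have := AM 0 0; rewrite ew0 mulr1; apply: le_trans; exact: cabs_ge0.
exists (M * L * S); apply: sle_le (sleZ (mulr_ge0 M0 L0) HS) => l.
rewrite cabsM mulrAC; apply: ler_pM; rewrite ?cabs_ge0//; exact: sle_term uL.
Qed.

Lemma hop_bounded : exists2 c : R, 0 < c & forall A M, exp_bounded s M A -> bounded_by p (c * M) (hop A).
Proof.
have [S S0 HS] := ewN_sle s0.
pose k := (Num.truncn (2 * p)).+1.
have pk : 2 * p <= k%:R by rewrite ltW// truncnS_gt.
have s2 : 0 < s / 2 by rewrite divr_gt0.
have [c [c0 Hc]] := @exp_poly R k _ s2.
have [S2 S20 HS2] := ewN_sle s2.
pose Fk : R := (2 * (1 + (mom_bound K)%:R)) ^+ k * c.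
have Fk0 : 0 <= Fk by rewrite mulr_ge0 ?exprn_ge0 ?mulr_ge0 ?addr_ge0// ltW.
have Fkl l : ew (- s) l * mfac l ^+ k <= Fk * ew (- (s / 2)) l.
  have m1 : mfac l <= 2 * (1 + (mom_bound K)%:R) * (1 + n1 l)%:R.
    rewrite /mfac natrD -mulrA ler_wpM2l// mulrDl mul1r mulrDr mulr1.
    have : 0 <= (mom_bound K)%:R :> R by []. have : 0 <= (n1 l)%:R :> R by []. lra.
  have m2 : mfac l ^+ k <= Fk * expR (s / 2 * (n1 l)%:R).
    apply: (@le_trans _ _ ((2 * (1 + (mom_bound K)%:R) * (1 + n1 l)%:R) ^+ k)).
      rewrite lerXn2r ?nnegrE ?(le_trans ler01 (mfac_ge1 l))// !mulr_ge0// addr_ge0//.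
    rewrite exprMn /Fk -mulrA ler_wpM2l ?exprn_ge0 ?mulr_ge0 ?addr_ge0//; exact: Hc.
  apply: le_trans (ler_wpM2l (ew_ge0 _ _) m2) _.
  have -> : ew (- (s / 2)) l = ew (- s) l * expR (s / 2 * (n1 l)%:R) :> R.
    by rewrite /ew -expRD; congr expR; field.
  by rewrite mulrCA mulrA.
pose q := Num.sqrt (S * (Fk * S2)).
have q0 : 0 <= q by exact: sqrtr_ge0.
exists (S + q + 1); first by rewrite ltr_wpDl// addr_ge0// ltW.
move=> A M AM u /in_HpP[[L uL] [H uH]].
have M0 : 0 <= M.
  have := AM 0 0; rewrite ew0 mulr1; apply: le_trans; exact: cabs_ge0.
have uL' := sle_tsum (l1w_ge0 u) uL; set T1 := tsum _ in uL'.
have uH' := sle_tsum (hpw_ge0 p u) uH; set T2 := tsum _ in uH'.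
have T10 : 0 <= T1 by exact: sle_ge0 uL'.
have T20 : 0 <= T2 by exact: sle_ge0 uH'.
have B1 : sums_le (l1w (hop A u)) (M * S * T1).
  apply: (@sle_csum _ _ _ (fun j l => A (inl (j - mom l)) l * u (j - mom l))).
  apply: (@sle_swap _ _ _ (fun l j => cabs (A (inl (j - mom l)) l * u (j - mom l)))).
  have MT0 : 0 <= M * T1 by exact: mulr_ge0.
  apply: (@sle_fub _ _ _ (fun l j => cabs (A (inl (j - mom l)) l * u (j - mom l))) (fun l => M * T1 * ew (- s) l)).
  - by move=> l j; exact: cabs_ge0.
  - move=> l; have Me0 : 0 <= M * ew (- s) l by rewrite mulr_ge0// ew_ge0.
    have -> : M * T1 * ew (- s) l = M * ew (- s) l * T1 by ring.
    apply: sle_le (sleZ Me0 (sle_inj (@shift_mom_inj l) uL')) => j.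
    by rewrite cabsM ler_wpM2r ?cabs_ge0.
  - have -> : M * S * T1 = M * T1 * S by ring.
    exact: sleZ.
pose f (j : J) (l : G) := ew (- s) l * mfac l ^+ k * hpw p u (j - mom l).
have f0 j l : 0 <= f j l.
  by rewrite /f mulr_ge0 ?hpw_ge0// mulr_ge0 ?ew_ge0// exprn_ge0// (le_trans ler01 (mfac_ge1 l)).
have fS : sums_le (fun z : J * G => f z.1 z.2) (Fk * S2 * T2).
  apply: (@sle_swap _ _ _ (fun l j => f j l)).
  apply: (@sle_fub _ _ _ (fun l j => f j l) (fun l => Fk * T2 * ew (- (s / 2)) l)) => //.
  - move=> l; have w0 : 0 <= ew (- s) l * mfac l ^+ k.
      by rewrite mulr_ge0 ?ew_ge0// exprn_ge0// (le_trans ler01 (mfac_ge1 l)).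
    apply: (@sle_leM _ _ _ (ew (- s) l * mfac l ^+ k * T2)).
      by rewrite [Fk * T2 * _]mulrAC; exact: ler_wpM2r.
    exact: sleZ w0 (sle_inj (@shift_mom_inj l) uH').
  - have -> : Fk * S2 * T2 = Fk * T2 * S2 by ring.
    apply: sleZ => //; exact: mulr_ge0.
have B2 : sums_le (hpw p (hop A u)) (M ^+ 2 * S * (Fk * S2 * T2)).
  have c1 : 0 <= M ^+ 2 * S by rewrite mulr_ge0 ?sqr_ge0// ltW.
  apply: sle_le (sleZ c1 (sle_rows f0 fS)) => j; rewrite /hpw.
  set w := japZ R j `^ (2 * p).
  have w0 : 0 < w by rewrite powR_gt0// jap_gt0.
  have fj : sums_le (f j) (tsum (f j)) by apply: (@sle_tsum _ _ _ (Fk * S2 * T2)) => //; exact: sle_row fS.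
  have w1 : 0 <= w^-1 by rewrite invr_ge0 ltW.
  have CS := @csum_CS R _ (fun l => A (inl (j - mom l)) l * u (j - mom l)) (fun l => ew (- s) l)
    (fun l => M * cabs (u (j - mom l))) S (M ^+ 2 * (w^-1 * tsum (f j))).
  apply: (@le_trans _ _ (w * (S * (M ^+ 2 * (w^-1 * tsum (f j)))))).
    apply: ler_wpM2l; first exact: ltW.
    apply: CS => //.
    + by move=> l; exact: ew_ge0.
    + move=> l; rewrite cabsM mulrCA mulrA ler_wpM2r ?cabs_ge0//.
    + apply: sle_le (sleZ (sqr_ge0 M) (sleZ w1 fj)) => l; rewrite exprMn mulrCA ler_wpM2l ?sqr_ge0//.
      rewrite [leRHS]mulrC ler_pdivlMr// /f /hpw.
      set ww := japZ R (j - mom l) `^ _; set cu := cabs _ ^+ 2.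
      have -> : ew (- s) l * mfac l ^+ k * (ww * cu) = ew (- s) l * cu * (mfac l ^+ k * ww) by ring.
      apply: ler_wpM2l; first by rewrite mulr_ge0 ?ew_ge0// sqr_ge0.
      rewrite /w /ww.
      have jj := japZ_shift j l; have j1 : 1 <= japZ R (j - mom l) by exact: jap_ge1.
      have m1 := mfac_ge1 l; have mf0 := le_trans ler01 m1; have jk0 := le_trans ler01 j1.
      apply: (@le_trans _ _ ((mfac l * japZ R (j - mom l)) `^ (2 * p))).
        apply: ge0_ler_powR; [by rewrite mulr_ge0// ltW|by rewrite nnegrE (le_trans ler01)// jap_ge1| |exact: jj].
        by rewrite nnegrE mulr_ge0.
      rewrite powRM// ler_wpM2r ?powR_ge0//.
      by rewrite -powR_mulrn//; exact: ler_powR.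
  rewrite le_eqVlt; apply/orP; left; apply/eqP; field; exact: lt0r_neq0.
have inA : in_Hp p (hop A u) by apply/in_HpP; split; eexists; [exact: B1|exact: B2].
split => //; rewrite !Hp_normE -/T1 -/T2.
have C1 := tsum_le (l1w_ge0 _) B1; have C2 := tsum_le (hpw_ge0 p _) B2.
have C3 : Num.sqrt (tsum (hpw p (hop A u))) <= M * q * Num.sqrt T2.
  have -> : M * q * Num.sqrt T2 = Num.sqrt (M ^+ 2 * S * (Fk * S2 * T2)).
    have -> : M ^+ 2 * S * (Fk * S2 * T2) = M ^+ 2 * (S * (Fk * S2) * T2) by ring.
    rewrite sqrtrM ?sqr_ge0// sqrtr_sqr ger0_norm// sqrtrM; last first.
      by rewrite mulr_ge0 ?mulr_ge0// ltW.
    by rewrite mulrA.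
  by rewrite ler_wsqrtr.
apply: le_trans (lerD C1 C3) _.
have sT : 0 <= Num.sqrt T2 by exact: sqrtr_ge0.
have z1 : 0 <= M * q * T1 by rewrite !mulr_ge0.
have z2 : 0 <= M * S * Num.sqrt T2 by rewrite !mulr_ge0// ltW.
have z3 : 0 <= M * T1 by rewrite mulr_ge0.
have z4 : 0 <= M * Num.sqrt T2 by rewrite mulr_ge0.
lra.
Qed.

Lemma hop_in A M u : exp_bounded s M A -> in_Hp p u -> in_Hp p (hop A u).
Proof. by move=> AM hu; have [c _ /(_ A M AM u hu) []] := hop_bounded. Qed.

Lemma hop_linear A M : exp_bounded s M A -> linear_op p (hop A).
Proof.
move=> AM a u v /in_HpP[[L uL] _] /in_HpP[[L' vL] _] j; rewrite /hop.
have h1 := hop_smb j AM uL; have h2 := hop_smb j AM vL.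
rewrite -csumZ// -csumD//; last exact: smbZ.
by apply: eq_csum => l; ring.
Qed.

Lemma hopD A B M N u : exp_bounded s M A -> exp_bounded s N B -> in_Hp p u ->
  hop (fun x l => A x l + B x l) u = (fun j => hop A u j + hop B u j).
Proof.
move=> AM BN /in_HpP[[L uL] _]; apply/funext => j; rewrite /hop -csumD; last 2 first.
- exact: hop_smb AM uL.
- exact: hop_smb BN uL.
by apply: eq_csum => l; rewrite mulrDl.
Qed.

Lemma hopZ c A M u : exp_bounded s M A -> in_Hp p u ->
  hop (fun x l => c * A x l) u = (fun j => c * hop A u j).
Proof.
move=> AM /in_HpP[[L uL] _]; apply/funext => j; rewrite /hop -csumZ; last exact: hop_smb AM uL.
by apply: eq_csum => l; rewrite mulrA.
Qed.

Lemma hop_ido (u : cseq R) : hop (ido R (X := Idx)) u = u.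
Proof.
apply/funext => j; rewrite /hop -[RHS](csum_single (0 : G)); apply: eq_csum => l; rewrite /ido.
by have [->|_] := eqVneq l 0; rewrite ?mul0r// mom0 subr0 mul1r.
Qed.

(** Makes [hop] a representation of the algebra, so that inverses and the eigenvector equation pass
    to operators on H^p. The modes are regrouped by their total n = l + m. *)
Lemma hop_comp A B M N u : exp_bounded s M A -> exp_bounded s N B -> in_Hp p u ->
  hop A (hop B u) = hop (cmul idx_shift A B) u.
Proof.
move=> AM BN hu; have /in_HpP[[L uL] _] := hu; have L0 : 0 <= L by exact: sle_ge0 uL.
have M0 : 0 <= M.
  have := AM 0 0; rewrite ew0 mulr1; apply: le_trans; exact: cabs_ge0.
have N0 : 0 <= N.
  have := BN 0 0; rewrite ew0 mulr1; apply: le_trans; exact: cabs_ge0.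
have [S S0 HS] := ewN_sle s0.
apply/funext => j; rewrite /hop.
pose f l m := A (inl (j - mom l)) l * (B (inl (j - mom l - mom m)) m * u (j - mom l - mom m)).
have fs : summable_c (fun z : G * G => f z.1 z.2).
  exists (M * N * L * S * S); have c0 : 0 <= M * N * L by rewrite !mulr_ge0.
  apply: (@sle_fub _ _ _ (fun l m => cabs (f l m)) (fun l => M * N * L * S * ew (- s) l)).
  - by move=> l m; exact: cabs_ge0.
  - move=> l; have c1 : 0 <= M * N * L * ew (- s) l by rewrite mulr_ge0// ew_ge0.
    have -> : M * N * L * S * ew (- s) l = M * N * L * ew (- s) l * S by ring.
    apply: sle_le (sleZ c1 HS) => m; rewrite /f !cabsM.
    have -> : M * N * L * ew (- s) l * ew (- s) m = M * ew (- s) l * (N * ew (- s) m * L) by ring.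
    apply: ler_pM; rewrite ?mulr_ge0 ?cabs_ge0//; apply: ler_pM; rewrite ?cabs_ge0//; exact: sle_term uL.
  - apply: sleZ => //; by rewrite mulr_ge0// ltW.
have E1 l : A (inl (j - mom l)) l * csum (fun m => B (inl (j - mom l - mom m)) m * u (j - mom l - mom m)) =
   csum (f l) by rewrite /f csumZ//; exact: hop_smb BN uL.
rewrite (eq_csum E1) csum_swap//.
pose g n m := f (n - m) m.
have E2 m : csum (f^~ m) = csum (fun n => g n m).
  by rewrite (csum_bij (f^~ m) (shift_bij m)).
rewrite (eq_csum E2).
have gs : summable_c (fun z : G * G => g z.1 z.2).
  have [Z HZ] := fs; exists Z.
  have ij : injective (fun z : G * G => (z.1 - z.2, z.2)).
    by move=> [a b] [a' b'] /= [h bb]; rewrite -bb in h *; rewrite (addIr _ h).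
  exact: (sle_inj ij HZ).
rewrite -csum_swap//; apply: eq_csum => n; rewrite /cmul -csumZr; last first.
  exists (M * N * S); have c0 : 0 <= M * N by rewrite mulr_ge0.
  apply: sle_le (sleZ c0 HS) => m; rewrite cabsM -mulrA; apply: ler_pM; rewrite ?cabs_ge0//.
  apply: le_trans (AM _ _) _; rewrite ler_piMr//.
  by rewrite /ew -expR0 ler_expR mulNr oppr_le0 mulr_ge0// ltW.
apply: eq_csum => m; rewrite /g /f /=; have -> : j - mom (n - m) - mom m = j - mom n.
  by rewrite momB -addrA -opprD subrK.
have -> : j - mom (n - m) = j - mom n + mom m by rewrite momB opprB addrA addrAC.
by rewrite mulrA.
Qed.

End Rate.

(* E(x + l)/(1 + E(x)) grows polynomially in l, so conjugating A by the Laplacian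
   costs an arbitrarily small part of the exponential decay. *)
Lemma hop_domain s A M u : 0 < s -> exp_bounded s M A -> in_domain p u -> in_domain p (hop A u).
Proof.
move=> s0 AM [hu hE]; split; first exact: (hop_in s0 AM hu).
pose e (j : J) : R := (sqnormZ j)%:~R.
have e0 j : 0 <= e j by rewrite ler0z sqnormZ_ge0.
pose A' : opT R d Idx := fun x l => if x is inl k then ((e (k + mom l)) / (1 + e k))%:C%C * A x l else 0.
pose w : cseq R := fun j => u j + neg_laplacian u j.
have hw : in_Hp p w by exact: in_HpD.
have s2 : 0 < s / 2 by rewrite divr_gt0.
have ss : s / 2 < s by rewrite ltr_pdivrMr// mulr2n mulrDr mulr1 ltrDr.
have B0 : 0 <= 2 * (1 + (mom_bound K)%:R ^+ 2) :> R by rewrite mulr_ge0// addr_ge0// exprn_ge0.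
have AA' x l : cabs (A' (inl x) l) <= 2 * (1 + (mom_bound K)%:R ^+ 2) * (1 + n1 l)%:R ^+ 2 * cabs (A (inl x) l).
  have d0 : 0 < 1 + e x by rewrite ltr_wpDr.
  rewrite /A' cabsM cabs_real ler_wpM2r ?cabs_ge0// ger0_norm ?divr_ge0// ?(ltW d0)//.
  rewrite ler_pdivrMr//; apply: le_trans (sqnormZD_le _ _) _.
  rewrite -/(e x) -(sqr_enormZ R (mom l)).
  have h2 := enormZ_mom l.
  have e2 : enormZ R (mom l) ^+ 2 <= ((mom_bound K)%:R * (n1 l)%:R) ^+ 2.
    by rewrite lerXn2r ?nnegrE ?sqrtr_ge0// mulr_ge0.
  rewrite exprMn in e2; set c := (mom_bound K)%:R ^+ 2 in e2 *; have c0 : 0 <= c by exact: sqr_ge0.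
  set n : R := (n1 l)%:R in e2 *; have nn : 0 <= n by [].
  have -> : (1 + n1 l)%:R = 1 + n :> R by rewrite natrD.
  have ex := e0 x; set E := e x in ex *.
  have k1 : 0 <= (1 + n) ^+ 2 - 1 by have := sqr_ge0 n; rewrite sqrrD; lra.
  have k2 : 0 <= (1 + n) ^+ 2 - n ^+ 2 by rewrite sqrrD; lra.
  have k3 := mulr_ge0 c0 k2; have k4 := mulr_ge0 ex k1.
  have k5 : 0 <= c * (1 + n) ^+ 2 * E by rewrite mulr_ge0// mulr_ge0// sqr_ge0.
  have k6 := sqr_ge0 (1 + n).
  lra.
have [c c0 Hc] := exp_bounded_weak 2 ss.
have -> : neg_laplacian (hop A u) = hop A' w; last exact: (hop_in s2 (Hc _ _ _ _ B0 AA' AM) hw).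
have /in_HpP[[L uL] _] := hu; apply/funext => j; rewrite /neg_laplacian /hop -csumZ; last exact: (hop_smb s0 j AM uL).
apply: eq_csum => l; rewrite /A' /w /neg_laplacian subrK.
set k := j - mom l; have d0 : 1 + e k != 0 by rewrite gt_eqF// ltr_wpDr.
have eC (i : J) : (sqnormZ i)%:~R = (e i)%:C%C :> C by rewrite /e rmorph_int.
rewrite !eC.
have -> : u k + (e k)%:C%C * u k = (1 + e k)%:C%C * u k by rewrite rmorphD/= mulrDl mul1r.
have -> : (e j / (1 + e k))%:C%C * A (inl k) l * ((1 + e k)%:C%C * u k) =
  (e j / (1 + e k) * (1 + e k))%:C%C * (A (inl k) l * u k) by rewrite rmorphM/=; ring.
by rewrite mulfVK.
Qed.

End Bounded.
End Hop.

(** * Lebesgue outer measure and small divisors *)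

Section OuterMeasure.
Variables (R : realType) (d : nat).
Implicit Types (A : set 'rV[R]_d) (M : R).

Definition vol (a b : 'rV[R]_d) : R := \prod_i (b 0 i - a 0 i).

Lemma vol_ge0 (a b : 'rV[R]_d) : (forall i, a 0 i <= b 0 i) -> 0 <= vol a b.
Proof. by move=> h; apply: prodr_ge0 => i _; rewrite subr_ge0. Qed.

Definition outer_le A M : Prop := (lebesgue_outer A <= M%:E)%E.

Hypothesis hd : (0 < d)%N.

Lemma vol_same (a : 'rV[R]_d) : vol a a = 0.
Proof. by rewrite /vol (bigD1 (Ordinal hd))//= subrr mul0r. Qed.

(** Any countable index type may be used: natural numbers that code nothing receive the degenerate
    box at 0, of volume zero because d > 0. *)
Lemma outer_cover (T : countType) (a b : T -> 'rV[R]_d) A M :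
  (forall x i, a x 0 i <= b x 0 i) -> A `<=` \bigcup_x box (a x) (b x) ->
  sums_le (fun x => vol (a x) (b x)) M -> outer_le A M.
Proof.
move=> ab AU sM.
pose a' n := if @choice.pickle_inv T n is Some x then a x else 0.
pose b' n := if @choice.pickle_inv T n is Some x then b x else 0.
have v0 n : 0 <= vol (a' n) (b' n).
  by apply: vol_ge0 => i; rewrite /a' /b'; case: choice.pickle_inv => // *; rewrite mxE.
apply: (@le_trans _ _ (\sum_(0 <= n <oo) (vol (a' n) (b' n))%:E)%E).
  apply: ereal_inf_lbound; exists a', b'; split => //.
    by move=> n i; rewrite /a' /b'; case: choice.pickle_inv => // *; rewrite mxE.
  move=> om /AU[x _ xb]; exists (choice.pickle x) => //.
  by rewrite /a' /b' choice.pickleK_inv.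
rewrite nneseries_esumT; last by move=> n; rewrite lee_fin.
apply/sleP => //.
move=> s us; apply: le_trans (sM _ (pmap_uniq (@choice.pickle_invK T) us)).
elim: s {us} => [|n s ih]; first by rewrite !big_nil.
rewrite big_cons /= /a' /b'; case: (@choice.pickle_inv T n) => [x|] /=; last by rewrite vol_same add0r.
by rewrite big_cons lerD2l.
Qed.

Lemma outer_ltE A M : (lebesgue_outer A < M%:E)%E ->
  exists a b : nat -> 'rV[R]_d, [/\ forall n i, a n 0 i <= b n 0 i,
    A `<=` \bigcup_n box (a n) (b n) & exists2 M', M' < M & sums_le (fun n => vol (a n) (b n)) M'].
Proof.
move=> /ereal_inf_lt [_ [a [b [ab AU ->]]] H]; exists a, b; split => //.
have v0 n : 0 <= vol (a n) (b n) by exact: vol_ge0.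
have n0 : (0 <= \sum_(0 <= n <oo) (vol (a n) (b n))%:E)%E.
  by apply: nneseries_ge0 => n _ _; rewrite lee_fin.
have fE : (\sum_(0 <= n <oo) (vol (a n) (b n))%:E)%E \is a fin_num.
  by rewrite ge0_fin_numE// (lt_trans H)// ltry.
exists (fine (\sum_(0 <= n <oo) (vol (a n) (b n))%:E)%E); first by rewrite -lte_fin fineK.
apply/sleP => //; rewrite -nneseries_esumT ?fineK//.
Qed.

Lemma outer_bigcup (T : countType) (A : T -> set 'rV[R]_d) (m : T -> R) M :
  (forall x, outer_le (A x) (m x)) -> sums_le m M -> outer_le (\bigcup_x A x) M.
Proof.
move=> Am mM; apply/lee_addgt0Pr => e e0; rewrite -EFinD.
have c2 x : (lebesgue_outer (A x) < (m x + e / 2 * 2 ^- (choice.pickle x))%:E)%E.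
  apply: le_lt_trans (Am x) _; rewrite lte_fin ltrDl mulr_gt0// ?invr_gt0 ?exprn_gt0//.
  by rewrite divr_gt0.
have /choice[a /choice[b H]] : forall x, exists a : nat -> 'rV[R]_d, exists b : nat -> 'rV[R]_d,
    [/\ forall n i, a n 0 i <= b n 0 i, A x `<=` \bigcup_n box (a n) (b n) &
     sums_le (fun n => vol (a n) (b n)) (m x + e / 2 * 2 ^- (choice.pickle x))].
  move=> x; have [a [b [ab AU [M' M'm sM]]]] := outer_ltE (c2 x).
  by exists a, b; split => //; apply: sle_leM sM; exact: ltW.
apply: (@outer_cover (T * nat)%type (fun p => a p.1 p.2) (fun p => b p.1 p.2)).
- by move=> [x n] i; case: (H x) => ab _ _; exact: ab.
- move=> om [x _ Ax]; case: (H x) => _ AU _; have [n _ weighted_le] := AU _ Ax.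
  by exists (x, n).
- apply: (@sle_fub _ _ _ (fun x n => vol (a x n) (b x n)) (fun x => m x + e / 2 * 2 ^- (choice.pickle x))).
  + by move=> x n; case: (H x) => ab _ _; exact: vol_ge0.
  + by move=> x; case: (H x).
  + apply: sleD mM _; have -> : e = e / 2 * 2 by field.
    have e2 : 0 <= e / 2 by rewrite divr_ge0// ltW.
    have -> : e / 2 * 2 / 2 = e / 2 by field.
    apply: (sleZ e2); exact: (sle_inj (pcan_inj (@choice.pickleK T)) (@sle_half R)).
Qed.

Lemma outer_sub A B M : A `<=` B -> outer_le B M -> outer_le A M.
Proof.
move=> AB; apply: le_trans; apply: le_ereal_inf => _ [a [b [ab BU ->]]].
by exists a, b; split => //; exact: subset_trans BU.
Qed.

Lemma outer_leW A M N : M <= N -> outer_le A M -> outer_le A N.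
Proof. by move=> MN /le_trans; apply; rewrite lee_fin. Qed.

Lemma outer_fin (T : finType) (a b : T -> 'rV[R]_d) A :
  (forall x i, a x 0 i <= b x 0 i) -> A `<=` \bigcup_x box (a x) (b x) ->
  outer_le A (\sum_x vol (a x) (b x)).
Proof.
move=> ab AU; have v0 x := vol_ge0 (ab x); apply: outer_cover ab AU _ => s us.
by rewrite big_uniq//= [leRHS](bigID (mem s))/= lerDl sumr_ge0.
Qed.

Lemma outer_box (a b : 'rV[R]_d) : (forall i, a 0 i <= b 0 i) -> outer_le (box a b) (vol a b).
Proof.
move=> ab; have := @outer_fin unit (fun=> a) (fun=> b) (box a b) (fun=> ab).
rewrite (big_pred1 tt) => [|[]//]; apply.
by move=> x; exists tt.
Qed.

Lemma outer_set0 : outer_le set0 0.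
Proof. by have := @outer_box 0 0 (fun=> lexx _); rewrite vol_same; apply: outer_sub. Qed.

Lemma lebesgue_outer_ge0 A : (0 <= lebesgue_outer A)%E.
Proof.
apply: le_ereal_inf_tmp => _ [a [b [ab _ ->]]]; apply: nneseries_ge0 => n _ _.
by rewrite lee_fin vol_ge0.
Qed.

Lemma outerU A B M N : outer_le A M -> outer_le B N -> outer_le (A `|` B) (M + N).
Proof.
move=> AM BN; pose F (c : bool) := if c then A else B; pose m (c : bool) := if c then M else N.
apply: (@outer_sub _ (\bigcup_c F c)).
  by move=> x [Ax|Bx]; [exists true|exists false].
have M0 : 0 <= M by rewrite -lee_fin (le_trans (lebesgue_outer_ge0 A)).
have N0 : 0 <= N by rewrite -lee_fin (le_trans (lebesgue_outer_ge0 B)).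
apply: (@outer_bigcup bool F m); first by case.
move=> s us; rewrite big_uniq//=; apply: (@le_trans _ _ (\sum_c m c)).
  by rewrite [leRHS](bigID (mem s))/= lerDl sumr_ge0// => -[].
by rewrite big_bool.
Qed.

Lemma outer_cube : outer_le (@cube R d) (2 ^+ d).
Proof.
have -> : 2 ^+ d = vol (const_mx (-1)) (const_mx 1).
  rewrite /vol (eq_bigr (fun=> 2)); last by move=> i _; rewrite !mxE opprK.
  by rewrite prodr_const card_ord.
apply: outer_sub (outer_box _) => [x xc i|i]; last by rewrite !mxE; lra.
by rewrite !mxE; exact: xc.
Qed.

Let mu0 : lebesgue_outer (set0 : set 'rV[R]_d) = 0%E.
Proof. by apply/eqP; rewrite eq_le lebesgue_outer_ge0 andbT; exact: outer_set0. Qed.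

Let mule : {homo (@lebesgue_outer R d) : A B / A `<=` B >-> (A <= B)%E}.
Proof.
move=> A B AB; apply: le_ereal_inf => _ [a [b [ab BU ->]]].
by exists a, b; split => //; exact: subset_trans BU.
Qed.

Let musig : sigma_subadditive (@lebesgue_outer R d).
Proof.
move=> F; have [fE|] := boolP ((\sum_(i <oo) lebesgue_outer (F i))%E \is a fin_num); last first.
  rewrite ge0_fin_numE; last by apply: nneseries_ge0 => *; exact: lebesgue_outer_ge0.
  by rewrite -leNgt leye_eq => /eqP ->; rewrite leey.
have Fi n : lebesgue_outer (F n) \is a fin_num.
  rewrite ge0_fin_numE ?lebesgue_outer_ge0// ltNge leye_eq; apply/eqP => Fn.
  have := @nneseries_pinfty R (fun i => lebesgue_outer (F i)) xpredT n
    (fun i _ => lebesgue_outer_ge0 (F i)) isT Fn.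
  by move=> h; rewrite h in fE.
rewrite -(fineK fE); apply: (@outer_bigcup nat F (fun n => fine (lebesgue_outer (F n)))).
  by move=> n; rewrite /outer_le fineK.
apply/sleP; first by move=> n; rewrite fine_ge0// lebesgue_outer_ge0.
rewrite (eq_esum (fun n _ => fineK (Fi n))) -nneseries_esumT ?fineK//.
by move=> n; exact: lebesgue_outer_ge0.
Qed.

(** Packed as an outer measure so that Caratheodory's theorem supplies the sigma-algebra. *)
Definition leb_outer : {outer_measure set 'rV[R]_d -> \bar R} :=
  HB.pack (@lebesgue_outer R d) (isOuterMeasure.Build R _ _ mu0 (@lebesgue_outer_ge0) mule musig).

Definition half (i : 'I_d) (c : R) : set 'rV[R]_d := [set x | x 0 i <= c].

(** The hyperplane cuts every box of a cover into two boxes whose volumes add up exactly ([vE]);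
    [cl] clamps the cut to the box when the hyperplane misses it. *)
Lemma half_measurable i c : lebesgue_measurable (half i c).
Proof.
apply: (@le_caratheodory_measurable _ _ leb_outer) => X /=.
have [fX|] := boolP (lebesgue_outer X \is a fin_num); last first.
  by rewrite ge0_fin_numE ?lebesgue_outer_ge0// -leNgt leye_eq => /eqP ->; rewrite leey.
rewrite -(fineK fX); apply/lee_addgt0Pr => e e0.
have XM : (lebesgue_outer X < (fine (lebesgue_outer X) + e)%:E)%E.
  by rewrite EFinD fineK// lteDl.
have [a [b [ab AU [M' M'm sM]]]] := outer_ltE XM.
apply: (@le_trans _ _ M'%:E); last by rewrite -EFinD lee_fin ltW.
pose cl n : R := Num.max (a n 0 i) (Num.min c (b n 0 i)).
pose b1 n : 'rV[R]_d := \row_k (if k == i then cl n else b n 0 k).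
pose a2 n : 'rV[R]_d := \row_k (if k == i then cl n else a n 0 k).
have cl1 n : a n 0 i <= cl n by rewrite /cl le_max lexx.
have cl2 n : cl n <= b n 0 i by rewrite /cl ge_max ab ge_min lexx orbT.
have ab1 n k : a n 0 k <= b1 n 0 k by rewrite mxE; case: eqP => [->|_].
have ab2 n k : a2 n 0 k <= b n 0 k by rewrite mxE; case: eqP => [->|_].
have vE n : vol (a n) (b1 n) + vol (a2 n) (b n) = vol (a n) (b n).
  rewrite /vol (bigD1 i)//= [X in _ + X](bigD1 i)//= [RHS](bigD1 i)//=.
  have -> : \prod_(k | k != i) (b1 n 0 k - a n 0 k) = \prod_(k | k != i) (b n 0 k - a n 0 k).
    by apply: eq_bigr => k /negbTE ki; rewrite mxE ki.
  have -> : \prod_(k | k != i) (b n 0 k - a2 n 0 k) = \prod_(k | k != i) (b n 0 k - a n 0 k).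
    by apply: eq_bigr => k /negbTE ki; rewrite mxE ki.
  by rewrite !mxE eqxx -mulrDl addrC -addrA; congr (_ * _); ring.
have s1 : sums_le (fun n => vol (a n) (b1 n)) (tsum (fun n => vol (a n) (b1 n))).
  apply: (@sle_tsum _ _ _ M'); first by move=> n; exact: vol_ge0.
  by apply: sle_le sM => n; rewrite -vE lerDl vol_ge0.
have s2 : sums_le (fun n => vol (a2 n) (b n)) (tsum (fun n => vol (a2 n) (b n))).
  apply: (@sle_tsum _ _ _ M'); first by move=> n; exact: vol_ge0.
  by apply: sle_le sM => n; rewrite -vE lerDr vol_ge0.
have ts : tsum (fun n => vol (a n) (b1 n)) + tsum (fun n => vol (a2 n) (b n)) <= M'.
  rewrite -(tsumD _ _ s1 s2); try by move=> n; exact: vol_ge0.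
  apply: tsum_le; first by move=> n; rewrite addr_ge0// vol_ge0.
  by apply: sle_le sM => n; rewrite vE.
apply: (@le_trans _ _ (tsum (fun n => vol (a n) (b1 n)) + tsum (fun n => vol (a2 n) (b n)))%:E); last by rewrite lee_fin.
rewrite EFinD; apply: leeD.
- apply: (outer_cover ab1 _ s1) => x [Xx xc]; have [n _ weighted_le] := AU _ Xx.
  exists n => // k; rewrite mxE; case: eqP => [->|_]; last exact: weighted_le.
  have /andP[h1 h2] := weighted_le i; rewrite h1 /cl le_max le_min h2 xc orbT//.
- apply: (outer_cover ab2 _ s2) => x [Xx xc]; have [n _ weighted_le] := AU _ Xx.
  exists n => // k; rewrite mxE; case: eqP => [->|_]; last exact: weighted_le.
  have /andP[h1 h2] := weighted_le i; rewrite h2 andbT /cl ge_max h1/= ge_min.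
  by move: xc => /negP; rewrite -ltNge => /ltW ->.
Qed.

Lemma leb_measurableC A : lebesgue_measurable A -> lebesgue_measurable (~` A).
Proof. exact: (@caratheodory_measurable_setC _ _ leb_outer). Qed.

Lemma leb_measurable_bigcup (F : nat -> set 'rV[R]_d) :
  (forall n, lebesgue_measurable (F n)) -> lebesgue_measurable (\bigcup_n F n).
Proof. exact: (@caratheodory_measurable_bigcup _ _ leb_outer). Qed.

Lemma leb_measurable_finI (T : Type) (s : seq T) (F : T -> set 'rV[R]_d) :
  (forall i, lebesgue_measurable (F i)) ->
  lebesgue_measurable [set x | forall i, List.In i s -> F i x].
Proof.
move=> mF; elim: s => [|i s ih].
  have -> : [set x | forall i, List.In i [::] -> F i x] = ~` set0.
    by rewrite setC0; apply/seteqP; split => // x _ i [].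
  apply: leb_measurableC; exact: (@caratheodory_measurable_set0 _ _ leb_outer).
have -> : [set x | forall j, List.In j (i :: s) -> F j x] = F i `&` [set x | forall i, List.In i s -> F i x].
  apply/seteqP; split => [x h|x [h1 h2] j [<-|js]]//=; last exact: h2.
  by split; [apply: h; left|move=> j js; apply: h; right].
exact: (@caratheodory_measurable_setI _ _ leb_outer _ _ (mF i) ih).
Qed.

Definition obox (a b : 'rV[R]_d) : set 'rV[R]_d := [set x | forall i, a 0 i < x 0 i < b 0 i].

Lemma lt_measurable i c : lebesgue_measurable [set x : 'rV[R]_d | x 0 i < c].
Proof.
have -> : [set x : 'rV[R]_d | x 0 i < c] = \bigcup_n half i (c - n.+1%:R^-1).
  apply/seteqP; split => [x /= xc|x [n _]]; last first.
    by rewrite /half/= => /le_lt_trans; apply; rewrite gtrBl invr_gt0.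
  have c0 : 0 < c - x 0 i by rewrite subr_gt0.
  exists (Num.truncn (c - x 0 i)^-1) => //=; rewrite /half/= lerBrDr -lerBrDl.
  rewrite invf_ple ?posrE//; apply/ltW; apply: truncnS_gt.
apply: leb_measurable_bigcup => n; exact: half_measurable.
Qed.

Lemma obox_measurable a b : lebesgue_measurable (obox a b).
Proof.
have -> : obox a b = [set x | forall i, List.In i (enum 'I_d) ->
    (~` half i (a 0 i) `&` [set x : 'rV[R]_d | x 0 i < b 0 i]) x].
  apply/seteqP; split => x /= h i.
    by move=> _; have /andP[h1 h2] := h i; split=> //; apply/negP; rewrite -ltNge.
  have [|/negP h1 h2] := h i; last by rewrite h2 andbT ltNge.
  have : i \in enum 'I_d by rewrite mem_enum.
  elim: (enum _) => [//|k s ih]; rewrite inE => /orP[/eqP->|/ih]; first by left.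
  by right.
apply: leb_measurable_finI => i; apply: (@caratheodory_measurable_setI _ _ leb_outer).
  exact/leb_measurableC/half_measurable.
exact: lt_measurable.
Qed.

Lemma cube_measurable : lebesgue_measurable (@cube R d).
Proof.
have -> : @cube R d = [set x | forall i, List.In i (enum 'I_d) ->
    (~` [set x : 'rV[R]_d | x 0 i < -1] `&` half i 1) x].
  apply/seteqP; split => x /= h i.
    by move=> _; have /andP[h1 h2] := h i; split=> //=; apply/negP; rewrite -leNgt.
  have [|/negP h1 h2] := h i; last by rewrite [_ <= 1]h2 andbT leNgt.
  have : i \in enum 'I_d by rewrite mem_enum.
  elim: (enum _) => [//|k s ih]; rewrite inE => /orP[/eqP->|/ih]; first by left.
  by right.
apply: leb_measurable_finI => i; apply: (@caratheodory_measurable_setI _ _ leb_outer).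
  exact/leb_measurableC/lt_measurable.
exact: half_measurable.
Qed.

End OuterMeasure.

(** * Measure of small divisor strips *)

Section Strips.
Variables (R : realType) (d : nat).
Hypothesis hd : (0 < d)%N.

Lemma digit (q : nat) (s y : R) : 0 < s -> 0 <= y <= s * q.+1%:R ->
  exists n : 'I_q.+1, s * n%:R <= y <= s * n.+1%:R.
Proof.
move=> s0 /andP[y0 yq]; pose m := Num.truncn (y / s).
have ys0 : 0 <= y / s by rewrite divr_ge0// ltW.
have /andP[m1 m2] := truncn_itv ys0; rewrite -/m in m1 m2.
have [mq|mq] := leqP m q.
  exists (Ordinal (mq : (m < q.+1)%N)) => /=.
  by rewrite -ler_pdivlMl// mulrC m1/= -ler_pdivrMl// mulrC ltW.
exists ord_max => /=; rewrite yq andbT.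
have : q%:R <= m%:R :> R by rewrite ler_nat ltnW.
by move=> /le_trans/(_ m1); rewrite ler_pdivlMr// mulrC.
Qed.

(** Takes the place of Fubini and asks no measurability: the other coordinates are cut into cells
    shorter than dl, over each of which S lies in an interval of length 2 w. *)
Lemma thin_outer (S : set 'rV[R]_d) (i : 'I_d) (w dl : R) : 0 < w -> 0 < dl -> S `<=` @cube R d ->
  (forall om om', S om -> S om' -> (forall k, k != i -> `|om 0 k - om' 0 k| <= dl) ->
     `|om 0 i - om' 0 i| <= w) ->
  outer_le S (2 ^+ d * w).
Proof.
move=> w0 dl0 Sc thin; pose q := Num.truncn (2 / dl); pose s : R := 2 / q.+1%:R.
have q0 : 0 < q.+1%:R :> R by rewrite ltr0n.
have s0 : 0 < s by rewrite divr_gt0.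
have sd : s <= dl.
  rewrite /s ler_pdivrMr// mulrC -ler_pdivrMr//.
  by rewrite ltW// truncnS_gt.
pose I := {ffun 'I_d -> 'I_q.+1}.
pose col (c : I) := [set om | S om /\ forall k, k != i -> -1 + s * (c k)%:R <= om 0 k <= -1 + s * (c k).+1%:R].
(* A point of S over the cell is the centre of its column; over an empty cell the value 0 is
   harmless. *)
pose pt c := (xget 0 (col c)) 0 i.
(* The column is cut into q + 1 pieces as well, so that the boxes are indexed by all functions from
   coordinates to digits and their number is (q + 1)^d. *)
pose z : R := 2 * w / q.+1%:R.
have z0 : 0 < z by rewrite divr_gt0// mulr_gt0.
pose a c : 'rV[R]_d := \row_k (if k == i then pt c - w + z * (c i)%:R else -1 + s * (c k)%:R).
pose b c : 'rV[R]_d := \row_k (if k == i then pt c - w + z * (c i).+1%:R else -1 + s * (c k).+1%:R).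
have ab c k : a c 0 k <= b c 0 k.
  by rewrite !mxE; case: ifP => _; rewrite lerD2l ler_wpM2l ?ler_nat// ltW.
have vE c : vol (a c) (b c) = z * s ^+ d.-1.
  rewrite /vol (bigD1 i)//= !mxE eqxx; congr (_ * _).
    by rewrite -natr1; ring.
  rewrite (eq_bigr (fun=> s)); last by move=> k /negbTE ki; rewrite !mxE ki -natr1; ring.
  by rewrite prodr_const cardC1 card_ord.
have -> : 2 ^+ d * w = \sum_(c : I) vol (a c) (b c).
  rewrite (eq_bigr _ (fun c _ => vE c)) sumr_const card_ffun !card_ord.
  rewrite -(prednK hd) /=; set e := d.-1.
  rewrite -[RHS]mulr_natl natrX /z /s expr_div_n exprS [q.+1%:R ^+ e.+1]exprS; field.
  by rewrite expf_neq0 ?gt_eqF.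
apply: (outer_fin hd ab) => om Som.
have D k : exists n : 'I_q.+1, -1 + s * n%:R <= om 0 k <= -1 + s * n.+1%:R.
  have /andP[y1 y2] := Sc _ Som k.
  have sq : s * q.+1%:R = 2 by rewrite /s mulfVK// gt_eqF.
  have [|n /andP[n1 n2]] := @digit q s (om 0 k + 1) s0.
    by rewrite sq; apply/andP; split; lra.
  by exists n; apply/andP; split; lra.
have [c0 Hc0] := choice D.
pose c1 : I := [ffun k => c0 k].
have cS : col c1 om by split=> // k _; rewrite ffunE; exact: Hc0.
have [pS pc] : col c1 (xget 0 (col c1)) by exact: xgetPex (ex_intro _ om cS).
have ow : `|om 0 i - pt c1| <= w.
  apply: thin => // k ki; apply: le_trans sd.
  have := pc k ki; have [_ /(_ k ki)] := cS; rewrite -natr1 => /andP[h1 h2] /andP[h3 h4].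
  by rewrite ler_norml; apply/andP; split; lra.
have zq : z * q.+1%:R = 2 * w by rewrite /z mulfVK// gt_eqF.
have [|n /andP[n1 n2]] := @digit q z (om 0 i - (pt c1 - w)) z0.
  by rewrite zq; move: ow; rewrite ler_norml => /andP[h1 h2]; apply/andP; split; lra.
pose c : I := [ffun k => if k == i then n else c0 k].
have cc : col c = col c1.
  apply/seteqP; split => x [Sx h]; split => // k ki; have := h k ki; rewrite !ffunE (negbTE ki)//.
exists c => // k; rewrite !mxE; case: eqP => [->|/eqP ki].
  by rewrite !ffunE eqxx /pt cc -/(pt c1); apply/andP; split; lra.
by rewrite !ffunE (negbTE ki); exact: Hc0.
Qed.

(** Along the i-th axis om.l moves with speed |l_i|, and h at most half as fast up to the error e,
    so the strip is thin in that direction. *)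
Lemma strip_outer (A : set 'rV[R]_d) (h : 'rV[R]_d -> R) (l : 'rV[int]_d) (i : 'I_d) (kp e th : R) :
  A `<=` @cube R d -> 0 <= kp -> 0 <= e -> 0 < th ->
  1 <= (`|l 0%R i|%N)%:R :> R -> 2 * kp <= (`|l 0%R i|%N)%:R ->
  (forall om om' r, A om -> A om' -> 0 <= r -> (forall k, `|om 0 k - om' 0 k| <= r) ->
     `|h om - h om'| <= kp * r + e) ->
  outer_le [set om | A om /\ `|dotRZ om l + h om| < th] (2 ^+ d * (2 * (3 * th + e))).
Proof.
move=> Ac kp0 e0 th0 l1 lk hL.
have W0 : 0 < 2 * (3 * th + e) by lra.
have N0 : 0 < kp + (n1 l)%:R + 1 by rewrite ltr_wpDl// addr_ge0.
(* Chosen so that moving the other coordinates by dl changes om.l + h by at most th, apart from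
   e. *)
set dl := th / (kp + (n1 l)%:R + 1).
have dl0 : 0 < dl by rewrite divr_gt0.
apply: (@thin_outer _ i _ dl) => //; first by move=> om [/Ac].
move=> om om' [Ao so] [Ao' so'] od; set x := `|om 0 i - om' 0 i|.
have x0 : 0 <= x by exact: normr_ge0.
have hh := hL om om' (x + dl) Ao Ao' (addr_ge0 x0 (ltW dl0)).
have {}hh : `|h om - h om'| <= kp * (x + dl) + e.
  apply: hh => k; have [->|ki] := eqVneq k i; first by rewrite lerDl ltW.
  by apply: le_trans (od k ki) _; rewrite lerDr.
have E : dotRZ om l - dotRZ om' l = (om 0 i - om' 0 i) * (l 0 i)%:~R +
    \sum_(k | k != i) (om 0 k - om' 0 k) * (l 0 k)%:~R.
  rewrite /dotRZ -sumrB (bigD1 i)//=; congr (_ + _); first by rewrite mulrBl.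
  by apply: eq_bigr => k _; rewrite mulrBl.
have tail : `|\sum_(k | k != i) (om 0 k - om' 0 k) * (l 0 k)%:~R| <= dl * (n1 l)%:R.
  apply: le_trans (ler_norm_sum _ _ _) _; rewrite /n1 natr_sum mulr_sumr.
  rewrite [leRHS](bigD1 i)//= [leRHS]addrC; apply: ler_wpDr; first by rewrite mulr_ge0// ltW.
  apply: ler_sum => k ki; rewrite normrM natr_absz intr_norm ler_wpM2r//; exact: od.
have main : x * (`|l 0%R i|%N)%:R <= 2 * th + (kp * (x + dl) + e) + dl * (n1 l)%:R.
  have -> : x * (`|l 0%R i|%N)%:R = `|(om 0 i - om' 0 i) * (l 0 i)%:~R|.
    by rewrite normrM natr_absz intr_norm.
  have -> : (om 0 i - om' 0 i) * (l 0 i)%:~R = (dotRZ om l + h om) - (dotRZ om' l + h om')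
     - (h om - h om') - \sum_(k | k != i) (om 0 k - om' 0 k) * (l 0 k)%:~R.
    by have := E; lra.
  apply: le_trans (ler_normB _ _) _; apply: lerD => //.
  apply: le_trans (ler_normB _ _) _; apply: lerD => //.
  apply: le_trans (ler_normB _ _) _; lra.
have dN : dl * (kp + (n1 l)%:R + 1) = th by rewrite /dl mulfVK// gt_eqF.
have m2 : x * (2 * kp) <= x * (`|l 0%R i|%N)%:R by rewrite ler_wpM2l.
have m3 : x * 1 <= x * (`|l 0%R i|%N)%:R by rewrite ler_wpM2l.
have dl1 : 0 <= dl by exact: ltW.
lra.
Qed.

Section Comb.
Variables (I : countType) (r : nat) (S : R).
Hypothesis S1 : 1 <= S.

(** [f x] is a correction of weight [nu x], and L measures the size of l. The error e makes room for
    the residual of approximate eigenvalues and must stay below the threshold th. [ch_kp] keeps n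
    corrections slower than half of om.l. *)
Record comb_hyp (n : nat) (th : R) (f : I -> 'rV[R]_d -> R) (nu : I -> R) (A : set 'rV[R]_d)
    (l : 'rV[int]_d) (i : 'I_d) (kp e gam L : R) : Prop := CombHyp {
  ch_A : A `<=` @cube R d;
  ch_gam : 0 < gam <= 1;
  ch_L : 2 <= L;
  ch_l : (n1 l)%:R <= L;
  ch_i : 1 <= (`|l 0%R i|%N)%:R :> R;
  ch_kp0 : 0 <= kp;
  ch_kp : 2 * (n%:R * kp) <= (`|l 0%R i|%N)%:R;
  ch_e : 0 <= e <= th;
  ch_nu : forall x, 0 <= nu x <= 1;
  ch_S : sums_le (fun x => nu x ^+ 8) S;
  ch_f : forall x om, A om -> `|f x om| <= gam * nu x + e;
  ch_lip : forall x om om' r, A om -> A om' -> 0 <= r -> (forall k, `|om 0 k - om' 0 k| <= r) ->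
     `|f x om - f x om'| <= kp * r + e }.

Lemma comb_hyp_le n m th th' f nu A l i kp e gam L : (m <= n)%N -> th <= th' ->
  comb_hyp n th f nu A l i kp e gam L -> comb_hyp m th' f nu A l i kp e gam L.
Proof.
move=> mn tt [hA hg hL hl hi hk0 hk /andP[e0 e1] hnu hS hf hlip]; split => //.
  apply: le_trans hk; rewrite ler_wpM2l// ler_wpM2r// ler_nat//.
by rewrite e0 (le_trans e1).
Qed.

(* All the corrections have weight at least L^-sg, so a union over them costs only
   a power of L. *)
Lemma comb_large n sg tau : (r + 2 + 8 * n * sg <= tau)%N ->
  forall f nu A l i kp e gam L, comb_hyp n (gam / L ^+ tau) f nu A l i kp e gam L ->
  outer_le [set om | A om /\ exists (m : int) (s : seq I), [/\ size s = n,
      forall x, x \in s -> (L ^+ sg)^-1 <= nu x &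
      `|dotRZ om l + m%:~R + \sum_(x <- s) f x om| < gam / L ^+ tau]]
    (2 ^+ d * (2 * (3 + n%:R)) * (n + 2)%:R ^+ 2 * (4 * S ^+ n) * (gam / L ^+ r)).
Proof.
move=> tauge f nu A l i kp e gam L [hA /andP[g0 g1] hL hl hi hk0 hk /andP[e0 e1] hnu hS hf hlip].
have L0 : 0 < L by apply: lt_le_trans hL.
have L1 : 1 <= L by apply: le_trans hL; rewrite ler1n.
set th := gam / L ^+ tau in e1 *.
have th0 : 0 < th by rewrite divr_gt0// exprn_gt0.
have th1 : th <= 1.
  rewrite ler_pdivrMr ?exprn_gt0// mul1r (le_trans g1)//; exact: exprn_ege1.
pose c : R := 2 ^+ d * (2 * (3 + n%:R)) * (n + 2)%:R ^+ 2 * (gam / L ^+ r).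
have c0 : 0 <= c.
  have k1 : 0 <= 2 ^+ d * (2 * (3 + n%:R)) :> R by rewrite mulr_ge0 ?exprn_ge0// mulr_ge0// addr_ge0.
  have k2 : 0 <= gam / L ^+ r by rewrite divr_ge0 ?exprn_ge0// ltW.
  by rewrite /c mulr_ge0// mulr_ge0// exprn_ge0.
pose g (s : seq I) : R := if size s == n then \prod_(x <- s) nu x ^+ 8 else 0.
have nu8 x : 0 <= nu x ^+ 8 by rewrite exprn_ge0//; case/andP: (hnu x).
have gs : sums_le g (S ^+ n) by exact: sle_seqprod.
have g_ge0 s : 0 <= g s by rewrite /g; case: ifP => // _; exact: prodr_ge0.
pose F (q : int * seq I) := [set om | [/\ A om, size q.2 = n, forall x, x \in q.2 -> (L ^+ sg)^-1 <= nu x &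
      `|dotRZ om l + (q.1%:~R + \sum_(x <- q.2) f x om)| < th]].
apply: (@outer_sub _ _ _ (\bigcup_q F q)).
  by move=> om [Ao [m [s [sn snu H]]]]; exists (m, s) => //; split => //=; rewrite addrA.
have -> : 2 ^+ d * (2 * (3 + n%:R)) * (n + 2)%:R ^+ 2 * (4 * S ^+ n) * (gam / L ^+ r) = c * ((2 + 2) * S ^+ n).
  by rewrite /c; ring.
apply: (@outer_bigcup _ _ hd _ _ (fun q => c * (wint R q.1 * g q.2))); last first.
  apply: sleZ => //; apply: (@sle_fub _ _ _ (fun m s => wint R m * g s) (fun m => wint R m * S ^+ n)).
  - by move=> m s; rewrite mulr_ge0// wint_ge0.
  - by move=> m; apply: sleZ => //; exact: wint_ge0.
  - have Sn0 : 0 <= S ^+ n by rewrite exprn_ge0// (le_trans ler01).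
    rewrite mulrC; apply: sle_le (sleZ Sn0 (@sle_wint R)) => m; by rewrite mulrC.
(* Only a nonempty slice costs anything, and a frequency in it bounds m by a multiple of L; this
   makes the weights of m and s at least powers of 1/L. *)
move=> [m s]; have [[om0 [Ao sn snu H0]]|/set0P/negP] := pselect (F (m, s) !=set0); last first.
  rewrite negbK => /eqP ->; apply: outer_leW (outer_set0 _ hd).
  by rewrite mulr_ge0// mulr_ge0// wint_ge0.
rewrite /= in sn snu H0 *.
have fbd om x : A om -> `|f x om| <= 2.
  move=> Aom; apply: le_trans (hf x om Aom) _; case/andP: (hnu x) => u0 u1.
  have : gam * nu x <= 1 by rewrite mulr_ile1// ltW.
  lra.
have sumbd : `|\sum_(x <- s) f x om0| <= 2 * n%:R.
  apply: le_trans (ler_norm_sum _ _ _) _.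
  apply: (@le_trans _ _ (\sum_(x <- s) 2)); first by apply: ler_sum => x _; exact: fbd.
  by rewrite big_const_seq count_predT sn iter_addr_0 mulr_natr.
have dot1 : `|dotRZ om0 l| <= L.
  apply: le_trans hl; have := dotRZ_le l (cube_le (hA _ Ao)); by rewrite mul1r.
have mbd : (1 + `|m|%N)%:R <= (n + 2)%:R * L.
  rewrite natrD natr_absz intr_norm natrD.
  have e2 : m%:~R = (dotRZ om0 l + (m%:~R + \sum_(x <- s) f x om0)) - dotRZ om0 l - \sum_(x <- s) f x om0 by ring.
  have : `|m%:~R| <= 1 + L + 2 * n%:R.
    rewrite e2; apply: le_trans (ler_normB _ _) _; apply: lerD => //.
    apply: le_trans (ler_normB _ _) _; apply: lerD => //; exact: le_trans (ltW H0) th1.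
  have : 0 <= n%:R * (L - 2) by rewrite mulr_ge0// subr_ge0.
  lra.
have wm : ((n + 2)%:R * L) ^- 2 <= wint R m.
  have p1 : 0 < (n + 2)%:R * L by rewrite mulr_gt0// ltr0n addn2.
  have p2 : 0 < (1 + `|m|%N)%:R :> R by rewrite ltr0n.
  rewrite /wint lef_pV2 ?posrE; [|exact: exprn_gt0|exact: exprn_gt0].
  by rewrite lerXn2r ?nnegrE// ltW.
have gsb : (L ^+ (8 * n * sg))^-1 <= g s.
  rewrite /g sn eqxx; have -> : (L ^+ (8 * n * sg))^-1 = \prod_(x <- s) (L ^+ sg)^-1 ^+ 8.
    rewrite big_const_seq count_predT sn iter_mulr_1 -!exprVn -!exprM; congr (_ ^+ _).
    by rewrite mulnC mulnA.
  rewrite big_seq [leRHS]big_seq; apply: ler_prod => x xs.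
  rewrite exprn_ge0 ?invr_ge0 ?exprn_ge0 ?(ltW L0)//= lerXn2r ?nnegrE ?invr_ge0 ?exprn_ge0 ?(ltW L0)//.
    by case/andP: (hnu x).
  exact: snu.
have ne0 : 0 <= n%:R * e by rewrite mulr_ge0.
have nk0 : 0 <= n%:R * kp by rewrite mulr_ge0.
have St := @strip_outer A (fun om => m%:~R + \sum_(x <- s) f x om) l i _ _ th hA nk0 ne0 th0 hi hk.
apply: (@outer_leW _ _ _ (2 ^+ d * (2 * (3 * th + n%:R * e)))); last first.
  apply: outer_sub (St _) => [om [Aom _ _ H]//|om om' t Aom Aom' t0 ht].
  have -> : m%:~R + \sum_(x <- s) f x om - (m%:~R + \sum_(x <- s) f x om') =
      \sum_(x <- s) (f x om - f x om') by rewrite sumrB; ring.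
  apply: le_trans (ler_norm_sum _ _ _) _.
  apply: (@le_trans _ _ (\sum_(x <- s) (kp * t + e))); first by apply: ler_sum => x _; exact: hlip.
  by rewrite big_const_seq count_predT sn iter_addr_0 -[leLHS]mulr_natl; lra.
have b1 : 2 ^+ d * (2 * (3 * th + n%:R * e)) <= 2 ^+ d * (2 * (3 + n%:R)) * th.
  have P0 : 0 <= 2 ^+ d :> R by rewrite exprn_ge0.
  have ne1 : n%:R * e <= n%:R * th by rewrite ler_wpM2l.
  have := ler_wpM2l P0 ne1; lra.
apply: le_trans b1 _.
have b2 : ((n + 2)%:R * L) ^- 2 * (L ^+ (8 * n * sg))^-1 <= wint R m * g s.
  by rewrite ler_pM// ?invr_ge0 ?exprn_ge0 ?mulr_ge0 ?(ltW L0).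
apply: (@le_trans _ _ (c * (((n + 2)%:R * L) ^- 2 * (L ^+ (8 * n * sg))^-1))); last by rewrite ler_wpM2l.
have N2 : (n + 2)%:R != 0 :> R by rewrite pnatr_eq0 addn2.
have Ln : L != 0 by rewrite gt_eqF.
have -> : c * (((n + 2)%:R * L) ^- 2 * (L ^+ (8 * n * sg))^-1) =
   2 ^+ d * (2 * (3 + n%:R)) * (gam / L ^+ (r + 2 + 8 * n * sg)).
  rewrite /c exprMn !exprD; field.
  rewrite natrD in N2; by rewrite Ln N2 !expf_neq0.
rewrite ler_wpM2l ?mulr_ge0 ?exprn_ge0 ?addr_ge0// ler_wpM2l ?(ltW g0)//.
by rewrite lef_pV2 ?posrE ?exprn_gt0// ler_weXn2l.
Qed.

(* Induction on n: a correction of weight below L^-sg is negligible against the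
   threshold for n - 1 corrections. *)
Lemma comb_outer n : exists (tau : nat) (C : R), 0 < C /\
  forall f nu A l i kp e gam L, comb_hyp n (gam / L ^+ tau) f nu A l i kp e gam L ->
  outer_le [set om | A om /\ exists (m : int) (s : seq I), (size s <= n)%N /\
      `|dotRZ om l + m%:~R + \sum_(x <- s) f x om| < gam / L ^+ tau]
    (C * (gam / L ^+ r)).
Proof.
have Cl0 k : 0 < 2 ^+ d * (2 * (3 + k%:R)) * (k + 2)%:R ^+ 2 * (4 * S ^+ k) :> R.
  have k1 : 0 < 2 ^+ d * (2 * (3 + k%:R)) :> R by rewrite mulr_gt0 ?exprn_gt0// mulr_gt0// ltr_wpDr.
  have k2 : 0 < 4 * S ^+ k by rewrite mulr_gt0// exprn_gt0// (lt_le_trans ltr01).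
  by rewrite mulr_gt0// mulr_gt0// exprn_gt0// ltr0n addn2.
elim: n => [|n [tn [Cn [Cn0 IH]]]].
  exists (r + 2)%N; eexists; split; first exact: (Cl0 0%N).
  move=> f nu A l i kp e gam L H.
  have tg : (r + 2 + 8 * 0 * 0 <= r + 2)%N by rewrite !muln0 addn0.
  apply: outer_sub (comb_large tg H) => om [Ao [m [s [sn h]]]]; split => //; exists m, s; split => //.
    by apply/eqP; rewrite -leqn0.
  by move: sn; rewrite leqn0 => /nilP -> x; rewrite in_nil.
(* Dropping a light correction leaves at most 3 gam / L^sg, and the surplus 2 in [sg] absorbs the 3
   because L >= 2. Then [tau] is taken large enough for [comb_large] and above both [tn] and
   [sg]. *)
pose sg := (tn + 2)%N; pose tau := (r + 2 + 8 * n.+1 * sg + sg)%N.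
exists tau, (Cn + 2 ^+ d * (2 * (3 + n.+1%:R)) * (n.+1 + 2)%:R ^+ 2 * (4 * S ^+ n.+1)).
split; first by rewrite addr_gt0.
move=> f nu A l i kp e gam L H; have [hA /andP[g0 g1] hL hl hi hk0 hk /andP[e0 e1] hnu hS hf hlip] := H.
have L0 : 0 < L by apply: lt_le_trans hL.
have L1 : 1 <= L by apply: le_trans hL; rewrite ler1n.
have pw a b : (a <= b)%N -> gam / L ^+ b <= gam / L ^+ a.
  move=> ab; rewrite ler_wpM2l ?(ltW g0)//.
  by rewrite lef_pV2 ?posrE ?exprn_gt0// ler_weXn2l.
have tn_tau : (tn <= tau)%N by rewrite /tau; apply: (leq_trans (leq_addr 2 tn)); exact: leq_addl.
have sg_tau : (sg <= tau)%N by rewrite /tau leq_addl.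
have tauge : (r + 2 + 8 * n.+1 * sg <= tau)%N by rewrite /tau leq_addr.
rewrite mulrDl; apply: outer_sub (outerU hd (IH _ _ _ _ _ _ _ _ _ (comb_hyp_le (leqnSn n) (pw _ _ tn_tau) H))
  (comb_large tauge H)) => om [Ao [m [s [sn h]]]].
have [sn'|sn'] := leqP (size s) n.
  by left; split => //; exists m, s; split => //; apply: lt_le_trans h (pw _ _ tn_tau).
have {sn'}sn : size s = n.+1 by apply/eqP; rewrite eqn_leq sn sn'.
have [/hasP[x xs nux]|/hasPn big] := boolP (has (fun x => nu x < (L ^+ sg)^-1) s); last first.
  by right; split => //; exists m, s; split => // x /big; rewrite -leNgt.
left; split => //; exists m, (rem x s); split; first by rewrite size_rem// sn.
have E : \sum_(y <- s) f y om = f x om + \sum_(y <- rem x s) f y om.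
  by rewrite (perm_big _ (perm_to_rem xs)) big_cons.
have -> : dotRZ om l + m%:~R + \sum_(y <- rem x s) f y om =
  (dotRZ om l + m%:~R + \sum_(y <- s) f y om) - f x om by rewrite E; ring.
have b1 : gam / L ^+ tau <= gam / L ^+ sg by exact: pw.
have b2 : gam * nu x <= gam / L ^+ sg by rewrite ler_wpM2l ?(ltW g0)// ltW.
have b3 := hf x om Ao.
have b4 : 3 * (gam / L ^+ sg) <= gam / L ^+ tn.
  have -> : gam / L ^+ sg = gam / L ^+ tn / L ^+ 2 by rewrite /sg exprD invfM mulrA.
  set y := gam / L ^+ tn; have y0 : 0 <= y by rewrite divr_ge0 ?exprn_ge0 ?(ltW g0) ?(ltW L0).
  rewrite mulrA ler_pdivrMr ?exprn_gt0// mulrC ler_wpM2l//.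
  by move: hL => hL2; nra.
apply: le_lt_trans (ler_normB _ _) _.
lra.
Qed.

End Comb.
End Strips.

(** * Cantor sets inside sets of large measure *)

Section Cantor.
Variables (R : realType) (d : nat).
Hypothesis hd : (0 < d)%N.

Lemma obox_open (a b : 'rV[R]_d) : open (obox a b).
Proof.
rewrite openE => x xab; rewrite /interior.
have : forall i : 'I_d, \forall y \near (x : 'rV[R]_d), (y : 'rV[R]_d) 0 i \in `](a 0 i), (b 0 i)[.
  move=> i; have op : open `](a 0 i), (b 0 i)[%classic by exact: itv_open.
  have N : nbhs ((x : 'rV[R]_d) 0 i) `](a 0 i), (b 0 i)[%classic.
    by apply: open_nbhs_nbhs; split => //=; rewrite in_itv/=; exact: xab.
  exact: (@coord_continuous R 1 d 0 i x _ N).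
move=> /filter_forall; apply: filterS => y h i; by have := h i; rewrite in_itv.
Qed.

Lemma cube_compact : compact (@cube R d).
Proof.
have -> : @cube R d = [set v : 'rV[R]_d | forall i, `[(-1), 1]%classic (v ord0 i)].
  by apply/seteqP; split => x h i; have := h i; rewrite /= in_itv.
by apply: (@rV_compact R d (fun=> `[(-1), 1]%classic)) => _; exact: segment_compact.
Qed.

Lemma cube_closed : closed (@cube R d).
Proof. apply: compact_closed cube_compact; exact: norm_hausdorff. Qed.

Lemma leb_measurableI (A B : set 'rV[R]_d) :
  lebesgue_measurable A -> lebesgue_measurable B -> lebesgue_measurable (A `&` B).
Proof. exact: (@caratheodory_measurable_setI _ _ (leb_outer R hd)). Qed.

Lemma rat_near (X w : R) : 0 < w -> exists q : rat, ratr q - w < X < ratr q + w.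
Proof.
move=> w0; have [|q] := @rat_in_itvoo R X (X + w); first by rewrite ltrDl.
by rewrite in_itv/= => /andP[h1 h2]; exists q; apply/andP; split; lra.
Qed.

Lemma near_chain (X Y q w r : R) : q - w < X < q + w -> q - w < Y < q + w -> 2 * w < r ->
  `|X - Y| < r.
Proof. by move=> /andP[h1 h2] /andP[h3 h4] h; rewrite ltr_norml; apply/andP; split; lra. Qed.

Lemma itv_wide (X : R) : -1 <= X <= 1 -> -2 < X < 2.
Proof. by move=> /andP[h1 h2]; apply/andP; split; lra. Qed.

Section Carved.
Variables (T : countType) (a b : T -> 'rV[R]_d).

Definition carved : set 'rV[R]_d := @cube R d `\` \bigcup_x obox (a x) (b x).

Lemma carved_sub : carved `<=` @cube R d. Proof. by move=> x []. Qed.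

Lemma carved_closed : closed carved.
Proof.
apply: closedI; first exact: cube_closed.
by apply: open_closedC; apply: bigcup_open => x _; exact: obox_open.
Qed.

Lemma carved_compact : compact carved.
Proof. exact: subclosed_compact carved_closed cube_compact carved_sub. Qed.

Lemma carved_measurable : lebesgue_measurable carved.
Proof.
have -> : carved = @cube R d `&` ~` \bigcup_n
    (if @choice.pickle_inv T n is Some x then obox (a x) (b x) else set0).
  rewrite /carved setDE; congr (_ `&` ~` _); apply/seteqP; split => y.
    by move=> [x _ h]; exists (choice.pickle x) => //; rewrite choice.pickleK_inv.
  by move=> [n _]; case: choice.pickle_inv => // x h; exists x.
apply: leb_measurableI; first exact: cube_measurable.
apply: leb_measurableC => //; apply: leb_measurable_bigcup => // n.
case: choice.pickle_inv => [x|]; first exact: obox_measurable.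
exact: (@caratheodory_measurable_set0 _ _ (leb_outer R hd)).
Qed.
End Carved.

Lemma prod_enlarge (s : seq R) (e : R) : 0 < e -> all (fun c => 0 <= c) s ->
  exists2 w, 0 < w & \prod_(c <- s) (c + 2 * w) <= \prod_(c <- s) c + e.
Proof.
elim: s e => [|c s ih] e e0; first by exists 1; rewrite // !big_nil lerDl ltW.
move=> /= /andP[c0 cs].
have P0 : 0 <= \prod_(x <- s) x by rewrite big_seq; apply: prodr_ge0 => x /(allP cs).
set P := \prod_(x <- s) x in P0 *.
have e'0 : 0 < e / (2 * (c + 1)) by rewrite divr_gt0// mulr_gt0// ltr_wpDl.
have [w w0 H] := ih _ e'0 cs; set e' := e / _ in e'0 H.
pose w' := Num.min w (e / (4 * (P + e' + 1))).
have q0 : 0 < 4 * (P + e' + 1) by rewrite mulr_gt0// ltr_wpDl// addr_ge0// ltW.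
have w'0 : 0 < w' by rewrite lt_min w0 divr_gt0.
have w'w : w' <= w by rewrite ge_min lexx.
have w'e : w' * (4 * (P + e' + 1)) <= e by rewrite -ler_pdivlMr// ge_min lexx orbT.
exists w' => //; rewrite !big_cons -/P.
have H' : \prod_(x <- s) (x + 2 * w') <= P + e'.
  apply: le_trans H; rewrite big_seq [leRHS]big_seq; apply: ler_prod => x /(allP cs) x0.
  rewrite addr_ge0 ?mulr_ge0 ?(ltW w'0)//= lerD2l ler_wpM2l//.
have E : e' * (2 * (c + 1)) = e.
  by rewrite /e' mulfVK// mulf_neq0// gt_eqF// ltr_wpDl.
apply: (@le_trans _ _ ((c + 2 * w') * (P + e'))).
  by rewrite ler_wpM2l// addr_ge0// mulr_ge0// ltW.
have h1 : 0 <= w' * e' by rewrite mulr_ge0 ?ltW.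
nra.
Qed.

Lemma box_enlarge (a b : 'rV[R]_d) (e : R) : 0 < e -> (forall i, a 0 i <= b 0 i) ->
  exists a' b' : 'rV[R]_d, [/\ forall i, a' 0 i <= b' 0 i, box a b `<=` obox a' b' &
    vol a' b' <= vol a b + e].
Proof.
move=> e0 ab; have := @prod_enlarge [seq b 0 i - a 0 i | i <- index_enum _] e e0.
case; first by apply/allP => _ /mapP[i _ ->]; rewrite subr_ge0.
move=> w w0; rewrite !big_map => H.
exists (\row_i (a 0 i - w)), (\row_i (b 0 i + w)); split.
- by move=> i; rewrite !mxE; have := ab i; lra.
- by move=> x h i; rewrite !mxE; have /andP[h1 h2] := h i; apply/andP; split; lra.
- apply: le_trans H; rewrite /vol le_eqVlt; apply/orP; left; apply/eqP.
  by apply: eq_bigr => i _; rewrite !mxE; ring.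
Qed.

Lemma outer_null (T : countType) (F : T -> set 'rV[R]_d) :
  (forall x, outer_le (F x) 0) -> outer_le (\bigcup_x F x) 0.
Proof. by move=> h; apply: (outer_bigcup hd h); exact: sle0. Qed.

Lemma pickle_weight (T : countType) (e : R) : 0 < e ->
  sums_le (fun x : T => e / 2 * 2 ^- choice.pickle x) e.
Proof.
move=> e0; have e2 : 0 <= e / 2 by rewrite divr_ge0// ltW.
have -> : e = e / 2 * 2 by field.
have -> : e / 2 * 2 / 2 = e / 2 by field.
apply: (sleZ e2); exact: (sle_inj (pcan_inj (@choice.pickleK T)) (@sle_half R)).
Qed.

Lemma sle_sum (T U : choiceType) (f : T -> R) (g : U -> R) M N :
  (forall x, 0 <= f x) -> (forall x, 0 <= g x) -> sums_le f M -> sums_le g N ->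
  sums_le (fun z : T + U => match z with inl x => f x | inr y => g y end) (M + N).
Proof.
move=> f0 g0 fM gN s us.
pose s1 := pmap (fun z : T + U => if z is inl x then Some x else None) s.
pose s2 := pmap (fun z : T + U => if z is inr y then Some y else None) s.
have u1 : uniq s1.
  by apply: (@pmap_uniq _ _ _ (fun x => inl x)) => // -[].
have u2 : uniq s2.
  by apply: (@pmap_uniq _ _ _ (fun x => inr x)) => // -[].
apply: le_trans (lerD (fM _ u1) (gN _ u2)); rewrite le_eqVlt; apply/orP; left; apply/eqP.
rewrite /s1 /s2; elim: s {us s1 s2 u1 u2} => [|[x|y] s ih]; rewrite /= ?big_nil ?addr0//.
  by rewrite !big_cons ih addrA.
by rewrite !big_cons ih addrCA.
Qed.

(* Remove open boxes covering the complement, the rational hyperplanes (thickened),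
   and the rational boxes in which the remaining set is null. *)
Lemma cantor_ex (A : set 'rV[R]_d) M : A `<=` @cube R d ->
  (lebesgue_outer (@cube R d `\` A) < M%:E)%E ->
  exists CC, [/\ CC `<=` A, lebesgue_measurable CC, cantor_set CC & outer_le (@cube R d `\` CC) M].
Proof.
move=> Ac /(@outer_ltE R d) [a0 [b0 [ab0 AU [M' M'm sM]]]].
(* The strict slack is shared equally between opening the boxes of the cover and thickening the
   hyperplanes. *)
pose e := (M - M') / 2; have e0 : 0 < e by rewrite divr_gt0// subr_gt0.
have H1 n : exists a' : 'rV[R]_d, exists b' : 'rV[R]_d, [/\ forall i, a' 0 i <= b' 0 i, box (a0 n) (b0 n) `<=` obox a' b' &
    vol a' b' <= vol (a0 n) (b0 n) + e / 2 * 2 ^- choice.pickle n].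
  apply: box_enlarge (ab0 n); apply: mulr_gt0; first by rewrite divr_gt0.
  by rewrite invr_gt0; exact: exprn_gt0.
have [a1 /choice[b1 H1']] := choice H1.
(* A slab of thickness 2 wd and side 4 in the other directions then has volume at most its share of
   e; side 4 makes its interior cross the whole cube. *)
pose wd (z : 'I_d * rat) : R := e / 2 * 2 ^- choice.pickle z / (2 * 4 ^+ d).
have wd0 z : 0 < wd z.
  rewrite /wd; apply: divr_gt0; apply: mulr_gt0; [exact: divr_gt0| |by []|exact: exprn_gt0].
  by rewrite invr_gt0; exact: exprn_gt0.
pose a2 z : 'rV[R]_d := \row_k (if k == z.1 then ratr z.2 - wd z else -2).
pose b2 z : 'rV[R]_d := \row_k (if k == z.1 then ratr z.2 + wd z else 2).
have ab2 z k : a2 z 0 k <= b2 z 0 k.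
  by rewrite !mxE; case: ifP => _; have := wd0 z; lra.
have v2 z : vol (a2 z) (b2 z) <= e / 2 * 2 ^- choice.pickle z.
  rewrite /vol (bigD1 z.1)//= !mxE eqxx (eq_bigr (fun=> 4)); last first.
    by move=> k /negbTE kz; rewrite !mxE kz; ring.
  rewrite prodr_const cardC1 card_ord.
  apply: (@le_trans _ _ (2 * wd z * 4 ^+ d)).
    have -> : ratr z.2 + wd z - (ratr z.2 - wd z) = 2 * wd z by ring.
    have w0 : 0 <= 2 * wd z by rewrite mulr_ge0// ltW.
    by rewrite (ler_wpM2l w0)// ler_weXn2l ?ler1n// leq_pred.
  rewrite /wd le_eqVlt; apply/orP; left; apply/eqP; field.
  by rewrite !expf_neq0.
pose T := (nat + 'I_d * rat)%type.
pose a3 (x : T) := match x with inl n => a1 n | inr z => a2 z end.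
pose b3 (x : T) := match x with inl n => b1 n | inr z => b2 z end.
pose K2 := carved a3 b3.
pose ac (z : 'rV[rat]_d * nat) : 'rV[R]_d := \row_k (ratr (z.1 0 k) - z.2.+1%:R^-1).
pose bc (z : 'rV[rat]_d * nat) : 'rV[R]_d := \row_k (ratr (z.1 0 k) + z.2.+1%:R^-1).
pose null z := outer_le (K2 `&` obox (ac z) (bc z)) 0.
pose T' := (T + 'rV[rat]_d * nat)%type.
(* Rational boxes that are not null contribute the open box from 0 to 0, which is empty. *)
pose a4 (x : T') := match x with inl n => a3 n | inr z => if pselect (null z) then ac z else 0 end.
pose b4 (x : T') := match x with inl n => b3 n | inr z => if pselect (null z) then bc z else 0 end.
pose CC := carved a4 b4.
have obox0 : obox 0 0 = set0 :> set 'rV[R]_d.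
  by rewrite -subset0 => x /(_ (Ordinal hd)) /andP[h1 /(lt_trans h1)]; rewrite ltxx.
have CK2 : CC `<=` K2.
  move=> x [xc nx]; split => // -[t _ xt]; apply: nx; by exists (inl t).
have KC : outer_le (K2 `\` CC) 0.
  apply: outer_sub (outer_null (F := fun z => if pselect (null z) then K2 `&` obox (ac z) (bc z) else set0) _).
    move=> x [Kx nx]; have [xc nx'] := Kx.
    have : (\bigcup_z obox (a4 z) (b4 z)) x by apply: contrapT => h; apply: nx.
    move=> [[t|z] _ h]; first by case: nx'; exists t.
    exists z => //; move: h; rewrite /=; case: (pselect (null z)) => /= nz h; first by split.
    by move: h; rewrite obox0.
  by move=> z; case: (pselect (null z)) => //= nz; exact: outer_set0.
exists CC; split.
- move=> x [xc nx]; apply: contrapT => nA; apply: nx.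
  have [n _ weighted_le] := AU x (conj xc nA); exists (inl (inl n)) => //=.
  by case: (H1' n) => _ + _; apply.
- exact: carved_measurable.
- split; first exact: carved_compact.
  + split; first exact: carved_closed.
    apply/seteqP; split; first by apply: subset_trans (@subset_limit_point _ CC) _; exact: carved_closed.
    (* If x were isolated, some rational box around it would meet [K2] only in x and a null set, and
       that box has been removed. *)
    move=> x Cx U /nbhs_ballP [r /= r0 rU].
    pose n := Num.truncn (2 / r).
    have n0 : 0 < n.+1%:R^-1 :> R by rewrite invr_gt0 ltr0n.
    have nr : 2 * n.+1%:R^-1 < r.
      by rewrite ltr_pdivrMr ?ltr0n// mulrC -ltr_pdivrMr// truncnS_gt.
    have Q k := rat_near ((x : 'rV[R]_d) 0 k) n0.
    have [q Hq] := choice Q; pose z : 'rV[rat]_d * nat := (\row_k q k, n).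
    have xz : obox (ac z) (bc z) x.
      by move=> k; rewrite !mxE; exact: Hq.
    have zU : obox (ac z) (bc z) `<=` U.
      move=> y yz; apply: rU; split => // i k; rewrite (ord1 i) /ball /=.
      have := yz k; rewrite !mxE => h; exact: near_chain (Hq k) h nr.
    apply: contrapT => ne; have [_ nx] := Cx; apply: nx; exists (inr z) => //=.
    case: (pselect (null z)) => [//|nn]; exfalso; apply: nn.
    have s1 : outer_le [set x] 0.
      rewrite -(vol_same hd x); apply: outer_sub (outer_box hd (fun=> lexx _)) => _ -> k /=.
      by rewrite lexx.
    have := outerU hd s1 KC; rewrite addr0; apply: outer_sub => y [Ky yz].
    have [yx|yx] := eqVneq y x; first by left.
    right; split => // Cy; apply: ne; exists y; split => //; exact: zU.
  + move=> x Cx; apply/seteqP; split; last first.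
      move=> _ ->; exists [set x]; last by [].
      by split => //; [move=> _ ->|exact: connected1].
    move=> y [B [Bx BC Bco] By] /=; apply: contrapT => yx.
    have [i xi] : exists i, x 0 i != y 0 i.
      apply: contrapT => h; apply: yx; apply/rowP => i; apply/eqP.
      by apply: contrapT => /negP ne; apply: h; exists i; rewrite eq_sym.
    (* A connected set with two points projects on some axis to a nontrivial interval, which
       contains a rational, and the corresponding hyperplane has been removed. *)
    have Ico : is_interval ((fun z : 'rV[R]_d => z 0 i) @` B).
      apply/connected_intervalP; apply: connected_continuous_connected => //.
      apply: continuous_subspaceT; exact: coord_continuous.
    have [q] : exists q : rat, ((fun z : 'rV[R]_d => z 0 i) @` B) (ratr q).
      wlog xy : x y Bx By {yx Cx} xi / x 0 i < y 0 i.
        move=> W; move: (xi); rewrite neq_lt => /orP[]; first exact: (W x y).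
        by apply: W => //; rewrite eq_sym.
      have [q] := rat_in_itvoo xy; rewrite in_itv/= => /andP[/ltW h1 /ltW h2].
      exists q; apply: (Ico (x 0 i) (y 0 i)); [by exists x|by exists y|by rewrite h1].
    move=> [z Bz zq]; have [zc nz] := BC z Bz; apply: nz; exists (inl (inr (i, q))) => // k /=.
    rewrite !mxE /=; case: eqP => [->|_]; last exact: itv_wide.
    by rewrite zq gtrBl ltrDl wd0.
- have sT : sums_le (fun x : T => vol (a3 x) (b3 x)) (M' + e + e).
    have v1 n : 0 <= vol (a1 n) (b1 n) by case: (H1' n) => h _ _; exact: vol_ge0.
    have v2' z : 0 <= vol (a2 z) (b2 z) by exact: vol_ge0.
    have S1 : sums_le (fun n => vol (a1 n) (b1 n)) (M' + e).
      apply: sle_le (sleD sM (@pickle_weight nat e e0)) => n; by case: (H1' n).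
    have S2 : sums_le (fun z => vol (a2 z) (b2 z)) e.
      by apply: sle_le (@pickle_weight _ e e0) => z; exact: v2.
    have := sle_sum v1 v2' S1 S2; apply: sle_le => -[n|z]; exact: lexx.
  have E : M' + e + e = M by rewrite /e; field.
  rewrite E in sT.
  have c1 : outer_le (@cube R d `\` K2) M.
    apply: (outer_cover hd _ _ sT) => [[n|z] i /=|x [xc nx]].
    - by case: (H1' n).
    - exact: ab2.
    - have : (\bigcup_z obox (a3 z) (b3 z)) x by apply: contrapT => h; apply: nx.
      by move=> [t _ h]; exists t => // i; have /andP[/ltW h1 /ltW h2] := h i; rewrite h1.
  have := outerU hd c1 KC; rewrite addr0; apply: outer_sub => x [xc nx].
  by have [Kx|Kx] := pselect (K2 x); [right|left].
Qed.

End Cantor.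

(** * Weights of the eigenvalue corrections *)

Section Weights.
Variables (R : realType) (kap delta : R).
Hypotheses (kap0 : 0 < kap) (delta01 : 0 < delta < 1 / 4).
Let mu := 1 - 2 * delta.

(** The Boolean is the sign with which a correction enters a divisor, [true] for plus. *)
Definition SignedIdx : Type := (bool * ('rV[int]_2 + 'rV[int]_2 * int))%type.

(** The decay of the two Theta terms for [inl j] and of the varpi term for [inr (v, b)]. The
    division by 2 normalises the sum of two terms to at most 1. *)
Definition wgt (x : Idx) : R :=
  match x with
  | inl j => (1 / (jap (bgen delta j)%:~R * japZ R j `^ mu) + 1 / (japZ R j `^ mu) ^+ 2) / 2
  | inr (v, b) => expR (- kap * enormZ R v) / jap b%:~R ^+ 2
  end.

Lemma japmu_ge1 (j : 'rV[int]_2) : 1 <= japZ R j `^ mu.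
Proof.
have mu0 : 0 <= mu by rewrite /mu; case/andP: delta01; lra.
have o1 : (1 : R) `^ mu = 1 by rewrite powR1.
by rewrite -[leLHS]o1 ge0_ler_powR// ?nnegrE ?jap_ge1// ltW// jap_gt0.
Qed.

Lemma wgt_inl j : wgt (inl j) <= (japZ R j `^ mu)^-1.
Proof.
have D1 := japmu_ge1 j; set D := japZ R j `^ mu in D1 *.
have B1 := jap_ge1 ((bgen delta j)%:~R : R); set B := jap _ in B1 *.
have D0 : 0 < D by exact: lt_le_trans D1.
have h1 : 1 / (B * D) <= D^-1.
  rewrite mul1r lef_pV2 ?posrE ?mulr_gt0 ?(lt_le_trans _ B1)//.
  by rewrite ler_peMl// ltW.
have h2 : 1 / D ^+ 2 <= D^-1.
  rewrite mul1r lef_pV2 ?posrE ?exprn_gt0//.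
  by rewrite expr2 ler_peMl// ltW.
by rewrite /= -/D -/B; lra.
Qed.

Lemma wgt01 x : 0 <= wgt x <= 1.
Proof.
case: x => [j|[v b]]; apply/andP; split.
- have D1 := japmu_ge1 j; have B1 := jap_ge1 ((bgen delta j)%:~R : R); rewrite /wgt.
  have D0 : 0 <= japZ R j `^ mu by exact: le_trans D1.
  have B0 := le_trans ler01 B1.
  by rewrite divr_ge0// addr_ge0// divr_ge0// ?mulr_ge0// exprn_ge0.
- apply: le_trans (wgt_inl j) _; have D1 := japmu_ge1 j.
  by rewrite invf_le1// (lt_le_trans _ D1).
- by rewrite /wgt divr_ge0 ?expR_ge0// exprn_ge0// (le_trans ler01)// jap_ge1.
- rewrite /wgt ler_pdivrMr ?exprn_gt0 ?jap_gt0// mul1r.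
  apply: (@le_trans _ _ 1); last by rewrite exprn_ege1// jap_ge1.
  by rewrite -expR0 ler_expR mulNr oppr_le0 mulr_ge0 ?sqrtr_ge0// ltW.
Qed.

(** Since delta < 1/4, mu exceeds 1/2 and the eighth power of <j>^-mu is below <j>^-4, which is
    summable on Z^2. For the reduced columns the exponential sums over v and the inverse square over
    b. *)
Lemma sle_wgt : exists S : R, 1 <= S /\ sums_le (fun x : SignedIdx => wgt x.2 ^+ 8) S.
Proof.
have k2 : 0 < kap / 2 by rewrite divr_gt0.
have [S1 [S10 HS1]] := @sle_exp R 2 _ k2.
have H1 : sums_le (fun j => wgt (inl j) ^+ 8) (3 ^+ 4 * 4 ^+ 2).
  have c0 : 0 <= 3 ^+ 4 :> R by rewrite exprn_ge0.
  apply: sle_le (sleZ c0 (@sle_wlat R 2)) => j.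
  have J1 := jap_ge1 (enormZ R j); rewrite -/(japZ R j) in J1.
  have J0 : 0 < japZ R j by exact: lt_le_trans J1.
  have D1 := japmu_ge1 j; have D0 : 0 < japZ R j `^ mu by exact: lt_le_trans D1.
  have [w0 _] := andP (wgt01 (inl j)).
  apply: (@le_trans _ _ ((japZ R j `^ mu)^-1 ^+ 8)).
    by rewrite lerXn2r ?nnegrE ?invr_ge0 ?(ltW D0)//; exact: wgt_inl.
  have E4 : japZ R j ^+ 4 <= (japZ R j `^ mu) ^+ 8.
    rewrite -powR_mulrn ?(ltW J0)// -powR_mulrn ?(ltW D0)// -powRrM.
    by apply: ler_powR => //; rewrite /mu; case/andP: delta01; lra.
  apply: (@le_trans _ _ (japZ R j ^- 4)).
    by rewrite exprVn lef_pV2 ?posrE ?exprn_gt0.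
  have n3 : (1 + n1 j)%:R <= 3 * japZ R j :> R.
    by have := n1_japZ R j; rewrite natrD; lra.
  have n0 : 0 < (1 + n1 j)%:R :> R by rewrite ltr0n.
  rewrite /wlat -ler_pdivrMl// ?exprn_gt0// -invfM -exprMn lef_pV2 ?posrE ?exprn_gt0 ?mulr_gt0//.
  by rewrite lerXn2r ?nnegrE ?mulr_ge0 ?(ltW J0) ?(ltW n0).
have H2 : sums_le (fun vb : 'rV[int]_2 * int => wgt (inr vb) ^+ 8) (4 * 4 * S1).
  apply: (@sle_le _ _ _ (fun p => expR (- (kap / 2) * (n1 p.1)%:R) * (4 * wint R p.2))).
    move=> [v b]; have [w0 w1] := andP (wgt01 (inr (v, b))).
    apply: (@le_trans _ _ (wgt (inr (v, b)))).
      by rewrite -[leRHS]expr1 ler_wiXn2l.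
    rewrite /wgt ler_pM ?expR_ge0 ?invr_ge0 ?exprn_ge0 ?(ltW (jap_gt0 _))//=.
      rewrite ler_expR !mulNr lerN2 -mulrA ler_wpM2l ?(ltW kap0)//.
      by have := n1_enormZ R v; lra.
    have b1 : (1 + `|b|%N)%:R <= 2 * jap b%:~R :> R.
      rewrite natrD natr_absz intr_norm /jap.
      have h1 : 1 <= Num.max 1 `|b%:~R| :> R by rewrite le_max lexx.
      have h2 : `|b%:~R| <= Num.max 1 `|b%:~R| :> R by rewrite le_max lexx orbT.
      lra.
    have b0 : 0 < (1 + `|b|%N)%:R :> R by rewrite ltr0n.
    have B0 := jap_gt0 (b%:~R : R).
    have e4 : 4 = 2 ^+ 2 :> R by rewrite -natrX.
    rewrite /wint -ler_pdivrMl// e4 -invfM -exprMn lef_pV2 ?posrE ?exprn_gt0 ?mulr_gt0//.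
    by rewrite lerXn2r ?nnegrE ?mulr_ge0 ?(ltW B0) ?(ltW b0).
  apply: (@sle_fub _ _ _ (fun v b => expR (- (kap / 2) * (n1 v)%:R) * (4 * wint R b))
     (fun v => expR (- (kap / 2) * (n1 v)%:R) * (4 * (2 + 2)))).
  - by move=> v b; rewrite mulr_ge0 ?expR_ge0// mulr_ge0// wint_ge0.
  - by move=> v; apply: sleZ; [exact: expR_ge0|apply: sleZ => //; exact: sle_wint].
  - have c0 : 0 <= 4 * 4 :> R by rewrite mulr_ge0.
    by apply: sle_le (sleZ c0 HS1) => v; rewrite mulrC; have -> : 4 * (2 + 2) = 4 * 4 :> R by ring.
have nn x : 0 <= wgt x ^+ 8 by rewrite exprn_ge0//; case/andP: (wgt01 x).
have H := sle_sum (fun j => nn (inl j)) (fun vb => nn (inr vb)) H1 H2.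
set S := _ + _ in H; have S0 : 0 <= S by exact: sle_ge0 H.
exists (1 + (S + S)); split; first by lra.
have HS : sums_le (fun _ : bool => S) (S + S).
  move=> s us; rewrite big_uniq//=; apply: (@le_trans _ _ (\sum_(b : bool) S)).
    by rewrite [leRHS](bigID (mem s))/= lerDl sumr_ge0.
  by rewrite big_bool.
apply: (@sle_leM _ _ _ (S + S)); first by lra.
apply: (@sle_fub _ _ _ (fun (b : bool) (x : 'rV[int]_2 + 'rV[int]_2 * int) => wgt x ^+ 8) (fun=> S)) => //.
by move=> _; apply: sle_le H => -[j|vb]; exact: lexx.
Qed.

End Weights.

(** * The set of good frequencies *)

Section KamSet.
Variables (R : realType) (d : nat) (K : 'M[int]_(d, 2)).
Notation G := ('rV[int]_d).
Notation mom := (momentum K).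
Notation C := R[i].
Notation idx_shift := (idx_shift K).
Notation idx_allowed := (idx_allowed K).
Notation idx_slope := (idx_slope R K).
Notation mom_sq := (mom_sq R K).
Notation flat := (flat K).
Variables (delta t Q : R) (tau C0 : nat) (V : G -> C) (p0 gam : R).

Definition potential_op (x : Idx) (l : G) : C := if idx_allowed x l then V l else 0.
Definition freqC (om : 'rV[R]_d) (l : G) : C := (dotRZ om l)%:C%C.
Definition energyC (x : Idx) : C := (idx_energy R x)%:C%C.
Definition kam_eig_at om n := klam idx_shift (freqC om) energyC potential_op C0 n.
Definition kam_col_at om n := kW idx_shift (freqC om) energyC potential_op C0 n.
Definition kam_good om n := good idx_shift idx_allowed (freqC om) energyC potential_op C0 gam tau n.
Definition kam_eig om := limlam idx_shift (freqC om) energyC potential_op C0.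
Definition kam_col om := limW idx_shift (freqC om) energyC potential_op C0.

Let rho : R := 2 ^- tau.+1.
Let f0 : R := C0%:R ^+ tau * p0 / gam.

Hypothesis hd : (0 < d)%N.
Hypothesis delta01 : 0 < delta < 1 / 4.
Hypothesis t0 : 0 < t.
Hypothesis ab : absorbs K delta t Q tau.
Hypothesis VN : forall l, V (- l) = ((V l)^*)%C.
Hypothesis zV : forall l, flat l -> V l = 0.
Hypothesis gam01 : 0 < gam <= 1.
Hypothesis p00 : 0 <= p0.
Hypothesis Vp : weighted_le (16 * t) p0 V.
Hypothesis C02 : (2 <= C0)%N.
Hypothesis tailrho : expR (- (16 * t / 4) * C0%:R) <= rho / 8.
Hypothesis f0rho : f0 <= rho / 16.
Let eps : R := 8 * f0.
Hypothesis epsCap : 32 * loss_const Q * Q * eps <= 1.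

Let Q1 : 1 <= Q. Proof. by case: ab. Qed.
Let gam0 : 0 < gam. Proof. by case/andP: gam01. Qed.
Let C0pos : (0 < C0)%N. Proof. exact: leq_trans C02. Qed.
Let a0 : 0 < 16 * t. Proof. by rewrite mulr_gt0. Qed.
Let CapQ1 : 1000 <= loss_const Q * Q.
Proof.
have : 1 <= Q ^+ 4 * Q by rewrite mulr_ege1// exprn_ege1.
by rewrite /loss_const; lra.
Qed.
Let f00 : 0 <= f0.
Proof. by rewrite /f0 divr_ge0 ?(ltW gam0)// mulr_ge0// exprn_ge0. Qed.
Lemma keps0 : 0 <= eps <= 1 / 1000.
Proof.
apply/andP; split; first by rewrite /eps mulr_ge0.
have e0 : 0 <= eps by rewrite /eps mulr_ge0.
by move: epsCap CapQ1 => h1 h2; nra.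
Qed.
Lemma kp0e : 0 <= p0 <= eps * gam.
Proof.
rewrite p00 /eps /f0 -!mulrA mulVf ?gt_eqF// mulr1 mulrA -[leLHS]mul1r ler_wpM2r//.
have : 1 <= C0%:R ^+ tau :> R by rewrite exprn_ege1// ler1n.
lra.
Qed.
Let p01 : p0 <= 1 / 1000.
Proof.
have /andP[_ h] := kp0e; have /andP[e0 e1] := keps0; case/andP: gam01 => g0 g1; nra.
Qed.
Let delta12 : 0 < delta < 1 / 2. Proof. by case/andP: delta01 => h1 h2; apply/andP; split; lra. Qed.

Lemma bd_potential_op : bd idx_allowed (16 * t) p0 potential_op.
Proof.
move=> x; split; last by move=> l; rewrite /potential_op => /negbTE ->.
by apply: nb_dom Vp => l; rewrite /potential_op; case: ifP; rewrite ?cabs0 ?cabs_ge0.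
Qed.

Lemma freqCB om l m : freqC om (l - m) = freqC om l - freqC om m.
Proof.
rewrite /freqC -rmorphB/=; congr (_%:C%C); rewrite /dotRZ -sumrB; apply: eq_bigr => i _.
by rewrite !mxE rmorphB/= mulrBr.
Qed.

Let half16 : 16 * t / 2 = 8 * t. Proof. by field. Qed.

Lemma approx_eigen_of om (la : Idx -> C) (W r : opT R d Idx) eta :
  bd idx_allowed (16 * t / 2) eps (fun x l => W x l - ido R x l) ->
  (forall x, cabs (la x) <= 1) -> bd idx_allowed (16 * t / 2) eta r ->
  (forall x l, (freqC om l + energyC (idx_shift x l)) * W x l + cmul idx_shift potential_op W x l
     - W x l * (energyC x + la x) = r x l) ->
  approx_eigen K t V eps eta om la W.
Proof.
rewrite half16 => We la1 rb H x; have [Wn Ws] := We x; have [rn rs] := rb x.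
have WS l : ~~ idx_allowed x l -> W x l = 0.
  move=> nl; have := Ws l nl; rewrite /ido; have [l0|_] := eqVneq l 0; last by rewrite subr0.
  by move: nl; rewrite l0 ial0.
split => //; exists (r x) => // l al.
have -> : gconv V (W x) l = cmul idx_shift potential_op W x l.
  apply: eq_csum => m; have [am|am] := boolP (idx_allowed x m); last by rewrite WS ?mulr0.
  by rewrite /potential_op ial_sh ialD' ?ialN.
rewrite -H; have := ien_sh R al => E.
have -> : dotRZ om l + idx_slope x l + mom_sq l = dotRZ om l + idx_energy R (idx_shift x l) - idx_energy R x by rewrite -addrA -E; ring.
by rewrite rmorphB rmorphD/= /freqC /energyC; ring.
Qed.

(** A statement about the iteration, instantiated at the frequency om with the data of this
    section. *)
Notation kk L om := (L R d Idx idx_shift idx_allowed (@ish0 d K) (@ishD d K) (@ial0 d K) (@ialD d K) (freqC om) energyC potential_op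
  (freqCB om) C0 (16 * t) p0 gam tau a0 gam0 C0pos bd_potential_op rho f0 erefl erefl f0rho tailrho p00).

Let rho01 : 0 < rho <= 1 / 2.
Proof.
rewrite /rho invr_gt0 exprn_gt0//= div1r lef_pV2 ?posrE ?exprn_gt0//.
by rewrite -[leLHS]expr1 ler_weXn2l ?ler1n.
Qed.

Definition kam_residual n : R := 2 * (p0 * rho ^+ n).
Definition stage n : set 'rV[R]_d :=
  [set om | [/\ cube om, dioph tau gam om & forall k, (k < n)%N -> kam_good om k]].

Lemma kam_eig_at0 om x : kam_eig_at om 0 x = 0. Proof. by []. Qed.

Lemma kam_eig_at_le om n x : (forall k, (k < n)%N -> kam_good om k) -> cabs (kam_eig_at om n x) <= 2 * p0 * (1 - 2 ^- n).
Proof.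
elim: n => [|n ih] g.
  by rewrite kam_eig_at0 cabs0 expr0 invr1 subrr mulr0.
rewrite /kam_eig_at klamS; apply: le_trans (cabsD _ _) _.
have g' k : (k < n)%N -> kam_good om k by move=> kn; apply: g; exact: leqW.
have h1 := ih g'; have h2 : cabs (kP idx_shift (freqC om) energyC potential_op C0 n x 0) <= p0 * rho ^+ n.
  by apply: (kk (@kP_bound) om); exact: g'.
have h3 : rho ^+ n <= 2 ^- n.
  case/andP: rho01 => r0 r1; rewrite -exprVn lerXn2r ?nnegrE ?invr_ge0 ?(ltW r0)//.
  by rewrite -div1r.
have h4 : p0 * rho ^+ n <= p0 * 2 ^- n by rewrite ler_wpM2l.
have E : 2 ^- n.+1 = 2 ^- n / 2 :> R by rewrite exprS invfM mulrC.
rewrite E; apply: le_trans (lerD h1 (le_trans h2 h4)) _; lra.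
Qed.

Lemma approx_eigen_at om n : (forall k, (k < n)%N -> kam_good om k) -> approx_eigen K t V eps (kam_residual n) om (kam_eig_at om n) (kam_col_at om n).
Proof.
move=> g; apply: (@approx_eigen_of om _ _ (cmul idx_shift (kam_col_at om n) (kP idx_shift (freqC om) energyC potential_op C0 n))).
- have h := kk (@kW_bound) om g.
  have f8 : 4 * f0 <= eps by rewrite /eps ler_wpM2r//; lra.
  exact: (@bd_le R d Idx idx_allowed (16 * t / 2) (16 * t / 2) (4 * f0) eps _ (lexx _) f8 h).
- move=> x; apply: le_trans (kam_eig_at_le x g) _.
  have h : 0 < 2 ^- n :> R by rewrite invr_gt0 exprn_gt0.
  by move: p01 p00 => h1 h2; nra.
- exact: (kk (@bd_kresidual) om g).
- by move=> x l; exact: (kk (@kresidual) om x l g).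
Qed.

Lemma approx_eigen_limit om : (forall n, kam_good om n) -> approx_eigen K t V eps 0 om (kam_eig om) (kam_col om).
Proof.
move=> g; apply: (@approx_eigen_of om _ _ (fun _ _ => 0)).
- exact: (kk (@bd_limW) om g).
- move=> x; have := kk (@limlam_bound) om g 0%N x; rewrite -/(kam_eig_at om 0) kam_eig_at0 subr0 expr0 mulr1 => /le_trans; apply.
  by move: p01 => h1; lra.
- by move=> x; split => //; apply: sle0 => // l; rewrite cabs0 mulr0.
- move=> x l; rewrite (kk (@limW_intertwines) om g x l); exact: subrr.
Qed.

(** For [inl j] the excess over the reduced eigenvalue, so that lam_j is the sum of the corrections
    of its reduced column and of [inl j]. Real parts, because at a finite stage the eigenvalues are
    real only up to the residual. *)
Definition eig_corr (la : Idx -> C) (x : Idx) : R :=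
  match x with
  | inl j => complex.Re (la (inl j)) - complex.Re (la (inr (vgen delta j, bgen delta j)))
  | inr vb => complex.Re (la (inr vb))
  end.

Let eps14 : 0 <= eps <= 1 / 4.
Proof. by have /andP[h1 h2] := keps0; rewrite h1/=; lra. Qed.
Let Cap0 : 0 <= loss_const Q. Proof. rewrite /loss_const; apply: mulr_ge0; [exact: ler0n|apply: exprn_ge0; exact: le_trans ler01 Q1]. Qed.

Let Q0 : 0 <= Q. Proof. exact: le_trans ler01 Q1. Qed.
Let eps_ge0 : 0 <= eps. Proof. by case/andP: eps14. Qed.
Let CQ0 : 0 <= loss_const Q * Q. Proof. exact: mulr_ge0 Cap0 Q0. Qed.
Let CQe0 : 0 <= loss_const Q * Q * eps. Proof. exact: mulr_ge0 CQ0 eps_ge0. Qed.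
Opaque loss_const.

Let Re_conj (z w : C) : `|complex.Re z - complex.Re w| <= cabs (z - (w^*)%C).
Proof.
have -> : complex.Re z - complex.Re w = complex.Re (z - (w^*)%C) by case: z w => [a b] [c e].
exact: cabs_Re.
Qed.

Lemma eig_corr_bound om la W eta x : cube om -> dioph tau gam om -> 0 <= eta <= 2 * eps ->
  approx_eigen K t V eps eta om la W ->
  `|eig_corr la x| <= 2 * loss_const Q * Q * (p0 * eps) * wgt (decay_rate K t) delta x + loss_const Q * Q * eta.
Proof.
move=> oc od e2 sol; have e0 : 0 <= eta by case/andP: e2.
have pe0 : 0 <= p0 * eps by rewrite mulr_ge0//; case/andP: eps14.
case: x => [j|[v b]].
  apply: le_trans (Re_conj _ _) _.
  apply: le_trans (lam_diff delta12 t0 ab VN zV gam01 eps14 kp0e e2 Vp oc od sol oc od sol erefl erefl erefl) _.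
  by rewrite /wgt; set s := (1 / _ + _ : R); lra.
apply: le_trans (cabs_Re _) _.
apply: le_trans (lam_reduced t0 ab VN zV gam01 eps14 kp0e e2 Vp oc od sol v b) _.
rewrite /wgt; set B := jap b%:~R; set ek := expR _.
have B0 : 0 < B ^+ 2 by rewrite exprn_gt0// jap_gt0.
have -> : loss_const Q * (p0 * eps) / B ^+ 2 * ek = loss_const Q * ((p0 * eps) * (ek / B ^+ 2)) by ring.
have -> : 2 * loss_const Q * Q * (p0 * eps) * (ek / B ^+ 2) = 2 * loss_const Q * Q * ((p0 * eps) * (ek / B ^+ 2)) by ring.
have y0 : 0 <= (p0 * eps) * (ek / B ^+ 2) by rewrite mulr_ge0// divr_ge0 ?expR_ge0// ltW.
have c1 : loss_const Q <= loss_const Q * Q by rewrite ler_peMr.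
apply: lerD; apply: ler_wpM2r => //.
by rewrite -mulrA; move: Cap0 => c0; lra.
Qed.

Lemma eig_corr_lip om om' la la' W W' eta x h : 0 <= eta <= 2 * eps ->
  approx_eigen K t V eps eta om la W -> approx_eigen K t V eps eta om' la' W' ->
  0 <= h -> (forall i, `|om 0 i - om' 0 i| <= h) ->
  `|eig_corr la x - eig_corr la' x| <= 1 / 8 * h + 2 * loss_const Q * Q * eta.
Proof.
move=> e2 sol sol' h0 oh; have e0 : 0 <= eta by case/andP: e2.
have L y : `|complex.Re (la y) - complex.Re (la' y)| <= loss_const Q * (eps ^+ 2 * h + eta).
  apply: le_trans (Re_conj _ _) _; exact: (lam_lip t0 ab VN eps14 e2 Vp sol sol' erefl h0 oh).
have B : 2 * (loss_const Q * (eps ^+ 2 * h + eta)) <= 1 / 8 * h + 2 * loss_const Q * Q * eta.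
  have m1 : loss_const Q * eta <= loss_const Q * Q * eta by rewrite ler_wpM2r// ler_peMr.
  have m2 : loss_const Q * eps <= 1 / 32.
    have := epsCap; have m3 : loss_const Q * eps <= loss_const Q * Q * eps.
      by rewrite ler_wpM2r ?ler_peMr//; case/andP: eps14.
    by lra.
  have m4 : loss_const Q * eps * (eps * h) <= 1 / 32 * (1 / 4 * h).
    case/andP: eps14 => e00 e01.
    have x1 : 0 <= loss_const Q * eps by exact: mulr_ge0.
    have x2 : 0 <= eps * h by exact: mulr_ge0.
    exact: ler_pM x1 x2 m2 (ler_wpM2r h0 e01).
  have -> : 2 * (loss_const Q * (eps ^+ 2 * h + eta)) = 2 * (loss_const Q * eps * (eps * h)) + 2 * (loss_const Q * eta) by ring.
  lra.
have L1 x' y := le_trans (ler_normB x' y).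
case: x => [j|vb] /=; last by apply: le_trans (L _) _; have := le_trans (normr_ge0 _) (L (inr vb)); lra.
apply: le_trans B.
have -> : complex.Re (la (inl j)) - complex.Re (la (inr (vgen delta j, bgen delta j))) -
  (complex.Re (la' (inl j)) - complex.Re (la' (inr (vgen delta j, bgen delta j)))) =
  (complex.Re (la (inl j)) - complex.Re (la' (inl j))) - (complex.Re (la (inr (vgen delta j, bgen delta j)))
   - complex.Re (la' (inr (vgen delta j, bgen delta j)))) by ring.
apply: le_trans (ler_normB _ _) _; rewrite mulr2n mulrDl mul1r; exact: lerD.
Qed.

Lemma eig_corr_gam : 2 * loss_const Q * Q * (p0 * eps) <= gam.
Proof.
have -> : 2 * loss_const Q * Q * (p0 * eps) = p0 * (2 * loss_const Q * Q * eps) by ring.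
have h1 : 2 * loss_const Q * Q * eps <= 1.
  by move: epsCap CQe0; lra.
have /andP[_ h2] := kp0e; have /andP[e0 e1] := keps0.
have h3 : eps * gam <= gam by rewrite ler_piMl ?(ltW gam0)//; lra.
have h4 : p0 * (2 * loss_const Q * Q * eps) <= p0 * 1 by rewrite ler_wpM2l.
by lra.
Qed.

Lemma kam_residual_le n : 0 <= kam_residual n <= 2 * eps.
Proof.
have r0 : 0 <= rho ^+ n by rewrite exprn_ge0//; case/andP: rho01 => /ltW.
have r1 : rho ^+ n <= 1 by rewrite exprn_ile1//; case/andP: rho01 => /ltW // _; lra.
have /andP[_ h2] := kp0e; have /andP[e0 e1] := keps0; case/andP: gam01 => g0 g1.
rewrite /kam_residual mulr_ge0 ?mulr_ge0//= ler_wpM2l//.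
by apply: le_trans (_ : p0 * 1 <= _); [rewrite ler_wpM2l|nra].
Qed.

(** Places the error due to the residual below the threshold of step n, as [ch_e] demands. *)
Lemma kam_residual_thr n : 2 * loss_const Q * Q * kam_residual n <= gam / ((kcut C0 n)%:R ^+ tau).
Proof.
have T0 := threshold_gt0 tau gam0 C0pos n.
have h := @kam_ratio R C0 p0 gam tau gam0 rho f0 erefl erefl n.
rewrite -/(threshold C0 gam tau n); set T := threshold _ _ _ _ in T0 h *.
have h2 : p0 * rho ^+ n <= f0 * T.
  rewrite -ler_pdivrMr//; apply: le_trans h _; rewrite ler_piMr//.
  by rewrite invf_le1 ?exprn_gt0// exprn_ege1// ler1n.
have h3 : 4 * loss_const Q * Q * f0 <= 1 by move: epsCap CQe0; rewrite /eps; lra.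
rewrite /kam_residual; apply: (@le_trans _ _ (4 * loss_const Q * Q * (f0 * T))).
  have -> : 2 * loss_const Q * Q * (2 * (p0 * rho ^+ n)) = 4 * (loss_const Q * Q) * (p0 * rho ^+ n) by ring.
  have -> : 4 * loss_const Q * Q * (f0 * T) = 4 * (loss_const Q * Q) * (f0 * T) by ring.
  by apply: ler_wpM2l h2; exact: mulr_ge0 (ler0n _ _) CQ0.
by rewrite mulrA ler_piMl// ltW.
Qed.

Definition signed_corr (la : Idx -> C) (z : SignedIdx) : R := if z.1 then eig_corr la z.2 else - eig_corr la z.2.
Definition signed_wgt (z : SignedIdx) : R := wgt (decay_rate K t) delta z.2.

Variables (S Cc : R).
Hypothesis S1 : 1 <= S.
Hypothesis wS : sums_le (fun z => signed_wgt z ^+ 8) S.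
Hypothesis Cc0 : 0 < Cc.
Hypothesis comb4 : forall (f : SignedIdx -> 'rV[R]_d -> R) nu A l i kp e g L,
  comb_hyp S 4 (g / L ^+ tau) f nu A l i kp e g L ->
  outer_le [set om | A om /\ exists (m : int) (s : seq SignedIdx), (size s <= 4)%N /\
      `|dotRZ om l + m%:~R + \sum_(x <- s) f x om| < g / L ^+ tau]
    (Cc * (g / L ^+ (2 * d + 1))).

Let kap0 : 0 < decay_rate K t.
Proof. by rewrite /decay_rate divr_gt0 ?mulr_gt0// ltr_wpDr. Qed.

Lemma signed_corr_bound om la W eta z : cube om -> dioph tau gam om -> 0 <= eta <= 2 * eps ->
  approx_eigen K t V eps eta om la W ->
  `|signed_corr la z| <= 2 * loss_const Q * Q * (p0 * eps) * signed_wgt z + loss_const Q * Q * eta.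
Proof.
move=> oc od e2 sol; have := eig_corr_bound z.2 oc od e2 sol.
by rewrite /signed_corr; case: z.1; rewrite ?normrN.
Qed.

Lemma signed_corr_lip om om' la la' W W' eta z h : 0 <= eta <= 2 * eps ->
  approx_eigen K t V eps eta om la W -> approx_eigen K t V eps eta om' la' W' ->
  0 <= h -> (forall i, `|om 0 i - om' 0 i| <= h) ->
  `|signed_corr la z - signed_corr la' z| <= 1 / 8 * h + 2 * loss_const Q * Q * eta.
Proof.
move=> e2 sol sol' h0 oh; have := eig_corr_lip z.2 e2 sol sol' h0 oh.
by rewrite /signed_corr; case: z.1 => //; rewrite -opprD normrN.
Qed.

Lemma entry_ex (l : G) : l != 0 -> exists i, 1 <= (`|l 0%R i|%N)%:R :> R.
Proof.
move=> l0; have [i li] : exists i, l 0 i != 0.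
  apply: contrapT => h; move/eqP: l0; apply; apply/rowP => i; rewrite mxE.
  by apply/eqP/negPn/negP => li; apply: h; exists i.
by exists i; rewrite ler1n absz_gt0.
Qed.

Lemma comb_bound (l : G) (L g : R) : (1 + n1 l)%:R <= 2 * L -> 0 < L -> 0 <= g ->
  g / L ^+ (2 * d + 1) <= g * 4 ^+ d * wlat R l / L.
Proof.
move=> lL L0 g0; rewrite -!mulrA ler_wpM2l//.
have n0 : 0 < (1 + n1 l)%:R :> R by rewrite ltr0n.
rewrite exprD expr1 invfM mulrA ler_wpM2r ?invr_ge0 ?(ltW L0)//.
rewrite /wlat (_ : 4 ^+ d = 2 ^+ (2 * d)); last by rewrite exprM; congr (_ ^+ _); ring.
rewrite -ler_pdivrMl ?exprn_gt0// -invfM -exprMn lef_pV2 ?posrE ?exprn_gt0 ?mulr_gt0//.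
by rewrite lerXn2r ?nnegrE ?(ltW n0)// mulr_ge0// ltW.
Qed.

Definition nondioph : set 'rV[R]_d := @cube R d `\` [set om | dioph tau gam om].

(** The same strip estimate with zero corrections and the empty list. *)
Lemma outer_nondioph : outer_le nondioph (Cc * 4 ^+ d * 4 ^+ d * gam).
Proof.
pose F (l : G) := if l == 0 then set0 else [set om : 'rV[R]_d | cube om /\ exists (m : int) (s : seq SignedIdx),
   (size s <= 4)%N /\ `|dotRZ om l + m%:~R + \sum_(x <- s) 0| < gam / (1 + n1 l)%:R ^+ tau].
apply: (@outer_sub _ _ _ (\bigcup_l F l)).
  move=> om [oc nd]; apply: contrapT => h; apply: nd => l l0.
  rewrite leNgt; apply/negP => small; apply: h; exists l => //.
  rewrite /F (negbTE l0); split => //; exists 0, [::]; split => //.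
  rewrite big_nil !addr0 ltr_pdivlMr ?exprn_gt0 ?ltr0n// mulrC//.
have w0 : 0 <= Cc * 4 ^+ d * gam by rewrite mulr_ge0 ?(ltW gam0)// mulr_ge0 ?(ltW Cc0)// exprn_ge0.
apply: (@outer_bigcup _ _ hd _ _ (fun l => Cc * 4 ^+ d * gam * wlat R l)); last first.
  have -> : Cc * 4 ^+ d * 4 ^+ d * gam = Cc * 4 ^+ d * gam * 4 ^+ d by ring.
  apply: sleZ w0 _; exact: sle_wlat.
move=> l; rewrite /F; have [_|l0] := eqVneq l 0.
  apply: outer_leW (outer_set0 _ hd); exact: mulr_ge0 w0 (wlat_ge0 _ _).
have [i li] := entry_ex l0.
have L2 : 2 <= (1 + n1 l)%:R :> R by rewrite ler_nat ltnS n1_gt0.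
have L0 : 0 < (1 + n1 l)%:R :> R by rewrite ltr0n.
have cb := @comb_bound l (1 + n1 l)%:R gam _ L0 (ltW gam0).
have {}cb : gam / (1 + n1 l)%:R ^+ (2 * d + 1) <= gam * 4 ^+ d * wlat R l.
  apply: le_trans (cb _) _; first by rewrite ler_peMl// ?ler1n// ltW.
  rewrite ler_piMr//; last by rewrite invf_le1// (le_trans _ L2)// ler1n.
  by rewrite mulr_ge0 ?wlat_ge0// mulr_ge0 ?exprn_ge0// ltW.
apply: (@outer_leW _ _ _ (Cc * (gam / (1 + n1 l)%:R ^+ (2 * d + 1)))).
  by apply: le_trans (ler_wpM2l (ltW Cc0) cb) _; rewrite le_eqVlt; apply/orP; left; apply/eqP; ring.
apply: (@comb4 (fun _ _ => 0) signed_wgt _ _ i (1 / 8) 0); split => //.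
- by rewrite ler_nat leq_addl.
- by apply: le_trans li; lra.
- by rewrite lexx/= divr_ge0 ?(ltW gam0)// exprn_ge0// ltW.
- by move=> z; apply: wgt01.
- by move=> z om _; rewrite normr0 addr0 mulr_ge0 ?(ltW gam0)//; case/andP: (@wgt01 R (decay_rate K t) delta kap0 delta01 z.2).
- by move=> z om om' r _ _ r0 _; rewrite subrr normr0 addr0 mulr_ge0.
Qed.

(** The real part suffices, since a small divisor has a small real part; slope and |mom l|^2
    together form the integer m. *)
Lemma Re_divisor om n x l : idx_allowed x l -> exists m : int,
  complex.Re (divisor idx_shift (freqC om) energyC (kam_eig_at om n) x l) =
  dotRZ om l + m%:~R + (complex.Re (kam_eig_at om n (idx_shift x l)) - complex.Re (kam_eig_at om n x)).
Proof.
move=> al; have [m mE] := ibet_int R al; exists (m + sqnormZ (mom l)).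
rewrite /divisor /freqC /energyC -!addrA; have := ien_sh R al; rewrite mE /mom_sq => E.
have -> : forall a b c : R, forall u v : C, complex.Re (a%:C%C + (b%:C%C + (- c%:C%C + (u - v)))) =
   a + (b - c + (complex.Re u - complex.Re v)).
  by move=> a b c [u1 u2] [v1 v2] /=; ring.
by rewrite E rmorphD/= !addrA.
Qed.

Let telescope4 (D m a b c e T : R) : `|D + m + (a - c)| < T ->
  `|D + m + (a - b + (b + (- (c - e) + (- e + 0))))| < T.
Proof. by have -> : a - b + (b + (- (c - e) + (- e + 0))) = a - c by ring. Qed.

(** A failure at step n places om in a strip with at most four signed corrections, two for each of
    the columns x and x + l. Of the power 2d + 1 of the cutoff, 2d pays for the sum over l, and the
    last one gives 2^-n and hence a sum over n. *)
Lemma outer_stage n : outer_le (stage n `\` [set om | kam_good om n])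
  (Cc * 4 ^+ d * 4 ^+ d * gam * 2 ^- n).
Proof.
set L : R := (kcut C0 n)%:R; pose th := gam / L ^+ tau.
have C2n : (2 <= kcut C0 n)%N by rewrite /kcut -[2%N]muln1 leq_mul// expn_gt0.
have L2 : 2 <= L by rewrite ler_nat.
have L0 : 0 < L by exact: lt_le_trans L2.
have Ln : L^-1 <= 2 ^- n.
  rewrite lef_pV2 ?posrE ?exprn_gt0// /L /kcut natrM natrX ler_peMl ?exprn_ge0//.
  by rewrite ler1n.
pose F (l : G) := if (l != 0) && (n1 l <= kcut C0 n)%N then [set om | stage n om /\ exists (m : int) (s : seq SignedIdx),
   (size s <= 4)%N /\ `|dotRZ om l + m%:~R + \sum_(z <- s) signed_corr (kam_eig_at om n) z| < th] else set0.
apply: (@outer_sub _ _ _ (\bigcup_l F l)).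
  move=> om [st ng]; apply: contrapT => h; apply: ng => x l al l0 ln.
  rewrite leNgt; apply/negP => small; apply: h; exists l => //.
  rewrite /F l0 ln; split => //; have [m E] := Re_divisor om n al.
  have {}small := le_lt_trans (cabs_Re _) small; rewrite E in small.
  exists m; case: x {E al} small => [j|vb] small.
    exists [:: (true, inl (j + mom l)); (true, inr (vgen delta (j + mom l), bgen delta (j + mom l)));
      (false, inl j); (false, inr (vgen delta j, bgen delta j))]; split => //.
    by rewrite !big_cons big_nil /signed_corr /=; exact: telescope4 small.
  exists [:: (true, idx_shift (inr vb) l); (false, inr vb)]; split => //.
  rewrite !big_cons big_nil /signed_corr addr0 /=; move: small; case: vb => v b /=.
  by rewrite addrA.
have w0 : 0 <= Cc * 4 ^+ d * gam * 2 ^- n.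
  by rewrite mulr_ge0 ?invr_ge0 ?exprn_ge0// mulr_ge0 ?(ltW gam0)// mulr_ge0 ?(ltW Cc0)// exprn_ge0.
apply: (@outer_bigcup _ _ hd _ _ (fun l => Cc * 4 ^+ d * gam * 2 ^- n * wlat R l)); last first.
  have -> : Cc * 4 ^+ d * 4 ^+ d * gam * 2 ^- n = Cc * 4 ^+ d * gam * 2 ^- n * 4 ^+ d by ring.
  apply: sleZ w0 _; exact: sle_wlat.
move=> l; rewrite /F; case: ifPn => [/andP[l0 ln]|_]; last first.
  apply: outer_leW (outer_set0 _ hd); exact: mulr_ge0 w0 (wlat_ge0 _ _).
have [i li] := entry_ex l0.
have lL : (n1 l)%:R <= L by rewrite ler_nat.
have cb : gam / L ^+ (2 * d + 1) <= gam * 4 ^+ d * wlat R l * 2 ^- n.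
  have l2 : (1 + n1 l)%:R <= 2 * L by rewrite natrD; lra.
  apply: le_trans (comb_bound l2 L0 (ltW gam0)) _; apply: ler_wpM2l Ln.
  by rewrite mulr_ge0 ?wlat_ge0// mulr_ge0 ?exprn_ge0// ltW.
apply: (@outer_leW _ _ _ (Cc * (gam / L ^+ (2 * d + 1)))).
  by apply: le_trans (ler_wpM2l (ltW Cc0) cb) _; rewrite le_eqVlt; apply/orP; left; apply/eqP; ring.
have ek := kam_residual_le n; have ek0 : 0 <= kam_residual n by case/andP: ek.
(* With Lipschitz constant 1/8 the condition [ch_kp] for four corrections reads 1 <= |l_i|, true at
   any nonzero entry. *)
apply: (@comb4 (fun z om => signed_corr (kam_eig_at om n) z) signed_wgt _ _ i (1 / 8) (2 * loss_const Q * Q * kam_residual n)); split; [|exact: gam01|exact: L2|exact: lL|exact: li| | | | |exact: wS| |].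
- by move=> om [].
- by rewrite divr_ge0.
- by apply: le_trans li; lra.
- by apply/andP; split; [have := mulr_ge0 CQ0 ek0; lra|exact: kam_residual_thr].
- by move=> z; apply: wgt01.
- move=> z om [oc od g]; apply: le_trans (signed_corr_bound z oc od ek (approx_eigen_at g)) _.
  have sw0 : 0 <= signed_wgt z by case/andP: (@wgt01 R (decay_rate K t) delta kap0 delta01 z.2).
  apply: lerD; first exact: ler_wpM2r eig_corr_gam.
  have := mulr_ge0 CQ0 ek0; lra.
- move=> z om om' r [oc od g] [oc' od' g'] r0 hr.
  exact: signed_corr_lip ek (approx_eigen_at g) (approx_eigen_at g') r0 hr.
Qed.

Definition kam_set : set 'rV[R]_d := [set om | [/\ cube om, dioph tau gam om & forall n, kam_good om n]].

Lemma outer_kam_set : outer_le (@cube R d `\` kam_set) (3 * Cc * 16 ^+ d * gam).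
Proof.
have w0 : 0 <= Cc * 4 ^+ d * 4 ^+ d * gam.
  by rewrite mulr_ge0 ?(ltW gam0)// mulr_ge0 ?exprn_ge0// mulr_ge0 ?(ltW Cc0)// exprn_ge0.
have U := @outer_bigcup _ _ hd nat _ _ _ outer_stage (sleZ w0 (@sle_half R)).
have e16 : 16 ^+ d = 4 ^+ d * 4 ^+ d :> R by rewrite -exprMn; congr (_ ^+ _); ring.
have -> : 3 * Cc * 16 ^+ d * gam = Cc * 4 ^+ d * 4 ^+ d * gam + Cc * 4 ^+ d * 4 ^+ d * gam * 2.
  by rewrite e16; ring.
apply: outer_sub (outerU hd outer_nondioph U) => om [oc nk].
have [od|nd] := pselect (dioph tau gam om); last by left.
right; apply: contrapT => h; apply: nk; split => //.
have H n : forall k, (k < n)%N -> kam_good om k.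
  elim: n => [//|n ih] k; rewrite ltnS leq_eqVlt => /orP[/eqP ->|]; last exact: ih.
  apply: contrapT => ng; apply: h; exists n => //; split => //; split => //.
by move=> n; exact: (H n.+1).
Qed.

Lemma kam_eig_real om x : (forall n, kam_good om n) -> kam_eig om x = (complex.Re (kam_eig om x))%:C%C.
Proof.
move=> g; have e00 : 0 <= (0 : R) <= 2 * eps by rewrite lexx/= mulr_ge0.
have sol := approx_eigen_limit g.
have h0 : forall i, `|om 0 i - om 0 i| <= 0 by move=> i; rewrite subrr normr0.
have := lam_lip t0 ab VN eps14 e00 Vp sol sol (erefl x) (lexx 0) h0; rewrite mulr0 addr0 mulr0.
move=> h; have /cabs_eq0 : cabs (kam_eig om x - ((kam_eig om x)^*)%C) = 0.
  by apply/eqP; rewrite eq_le cabs_ge0 andbT.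
case: (kam_eig om x) => u v /eqP; rewrite eq_complex /= => /andP[_ /eqP v0].
by apply/eqP; rewrite eq_complex /= eqxx/=; apply/eqP; move: v0; lra.
Qed.

Definition kam_col_inv om := neum idx_shift (fun x l => - (kam_col om x l - ido R x l)).

Section Inverse.
Variable om : 'rV[R]_d.
Hypothesis g : forall n, kam_good om n.

Let t8 : 0 <= 8 * t. Proof. by rewrite mulr_ge0// ltW. Qed.
Lemma bd_kam_col : bd idx_allowed (8 * t) eps (fun x l => kam_col om x l - ido R x l).
Proof. by rewrite -half16; exact: (kk (@bd_limW) om g). Qed.
Let eps1 : eps < 1. Proof. by have /andP[_ h] := keps0; lra. Qed.

Lemma bd_kam_col_inv : bd idx_allowed (8 * t) 2 (kam_col_inv om).
Proof.
have h := bd_neum (@ial0 d K) (@ialD d K) t8 (bdN bd_kam_col) eps1.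
apply: (@bd_le R d Idx _ _ _ _ _ _ (lexx _) _ h).
have /andP[_ e1] := keps0; have p : 0 < 1 - eps by lra.
rewrite -[leRHS]invrK lef_pV2 ?posrE ?invr_gt0//; lra.
Qed.

Let lwE : kam_col om = (fun x l => ido R x l + - (- (kam_col om x l - ido R x l))).
Proof. by apply/funext => x; apply/funext => l; ring. Qed.

Lemma kam_col_invK : cmul idx_shift (kam_col_inv om) (kam_col om) = @ido R d Idx.
Proof.
have F1 := bdN bd_kam_col; have I1 := @bd_ido R d Idx _ (@ial0 d K) (8 * t).
have D := cmulDr idx_shift t8 bd_kam_col_inv I1 (bdN F1); have N := cmulNr idx_shift t8 bd_kam_col_inv F1.
rewrite [in LHS]lwE; apply: (etrans D); rewrite N (cmul1r (@ish0 d K)).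
rewrite /kam_col_inv (neum_cmul (@ish0 d K) (@ishD d K) (@ial0 d K) (@ialD d K) t8 F1 eps1).
by apply/funext => x; apply/funext => l; ring.
Qed.

Lemma kam_colK : cmul idx_shift (kam_col om) (kam_col_inv om) = @ido R d Idx.
Proof.
have F1 := bdN bd_kam_col; have I1 := @bd_ido R d Idx _ (@ial0 d K) (8 * t).
rewrite [in LHS]lwE (cmulDl idx_shift t8 I1 (bdN F1) bd_kam_col_inv) cmul1l (cmulNl idx_shift t8 F1 bd_kam_col_inv).
rewrite /kam_col_inv (cmul_neum (@ial0 d K) (@ialD d K) t8 F1 eps1).
by apply/funext => x; apply/funext => l; ring.
Qed.

Lemma kam_col_intertwines j l :
  ((dotRZ om l)%:C%C + (sqnormZ (j + mom l))%:~R) * kam_col om (inl j) l +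
    csum (fun m => V (l - m) * kam_col om (inl j) m) =
  kam_col om (inl j) l * ((sqnormZ j)%:~R + eig_corr (kam_eig om) (inr (vgen delta j, bgen delta j))
    + eig_corr (kam_eig om) (inl j))%:C%C.
Proof.
have h := kk (@limW_intertwines) om g (inl j) l.
have E (m : int) : (m%:~R : C) = (m%:~R : R)%:C%C by rewrite rmorph_int.
have e : (sqnormZ j)%:~R + eig_corr (kam_eig om) (inr (vgen delta j, bgen delta j)) + eig_corr (kam_eig om) (inl j) =
    (sqnormZ j)%:~R + complex.Re (kam_eig om (inl j)) by rewrite /eig_corr; ring.
by rewrite e rmorphD/= -kam_eig_real// E; exact: h.
Qed.

End Inverse.

(* The correction attached to [inl j] is lam_j minus its reduced counterpart. *)
Lemma kam_reduction : exists (A : set 'rV[R]_d) (W U : 'rV[R]_d -> opT R d Idx) (f : Idx -> 'rV[R]_d -> R),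
  [/\ A `<=` @cube R d, outer_le (@cube R d `\` A) (3 * Cc * 16 ^+ d * gam),
    forall om, A om -> [/\ bd idx_allowed (8 * t) eps (fun x l => W om x l - ido R x l),
      bd idx_allowed (8 * t) 2 (U om), cmul idx_shift (U om) (W om) = @ido R d Idx,
      cmul idx_shift (W om) (U om) = @ido R d Idx &
      forall j l, ((dotRZ om l)%:C%C + (sqnormZ (j + mom l))%:~R) * W om (inl j) l +
          csum (fun m => V (l - m) * W om (inl j) m) =
        W om (inl j) l * ((sqnormZ j)%:~R + f (inr (vgen delta j, bgen delta j)) om + f (inl j) om)%:C%C],
    forall x om, A om -> `|f x om| <= 2 * loss_const Q * Q * (p0 * eps) * wgt (decay_rate K t) delta x &
    forall x om om' h, A om -> A om' -> 0 <= h -> (forall i, `|om 0 i - om' 0 i| <= h) ->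
      `|f x om - f x om'| <= 1 / 8 * h].
Proof.
have e00 : 0 <= (0 : R) <= 2 * eps by rewrite lexx/= mulr_ge0.
exists kam_set, kam_col, kam_col_inv, (fun x om => eig_corr (kam_eig om) x); split.
- by move=> om [].
- exact: outer_kam_set.
- move=> om [oc od g]; split; [exact: bd_kam_col|exact: bd_kam_col_inv|exact: kam_col_invK|exact: kam_colK|exact: kam_col_intertwines].
- move=> x om [oc od g]; apply: le_trans (eig_corr_bound x oc od e00 (approx_eigen_limit g)) _.
  by rewrite mulr0 addr0.
- move=> x om om' h [oc od g] [oc' od' g'] h0 oh.
  apply: le_trans (eig_corr_lip x e00 (approx_eigen_limit g) (approx_eigen_limit g') h0 oh) _.
  by rewrite mulr0 addr0.
Qed.

End KamSet.

(** * Estimates for e^(ix) *)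

Section Cis.
Variable R : realType.
Notation C := R[i].

Lemma mvt0 (f df : R -> R) (x : R) : (forall y : R, is_derive y 1 f (df y)) ->
  exists2 c, `|c| <= `|x| & f x - f 0 = df c * x.
Proof.
move=> fd; have fc : continuous f.
  by move=> y; apply: differentiable_continuous; apply/derivable1_diffP; case: (fd y).
have [x0|x0] := leP 0 x.
  have [c + E] := MVT_segment x0 (fun y _ => fd y) (continuous_subspaceT fc).
  rewrite in_itv/= => /andP[c0 cx]; exists c; last by rewrite E subr0.
  by rewrite !ger0_norm.
have [c + E] := MVT_segment (ltW x0) (fun y _ => fd y) (continuous_subspaceT fc).
rewrite in_itv/= => /andP[cx c0]; exists c; first by rewrite !ler0_norm ?lerN2// ltW.
by rewrite -opprB E sub0r mulrN opprK.
Qed.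

Lemma sin_le (x : R) : `|sin x| <= `|x|.
Proof.
have [c _] := @mvt0 sin cos x (@is_derive_sin R); rewrite sin0 subr0 => ->.
rewrite normrM ler_piMl// ler_norml; apply/andP; split; [exact: cos_geN1|exact: cos_le1].
Qed.

Lemma cos_sub1 (x : R) : `|cos x - 1| <= `|x| ^+ 2.
Proof.
have [c cx] := @mvt0 cos (fun y => - sin y) x (@is_derive_cos R); rewrite cos0 => ->.
rewrite normrM normrN expr2 ler_wpM2r//; exact: le_trans (sin_le c) cx.
Qed.

Lemma cos_sub1' (x : R) : `|cos x - 1| <= `|x|.
Proof.
have [c cx] := @mvt0 cos (fun y => - sin y) x (@is_derive_cos R); rewrite cos0 => ->.
rewrite normrM normrN ler_piMl// ler_norml; apply/andP; split; [exact: sin_geN1|exact: sin_le1].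
Qed.

Lemma sin_subx (x : R) : `|sin x - x| <= `|x| ^+ 2.
Proof.
have d (y : R) : is_derive y 1 (fun z : R => sin z - z) (cos y - 1).
  exact: is_deriveB.
have [c cx] := @mvt0 _ _ x d; rewrite sin0 subr0 subr0 => ->.
rewrite normrM expr2 ler_wpM2r//; exact: le_trans (cos_sub1' c) cx.
Qed.

Lemma cabs_le2 (z : C) : cabs z <= `|complex.Re z| + `|complex.Im z|.
Proof.
have -> : z = (complex.Re z)%:C%C + 'i%C * (complex.Im z)%:C%C.
  by case: z => a b; apply/eqP; rewrite eq_complex /=; apply/andP; split; apply/eqP; ring.
apply: le_trans (cabsD _ _) _; rewrite cabsM !cabs_real.
have -> : cabs ('i%C : C) = 1.
  by rewrite /cabs /ComplexField.Normc.normc /= expr0n add0r expr1n sqrtr1.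
by rewrite mul1r /= !mul0r !mul1r !(addr0, add0r, subr0).
Qed.

Lemma cisD (x y : R) : cis (x + y) = cis x * cis y.
Proof.
rewrite /cis cosD sinD; apply/eqP; rewrite eq_complex /= eqxx/=; apply/eqP; ring.
Qed.

Lemma cis0 : cis (0 : R) = 1.
Proof. by rewrite /cis cos0 sin0. Qed.

Lemma cabs_cis (x : R) : cabs (cis x) = 1.
Proof. by rewrite /cabs /cis /ComplexField.Normc.normc /= cos2Dsin2 sqrtr1. Qed.

Lemma cis2pi : cis (2 * pi : R) = 1.
Proof. by rewrite /cis mulr_natl cos2pi sin2pi. Qed.

Lemma cis_period (m : int) : cis (2 * pi * m%:~R : R) = 1.
Proof.
have N (n : nat) : cis (2 * pi * n%:R : R) = 1.
  elim: n => [|n ih]; first by rewrite mulr0 cis0.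
  by rewrite -[n.+1%:R]natr1 mulrDr mulr1 cisD ih mul1r cis2pi.
case: m => n; first exact: N.
rewrite NegzE rmorphN/= mulrN.
have : cis (- (2 * pi * n.+1%:R)) * cis (2 * pi * n.+1%:R) = 1 :> C.
  by rewrite -cisD addNr cis0.
by rewrite N mulr1.
Qed.

Lemma cis_sub (x y : R) : cabs (cis x - cis y) <= 2 * `|x - y|.
Proof.
have -> : cis x - cis y = cis y * (cis (x - y) - 1).
  have -> : cis x = cis y * cis (x - y) by rewrite -cisD addrCA subrr addr0.
  by ring.
rewrite cabsM cabs_cis mul1r; apply: le_trans (cabs_le2 _) _.
rewrite /cis /= subr0 mulr2n mulrDl mul1r; apply: lerD; [exact: cos_sub1'|exact: sin_le].
Qed.

Lemma cis_deriv (th s h : R) : h != 0 ->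
  cabs ((h^-1)%:C%C * (cis ((s + h) * th) - cis (s * th)) - 'i%C * th%:C%C * cis (s * th)) <=
    2 * `|h| * `|th| ^+ 2.
Proof.
move=> h0; have -> : (h^-1)%:C%C * (cis ((s + h) * th) - cis (s * th)) - 'i%C * th%:C%C * cis (s * th) =
   (h^-1)%:C%C * cis (s * th) * (cis (h * th) - 1 - 'i%C * (h * th)%:C%C).
  rewrite mulrDl cisD rmorphM/=.
  have hh : (h^-1)%:C%C * h%:C%C = 1 :> C by rewrite -rmorphM/= mulVf.
  have -> : (h^-1)%:C%C * cis (s * th) * (cis (h * th) - 1 - 'i%C * (h%:C%C * th%:C%C)) =
    (h^-1)%:C%C * cis (s * th) * (cis (h * th) - 1) - ((h^-1)%:C%C * h%:C%C) * (cis (s * th) * 'i%C * th%:C%C) by ring.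
  rewrite hh; ring.
rewrite !cabsM cabs_cis mulr1 cabs_real normfV.
rewrite mulrC ler_pdivrMr ?normr_gt0//.
apply: le_trans (cabs_le2 _) _.
rewrite /cis /= !mul0r !mul1r !subr0 !add0r.
have h1 := cos_sub1 (h * th); have h2 := sin_subx (h * th).
rewrite normrM exprMn in h1 h2.
have -> : 2 * `|h| * `|th| ^+ 2 * `|h| = `|h| ^+ 2 * `|th| ^+ 2 + `|h| ^+ 2 * `|th| ^+ 2 by ring.
apply: lerD; first by apply: le_trans h1; rewrite ?mulr0 ?oppr0 ?addr0 ?subr0.
by apply: le_trans h2; rewrite ?mulr0 ?oppr0 ?addr0 ?subr0.
Qed.

End Cis.

(** * Time dependence and conjugation of the Schrodinger operator *)

Section Phase.
Variables (R : realType) (d : nat) (K : 'M[int]_(d, 2)) (p : R).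
Hypothesis p0 : 0 < p.
Notation G := ('rV[int]_d).
Notation C := R[i].
Notation hop := (@hop R d K).
Notation idx_shift := (idx_shift K).

(** Restores the time phase of each mode, so that [hop (twist phi A)] is the operator at the angle
    phi. *)
Definition twist (phi : 'rV[R]_d) (A : opT R d Idx) : opT R d Idx :=
  fun x l => cis (dotRZ phi l) * A x l.

Lemma exp_bounded_twist s M phi A : exp_bounded s M A -> exp_bounded s M (twist phi A).
Proof. by move=> h x l; rewrite /twist cabsM cabs_cis mul1r. Qed.

Lemma hop_ext A B : (forall j l, A (inl j) l = B (inl j) l) -> hop A = hop B.
Proof. by move=> AB; apply/funext => u; apply/funext => j; apply: eq_csum => l; rewrite AB. Qed.

Lemma dotRZB (phi psi : 'rV[R]_d) (l : G) : dotRZ (phi - psi) l = dotRZ phi l - dotRZ psi l.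
Proof. by rewrite /dotRZ -sumrB; apply: eq_bigr => i _; rewrite !mxE mulrBl. Qed.

Lemma dotRZBr (phi : 'rV[R]_d) (l m : G) : dotRZ phi (l - m) = dotRZ phi l - dotRZ phi m.
Proof. by rewrite /dotRZ -sumrB; apply: eq_bigr => i _; rewrite !mxE rmorphB/= mulrBr. Qed.

Lemma dotRZZ (t : R) (phi : 'rV[R]_d) (l : G) : dotRZ (t *: phi) l = t * dotRZ phi l.
Proof. by rewrite /dotRZ mulr_sumr; apply: eq_bigr => i _; rewrite !mxE mulrA. Qed.

Lemma twist_period phi (m : 'rV[int]_d) A : twist (phi + (2 * pi) *: map_mx intr m) A = twist phi A.
Proof.
apply/funext => x; apply/funext => l; rewrite /twist; congr (_ * _).
have -> : dotRZ (phi + (2 * pi) *: map_mx intr m) l = dotRZ phi l + 2 * pi * (dotZ m l)%:~R.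
  rewrite /dotRZ /dotZ rmorph_sum/= mulr_sumr -big_split/=; apply: eq_bigr => i _.
  by rewrite !mxE rmorphM/=; ring.
by rewrite cisD cis_period mulr1.
Qed.

Section Rate.
Variables (s M : R) (A : opT R d Idx).
Hypotheses (s0 : 0 < s) (AM : exp_bounded s M A).

Let hopB (X Y : opT R d Idx) (r N1 N2 : R) u : 0 < r -> exp_bounded r N1 X -> exp_bounded r N2 Y -> in_Hp p u ->
  (fun j => hop X u j - hop Y u j) = hop (fun x l => X x l - Y x l) u.
Proof.
move=> r0 XN YN hu.
have YN' : exp_bounded r N2 (fun x l => -1 * Y x l) by move=> x l; rewrite mulN1r cabsN.
have := hopD K r0 XN YN' hu; rewrite (hopZ K r0 (-1) YN hu) => E.
have -> : hop (fun x l => X x l - Y x l) u = hop (fun x l => X x l + -1 * Y x l) u.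
  by congr (hop _ u); apply/funext => x; apply/funext => l; rewrite mulN1r.
by rewrite E; apply/funext => j; rewrite mulN1r.
Qed.

Let s2 : 0 < s / 2. Proof. by rewrite divr_gt0. Qed.
Let ss : s / 2 < s. Proof. by rewrite ltr_pdivrMr// mulr2n mulrDr mulr1 ltrDr. Qed.
Let M0 : 0 <= M.
Proof. by have := AM 0 0; rewrite ew0 mulr1; apply: le_trans; exact: cabs_ge0. Qed.

(** A change of phase costs a factor of size n1 l, paid by lowering the rate from s to s/2; the
    derivative in [hop_derivative] costs its square in the same way. *)
Lemma hop_torus : op_torus_family p (fun phi => hop (twist phi A)).
Proof.
split=> [phi m u _|phi eta eta0]; first by rewrite twist_period.
have [c c0 Hc] := @exp_bounded_weak R d s (s / 2) 1 ss.
have [b b0 Hb] := hop_bounded K p0 s2.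
pose r := eta / (b * (c * 2 * (M + 1))).
have D0 : 0 < b * (c * 2 * (M + 1)) by rewrite !mulr_gt0// ltr_wpDl.
have r0 : 0 < r by rewrite divr_gt0.
apply/nbhs_ballP; exists r => //= psi [_ hb].
have pr i : `|psi 0 i - phi 0 i| <= r.
  by have := hb 0 i; rewrite /ball /= distrC => /ltW.
apply: (@bounded_by_ext _ _ _ (hop (fun x l => twist psi A x l - twist phi A x l))).
  by move=> u hu; rewrite -(hopB s0 (exp_bounded_twist psi AM) (exp_bounded_twist phi AM) hu).
have r20 : 0 <= 2 * r by rewrite mulr_ge0// ltW.
have BA x l : cabs (twist psi A (inl x) l - twist phi A (inl x) l) <= 2 * r * (1 + n1 l)%:R ^+ 1 * cabs (A (inl x) l).
  rewrite /twist -mulrBl cabsM ler_wpM2r ?cabs_ge0//; apply: le_trans (cis_sub _ _) _.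
  rewrite -mulrA ler_wpM2l// expr1 -dotRZB.
  apply: le_trans (dotRZ_le (M := r) l _) _; first by move=> i; rewrite !mxE; exact: pr.
  by rewrite ler_wpM2l ?(ltW r0)// ler_nat leq_addl.
apply: bounded_by_le (Hb _ _ (Hc _ _ _ _ r20 BA AM)).
have -> : b * (c * (2 * r) * M) = r * (b * (c * 2 * M)) by ring.
rewrite /r mulrAC ler_pdivrMr// ler_wpM2l ?(ltW eta0)// ler_wpM2l ?(ltW b0)//.
by rewrite ler_wpM2l ?mulr_ge0 ?(ltW c0)// lerDl.
Qed.

Definition dtwist (om : 'rV[R]_d) : opT R d Idx := fun x l => 'i%C * (dotRZ om l)%:C%C * A x l.

Variable om : 'rV[R]_d.
Hypothesis omc : cube om.

Lemma dot_n1 l : `|dotRZ om l| <= (1 + n1 l)%:R.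
Proof.
apply: le_trans (dotRZ_le l (cube_le omc)) _; by rewrite mul1r ler_nat leq_addl.
Qed.

Lemma exp_bounded_dtwist : exists N, exp_bounded (s / 2) N (dtwist om).
Proof.
have [c c0 Hc] := @exp_bounded_weak R d s (s / 2) 1 ss.
exists (c * 1 * M); apply: (Hc 1 M A) => // x l.
rewrite /dtwist !cabsM cabs_real ler_wpM2r ?cabs_ge0// mul1r expr1.
have -> : cabs ('i%C : C) = 1.
  by rewrite /cabs /ComplexField.Normc.normc /= expr0n add0r expr1n sqrtr1.
by rewrite mul1r; exact: dot_n1.
Qed.

Lemma hop_derivative t : op_derivative p (fun r => hop (twist (r *: om) A)) t (hop (twist (t *: om) (dtwist om))).
Proof.
move=> eta eta0.
have [c c0 Hc] := @exp_bounded_weak R d s (s / 2) 2 ss.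
have [b b0 Hb] := hop_bounded K p0 s2.
have [N DN] := exp_bounded_dtwist.
pose r := eta / (b * (c * 2 * (M + 1))).
have D0 : 0 < b * (c * 2 * (M + 1)) by rewrite !mulr_gt0// ltr_wpDl.
have r0 : 0 < r by rewrite divr_gt0.
have AM2 : exp_bounded (s / 2) M A.
  by move=> x l; apply: le_trans (AM x l) _; rewrite ler_wpM2l// ew_le// lerN2 ltW.
apply: filterS2 (dnbhs0_lt r0) (nbhs_dnbhs_neq (0 : R)) => h hr h0.
pose X : opT R d Idx := fun x l => (h^-1)%:C%C * (twist ((t + h) *: om) A x l - twist (t *: om) A x l)
   - twist (t *: om) (dtwist om) x l.
apply: (@bounded_by_ext _ _ _ (hop X)).
  move=> u hu.
  have T1 := exp_bounded_twist ((t + h) *: om) AM2; have T2 := exp_bounded_twist (t *: om) AM2.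
  have T3 : exp_bounded (s / 2) (M + M) (fun x l => twist ((t + h) *: om) A x l - twist (t *: om) A x l).
    move=> x l; apply: le_trans (cabsB _ _) _; rewrite mulrDl; apply: lerD; [exact: T1|exact: T2].
  have T4 : exp_bounded (s / 2) (`|h^-1| * (M + M)) (fun x l => (h^-1)%:C%C * (twist ((t + h) *: om) A x l - twist (t *: om) A x l)).
    by move=> x l; rewrite cabsM cabs_real -mulrA ler_wpM2l//; exact: T3.
  have E := hopB s2 T4 (exp_bounded_twist (t *: om) DN) hu.
  by rewrite -/X in E; rewrite -E (hopZ K s2 _ T3 hu) -(hopB s2 T1 T2 hu).
have h20 : 0 <= 2 * `|h| by rewrite mulr_ge0.
have BA x l : cabs (X (inl x) l) <= 2 * `|h| * (1 + n1 l)%:R ^+ 2 * cabs (A (inl x) l).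
  have -> : X (inl x) l = ((h^-1)%:C%C * (cis ((t + h) * dotRZ om l) - cis (t * dotRZ om l))
      - 'i%C * (dotRZ om l)%:C%C * cis (t * dotRZ om l)) * A (inl x) l.
    by rewrite /X /twist /dtwist !dotRZZ; ring.
  rewrite cabsM ler_wpM2r ?cabs_ge0//; apply: le_trans (cis_deriv _ _ h0) _.
  rewrite ler_wpM2l// lerXn2r ?nnegrE//; exact: dot_n1.
apply: bounded_by_le (Hb _ _ (Hc _ _ _ _ h20 BA AM)).
have -> : b * (c * (2 * `|h|) * M) = `|h| * (b * (c * 2 * M)) by ring.
apply: (@le_trans _ _ (r * (b * (c * 2 * M)))).
  by rewrite ler_wpM2r ?(ltW hr)// !mulr_ge0// ltW.
rewrite /r mulrAC ler_pdivrMr// ler_wpM2l ?(ltW eta0)// ler_wpM2l ?(ltW b0)//.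
by rewrite ler_wpM2l ?mulr_ge0 ?(ltW c0)// lerDl.
Qed.

End Rate.

Section Conjugation.
Variables (s Mw Mu Mv : R) (W U : opT R d Idx) (V : G -> C) (Om : 'rV[int]_2 -> R) (om : 'rV[R]_d).
Hypotheses (s0 : 0 < s) (WM : exp_bounded s Mw W) (UM : exp_bounded s Mu U) (VM : exp_bounded s Mv (fun _ => V)).
Hypothesis UW : forall j l, cmul idx_shift U W (inl j) l = ido R (inl j : Idx) l.
Hypothesis omc : cube om.
Hypothesis itw : forall j l, ((dotRZ om l)%:C%C + (sqnormZ (j + momentum K l))%:~R) * W (inl j) l +
  csum (fun m => V (l - m) * W (inl j) m) = W (inl j) l * (Om j)%:C%C.
Hypothesis OmB : exists B, forall j, `|Om j - (sqnormZ j)%:~R| <= B.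

Lemma twist_cmul phi A B MA MB j l : exp_bounded s MA A -> exp_bounded s MB B ->
  cmul idx_shift (twist phi A) (twist phi B) (inl j) l = cis (dotRZ phi l) * cmul idx_shift A B (inl j) l.
Proof.
move=> AM BM; have [S S0 HS] := @ewN_sle R d _ s0; rewrite /cmul -csumZ; last first.
  have A0 : 0 <= MA by have := AM 0 0; rewrite ew0 mulr1; apply: le_trans; exact: cabs_ge0.
  have B0 : 0 <= MB by have := BM 0 0; rewrite ew0 mulr1; apply: le_trans; exact: cabs_ge0.
  exists (MA * MB * S); apply: sle_le (sleZ (mulr_ge0 A0 B0) HS) => m.
  rewrite cabsM -mulrA; apply: ler_pM; rewrite ?cabs_ge0//.
  apply: le_trans (AM _ _) _; rewrite ler_piMr//.
  by rewrite /ew -expR0 ler_expR mulNr oppr_le0 mulr_ge0// ltW.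
apply: eq_csum => m; rewrite /twist.
have -> : cis (dotRZ phi l) = cis (dotRZ phi (l - m)) * cis (dotRZ phi m) :> C.
  by rewrite -cisD dotRZBr subrK.
by ring.
Qed.

Lemma exp_bounded_cmul A B MA MB S : sums_le (fun l : G => ew (- (s / 2)) l) S -> exp_bounded s MA A -> exp_bounded s MB B ->
  exp_bounded (s / 2) (MA * MB * S) (cmul idx_shift A B).
Proof.
move=> HS AM BM x l; apply: csum_le.
have A0 : 0 <= MA by have := AM 0 0; rewrite ew0 mulr1; apply: le_trans; exact: cabs_ge0.
have B0 : 0 <= MB by have := BM 0 0; rewrite ew0 mulr1; apply: le_trans; exact: cabs_ge0.
have c0 : 0 <= MA * MB * ew (- (s / 2)) l by rewrite mulr_ge0 ?ew_ge0// mulr_ge0.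
have -> : MA * MB * S * ew (- (s / 2)) l = MA * MB * ew (- (s / 2)) l * S by ring.
apply: sle_le (sleZ c0 HS) => m; rewrite cabsM.
apply: (@le_trans _ _ (MA * ew (- s) (l - m) * (MB * ew (- s) m))).
  exact: ler_pM (cabs_ge0 _) (cabs_ge0 _) (AM _ _) (BM _ _).
have -> : MA * ew (- s) (l - m) * (MB * ew (- s) m) = MA * MB * (ew (- s) (l - m) * ew (- s) m) by ring.
rewrite -[leRHS]mulrA ler_wpM2l ?mulr_ge0// /ew -!expRD ler_expR.
have h : (n1 l)%:R <= (n1 (l - m))%:R + (n1 m)%:R :> R.
  by rewrite -natrD ler_nat; have := n1D (l - m) m; rewrite subrK.
have h1 : s / 2 * (n1 l)%:R <= s / 2 * ((n1 (l - m))%:R + (n1 m)%:R) by rewrite ler_wpM2l// divr_ge0// ltW.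
have h2 : 0 <= s / 2 * (n1 (l - m))%:R by rewrite mulr_ge0// divr_ge0// ltW.
by lra.
Qed.

Lemma hop_inverse A B MA MB phi u : exp_bounded s MA A -> exp_bounded s MB B ->
  (forall j l, cmul idx_shift A B (inl j) l = ido R (inl j : Idx) l) -> in_Hp p u ->
  hop (twist phi A) (hop (twist phi B) u) = u.
Proof.
move=> AM BM AB hu; rewrite (hop_comp K s0 (exp_bounded_twist phi AM) (exp_bounded_twist phi BM) hu).
rewrite -[RHS](hop_ido K u); congr (_ u); apply: hop_ext => j l.
rewrite (twist_cmul phi j l AM BM) AB /ido; have [->|_] := eqVneq l 0; last by rewrite mulr0.
rewrite mulr1 (_ : dotRZ phi 0 = 0) ?cis0//.
by rewrite /dotRZ big1// => i _; rewrite mxE mulr0.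
Qed.

Lemma hop_conjugates : conjugates_to_diag K p V om (fun phi => hop (twist phi W)) (fun phi => hop (twist phi U)) Om.
Proof.
have [N DN] := exp_bounded_dtwist s0 WM omc; have s2 : 0 < s / 2 by rewrite divr_gt0.
exists (fun t => hop (twist (t *: om) (dtwist W om))) => t; set phi := t *: om.
have [b b0 Hb] := hop_bounded K p0 s2.
have inD u : in_Hp p u -> in_Hp p (hop (twist phi (dtwist W om)) u).
  by move=> hu; exact: (hop_in K p0 s2 (exp_bounded_twist phi DN) hu).
split.
- by exists (b * N); apply: Hb; exact: exp_bounded_twist.
- exact: hop_derivative s0 WM _ omc t.
- move=> u hu; split => [h|h]; last exact: (hop_domain K p0 s0 (exp_bounded_twist phi WM) h).
  rewrite -(hop_inverse phi UM WM UW hu); exact: (hop_domain K p0 s0 (exp_bounded_twist phi UM) h).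
- move=> u [hu hE] j.
  (* diag(Om) is a bounded perturbation of the Laplacian, hence defined on the same domain. *)
  have hd : in_Hp p (diag_op Om u).
    have [B HB] := OmB; have B0 : 0 <= B by exact: le_trans (normr_ge0 _) (HB 0).
    have -> : diag_op Om u = (fun j => neg_laplacian u j + (Om j - (sqnormZ j)%:~R)%:C%C * u j).
      apply/funext => k; rewrite /diag_op /neg_laplacian -mulrDl rmorphB/= rmorph_int; ring.
    apply: in_HpD => //; have /in_HpP[[L uL] [H uH]] := hu; apply/in_HpP; split.
      exists (B * L); apply: sle_le (sleZ B0 uL) => k; rewrite /l1w cabsM cabs_real.
      by rewrite ler_wpM2r ?cabs_ge0.
    exists (B ^+ 2 * H); apply: sle_le (sleZ (sqr_ge0 B) uH) => k.
    rewrite /hpw cabsM exprMn mulrCA cabs_real ler_wpM2r; [by []|exact: hpw_ge0|].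
    by rewrite lerXn2r ?nnegrE.
  have /in_HpP[[L uL] _] := hu.
  have WV := exp_bounded_twist phi WM; have VV := exp_bounded_twist phi VM.
  (* The column equation [itw] read in space: L G = i dG/dt + G diag(Om), where the sign comes from
     i times i (om.l). Applying G^-1 then concludes. *)
  have key : schrodinger K V phi (hop (twist phi W) u) =
    (fun k => 'i%C * hop (twist phi (dtwist W om)) u k + hop (twist phi W) (diag_op Om u) k).
    apply/funext => k; rewrite /schrodinger.
    have -> : mul_potential K V phi (hop (twist phi W) u) k = hop (twist phi (fun _ => V)) (hop (twist phi W) u) k.
      by apply: eq_csum => l; rewrite /twist; ring.
    rewrite (hop_comp K s0 VV WV hu) /neg_laplacian /hop.
    rewrite -(csumZ _ (hop_smb K s0 k WV uL)).
    have DD := exp_bounded_twist phi DN.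
    rewrite -(csumZ _ (hop_smb K s2 k DD uL)).
    have /in_HpP[[L' dL] _] := hd.
    rewrite -csumD; last 2 first.
    + apply: smbZ; exact: (hop_smb K s0 k WV uL).
    + have [S S0 HS] := @ewN_sle R d _ s2.
      have C1 : exp_bounded (s / 2) (Mv * Mw * S) (cmul idx_shift (twist phi (fun _ => V)) (twist phi W)).
        exact: exp_bounded_cmul HS VV WV.
      exact: (hop_smb K s2 k C1 uL).
    rewrite -csumD; last 2 first.
    + apply: smbZ; exact: (hop_smb K s2 k DD uL).
    + exact: (hop_smb K s0 k WV dL).
    apply: eq_csum => l; rewrite (twist_cmul phi _ l VM WM) /diag_op /dtwist.
    set i := k - _; have ki : k = i + momentum K l by rewrite subrK.
    have e := itw i l; rewrite -ki in e.
    have -> : cmul idx_shift (fun _ => V) W (inl i) l = csum (fun m => V (l - m) * W (inl i) m) by [].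
    rewrite /twist; set c := cis _; set w := W _ _ in e *; set cc := csum _ in e *.
    have ii : ('i%C : C) * 'i%C = -1 by rewrite -expr2 sqr_i.
    have -> : 'i%C * (c * ('i%C * (dotRZ om l)%:C%C * w) * u i) =
      ('i%C * 'i%C) * (c * ((dotRZ om l)%:C%C * w) * u i) by ring.
    have -> : c * w * ((Om i)%:C%C * u i) = c * (w * (Om i)%:C%C) * u i by ring.
    rewrite ii -e; ring.
  rewrite key.
  have hG := hop_in K p0 s0 WV hd.
  rewrite (hop_linear K s0 (exp_bounded_twist phi UM) 'i%C (inD _ hu) hG) (hop_inverse phi UM WM UW hd).
  by rewrite addrA addrC mulNr addNr addr0.
Qed.

End Conjugation.
End Phase.

(** * Fourier coefficients of a real potential *)

Section Fourier.
Variables (R : realType) (d : nat).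
Notation G := ('rV[int]_d).
Notation C := R[i].

Lemma csum_sum (f : nat -> G -> C) q : (forall k, summable_c (f k)) ->
  summable_c (fun l => \sum_(k < q) f k l) /\ csum (fun l => \sum_(k < q) f k l) = \sum_(k < q) csum (f k).
Proof.
move=> fs; elim: q => [|q [ih1 ih2]].
  split; last first.
    transitivity (csum (fun _ : G => 0 : C)); last by rewrite csum0 big_ord0.
    by apply: eq_csum => l; rewrite big_ord0.
  by exists 0; apply: sle0 => // l; rewrite big_ord0 cabs0.
have E l : \sum_(k < q.+1) f k l = \sum_(k < q) f k l + f q l by rewrite big_ord_recr.
rewrite (eq_csum E) csumD// ih2 big_ord_recr; split => //.
by have [M HM] := smbD ih1 (fs q); exists M; apply: sle_le HM => l; rewrite E.
Qed.

Definition vanishing (c : G -> C) := summable_c c /\ forall phi : 'rV[R]_d, csum (fun l => c l * cis (dotRZ phi l)) = 0.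

Lemma smb_cis c (phi : 'rV[R]_d) : summable_c c -> summable_c (fun l => c l * cis (dotRZ phi l)).
Proof. by move=> [M HM]; exists M; apply: sle_le HM => l; rewrite cabsM cabs_cis mulr1. Qed.

(** The root of unity picked up by the mode l under a translation by 2 pi / q in the i-th angle. *)
Definition root_char (q : nat) (i : 'I_d) (l : G) : C := cis (2 * pi * (l 0 i)%:~R / q%:R).

Lemma cis_mulrn (x : R) k : cis (x * k%:R) = cis x ^+ k :> C.
Proof.
elim: k => [|k ih]; first by rewrite mulr0 cis0.
by rewrite -[k.+1%:R]natr1 mulrDr mulr1 cisD ih exprSr.
Qed.

Lemma root_char_sum q i l : (0 < q)%N -> \sum_(k < q) root_char q i l ^+ k = if root_char q i l == 1 then q%:R else 0.
Proof.
move=> q0; case: eqP => [->|/eqP z1].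
  by rewrite (eq_bigr (fun=> 1)) ?sumr_const ?card_ord// => k _; rewrite expr1n.
have zq : root_char q i l ^+ q = 1.
  rewrite /root_char -cis_mulrn mulfVK ?pnatr_eq0 -?lt0n//; exact: cis_period.
have := subrX1 (root_char q i l) q; rewrite zq subrr => /esym/eqP; rewrite mulf_eq0 subr_eq0 (negbTE z1)/= => /eqP.
by [].
Qed.

(* Averaging over the q translates by 2 pi k / q in the i-th angle keeps exactly the
   coefficients with q | l_i, which isolates a coefficient without integrals. *)
Lemma vanishing_restr q i c : (0 < q)%N -> vanishing c ->
  vanishing (restr (fun l => root_char q i l == 1) c).
Proof.
move=> q0 [cs cv]; split.
  have [M HM] := cs; exists M; apply: sle_le HM => l; rewrite /restr; case: ifP => // _.
  by rewrite cabs0 cabs_ge0.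
move=> phi; pose e k : 'rV[R]_d := phi + (2 * pi * k%:R / q%:R) *: \row_j (j == i)%:R.
have qn : q%:R != 0 :> R by rewrite pnatr_eq0 -lt0n.
have eE k l : cis (dotRZ (e k) l) = cis (dotRZ phi l) * root_char q i l ^+ k.
  rewrite /root_char -cis_mulrn -cisD; congr cis.
  have -> : dotRZ (e k) l = dotRZ phi l + (2 * pi * k%:R / q%:R) * dotRZ (\row_j (j == i)%:R) l.
    by rewrite /dotRZ mulr_sumr -big_split/=; apply: eq_bigr => j _; rewrite !mxE; ring.
  have -> : dotRZ (\row_j (j == i)%:R) l = (l 0 i)%:~R :> R.
    rewrite /dotRZ (bigD1 i)//= mxE eqxx mul1r big1 ?addr0// => j /negbTE ji.
    by rewrite mxE ji mul0r.
  congr (_ + _); field; exact: qn.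
have [fs fE] := csum_sum q (fun k => smb_cis (e k) cs).
have Z : csum (fun l => \sum_(k < q) c l * cis (dotRZ (e k) l)) = 0.
  by rewrite fE big1// => k _; exact: cv.
have rs : summable_c (fun l => restr (fun l => root_char q i l == 1) c l * cis (dotRZ phi l)).
  have [M HM] := smb_cis phi cs; exists M; apply: sle_le HM => l; rewrite /restr; case: ifP => // _.
  by rewrite mul0r cabs0 cabs_ge0.
have qC : (q%:R : C) != 0 by rewrite pnatr_eq0 -lt0n.
apply: (mulfI qC); rewrite mulr0 -csumZ// -Z; apply: eq_csum => l.
under eq_bigr do rewrite eE mulrA.
rewrite -mulr_sumr root_char_sum// /restr; case: ifP => _; last by rewrite mul0r !mulr0.
by ring.
Qed.

Definition all_root_char q (s : seq 'I_d) (l : G) := all (fun i => root_char q i l == 1) s.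

Lemma vanishing_all q s c : (0 < q)%N -> vanishing c -> vanishing (restr (all_root_char q s) c).
Proof.
move=> q0 cv; elim: s => [|i s ih].
  by have -> : restr (all_root_char q [::]) c = c by apply/funext => l.
have -> : restr (all_root_char q (i :: s)) c = restr (fun l => root_char q i l == 1) (restr (all_root_char q s) c).
  by apply/funext => l; rewrite /restr /all_root_char /=; case: eqP.
exact: vanishing_restr.
Qed.

(** Positivity of the sine on (0, pi) excludes 0 < |l_i| < q/2, and this range is enough to push the
    surviving modes to infinity with q. *)
Lemma root_char_small q i l : (0 < q)%N -> root_char q i l = 1 -> l 0 i != 0 -> (q <= 2 * `|l 0%R i|%N)%N.
Proof.
move=> q0 r1 li; rewrite leqNgt; apply/negP => lq.
have qn : 0 < q%:R :> R by rewrite ltr0n.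
pose x : R := 2 * pi * `|(l 0 i)%:~R| / q%:R.
have pi0 : 0 < pi :> R by exact: pi_gt0.
have ln : 0 < `|(l 0 i)%:~R| :> R by rewrite normr_gt0 intr_eq0.
have x0 : 0 < x by rewrite divr_gt0// !mulr_gt0.
have xpi : x < pi.
  rewrite /x ltr_pdivrMr// [2 * pi]mulrC -mulrA ltr_pM2l//.
  by rewrite -intr_norm -natr_absz -natrM ltr_nat.
have sx : 0 < sin x by apply: sin_gt0_pi; rewrite x0 xpi.
have : complex.Im (root_char q i l) = 0 by rewrite r1.
rewrite /root_char /cis /=.
have [h|h] := leP 0 ((l 0 i)%:~R : R).
  by move=> e; move: sx; rewrite /x ger0_norm// e ltxx.
move=> e; move: sx; rewrite /x ltr0_norm// mulrN mulNr sinN e oppr0 ltxx//.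
Qed.

(** After averaging in every angle the modes left besides 0 satisfy 2 n1 l >= q, and by the
    exponential weight their total is of order 1/q. *)
Lemma vanishing0 s M c : 0 < s -> weighted_le s M c -> vanishing c -> c 0 = 0.
Proof.
move=> s0 cM cv; have M0 : 0 <= M by exact: sle_ge0 cM.
have B q : (0 < q)%N -> cabs (c 0) <= 2 * M / (s * q%:R).
  move=> q0; have [ts tv] := vanishing_all (enum 'I_d) q0 cv.
  pose g := restr (all_root_char q (enum 'I_d)) c.
  have g0 : g 0 = c 0.
    rewrite /g /restr /all_root_char; case: allP => // h; exfalso; apply: h => i _.
    by rewrite /root_char mxE mulr0 mul0r cis0.
  have := tv 0.
  have -> : csum (fun l => restr (all_root_char q (enum 'I_d)) c l * cis (dotRZ 0 l)) = csum g.
    apply: eq_csum => l; rewrite (_ : dotRZ 0 l = 0) ?cis0 ?mulr1//.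
    by rewrite /dotRZ big1// => i _; rewrite mxE mul0r.
  have E : csum g = c 0 + csum (off g).
    rewrite -g0 -[g 0](csum_single (0 : G)) -csumD; last 2 first.
    - exists (cabs (g 0)); apply: sle_le (sle_single (0 : G) (cabs_ge0 (g 0))) => l.
      by case: eqP; rewrite ?cabs0.
    - have [Z HZ] := ts; exists Z; apply: sle_le HZ => l; rewrite /off /restr; case: ifP => // _.
      by rewrite cabs0 cabs_ge0.
    apply: eq_csum => l; have [->|l0] := eqVneq l 0.
      have -> : off g 0 = 0 by rewrite /off /restr eqxx.
      by rewrite addr0.
    have -> : off g l = g l by rewrite /off /restr l0.
    by rewrite add0r.
  rewrite E => /eqP; rewrite addr_eq0 => /eqP ->; rewrite cabsN; apply: csum_le.
  have k0 : 0 <= 2 / (s * q%:R) by rewrite divr_ge0// mulr_ge0// ltW.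
  have -> : 2 * M / (s * q%:R) = 2 / (s * q%:R) * M by ring.
  apply: sle_le (sleZ k0 cM) => l; rewrite /off /restr; case: ifPn => [l0|_]; last first.
    rewrite cabs0; apply: mulr_ge0 => //; apply: mulr_ge0; [exact: ew_ge0|exact: cabs_ge0].
  rewrite /g /restr; case: ifPn => [/allP al|_]; last first.
    rewrite cabs0; apply: mulr_ge0 => //; apply: mulr_ge0; [exact: ew_ge0|exact: cabs_ge0].
  rewrite mulrA ler_peMl ?cabs_ge0//.
  have [i li] : exists i, l 0 i != 0.
    apply: contrapT => h; move/eqP: l0; apply; apply/rowP => i; rewrite mxE.
    by apply/eqP/negPn/negP => li; apply: h; exists i.
  have qi : (q <= 2 * n1 l)%N.
    apply: leq_trans (root_char_small q0 _ li) _; first by apply/eqP/al; rewrite mem_enum.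
    by rewrite leq_mul2l n1_entry orbT.
  have sq : 0 < s * q%:R by rewrite mulr_gt0// ltr0n.
  rewrite mulrAC ler_pdivlMr// mul1r.
  have h1 : q%:R <= 2 * (n1 l)%:R :> R by rewrite -natrM ler_nat.
  have h2 := expR_ge1Dx (s * (n1 l)%:R).
  have h3 : s * q%:R <= s * (2 * (n1 l)%:R) by rewrite ler_wpM2l// ltW.
  rewrite /ew; lra.
apply: cabs_eq0; apply/eqP; rewrite eq_le cabs_ge0 andbT leNgt; apply/negP => c0.
pose q := (Num.truncn (2 * M / (s * cabs (c 0)))).+1.
have := B q isT; rewrite leNgt => /negP; apply.
have q0 : 0 < q%:R :> R by rewrite ltr0n.
have : 2 * M / (s * cabs (c 0)) < q%:R by exact: truncnS_gt.
by rewrite !ltr_pdivrMr ?mulr_gt0// => h; lra.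
Qed.

Lemma vanishing_eq0 s M c l0 : 0 < s -> weighted_le s M c -> vanishing c -> c l0 = 0.
Proof.
move=> s0 cM [cs cv]; pose c' (l : G) := c (l + l0).
have bij : bijective (fun l : G => l + l0) by exists (fun l => l - l0) => l; rewrite ?addrK ?subrK.
have M0 : 0 <= M by exact: sle_ge0 cM.
have c'M : weighted_le s (ew s l0 * M) c'.
  apply: sle_le (sleZ (ew_ge0 s l0) (sle_inj (bij_inj bij) cM)) => l.
  rewrite /= mulrA ler_wpM2r ?cabs_ge0//.
  have := ewD (l + l0) (- l0) (ltW s0); rewrite addrK => /le_trans; apply.
  by rewrite mulrC /ew n1N.
have -> : c l0 = c' 0 by rewrite /c' add0r.
apply: (vanishing0 s0 c'M); split; first exact: nb_smb (ltW s0) c'M.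
move=> phi; have := cv phi; rewrite (csum_bij _ bij) => h.
have z : cis (dotRZ phi l0) * cis (- dotRZ phi l0) = 1 :> C by rewrite -cisD subrr cis0.
have -> : csum (fun l => c' l * cis (dotRZ phi l)) =
  csum (fun l => cis (- dotRZ phi l0) * (c (l + l0) * cis (dotRZ phi (l + l0)))).
  apply: eq_csum => l; rewrite /c'.
  have -> : dotRZ phi (l + l0) = dotRZ phi l + dotRZ phi l0.
    by rewrite /dotRZ -big_split/=; apply: eq_bigr => i _; rewrite !mxE rmorphD/= mulrDr.
  rewrite cisD.
  have -> : cis (- dotRZ phi l0) * (c (l + l0) * (cis (dotRZ phi l) * cis (dotRZ phi l0))) =
    (cis (dotRZ phi l0) * cis (- dotRZ phi l0)) * (c (l + l0) * cis (dotRZ phi l)) by ring.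
  by rewrite z mul1r.
rewrite csumZ; last first.
  have := smb_cis phi cs => -[Z HZ]; exists Z; exact: (sle_inj (bij_inj bij) HZ).
by rewrite -[csum _]/(csum ((fun l => c l * cis (dotRZ phi l)) \o (fun l => l + l0))) h mulr0.
Qed.

Lemma conj_cis (x : R) : ((cis x)^*)%C = cis (- x).
Proof. by rewrite /cis cosN sinN. Qed.

(** The differences of the two sides are the Fourier coefficients of the function phi -> V(-phi)
    minus its conjugate, which is zero. *)
Lemma real_potential s M (V : G -> C) : 0 < s -> weighted_le s M V ->
  (forall phi, complex.Im (potential_fun V phi) = 0) -> forall l, V (- l) = ((V l)^*)%C.
Proof.
move=> s0 VM Vr l0; have Vs := nb_smb (ltW s0) VM.
pose c l := V (- l) - ((V l)^*)%C.
have bij : bijective (fun l : G => - l) by exists (fun l => - l) => l; rewrite opprK.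
have V1 : weighted_le s M (fun l => V (- l)).
  by apply: sle_le (sle_inj (bij_inj bij) VM) => l; rewrite /= /ew n1N.
have V2 : weighted_le s M (fun l => - ((V l)^*)%C) by apply: nb_dom VM => l; rewrite cabsN cabs_conj.
apply/eqP; rewrite -subr_eq0; apply/eqP; rewrite -/(c l0).
apply: (vanishing_eq0 l0 s0 (nbD V1 V2)); split; first exact: nb_smb (ltW s0) (nbD V1 V2).
move=> phi; rewrite -/c.
have E l : c l * cis (dotRZ phi l) = V (- l) * cis (dotRZ phi l) - ((V l)^*)%C * cis (dotRZ phi l).
  by rewrite /c mulrBl.
have nphi l : dotRZ (- phi) l = - dotRZ phi l.
  by rewrite /dotRZ -sumrN; apply: eq_bigr => i _; rewrite !mxE mulNr.
have nphi' l : dotRZ phi (- l) = - dotRZ phi l.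
  by rewrite /dotRZ -sumrN; apply: eq_bigr => i _; rewrite !mxE rmorphN/= mulrN.
rewrite -/(c) (eq_csum E) csumB; last 2 first.
- exact: smb_cis (nb_smb (ltW s0) V1).
- by apply: smb_cis; have := nb_smb (ltW s0) VM => -[Z HZ]; exists Z; apply: sle_le HZ => l; rewrite cabs_conj.
have -> : csum (fun l => V (- l) * cis (dotRZ phi l)) = potential_fun V (- phi).
  rewrite /potential_fun (csum_bij (fun l => V l * cis (dotRZ (- phi) l)) bij); apply: eq_csum => l /=.
  by rewrite nphi nphi' opprK.
have -> : csum (fun l => ((V l)^*)%C * cis (dotRZ phi l)) = ((potential_fun V (- phi))^*)%C.
  rewrite /potential_fun -csum_conj; last exact: smb_cis.
  by apply: eq_csum => l; rewrite cjM conj_cis nphi opprK.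
have := Vr (- phi); case: (potential_fun V (- phi)) => x y /= ->.
by rewrite oppr0 subrr.
Qed.

End Fourier.

(** * From the norm of V to weighted sums *)

Section PotentialNorm.
Variables (R : realType) (d : nat) (a q : R).
Hypotheses (hd : (0 < d)%N) (a0 : 0 < a) (q0 : 0 <= q).
Variable V : 'rV[int]_d -> R[i].
Hypothesis Vfin : (potential_mass a q V < +oo)%E.

Lemma potential_le l : cabs (V l) <= potential_norm a q V * expR (- (a * enormZ R l)).
Proof.
pose f l := expR (2 * a * enormZ R l) * cabs (V l) ^+ 2 * japZ R l `^ (2 * q).
have f0 l' : 0 <= f l' by rewrite mulr_ge0 ?powR_ge0// mulr_ge0 ?expR_ge0// sqr_ge0.
have [M HM] : exists M, sums_le f M by apply/esum_fin.
have HT := sle_tsum f0 HM; have Tl := sle_term l HT.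
have N0 : 0 <= potential_norm a q V by exact: sqrtr_ge0.
rewrite expRN ler_pdivlMr ?expR_gt0//.
rewrite -(ler_pXn2r (_ : (0 < 2)%N)) ?nnegrE ?mulr_ge0 ?cabs_ge0 ?expR_ge0//.
have -> : potential_norm a q V ^+ 2 = tsum f by rewrite sqr_sqrtr// tsum_ge0.
apply: le_trans Tl; rewrite /f exprMn -expRM_natl.
have -> : 2%:R * (a * enormZ R l) = 2 * a * enormZ R l by rewrite mulrA.
rewrite mulrC; apply: ler_peMr; first by apply: mulr_ge0; [exact: expR_ge0|exact: sqr_ge0].
have o1 : (1 : R) `^ (2 * q) = 1 by rewrite powR1.
have J1 := jap_ge1 (enormZ R l); rewrite -[leLHS]o1; apply: ge0_ler_powR => //.
- exact: mulr_ge0.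
- by rewrite nnegrE.
- by rewrite nnegrE; exact: le_trans ler01 J1.
Qed.

End PotentialNorm.

(** As n1 l <= d |l|, decay at rate a in |l| is decay at rate a/d in n1; half is kept as weight and
    half is spent on the summation over l. *)
Lemma potential_nb (R : realType) (d : nat) (a : R) : (0 < d)%N -> 0 < a ->
  exists S : R, 0 < S /\ forall q V, 0 <= q -> (potential_mass a q V < +oo)%E ->
    @weighted_le R d (a / (2 * d%:R)) (S * potential_norm a q V) V.
Proof.
move=> hd a0; have dn : 0 < d%:R :> R by rewrite ltr0n.
have s0 : 0 < a / (2 * d%:R) by rewrite divr_gt0// mulr_gt0.
have [S [S0 HS]] := @sle_exp R d _ s0; exists S; split => // q V q0 Vf.
have N0 : 0 <= potential_norm a q V by exact: sqrtr_ge0.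
rewrite [S * _]mulrC; apply: sle_le (sleZ N0 HS) => l.
apply: le_trans (ler_wpM2l (ew_ge0 _ _) (potential_le q0 Vf l)) _.
rewrite mulrCA ler_wpM2l// /ew -expRD ler_expR.
have h := n1_enormZ R l.
have h2 : a / (2 * d%:R) * (n1 l)%:R <= a / (2 * d%:R) * (d%:R * enormZ R l) by rewrite ler_wpM2l// ltW.
have E : a / (2 * d%:R) * (d%:R * enormZ R l) = a * enormZ R l / 2 by field; rewrite gt_eqF.
lra.
Qed.

(** * Lipschitz extension in the frequency *)

Section Extension.
Variables (R : realType) (d : nat).

Lemma le_mx_norm (x : 'rV[R]_d) i : `|x 0 i| <= `|x|.
Proof.
rewrite [leRHS]mx_normrE; exact: (le_bigmax _ (fun ij : 'I_1 * 'I_d => `|x ij.1 ij.2|) (0, i)).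
Qed.

(** McShane's extension, the supremum over a in A of f(a) - k |om - a|, truncated below at -B; the
    upper bound B is automatic. An empty A is treated apart, its supremum being meaningless. *)
Lemma mcshane (A : set 'rV[R]_d) (f : 'rV[R]_d -> R) (k B : R) : 0 <= k -> 0 <= B ->
  (forall om, A om -> `|f om| <= B) ->
  (forall om om' h, A om -> A om' -> 0 <= h -> (forall i, `|om 0 i - om' 0 i| <= h) ->
     `|f om - f om'| <= k * h) ->
  exists g : 'rV[R]_d -> R, [/\ forall om, A om -> g om = f om, forall om, `|g om| <= B &
     forall om om', `|g om - g om'| <= k * `|om - om'|].
Proof.
move=> k0 B0 fB fk; have [[a0 Aa0]|nA] := pselect (exists a, A a); last first.
  exists (fun=> 0); split => [om Ao|om|om om']; first by exfalso; apply: nA; exists om.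
    by rewrite normr0.
  by rewrite subrr normr0 mulr_ge0.
have fk' om om' : A om -> A om' -> `|f om - f om'| <= k * `|om - om'|.
  by move=> h h'; apply: fk => // i; have := le_mx_norm (om - om') i; rewrite !mxE.
pose E om := [set f a - k * `|om - a| | a in A].
have Eub om : has_ubound (E om).
  exists B => _ [a Aa <-]; have := fB _ Aa; rewrite ler_norml => /andP[_ h].
  by apply: le_trans h; rewrite gerBl mulr_ge0.
have En om : E om !=set0 by exists (f a0 - k * `|om - a0|), a0.
pose g om := Num.max (- B) (sup (E om)).
have lip om om' : sup (E om) - sup (E om') <= k * `|om - om'|.
  rewrite lerBlDr; apply: ge_sup (En om) _ => _ [a Aa <-].
  have h : f a - k * `|om' - a| <= sup (E om') by apply: ub_le_sup => //; exists a.
  have t : `|om' - a| <= `|om - om'| + `|om - a|.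
    by rewrite [in leRHS](distrC om); exact: ler_distD.
  have := ler_wpM2l k0 t; rewrite mulrDr; lra.
have supB om : sup (E om) <= B.
  apply: ge_sup (En om) _ => _ [a Aa <-]; have := fB _ Aa; rewrite ler_norml => /andP[_ h].
  by apply: le_trans h; rewrite gerBl mulr_ge0.
exists g; split.
- move=> om Ao; have s1 : sup (E om) <= f om.
    apply: ge_sup (En om) _ => _ [a Aa <-]; have := fk' _ _ Ao Aa; rewrite ler_norml => /andP[h _].
    by move: h; lra.
  have s2 : f om <= sup (E om).
    by apply: ub_le_sup => //; exists om => //; rewrite subrr normr0 mulr0 subr0.
  have -> : g om = Num.max (- B) (f om) by rewrite /g; congr Num.max; apply/eqP; rewrite eq_le s1.
  by apply: max_r; have := fB _ Ao; rewrite ler_norml => /andP[].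
- move=> om; rewrite ler_norml /g le_max lexx/= ge_max supB andbT.
  by move: B0; lra.
- move=> om om'; have l1 := lip om om'; have l2 := lip om' om.
  rewrite distrC in l2; have n0 : 0 <= k * `|om - om'| by rewrite mulr_ge0.
  rewrite /g; move: (sup _) (sup _) l1 l2 => x y l1 l2.
  by rewrite ler_norml; case: (leP (- B) x) => h1; case: (leP (- B) y) => h2; apply/andP; split; move: h1 h2; lra.
Qed.

Lemma lipschitz_of (A : set 'rV[R]_d) (g : 'rV[R]_d -> R) k :
  (forall x y, `|g x - g y| <= k * `|x - y|) -> [lipschitz (g om : R^o) | om in A].
Proof.
move=> H; exists k; split; first exact: num_real.
move=> M kM [x y] _ /=; apply: le_trans (H x y) _.
by rewrite ler_wpM2r// ltW.
Qed.

End Extension.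

(** * Resonance indices as finite lists *)

Section Resonances.
Variables (R : realType) (d : nat) (K : 'M[int]_(d, 2)).

(** Distinct j with L_j nonzero number at most N, so a list of them of maximal length contains the
    whole support. *)
Lemma resonance_support N (l : 'rV[int]_d) (L : 'rV[int]_2 -> int) :
  resonance_index R K N l L -> exists s : seq 'rV[int]_2,
    [/\ uniq s, forall j, j \notin s -> L j = 0 & (\sum_(j <- s) `|L j| <= N)%N].
Proof.
move=> [/sleP LN _ _ _].
have {}LN : sums_le (fun j => (`|L j|%:~R : R)) N%:R by apply: LN => j; rewrite ler0z.
have LN' s : uniq s -> (\sum_(j <- s) `|L j| <= N)%N.
  move=> us; have := LN s us; rewrite -(ler_nat R) natr_sum; apply: le_trans.
  by rewrite le_eqVlt; apply/orP; left; apply/eqP/eq_bigr => j _; rewrite natr_absz.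
pose P n := `[<exists s, [/\ uniq s, forall j, j \in s -> L j != 0 & size s = n]>].
have P0 : exists n, P n by exists 0%N; apply/asboolP; exists [::].
have Pub n : P n -> (n <= N)%N.
  move=> /asboolP[s [us sL <-]]; apply: leq_trans (LN' s us).
  rewrite -sum1_size big_seq [leqRHS]big_seq; apply: leq_sum => j js.
  by rewrite absz_gt0 sL.
case: (ex_maxnP P0 Pub) => n /asboolP[s [us sL sn]] nmax.
exists s; split; [exact: us| |exact: LN'] => j js; apply: contrapT => /eqP Lj.
suff : P n.+1 by move=> /nmax; rewrite ltnn.
apply/asboolP; exists (j :: s); rewrite /= js us sn; split => // i.
by rewrite in_cons => /orP[/eqP ->|/sL].
Qed.

Lemma fsum_support (V : zmodType) (s : seq 'rV[int]_2) (L : 'rV[int]_2 -> int) (F : 'rV[int]_2 -> V) :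
  uniq s -> (forall j, j \notin s -> L j = 0) -> (forall j, L j = 0 -> F j = 0) ->
  \sum_(j \in [set: 'rV[int]_2]) F j = \sum_(j <- s) F j.
Proof.
move=> us sL LF; rewrite (fsbigE s)//.
  by apply: eq_bigl => j; rewrite in_setT.
by move=> j _ js; apply: LF; exact: sL.
Qed.

(** Brings sum_j Omega_j L_j to the form treated by [comb_outer]: each unit of |L_j| contributes two
    signed corrections, at most 2N in all. *)
Lemma signed_list (w : 'rV[int]_2 -> Idx) (s : seq 'rV[int]_2) (L : 'rV[int]_2 -> int) N :
  (\sum_(j <- s) `|L j| <= N)%N ->
  exists zs : seq SignedIdx, (size zs <= 2 * N)%N /\ forall c : Idx -> R,
    \sum_(z <- zs) (if z.1 then c z.2 else - c z.2) =
    \sum_(j <- s) (c (w j) + c (inl j)) * (L j)%:~R.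
Proof.
elim: s N => [|j s ih] N.
  by move=> _; exists [::]; split => // c; rewrite !big_nil.
rewrite big_cons => LN.
have [zs [zsz zsE]] := ih (N - `|L j|)%N ltac:(by rewrite leq_subRL//; apply: leq_trans LN; rewrite leq_addr).
exists (nseq `|L j| (0 <= L j, w j) ++ nseq `|L j| (0 <= L j, inl j) ++ zs); split.
  rewrite !size_cat !size_nseq; have := leq_trans (leq_addr _ _) LN; lia.
move=> c; rewrite !big_cat/= zsE big_cons.
have E y : \sum_(z <- nseq `|L j| (0 <= L j, y)) (if z.1 then c z.2 else - c z.2) = c y * (L j)%:~R.
  rewrite big_nseq; set u := if _ then _ else _.
  have -> : forall n, iter n (GRing.add u) 0 = u *+ n by elim=> [|n /= ->]; rewrite ?mulrS.
  rewrite /u /=; case: (L j) => n /=; rewrite -mulr_natr//.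
  by rewrite NegzE mulrNz mulNr mulrN.
by rewrite !E; ring.
Qed.

End Resonances.

(** * Non-resonance conditions of order N *)

Section Nonresonance.
Variables (R : realType) (d : nat) (K : 'M[int]_(d, 2)) (kap delta : R).
Hypotheses (hd : (0 < d)%N) (kap0 : 0 < kap) (delta01 : 0 < delta < 1 / 4).
Notation G := ('rV[int]_d).

Definition reduced (j : 'rV[int]_2) : Idx := inr (vgen delta j, bgen delta j).

Record correction (gam : R) (g : Idx -> 'rV[R]_d -> R) : Prop := Correction {
  co_bound : forall x om, `|g x om| <= gam * wgt kap delta x;
  co_lip : forall x om om', `|g x om - g x om'| <= 1 / 8 * `|om - om'| }.

Definition signed (g : Idx -> 'rV[R]_d -> R) (z : SignedIdx) om : R :=
  if z.1 then g z.2 om else - g z.2 om.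

Lemma mx_norm_le (x : 'rV[R]_d) r : 0 <= r -> (forall i, `|x 0 i| <= r) -> `|x| <= r.
Proof.
by move=> r0 h; rewrite [leLHS]mx_normrE; apply: bigmax_le => // -[a i] _; rewrite /= (ord1 a); exact: h.
Qed.

(** With l and m confined to a finite range, strips of width proportional to gam can all be removed,
    whatever the corrections. *)
Lemma thick_outer (T : nat) (w : R) : 0 <= w -> exists c : R, 0 < c /\ forall gam, 0 < gam ->
  outer_le [set om | @cube R d om /\ exists (l : G) (m : int),
    [/\ l != 0, (n1 l <= T)%N & `|dotRZ om l + m%:~R| < (w + 1) * gam /\ (`|m|%:~R : R) <= T%:R + (w + 1)]]
   (c * gam).
Proof.
move=> w0; pose Mb := (T + (Num.truncn (w + 1)).+1)%N.
pose c1 : R := 2 ^+ d * (2 * (3 * (w + 1))) * ((1 + Mb)%:R ^+ 2) * (1 + T)%:R ^+ (2 * d).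
have c10 : 0 < c1 by rewrite !mulr_gt0 ?exprn_gt0 ?ltr0n//; lra.
exists (c1 * 4 ^+ d * (2 + 2)); split; first by rewrite !mulr_gt0// ?exprn_gt0//; lra.
move=> gam gam0.
pose F (p : G * int) : set 'rV[R]_d := if [&& p.1 != 0, (n1 p.1 <= T)%N & (`|p.2|%N <= Mb)%N] then
  [set om | @cube R d om /\ `|dotRZ om p.1 + p.2%:~R| < (w + 1) * gam] else set0.
apply: (@outer_sub _ _ _ (\bigcup_p F p)).
  move=> om [oc [l [m [l0 lT [sm mM]]]]]; exists (l, m) => //; rewrite /F/= l0 lT /=.
  have -> // : (`|m|%N <= Mb)%N.
  rewrite -(ler_nat R) natr_absz; apply: le_trans mM _; rewrite /Mb natrD lerD2l ltW//.
  by apply: truncnS_gt.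
have W0 : 0 < (w + 1) * gam by rewrite mulr_gt0//; lra.
apply: (@outer_bigcup _ _ hd _ _ (fun p => c1 * gam * (wlat R p.1 * wint R p.2))); last first.
  have -> : c1 * 4 ^+ d * (2 + 2) * gam = c1 * gam * (4 ^+ d * (2 + 2)) by ring.
  apply: sleZ; first by rewrite mulr_ge0// ltW.
  apply: (@sle_fub _ _ _ (fun l m => wlat R l * wint R m) (fun l => wlat R l * (2 + 2))).
  - by move=> l m; apply: mulr_ge0; [exact: wlat_ge0|exact: wint_ge0].
  - by move=> l; apply: sleZ; [exact: wlat_ge0|exact: sle_wint].
  - have c4 : 0 <= 2 + 2 :> R by lra.
    by rewrite [4 ^+ d * _]mulrC; apply: sle_le (sleZ c4 (@sle_wlat R d)) => l; rewrite mulrC.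
move=> [l m]; rewrite /F /=; have b0 : 0 <= c1 * gam * (wlat R l * wint R m).
  by apply: mulr_ge0; apply: mulr_ge0; [exact: ltW|exact: ltW|exact: wlat_ge0|exact: wint_ge0].
case: ifPn => [/and3P[l0 lT mM]|_]; last by apply: outer_leW b0 (outer_set0 _ hd).
have [i li] : exists i, 1 <= (`|l 0%R i|%N)%:R :> R.
  have [i li] : exists i, l 0 i != 0.
    apply: contrapT => h; move/eqP: l0; apply; apply/rowP => i; rewrite mxE.
    by apply/eqP/negPn/negP => li; apply: h; exists i.
  by exists i; rewrite ler1n absz_gt0.
have li0 : 2 * 0 <= (`|l 0%R i|%N)%:R :> R by rewrite mulr0.
have hL : forall om om' r, @cube R d om -> @cube R d om' -> 0 <= r -> (forall k, `|om 0 k - om' 0 k| <= r) ->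
    `|m%:~R - m%:~R| <= 0 * r + 0 :> R by move=> *; rewrite subrr normr0 mul0r addr0.
have := @strip_outer R d hd _ (fun=> m%:~R) l i 0 0 _ (fun x => id) (lexx _) (lexx _) W0 li li0 hL.
apply: outer_leW; rewrite addr0.
have wl : ((1 + T)%:R ^+ (2 * d))^-1 <= wlat R l.
  by rewrite /wlat lef_pV2 ?posrE ?exprn_gt0 ?ltr0n// lerXn2r ?nnegrE// ler_nat leq_add2l.
have wi : ((1 + Mb)%:R ^+ 2)^-1 <= wint R m.
  by rewrite /wint lef_pV2 ?posrE ?exprn_gt0 ?ltr0n// lerXn2r ?nnegrE// ler_nat leq_add2l.
have -> : 2 ^+ d * (2 * (3 * ((w + 1) * gam))) =
    c1 * gam * (((1 + T)%:R ^+ (2 * d))^-1 * ((1 + Mb)%:R ^+ 2)^-1).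
  rewrite /c1; set x := (1 + T)%:R ^+ _; set y := (1 + Mb)%:R ^+ _.
  have x0 : x != 0 by rewrite expf_neq0// pnatr_eq0.
  have y0 : y != 0 by rewrite expf_neq0// pnatr_eq0.
  by field; rewrite x0 y0.
apply: ler_wpM2l; first by apply: mulr_ge0; apply: ltW.
by apply: ler_pM wl wi; rewrite invr_ge0 exprn_ge0.
Qed.

(* If l has a large entry, om.l dominates the corrections and comb_outer applies; for
   the finitely many other l <> 0 the strips of width gam are removed; for l = 0 the
   integer sum_j |j|^2 L_j is nonzero, which suffices once gam is small, and when gam
   is not small the empty set will do. *)
Lemma nonresonant N : exists tau c : R, [/\ 0 < tau, 0 < c & forall gam M CC g,
  0 < gam <= 1 -> correction gam g -> CC `<=` @cube R d -> outer_le (@cube R d `\` CC) M ->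
  exists CN, [/\ CN `<=` CC, lebesgue_measurable CN, cantor_set CN, outer_le (@cube R d `\` CN) (M + c * gam) &
    forall om, CN om -> forall (l : G) L, resonance_index R K N l L ->
      gam * japZ R l `^ (- tau) <= `|dotRZ om l + \sum_(j \in [set: 'rV[int]_2])
        ((sqnormZ j)%:~R + g (reduced j) om + g (inl j) om) * (L j)%:~R|]].
Proof.
have [S [S1 HS]] := @sle_wgt R kap delta kap0 delta01.
have [tau [Cc [Cc0 comb]]] := @comb_outer R d hd SignedIdx (2 * d + 1) S S1 (2 * N).
(* N makes an entry of size T dominate 2N corrections of Lipschitz constant 1/8. The term (1 +
   d)^tau absorbs the passage from 1 + n1 l to <l>, at the price of one more power of <l> in the
   final exponent tau + 1. *)
pose T := (N + (1 + d) ^ tau)%N.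
have [c [c0 thick]] := @thick_outer (d * T) (2 * N%:R) (mulr_ge0 (ler0n _ _) (ler0n _ _)).
(* Makes c2 gam exceed the volume 2^d of the cube as soon as (2N + 1) gam > 1. *)
pose c2 : R := 2 ^+ d * (2 * N%:R + 1).
have c20 : 0 < c2 by rewrite mulr_gt0 ?exprn_gt0//; have := ler0n R N; lra.
have cc0 : 0 <= Cc * 4 ^+ d by rewrite mulr_ge0 ?exprn_ge0// ltW.
exists (tau%:R + 1), (Cc * 4 ^+ d + c + c2 + 1); split.
- by have := ler0n R tau; lra.
- by lra.
move=> gam M CC g /andP[gam0 gam1] [gB gL] CCc CCM.
have w01 x : 0 <= wgt kap delta x <= 1 by exact: wgt01.
have g_gam x om : `|g x om| <= gam.
  by apply: le_trans (gB x om) _; rewrite ler_piMr ?(ltW gam0)//; case/andP: (w01 x).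
have M0 : 0 <= M by have := le_trans (lebesgue_outer_ge0 _) CCM; rewrite lee_fin.
have finish A M1 : A `<=` CC -> outer_le (@cube R d `\` A) M1 -> M1 < M + (Cc * 4 ^+ d + c + c2 + 1) * gam ->
    (forall om, A om -> forall (l : G) L, resonance_index R K N l L ->
      gam * japZ R l `^ (- (tau%:R + 1)) <= `|dotRZ om l + \sum_(j \in [set: 'rV[int]_2])
        ((sqnormZ j)%:~R + g (reduced j) om + g (inl j) om) * (L j)%:~R|) ->
  exists CN, [/\ CN `<=` CC, lebesgue_measurable CN, cantor_set CN,
    outer_le (@cube R d `\` CN) (M + (Cc * 4 ^+ d + c + c2 + 1) * gam) &
    forall om, CN om -> forall (l : G) L, resonance_index R K N l L ->
      gam * japZ R l `^ (- (tau%:R + 1)) <= `|dotRZ om l + \sum_(j \in [set: 'rV[int]_2])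
        ((sqnormZ j)%:~R + g (reduced j) om + g (inl j) om) * (L j)%:~R|].
  move=> ACC AM M1M HA; have [||CN [CNA CNm CNc CNo]] := @cantor_ex R d hd A (M + (Cc * 4 ^+ d + c + c2 + 1) * gam).
  - exact: subset_trans ACC CCc.
  - by apply: le_lt_trans AM _; rewrite lte_fin.
  by exists CN; split => //; [exact: subset_trans CNA ACC|move=> om /CNA; exact: HA].
have [big|small] := ltP 1 ((2 * N%:R + 1) * gam).
  apply: (finish set0 (2 ^+ d)) => //.
    by rewrite setD0; exact: outer_cube.
  have : 2 ^+ d < c2 * gam by rewrite /c2 -mulrA ltr_pMr ?exprn_gt0.
  have : 0 <= (Cc * 4 ^+ d + c) * gam by rewrite mulr_ge0 ?addr_ge0// ltW.
  by lra.
pose B1 := [set om | @cube R d om /\ exists (l : G) (m : int),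
    [/\ l != 0, (n1 l <= d * T)%N & `|dotRZ om l + m%:~R| < (2 * N%:R + 1) * gam /\
       (`|m|%:~R : R) <= (d * T)%:R + (2 * N%:R + 1)]].
pose F (l : G) : set 'rV[R]_d := if `[< exists i, (T <= `|l 0%R i|)%N >] then
  [set om | @cube R d om /\ exists (m : int) (s : seq SignedIdx), (size s <= 2 * N)%N /\
      `|dotRZ om l + m%:~R + \sum_(z <- s) signed g z om| < gam / (1 + n1 l)%:R ^+ tau] else set0.
have B1o : outer_le B1 (c * gam) by exact: thick.
have T0 : (0 < T)%N by rewrite /T addn_gt0 expn_gt0 orbT.
have Fo : outer_le (\bigcup_l F l) (Cc * 4 ^+ d * gam).
  have cg : 0 <= Cc * gam by rewrite mulr_ge0// ltW.
  apply: (@outer_bigcup _ _ hd _ _ (fun l => Cc * gam * wlat R l)); last first.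
    by rewrite mulrAC; apply: sleZ cg _; exact: sle_wlat.
  move=> l; rewrite /F; case: ifPn => [/asboolP[i li]|_]; last first.
    by apply: outer_leW (outer_set0 _ hd); rewrite mulr_ge0 ?wlat_ge0.
  have l1 : (1 <= n1 l)%N by apply: leq_trans (n1_entry l i); exact: leq_trans li.
  have L2 : 2 <= (1 + n1 l)%:R :> R by rewrite ler_nat ltnS.
  have L0 : 0 < (1 + n1 l)%:R :> R by rewrite ltr0n.
  apply: (@outer_leW _ _ _ (Cc * (gam / (1 + n1 l)%:R ^+ (2 * d + 1)))).
    rewrite -!mulrA ler_wpM2l ?(ltW Cc0)// ler_wpM2l ?(ltW gam0)//.
    by rewrite /wlat lef_pV2 ?posrE ?exprn_gt0// ler_weXn2l ?leq_addr// (le_trans _ L2)// ler1n.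
  have liR : T%:R <= (`|l 0%R i|%N)%:R :> R by rewrite ler_nat.
  apply: (@comb (signed g) (fun z => wgt kap delta z.2) (@cube R d) l i (1 / 8) 0); split => //.
  - by apply/andP.
  - by rewrite ler_nat leq_addl.
  - by apply: le_trans liR; rewrite ler1n.
  - apply: le_trans liR; rewrite /T natrD natrM; have := ler0n R N.
    have := ler0n R ((1 + d) ^ tau)%N; lra.
  - by rewrite lexx/= divr_ge0 ?exprn_ge0// ltW.
  - by move=> z om _; rewrite addr0 /signed; case: z.1; rewrite ?normrN; exact: gB.
  - move=> z om om' r _ _ r0 hr; rewrite addr0.
    have : `|g z.2 om - g z.2 om'| <= 1 / 8 * r.
      apply: le_trans (gL _ _ _) _; rewrite ler_wpM2l ?divr_ge0// mx_norm_le// => k.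
      by rewrite !mxE; exact: hr.
    by rewrite /signed; case: z.1 => //; rewrite -opprD normrN.
apply: (finish (CC `\` (B1 `|` \bigcup_l F l)) (M + (c * gam + Cc * 4 ^+ d * gam))).
- by move=> om [].
- have := outerU hd CCM (outerU hd B1o Fo); apply: outer_sub => om [oc h].
  by have [CCo|] := pselect (CC om); [right; apply: contrapT => h'; apply: h|left].
- have : 0 < (c2 + 1) * gam by rewrite mulr_gt0// addr_gt0.
  by lra.
move=> om [CCo nB] l L res.
have oc : cube om by exact: CCc.
have [s [us sL sN]] := resonance_support res.
rewrite (@fsum_support _ s L) //; last by move=> j ->; rewrite mulr0.
have E1 : \sum_(j <- s) ((sqnormZ j)%:~R + g (reduced j) om + g (inl j) om) * (L j)%:~R =
   (\sum_(j <- s) sqnormZ j * L j)%:~R + \sum_(j <- s) (g (reduced j) om + g (inl j) om) * (L j)%:~R.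
  rewrite rmorph_sum/= -big_split/=; apply: eq_bigr => j _; rewrite rmorphM/=; ring.
rewrite E1; set m := \sum_(j <- s) sqnormZ j * L j.
have [zs [zsN zsE]] := signed_list R reduced sN.
have {}zsE := zsE (fun x => g x om); set X := \sum_(j <- s) _ in zsE *.
have XN : `|X| <= 2 * N%:R * gam.
  rewrite -zsE; apply: le_trans (ler_norm_sum _ _ _) _.
  apply: (@le_trans _ _ (\sum_(z <- zs) gam)).
    by apply: ler_sum => z _; case: z.1; rewrite ?normrN.
  rewrite big_const_seq count_predT iter_addr_0 -[gam *+ _]mulr_natl; apply: (ler_wpM2r (ltW gam0)).
  by rewrite -natrM ler_nat.
have J1 : 1 <= japZ R l by exact: jap_ge1.
have Jp : japZ R l `^ (- (tau%:R + 1)) <= 1.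
  rewrite powRN invf_le1 ?powR_gt0 ?(lt_le_trans _ J1)//.
  have o1 : (1 : R) `^ (tau%:R + 1) = 1 by rewrite powR1.
  by rewrite -[leLHS]o1 ge0_ler_powR ?nnegrE ?(le_trans _ J1)// addr_ge0.
have Jg : gam * japZ R l `^ (- (tau%:R + 1)) <= gam by rewrite ler_piMr// ltW.
have [l0|l0] := eqVneq l 0.
  have mz : m != 0.
    have [_ _ _ /(_ l0)] := res; rewrite (@fsum_support _ s L) //; last by move=> j ->; rewrite mulr0.
    by move/eqP.
  apply: le_trans Jg _; rewrite l0 dotRZ0 add0r.
  (* The corrections total at most 2N gam, and (2N + 1) gam <= 1 here, so at least gam is left of
     the nonzero integer. *)
  have m1 : 1 <= `|m%:~R| :> R by rewrite -intr_norm ler1z -gtz0_ge1 normr_gt0.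
  have := lerB_dist (m%:~R : R) (- X); rewrite opprK normrN.
  by move: small; lra.
have [[i li]|nl] := pselect (exists i, (T <= `|l 0%R i|)%N).
  rewrite leNgt; apply/negP => lt; apply: nB; right; exists l => //; rewrite /F.
  case: ifPn => [_|/asboolP]; last by case; exists i.
  split => //; exists m, zs; split => //; rewrite /signed zsE -addrA.
  apply: lt_le_trans lt _; rewrite ler_wpM2l ?(ltW gam0)//.
  have J0 : 0 < japZ R l by exact: lt_le_trans J1.
  rewrite powRN lef_pV2 ?posrE ?powR_gt0 ?exprn_gt0 ?ltr0n//.
  have -> : japZ R l `^ (tau%:R + 1) = japZ R l ^+ tau * japZ R l.
    rewrite powRD ?powRr1 ?(ltW J0) ?powR_mulrn ?(ltW J0)//.
    by apply/implyP => _; rewrite gt_eqF.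
  have TJ : (1 + d)%:R ^+ tau <= japZ R l.
    apply: (@le_trans _ _ (`|l 0%R i|%N)%:R); last first.
      by apply: le_trans (entry_enormZ R l i) _; rewrite /japZ /jap le_max (ger0_norm (sqrtr_ge0 _)) lexx orbT.
    by rewrite -natrX ler_nat; apply: leq_trans li; rewrite /T leq_addl.
  apply: (@le_trans _ _ (((1 + d)%:R * japZ R l) ^+ tau)).
    by rewrite lerXn2r ?nnegrE ?mulr_ge0 ?(ltW J0)//; have := n1_japZ R l; rewrite !natrD.
  by rewrite exprMn mulrC ler_wpM2l ?exprn_ge0// ltW.
apply: le_trans Jg _; rewrite leNgt; apply/negP => lt; apply: nB; left; split => //.
have lT : (n1 l <= d * T)%N.
  rewrite /n1 -[d in (d * _)%N]card_ord -sum_nat_const; apply: leq_sum => i _.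
  by rewrite leqNgt; apply/negP => h; apply: nl; exists i; exact: ltnW.
have sm : `|dotRZ om l + m%:~R| < (2 * N%:R + 1) * gam.
  have -> : dotRZ om l + m%:~R = (dotRZ om l + (m%:~R + X)) - X by ring.
  apply: le_lt_trans (ler_normB _ _) _; lra.
exists l, m; split => //; split => //.
have := dotRZ_le l (cube_le oc); rewrite mul1r => h.
have -> : (`|m|%:~R : R) = `|(dotRZ om l + m%:~R) - dotRZ om l| by rewrite addrAC subrr add0r intr_norm.
apply: le_trans (ler_normB _ _) _.
have lT' : (n1 l)%:R <= (d * T)%:R :> R by rewrite ler_nat.
have : (2 * N%:R + 1) * gam <= 2 * N%:R + 1.
  by rewrite ler_piMr//; have := ler0n R N; lra.
lra.
Qed.

End Nonresonance.

Section Family.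
Variables (R : realType) (d : nat) (K : 'M[int]_(d, 2)) (p s : R).
Hypotheses (p0 : 0 < p) (s0 : 0 < s).
Notation G := ('rV[int]_d).
Notation idx_shift := (idx_shift K).
Notation idx_allowed := (idx_allowed K).

Lemma near_ido_exp_bounded e (W : opT R d Idx) : bd idx_allowed s e (fun x l => W x l - ido R x l) -> exp_bounded s (e + 1) W.
Proof.
move=> We; have h := bdD We (@bd_ido R d Idx _ (@ial0 d K) s).
have := bd_exp_bounded h; have -> // : (fun x l => W x l - ido R x l + ido R x l) = W.
by apply/funext => x; apply/funext => l; rewrite subrK.
Qed.

Lemma hop_near_id : exists2 c : R, 0 < c & forall e (W : opT R d Idx) phi, 
  bd idx_allowed s e (fun x l => W x l - ido R x l) ->
  bounded_by p (c * e) (op_sub (hop K (twist phi W)) id).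
Proof.
have [c c0 Hc] := hop_bounded K p0 s0; exists c => // e W phi We.
have D := exp_bounded_twist phi (bd_exp_bounded We); apply: (bounded_by_ext _ (Hc _ _ D)) => u hu.
have E : hop K (twist phi W) u = hop K (fun x l => twist phi (fun x l => W x l - ido R x l) x l + ido R x l) u.
  congr (_ u); apply: hop_ext => j l; rewrite /twist /ido; have [->|_] := eqVneq l 0; last by rewrite subr0 addr0.
  by rewrite dotRZ0 cis0 !mul1r subrK.
have I := bd_exp_bounded (@bd_ido R d Idx _ (@ial0 d K) s).
apply/funext => j; rewrite /op_sub E (hopD K s0 D I hu) hop_ido.
by rewrite addrK.
Qed.

End Family.

(** * Choice of the constants and assembly of the theorem *)

Lemma japmu_sqr (R : realType) (mu : R) (j : 'rV[int]_2) : japZ R j `^ (2 * mu) = (japZ R j `^ mu) ^+ 2.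
Proof. by rewrite mulrC powRrM powR_mulrn// powR_ge0. Qed.

Lemma tail_cutoff (R : realType) (t rho : R) : 0 < t -> 0 < rho ->
  exists C0 : nat, (2 <= C0)%N /\ expR (- (16 * t / 4) * C0%:R) <= rho / 8.
Proof.
move=> t0 r0; pose C0 := (Num.truncn (2 / (rho * t))).+2; exists C0; split => //.
have h : 2 / (rho * t) <= C0%:R.
  apply: ltW; apply: lt_le_trans (truncnS_gt _) _; rewrite ler_nat; exact: leqnSn.
have root_char : 0 < rho * t by rewrite mulr_gt0.
rewrite ler_pdivrMr// in h.
rewrite mulNr expRN.
have e1 := expR_ge1Dx (16 * t / 4 * C0%:R).
have x0 : 0 < 16 * t / 4 * C0%:R by rewrite mulr_gt0 ?ltr0n// divr_gt0 ?mulr_gt0.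
rewrite -[leRHS]invrK lef_pV2 ?posrE ?expR_gt0 ?invr_gt0 ?divr_gt0//.
apply: le_trans e1; rewrite invf_div ler_pdivrMr//.
by move: h r0; lra.
Qed.

Lemma potential_norm_ge0 (R : realType) d a q (V : 'rV[int]_d -> R[i]) : 0 <= potential_norm a q V.
Proof. exact: sqrtr_ge0. Qed.

(** One smallness for three purposes: rho/16 for the convergence of the iteration, the 1 in 1 + Sp
    for the cap on eps, and Sp for the bound of the corrections by the norm of V. *)
Lemma threshold_ex (R : realType) (rho CQ Sp : R) : 0 < rho -> 1000 <= CQ -> 0 < Sp ->
  exists2 theta : R, 0 < theta & theta <= rho / 16 /\ theta * (256 * CQ * (1 + Sp)) <= 1.
Proof.
move=> r0 C1 S0; have d0 : 0 < 256 * CQ * (1 + Sp) by apply: mulr_gt0; lra.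
exists (Num.min (rho / 16) (1 / (256 * CQ * (1 + Sp)))); first by rewrite lt_min !divr_gt0.
split; first by rewrite ge_min lexx.
by rewrite -ler_pdivlMr// ge_min lexx orbT.
Qed.

Lemma absorbed_cap (R : realType) (Q : R) : 1 <= Q -> 1000 <= loss_const Q * Q.
Proof.
move=> Q1; have : 1 <= Q ^+ 4 * Q by rewrite mulr_ege1// exprn_ege1.
by rewrite /loss_const; lra.
Qed.
Opaque loss_const.

Theorem theorem1p8 (R : realType) (d : nat) (hd : (0 < d)%N)
    (K : 'M[int]_(d, 2))
    (hK : \rank (map_mx intr K : 'M[rat]_(d, 2)) = minn d 2)
    (a : R) (ha : 0 < a) :
  exists kappa : R, 0 < kappa /\
  forall q : R, d%:R / 2 < q ->
  exists delta0 : R, 0 < delta0 /\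
  forall delta : R, 0 < delta < delta0 ->
  let mu := 1 - 2 * delta in
  forall p : R, 0 < p ->
  exists gammas epss C : R, exists tau c : nat -> R,
    [/\ 0 < gammas, 0 < epss, 0 < C &
        forall N : nat, (3 <= N)%N -> 0 < tau N /\ 0 < c N] /\
  forall gamma : R, 0 < gamma < gammas ->
  forall V : 'rV[int]_d -> R[i], hypV K a q V ->
  gamma^-1 * potential_norm a q V < epss ->
  exists (CC : set 'rV[R]_d)
         (Om : 'rV[int]_2 -> 'rV[R]_d -> R)
         (G Ginv : 'rV[R]_d -> 'rV[R]_d -> cseq R -> cseq R)
         (varpi : 'rV[int]_2 -> int -> 'rV[R]_d -> R)
         (Theta1 Theta2 : 'rV[int]_2 -> 'rV[R]_d -> R),
    [/\ [/\ CC `<=` @cube R d, lebesgue_measurable CC, cantor_set CC &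
            (lebesgue_outer (@cube R d `\` CC) <= (C * gamma)%:E)%E],
        forall j, [lipschitz (Om j om : R^o) | om in @cube R d],
        forall om, cube om ->
          op_torus_family p (G om) /\
          forall phi,
            [/\ linear_op p (G om phi),
                bounded_op p (G om phi),
                bounded_op p (Ginv om phi),
                inverse_op p (G om phi) (Ginv om phi) &
                bounded_by p (C * (gamma^-1 * potential_norm a q V))
                  (op_sub (G om phi) id)],
        forall om, CC om ->
          conjugates_to_diag K p V om (G om) (Ginv om) (fun j => Om j om) &
        [/\ forall j om, cube om ->
              Om j om = (sqnormZ j)%:~R
                + varpi (vgen delta j) (bgen delta j) om
                    / jap (bgen delta j)%:~R ^+ 2
                    * expR (- kappa * enormZ R (vgen delta j))
                + Theta1 j om
                    / (jap (bgen delta j)%:~R * japZ R j `^ mu)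
                + Theta2 j om / japZ R j `^ (2 * mu),
            forall j om, cube om ->
              `|varpi (vgen delta j) (bgen delta j) om| + `|Theta1 j om|
                + `|Theta2 j om| <= 2 * potential_norm a q V &
            forall N : nat, (3 <= N)%N ->
              exists CN : set 'rV[R]_d,
                [/\ CN `<=` CC, lebesgue_measurable CN, cantor_set CN,
                    (lebesgue_outer (@cube R d `\` CN) <= (c N * gamma)%:E)%E &
                    forall om, CN om ->
                    forall (l : 'rV[int]_d) (L : 'rV[int]_2 -> int),
                      resonance_index R K N l L ->
                      gamma * japZ R l `^ (- tau N) <=
                      `|dotRZ om l
                        + \sum_(j \in [set: 'rV[int]_2]) Om j om * (L j)%:~R|]]].
Proof.
have dn : 0 < d%:R :> R by rewrite ltr0n.
(* 16 t = a / (2d) is the weight at which [potential_nb] controls V. It involves a and d only, so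
   kappa can be fixed before all other parameters. *)
pose t := a / (32 * d%:R); have t0 : 0 < t by rewrite divr_gt0// mulr_gt0.
have t8 : 0 < 8 * t by rewrite mulr_gt0.
have t16 : 16 * t = a / (2 * d%:R) by rewrite /t; field; rewrite gt_eqF.
have kap0 : 0 < decay_rate K t by rewrite /decay_rate; apply: divr_gt0 t8 _; rewrite ltr_wpDr.
exists (decay_rate K t); split => // q hq; have q0 : 0 <= q by apply/ltW/(le_lt_trans _ hq); rewrite divr_ge0.
(* delta < 1/4 gives mu > 1/2, on which the summability of the weights rests. *)
exists (1 / 4); split; first lra.
move=> delta delta01 mu p p0.
have delta12 : 0 < delta < 1 / 2 by case/andP: delta01 => h1 h2; apply/andP; split; lra.
have [S [S1 wS]] := sle_wgt kap0 delta01.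
(* Four corrections per divisor of the iteration. The exponent tau comes before Q, rho and the
   cutoff, which depend on it. *)
have [tau [Cc [Cc0 comb4]]] := @comb_outer R d hd SignedIdx (2 * d + 1) S S1 4.
have [Q ab] := absorbs_ex K delta12 tau t0.
have Q1 : 1 <= Q by case: ab.
pose rho : R := 2 ^- tau.+1.
have rho0 : 0 < rho by rewrite invr_gt0 exprn_gt0.
have [C0 [C02 tail]] := tail_cutoff t0 rho0.
have [Sp [Sp0 VS]] := @potential_nb R d a hd ha.
have [Ch Ch0 near] := hop_near_id K p0 t8.
(* tau_N and c_N must be chosen for all N before gamma and V are given. *)
have /choice[tc Htc] : forall N, exists y : R * R, [/\ 0 < y.1, 0 < y.2 & forall gam M CC g,
  0 < gam <= 1 -> correction (decay_rate K t) delta gam g -> CC `<=` @cube R d -> outer_le (@cube R d `\` CC) M ->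
  exists CN, [/\ CN `<=` CC, lebesgue_measurable CN, cantor_set CN, outer_le (@cube R d `\` CN) (M + y.2 * gam) &
    forall om, CN om -> forall (l : 'rV[int]_d) L, resonance_index R K N l L ->
      gam * japZ R l `^ (- y.1) <= `|dotRZ om l + \sum_(j \in [set: 'rV[int]_2])
        ((sqnormZ j)%:~R + g (reduced delta j) om + g (inl j) om) * (L j)%:~R|]].
  by move=> N; have [x [y [x0 y0 H]]] := @nonresonant R d K (decay_rate K t) delta hd kap0 delta01 N; exists (x, y).
have C0t : 1 <= C0%:R ^+ tau :> R by rewrite exprn_ege1// ler1n (leq_trans _ C02).
have C0t0 : 0 < C0%:R ^+ tau :> R by exact: lt_le_trans C0t.
have [CQ CQE] : exists CQ, CQ = loss_const Q * Q by exists (loss_const Q * Q).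
have CQ1 : 1000 <= CQ by rewrite CQE; exact: absorbed_cap.
have CQ0 : 0 < CQ by apply: lt_le_trans CQ1; rewrite ltr0n.
have [theta th0 [thrho thCQ]] := threshold_ex rho0 CQ1 Sp0.
(* The added 1 provides the strict inequality that [cantor_ex] needs; [CC2] measures the distance of
   G from the identity. *)
pose CC1 := 3 * Cc * 16 ^+ d + 1; pose CC2 := Ch * (8 * (C0%:R ^+ tau * Sp)).
have CC10 : 0 < CC1 by rewrite ltr_pwDr// mulr_ge0 ?exprn_ge0// mulr_ge0// ltW.
have CC20 : 0 < CC2 by rewrite !mulr_gt0.
exists 1, (theta / (C0%:R ^+ tau * Sp)), (CC1 + CC2), (fun N => (tc N).1), (fun N => CC1 + (tc N).2).
split.
  split => //; first by rewrite divr_gt0// mulr_gt0.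
    by rewrite addr_gt0.
  by move=> N _; have [h1 h2 _] := Htc N; split => //; rewrite addr_gt0.
move=> gam /andP[gam0 gam1'] V [Vfin Vr Vz] small.
have gam01 : 0 < gam <= 1 by rewrite gam0 ltW.
set nV := potential_norm a q V in small *.
have nV0 : 0 <= nV by exact: potential_norm_ge0.
have Vp : weighted_le (16 * t) (Sp * nV) V by rewrite t16; exact: VS.
have VN : forall l, V (- l) = ((V l)^*)%C.
  by apply: real_potential Vp Vr; rewrite mulr_gt0.
have zV : forall l, flat K l -> V l = 0 by move=> l /eqP ml; apply: Vz; left.
have p00 : 0 <= Sp * nV by rewrite mulr_ge0// ltW.
pose f0 := C0%:R ^+ tau * (Sp * nV) / gam.
have f0E : f0 = (C0%:R ^+ tau * Sp) * (gam^-1 * nV) by rewrite /f0; ring.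
have f0th : f0 <= theta.
  rewrite f0E -ler_pdivlMl; last exact: mulr_gt0.
  by rewrite [leRHS]mulrC; exact: ltW.
have f00 : 0 <= f0 by rewrite f0E mulr_ge0 ?mulr_ge0 ?invr_ge0// ltW.
have f0rho : f0 <= rho / 16 by exact: le_trans f0th thrho.
have f0CQ : f0 * (256 * CQ * (1 + Sp)) <= 1.
  apply: le_trans thCQ; apply: ler_wpM2r f0th; apply: mulr_ge0; first by apply: mulr_ge0 => //; exact: ltW.
  by apply: addr_ge0 => //; exact: ltW.
have CQf0 : 0 <= CQ * f0 by rewrite mulr_ge0// ltW.
have CQfS : 0 <= CQ * f0 * Sp by rewrite mulr_ge0// ltW.
have epsCap : 32 * loss_const Q * Q * (8 * f0) <= 1.
  have -> : 32 * loss_const Q * Q * (8 * f0) = 256 * (CQ * f0) by rewrite CQE; ring.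
  by move: f0CQ CQfS => k1 k2; lra.
have [A [W [U [f [Ac Ao AW fB fL]]]]] :=
  kam_reduction hd delta01 t0 ab VN zV gam01 p00 Vp C02 tail f0rho epsCap wS Cc0 comb4.
(* The common bound of the corrections on A. Being quadratic in V over gamma, it lies below both the
   norm of V and gamma. *)
pose B := 2 * CQ * (Sp * nV * (8 * f0)).
have B0 : 0 <= B.
  by apply: mulr_ge0; [apply: mulr_ge0 => //; exact: ltW|apply: mulr_ge0 => //; exact: mulr_ge0].
have BV : B <= nV.
  have -> : B = (16 * (CQ * f0 * Sp)) * nV by rewrite /B; ring.
  by rewrite ler_piMl//; lra.
have BE : B = 2 * loss_const Q * Q * (Sp * nV * (8 * f0)) by rewrite /B CQE; ring.
have Bgam : B <= gam by rewrite BE; exact: eig_corr_gam ab gam01 p00 C02 epsCap.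
have w01 x : 0 <= wgt (decay_rate K t) delta x <= 1 by exact: wgt01.
(* The eigenvalues are controlled on A only, while Omega_j must be Lipschitz and have its expansion
   on the whole cube; each correction is extended separately, with its own bound. *)
have /choice[g Hg] : forall x, exists g : 'rV[R]_d -> R, [/\ forall om, A om -> g om = f x om,
    forall om, `|g om| <= B * wgt (decay_rate K t) delta x & forall om om', `|g om - g om'| <= 1 / 8 * `|om - om'|].
  move=> x; apply: (mcshane (divr_ge0 ler01 (ler0n _ 8))).
  - by apply: mulr_ge0 => //; case/andP: (w01 x).
  - by move=> om h; rewrite BE; exact: fB.
  - by move=> om om' h; exact: fL.
have gE x om : A om -> g x om = f x om by have [h _ _] := Hg x; exact: h.
have gB x om : `|g x om| <= B * wgt (decay_rate K t) delta x by have [_ h _] := Hg x.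
have gL x om om' : `|g x om - g x om'| <= 1 / 8 * `|om - om'| by have [_ _ h] := Hg x.
have gco : correction (decay_rate K t) delta gam g.
  split => // x om; apply: le_trans (gB x om) _; rewrite ler_wpM2r//; by case/andP: (w01 x).
have [CC [CCA CCm CCc CCo]] : exists CC, [/\ CC `<=` A, lebesgue_measurable CC, cantor_set CC &
    outer_le (@cube R d `\` CC) (CC1 * gam)].
  apply: (cantor_ex hd) => //; apply: le_lt_trans Ao _; rewrite lte_fin /CC1 ltr_pM2r//.
  by rewrite ltrDl.
have CCcube : CC `<=` @cube R d by exact: subset_trans CCA Ac.
(* Off A no conjugation is claimed, and the identity satisfies all the bounds. *)
pose Wt om := if `[< A om >] then W om else @ido R d Idx.
pose Ut om := if `[< A om >] then U om else @ido R d Idx.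
have eps8 : 0 <= 8 * f0 by rewrite mulr_ge0.
have Wt1 om : bd (idx_allowed K) (8 * t) (8 * f0) (fun x l => Wt om x l - ido R x l).
  rewrite /Wt; case: asboolP => [/AW[]//|_] x; split; last by move=> l _; rewrite subrr.
  by apply: sle0 => // l; rewrite subrr cabs0 mulr0.
have I1 := bd_exp_bounded (@bd_ido R d Idx _ (@ial0 d K) (8 * t)).
have Ut1 om : exists M, exp_bounded (8 * t) M (Ut om).
  by rewrite /Ut; case: asboolP => [/AW[_ h _ _ _]|_]; [exists 2; exact: bd_exp_bounded h|exists 1; exact: I1].
have Wt2 om := near_ido_exp_bounded (Wt1 om).
have UW om : cmul (idx_shift K) (Ut om) (Wt om) = @ido R d Idx.
  by rewrite /Ut /Wt; case: asboolP => [/AW[]//|_]; rewrite (cmul1r (@ish0 d K)).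
have WU om : cmul (idx_shift K) (Wt om) (Ut om) = @ido R d Idx.
  by rewrite /Ut /Wt; case: asboolP => [/AW[]//|_]; rewrite (cmul1r (@ish0 d K)).
pose Om j om := (sqnormZ j)%:~R + g (reduced delta j) om + g (inl j) om.
pose D (j : 'rV[int]_2) := japZ R j `^ mu; pose b j : R := jap (bgen delta j)%:~R.
pose den j : R := 1 / (b j * D j) + 1 / D j ^+ 2.
have D1 j : 1 <= D j by exact: japmu_ge1.
have b1 j : 1 <= b j by exact: jap_ge1.
have den0 j : 0 < den j.
  have d0 := lt_le_trans ltr01 (D1 j); have b0 := lt_le_trans ltr01 (b1 j).
  by rewrite /den addr_gt0// divr_gt0 ?mulr_gt0 ?exprn_gt0.
(* One function plays both Theta1 and Theta2: the correction of [inl j] divided by the sum of their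
   two denominators' inverses. The 1/2 in [wgt] bounds it by B/2, so the three terms total at most 2
   B. *)
pose Theta j om := g (inl j) om / den j.
pose varpi v (n : int) om := g (inr (v, n)) om * jap n%:~R ^+ 2 * expR (decay_rate K t * enormZ R v).
have ThetaB j om : `|Theta j om| <= B / 2.
  rewrite /Theta normrM normfV (gtr0_norm (den0 j)) ler_pdivrMr//.
  have := gB (inl j) om; rewrite /wgt -/mu -/(D j) -/(b j) -/(den j); lra.
have varpiB v n om : `|varpi v n om| <= B.
  have J0 : 0 < (jap n%:~R : R) ^+ 2 by rewrite exprn_gt0// jap_gt0.
  have e0 := expR_gt0 (decay_rate K t * enormZ R v).
  rewrite /varpi normrM (gtr0_norm e0) normrM (gtr0_norm J0).
  rewrite -ler_pdivlMr// -ler_pdivlMr// -mulrA.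
  by have := gB (inr (v, n)) om; rewrite /wgt mulNr expRN.
exists CC, Om, (fun om phi => hop K (twist phi (Wt om))), (fun om phi => hop K (twist phi (Ut om))), varpi, Theta, Theta.
have cgam : CC1 * gam <= (CC1 + CC2) * gam by rewrite ler_wpM2r ?(ltW gam0)// lerDl ltW.
split.
- split => //; exact: outer_leW cgam CCo.
- move=> j; apply: (@lipschitz_of R d _ _ (1 / 4)) => x y.
  have h1 := gL (reduced delta j) x y; have h2 := gL (inl j) x y.
  have -> : Om j x - Om j y = (g (reduced delta j) x - g (reduced delta j) y) + (g (inl j) x - g (inl j) y).
    by rewrite /Om; ring.
  by apply: le_trans (ler_normD _ _) _; lra.
- move=> om oc; split; first exact (hop_torus K p0 t8 (Wt2 om)).
  have [M UM] := Ut1 om; move=> phi.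
  have [cb cb0 Hb] := hop_bounded K p0 t8.
  split.
  + exact (hop_linear K t8 (exp_bounded_twist phi (Wt2 om))).
  + by exists (cb * (8 * f0 + 1)); apply: Hb; apply: exp_bounded_twist.
  + by exists (cb * M); apply: Hb; apply: exp_bounded_twist.
  + move=> u hu; split; [apply: (hop_inverse t8 phi (Wt2 om) UM _ hu)|apply: (hop_inverse t8 phi UM (Wt2 om) _ hu)].
      by move=> j l; rewrite WU.
    by move=> j l; rewrite UW.
  + apply: bounded_by_le (near _ _ phi (Wt1 om)).
    have -> : Ch * (8 * f0) = CC2 * (gam^-1 * nV) by rewrite f0E /CC2; ring.
    by rewrite ler_wpM2r ?mulr_ge0 ?invr_ge0 ?(ltW gam0)// lerDr ltW.
- move=> om CCom; have Aom := CCA _ CCom; have [M UM] := Ut1 om.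
  have VM : exp_bounded (8 * t) (Sp * nV) (fun _ : Idx => V).
    have V8 : weighted_le (8 * t) (Sp * nV) V by apply: nb_le Vp => //; lra.
    by apply: (@bd_exp_bounded R d (fun _ _ => true)) => x; split.
  apply: (hop_conjugates p0 t8 (Wt2 om) UM VM).
  + by move=> j l; rewrite UW.
  + exact: CCcube.
  + move=> j l; rewrite /Wt; case: asboolP => // h.
    have [_ _ _ _ itw] := AW _ h.
    by rewrite itw /Om !gE.
  + exists (2 * B) => j; have -> : Om j om - (sqnormZ j)%:~R = g (reduced delta j) om + g (inl j) om.
      by rewrite /Om; ring.
    have gB1 x : `|g x om| <= B.
      by apply: le_trans (gB x om) _; rewrite ler_piMr//; case/andP: (w01 x).
    by apply: le_trans (ler_normD _ _) _; have := gB1 (reduced delta j); have := gB1 (inl j); lra.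
split.
- move=> j om oc; rewrite japmu_sqr -/(D j) -/(b j) /Om /reduced.
  have J0 : b j != 0 by rewrite gt_eqF// (lt_le_trans _ (b1 j)).
  have -> : varpi (vgen delta j) (bgen delta j) om / b j ^+ 2 * expR (- decay_rate K t * enormZ R (vgen delta j)) =
     g (inr (vgen delta j, bgen delta j)) om.
    rewrite /varpi -/(b j) mulNr expRN; have := expR_gt0 (decay_rate K t * enormZ R (vgen delta j)).
    by move: (expR _) => e e0; field; rewrite J0 gt_eqF.
  rewrite -!addrA; congr (_ + (_ + _)).
  have -> : Theta j om / (b j * D j) + Theta j om / D j ^+ 2 = Theta j om * den j by rewrite /den; ring.
  by rewrite /Theta mulfVK// gt_eqF.
- move=> j om oc; have := varpiB (vgen delta j) (bgen delta j) om; have := ThetaB j om; lra.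
- move=> N N3; have [_ _ H] := Htc N.
  have [CN [h1 h2 h3 h4 h5]] := H gam (CC1 * gam) CC g gam01 gco CCcube CCo.
  exists CN; split => //; first by rewrite mulrDl.
Qed.
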